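(* Let $\mathbb{B}^2$ be the open unit ball in $\mathbb{C}^2$ and let $f:\partial\mathbb{B}^2\to\mathbb{C}$ be a (real-)analytic function on the sphere $\partial\mathbb{B}^2$. Let $p\in\mathbb{C}^2\setminus\overline{\mathbb{B}^2}$. Suppose that $f$ extends holomorphically in each variable separately (that is, along every complex line parallel to the $z_1$-axis and along every complex line parallel to the $z_2$-axis) and along each complex line through $p$. Then $f$ extends holomorphically to $\mathbb{B}^2$, i.e. there is a continuous function on $\overline{\mathbb{B}^2}$ that is holomorphic in $\mathbb{B}^2$ and equals $f$ on $\partial\mathbb{B}^2$.
   Context: ''Analytic on $\partial\mathbb{B}^2$'' means real-analytic on the real-analytic manifold $\partial\mathbb{B}^2$ (complex-valued). For a complex line (complex affine line) $L\subset\mathbb{C}^2$ meeting $\mathbb{B}^2$, the function $f$ is said to extend holomorphically along $L$ if there is a continuous function on $L\cap\overline{\mathbb{B}^2}$ that is holomorphic on the disc $L\cap\mathbb{B}^2$ and agrees with $f$ on the circle $L\cap\partial\mathbb{B}^2$. Only lines meeting $\mathbb{B}^2$ impose a condition. *)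

(* Defs.v *)
From Stdlib Require Import Reals.
From Coquelicot Require Import Coquelicot.
Open Scope R_scope.

Definition C2 : Type := (C * C)%type.

Definition normsq (z : C2) : R := Cmod (fst z) ^ 2 + Cmod (snd z) ^ 2.

Definition in_ball (z : C2) : Prop := normsq z < 1.
Definition in_closed_ball (z : C2) : Prop := normsq z <= 1.
Definition in_sphere (z : C2) : Prop := normsq z = 1.

(** ** Real-analytic functions *)

(* Sum of the terms of total degree [n] of a family indexed by N^3. *)
Definition degree_sum {G : AbelianMonoid} (a : nat -> nat -> nat -> G)
    (n : nat) : G :=
  sum_n (fun i => sum_n (fun j => a i j (n - i - j)%nat) (n - i)) n.

(* On a box around [(x0, y0, z0)], [g] is the sum of an absolutely convergent
   power series in three real variables with complex coefficients.  Absolute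
   convergence makes the grouping by total degree immaterial. *)
Definition real_analytic_at (g : R -> R -> R -> C) (x0 y0 z0 : R) : Prop :=
  exists (c : nat -> nat -> nat -> C) (r : R), 0 < r /\
    forall x y z : R,
      Rabs (x - x0) < r -> Rabs (y - y0) < r -> Rabs (z - z0) < r ->
      let term i j k : C :=
        (c i j k * RtoC ((x - x0) ^ i * (y - y0) ^ j * (z - z0) ^ k))%C in
      ex_series (degree_sum (G := R_AbelianMonoid)
                   (fun i j k => Cmod (term i j k))) /\
      is_series (K := C_AbsRing) (V := C_NormedModule)
        (degree_sum (G := C_AbelianMonoid) term) (g x y z).

(* Inverses of the stereographic projections of the unit sphere of C^2 = R^4
   from the poles (0, i) and (0, -i).  These two charts cover the sphere and
   generate its real-analytic structure. *)
Definition stereo_north (x y z : R) : C2 :=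
  let s := x ^ 2 + y ^ 2 + z ^ 2 in
  ((2 * x / (1 + s), 2 * y / (1 + s)), (2 * z / (1 + s), (s - 1) / (1 + s))).

Definition stereo_south (x y z : R) : C2 :=
  let s := x ^ 2 + y ^ 2 + z ^ 2 in
  ((2 * x / (1 + s), 2 * y / (1 + s)), (2 * z / (1 + s), (1 - s) / (1 + s))).

(* Functions on the sphere are represented by functions on C^2 whose values
   off the sphere are never used. *)
Definition real_analytic_on_sphere (f : C2 -> C) : Prop :=
  forall x0 y0 z0 : R,
    real_analytic_at (fun x y z => f (stereo_north x y z)) x0 y0 z0 /\
    real_analytic_at (fun x y z => f (stereo_south x y z)) x0 y0 z0.

(** ** Holomorphic extension *)

Definition line_pt (a v : C2) (t : C) : C2 :=
  (fst a + t * fst v, snd a + t * snd v)%C.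

Definition on_line (a v z : C2) : Prop := exists t : C, z = line_pt a v t.

Definition line_meets_ball (a v : C2) : Prop :=
  exists t : C, in_ball (line_pt a v t).

(* [g] only matters on the part of the line [a + C v] (with [v <> 0]) in the
   closed ball.  Holomorphy on the disc is expressed in the affine coordinate
   [t] of the line. *)
Definition extends_along_line (f : C2 -> C) (a v : C2) : Prop :=
  exists g : C2 -> C,
    continuous_on (T := prod_UniformSpace C_UniformSpace C_UniformSpace)
      (U := C_UniformSpace)
      (fun z => on_line a v z /\ in_closed_ball z) g /\
    (forall t : C, in_ball (line_pt a v t) ->
       ex_derive (K := C_AbsRing) (V := C_NormedModule)
         (fun s => g (line_pt a v s)) t) /\
    (forall z : C2, on_line a v z -> in_sphere z -> g z = f z).

(* Complex Frechet differentiability at [z]. *)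
Definition holomorphic_at (g : C2 -> C) (z : C2) : Prop :=
  ex_filterdiff (K := C_AbsRing)
    (U := prod_NormedModule C_AbsRing C_NormedModule C_NormedModule)
    (V := C_NormedModule) g
    (locally (T := prod_UniformSpace C_UniformSpace C_UniformSpace) z).

Definition extends_to_ball (f : C2 -> C) : Prop :=
  exists g : C2 -> C,
    continuous_on (T := prod_UniformSpace C_UniformSpace C_UniformSpace)
      (U := C_UniformSpace) in_closed_ball g /\
    (forall z : C2, in_ball z -> holomorphic_at g z) /\
    (forall z : C2, in_sphere z -> g z = f z).

(* Main.v *)
(* Rotate so that p = (1/b, 0) with 0 < b < 1.  Extension in z1 and in z2 gives, by Fourier expansion in one of the variables, extension
   along all lines through 0; only these lines and the lines through p are used from there on.

   Fix the n-th Fourier coefficient of f along the circles |u2| = sqrt(1 - |u1|^2) and divide it by sqrt(1 - |u1|^2)^n: this gives a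
   function H on the unit disc.  The lines through 0 show that H z^|n| extends holomorphically from every circle |z| = r, and, after the
   automorphism exchanging 0 and b, the lines through p show that (up to a holomorphic factor) H extends holomorphically from the small
   hyperbolic circles around b.  By analyticity H near b is H(z, w) at w = conj z with H holomorphic in two variables; the second family
   gives H = sum_i xi^i p_i(eta) in the coordinates xi = phi z, eta = phi w, where p_i is a polynomial of degree at most i, and the first
   family says that for fixed s = z w the function of z has an expansion sum_k beta_k(sqrt s) (z - b)^k.  Letting z tend to b and
   arguing by induction on k, beta_k(sqrt(b w)) is a polynomial in phi w up to constants.  It continues analytically to s < 1, where phi w
   has a pole at s = 1, whereas f bounded and analytic keeps beta_k bounded; so the polynomial is constant.  Hence H z^|n| does not depend
   on s, all Fourier coefficients of f on the tori are monomials, f is a uniform limit of polynomials on the sphere (Fejér), and the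
   mean value property on circles of complex lines carries the limit to the ball. *)

From Stdlib Require Import Reals Lra Lia Psatz ZArith ClassicalEpsilon FunctionalExtensionality.
From Coquelicot Require Import Coquelicot.
Require Import Defs.
Open Scope R_scope.

(** Extension along a line enters only as a family of moment conditions: for a holomorphic
    parametrisation by the unit disc, the averages against [ei (l * t)] with [l > 0] vanish.
    Rotations, the automorphism of the ball and interchanges of averages act directly on these. The
    obstacle is the division by [sqrt (1 - r ^ 2) ^ n] for [n > 0], which is singular as [r] tends
    to [1]. Analyticity removes it: in the complexified sphere the fibre circle can be enlarged to a
    fixed radius, and Cauchy's estimate regains the lost power. This needs a neighbourhood of
    uniform width, hence a compactness argument on the sphere. In the induction two values [w], [w']
    are compared at the same [z], on the circles [r ^ 2 = z * w] and [r ^ 2 = z * w']. The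
    coefficients already known to be constant cancel on both sides, so both differences begin at
    order [k] and their leading terms can be compared although the circles move with [z]. The point
    [b] must lie inside the circles, so the argument runs for [r > b]; smaller radii follow by
    analyticity in [r]. *)

Lemma C_eq (x y : C) : Re x = Re y -> Im x = Im y -> x = y.
Proof. destruct x, y; simpl; intros -> ->; reflexivity. Qed.

Lemma Cmod_le_re_im (z : C) : Cmod z <= Rabs (Re z) + Rabs (Im z).
Proof.
  pose proof (Rabs_pos (Re z)); pose proof (Rabs_pos (Im z)).
  apply Rsqr_incr_0_var; [| lra].
  pose proof (Cmod2_alt z); unfold Rsqr.
  pose proof (pow2_abs (Re z)); pose proof (pow2_abs (Im z)); nra.
Qed.

Lemma im_le_Cmod (z : C) : Rabs (Im z) <= Cmod z.
Proof.
  pose proof (Rmax_Cmod z). pose proof (Rmax_r (Rabs (fst z)) (Rabs (snd z))). unfold Im; lra.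
Qed.

Lemma Cmod_sub_sym (x y : C) : Cmod (x - y) = Cmod (y - x).
Proof. rewrite <- Cmod_opp. f_equal. ring. Qed.

Lemma Cmod_tri_sub (x y z : C) : Cmod (x - z) <= Cmod (x - y) + Cmod (y - z).
Proof. replace (x - z)%C with ((x - y) + (y - z))%C by ring. apply Cmod_triangle. Qed.

Lemma Cmod_tri_minus (x y : C) : Cmod (x - y) <= Cmod x + Cmod y.
Proof. rewrite <- (Cmod_opp y). apply Cmod_triangle. Qed.

Lemma Cmod_le_add (x y : C) : Cmod x <= Cmod y + Cmod (x - y).
Proof. replace x with (y + (x - y))%C at 1 by ring. apply Cmod_triangle. Qed.

Lemma Cmod_small_0 (z : C) : (forall e, 0 < e -> Cmod z <= e) -> z = RtoC 0.
Proof.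
  intros H. apply Cmod_eq_0. apply Rle_antisym; [| apply Cmod_ge_0].
  apply le_epsilon. intros e He. specialize (H e He). lra.
Qed.

(** * Unimodular exponentials *)

Definition ei (t : R) : C := (cos t, sin t).

Lemma Cmod_ei t : Cmod (ei t) = 1.
Proof.
  unfold Cmod, ei; simpl. transitivity (sqrt 1); [f_equal | apply sqrt_1].
  transitivity (Rsqr (sin t) + Rsqr (cos t)); [unfold Rsqr; ring | apply sin2_cos2].
Qed.

Lemma ei_plus s t : ei (s + t) = (ei s * ei t)%C.
Proof. apply C_eq; simpl; [apply cos_plus | rewrite sin_plus; ring]. Qed.

Lemma ei_0 : ei 0 = RtoC 1.
Proof. apply C_eq; simpl; [apply cos_0 | apply sin_0]. Qed.

Lemma ei_conj t : Cconj (ei t) = ei (- t).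
Proof. apply C_eq; simpl; [rewrite cos_neg | rewrite sin_neg]; reflexivity. Qed.

Lemma ei_neg_mul t : (ei (- t) * ei t)%C = RtoC 1.
Proof. rewrite <- ei_plus. replace (- t + t) with 0 by ring. apply ei_0. Qed.

Lemma ei_nz t : ei t <> RtoC 0.
Proof. intros H. pose proof (Cmod_ei t) as E. rewrite H, Cmod_0 in E. lra. Qed.

Lemma ei_pow n t : (ei t ^ n)%C = ei (INR n * t).
Proof.
  induction n as [|n IH].
  - simpl. rewrite Rmult_0_l. symmetry; apply ei_0.
  - rewrite Cpow_S, IH, <- ei_plus, S_INR. f_equal; ring.
Qed.

Lemma ei_2pi t : ei (t + 2 * PI) = ei t.
Proof. apply C_eq; simpl; [apply cos_2PI_neq || idtac | idtac]; rewrite ?cos_plus, ?sin_plus, ?cos_2PI, ?sin_2PI; ring. Qed.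

Lemma ei_Z_2pi (m : Z) t : ei (IZR m * (t + 2 * PI)) = ei (IZR m * t).
Proof.
  assert (Hn : forall n, ei (INR n * (2 * PI)) = RtoC 1).
  { intros n. rewrite <- ei_pow. replace (2 * PI) with (0 + 2 * PI) by ring.
    rewrite ei_2pi, ei_0. apply Cpow_1_l. }
  rewrite Rmult_plus_distr_l, ei_plus.
  enough (ei (IZR m * (2 * PI)) = RtoC 1) as -> by ring.
  destruct (Z_le_gt_dec 0 m) as [Hm|Hm].
  - rewrite <- (Z2Nat.id m) by lia. rewrite <- INR_IZR_INZ. apply Hn.
  - replace (IZR m) with (- INR (Z.to_nat (- m))).
    2:{ rewrite INR_IZR_INZ, Z2Nat.id by lia. rewrite opp_IZR; ring. }
    rewrite Ropp_mult_distr_l_reverse, <- ei_conj, Hn. apply C_eq; simpl; ring.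
Qed.

(** Links chords with [1 - cos], the function against which the Fejér kernel is tested. *)
Lemma ei_dist2 s t : Cmod (ei s - ei t) ^ 2 = 2 * (1 - cos (s - t)).
Proof.
  rewrite Cmod2_alt. simpl. rewrite cos_minus.
  pose proof (sin2_cos2 s) as A; pose proof (sin2_cos2 t) as B; unfold Rsqr in *. nra.
Qed.

(** The chord is [2 * |sin ((s - t) / 2)|], and the mean value theorem bounds the sine by its
    argument. *)
Lemma ei_lip s t : Cmod (ei s - ei t) <= Rabs (s - t).
Proof.
  apply Rsqr_incr_0_var; [| apply Rabs_pos]. rewrite !Rsqr_pow2, ei_dist2, pow2_abs.
  pose proof (cos_2a_sin ((s - t) / 2)) as H.
  replace (2 * ((s - t) / 2)) with (s - t) in H by field. rewrite H.
  assert (Rabs (sin ((s - t) / 2)) <= Rabs ((s - t) / 2)).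
  { destruct (Req_dec ((s-t)/2) 0) as [E|E]; [rewrite E, sin_0; lra|].
    destruct (MVT_cor2 sin cos 0 (Rabs ((s-t)/2))) as [c [Hc _]].
    - apply Rabs_pos_lt; auto.
    - intros; apply derivable_pt_lim_sin.
    - rewrite sin_0 in Hc.
      assert (Rabs (sin ((s-t)/2)) = Rabs (sin (Rabs ((s-t)/2)))).
      { unfold Rabs at 3. destruct (Rcase_abs ((s-t)/2)); [rewrite sin_neg, Rabs_Ropp|]; reflexivity. }
      rewrite H0. replace (sin (Rabs ((s-t)/2))) with (cos c * Rabs ((s-t)/2)) by lra.
      rewrite Rabs_mult, Rabs_Rabsolu.
      pose proof (COS_bound c). assert (Rabs (cos c) <= 1) by (apply Rabs_le; lra).
      pose proof (Rabs_pos ((s-t)/2)). nra. }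
  pose proof (Rsqr_le_abs_1 _ _ H0) as H1. unfold Rsqr in H1. nra.
Qed.

Lemma polar_unit (z : C) : Cmod z = 1 -> exists t, - PI <= t <= PI /\ z = ei t.
Proof.
  intros H. pose proof (Cmod2_alt z) as E. rewrite H in E. pose proof (pow2_ge_0 (Re z)). pose proof (pow2_ge_0 (Im z)).
  assert (-1 <= Re z <= 1) by (split; nra). pose proof (acos_bound (Re z)) as B. pose proof PI_RGT_0.
  assert (Hs : sin (acos (Re z)) = Rabs (Im z)).
  { rewrite sin_acos by auto. rewrite <- sqrt_Rsqr_abs. f_equal. unfold Rsqr; nra. }
  destruct (Rle_dec 0 (Im z)).
  - exists (acos (Re z)). split; [lra|]. apply C_eq; simpl; [rewrite cos_acos|rewrite Hs, Rabs_right]; auto; lra.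
  - exists (- acos (Re z)). split; [lra|]. apply C_eq; simpl.
    + rewrite cos_neg, cos_acos; auto.
    + rewrite sin_neg, Hs, Rabs_left; lra.
Qed.

Lemma polar_bd (z : C) : exists t, - PI <= t <= PI /\ z = (Cmod z * ei t)%C.
Proof.
  pose proof PI_RGT_0. destruct (Req_dec (Cmod z) 0) as [E|E].
  - exists 0. split; [lra|]. rewrite E. apply Cmod_eq_0 in E. subst z. ring.
  - assert (RtoC (Cmod z) <> 0) by (intros A; apply RtoC_inj in A; auto).
    destruct (polar_unit (z / Cmod z)) as [t [Hb Ht]].
    + rewrite Cmod_div, Cmod_R, Rabs_right by (auto; apply Rle_ge, Cmod_ge_0). field; auto.
    + exists t. split; auto. rewrite <- Ht. field; auto.
Qed.

Lemma polar (z : C) : exists t, z = (Cmod z * ei t)%C.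
Proof. destruct (polar_bd z) as [t [_ Ht]]. exists t. auto. Qed.

(** * Finite sums and series *)

Fixpoint csum (w : nat -> C) (n : nat) : C :=
  match n with O => RtoC 0 | S n => (csum w n + w n)%C end.

Definition cser (w : nat -> C) (l : C) : Prop :=
  forall e, 0 < e -> exists N, forall n, (N <= n)%nat -> Cmod (csum w n - l) < e.

Lemma csum_ext w v n : (forall k, (k < n)%nat -> w k = v k) -> csum w n = csum v n.
Proof. induction n; intros H; simpl; auto. rewrite IHn by auto. rewrite H by auto. auto. Qed.

Lemma csum_0 n : csum (fun _ => RtoC 0) n = 0.
Proof. induction n; simpl; auto. rewrite IHn; ring. Qed.

Lemma csum_eq0 w n : (forall k, (k < n)%nat -> w k = RtoC 0) -> csum w n = 0.
Proof. intros H. rewrite (csum_ext w (fun _ => RtoC 0)) by auto. apply csum_0. Qed.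

Lemma csum_plus w v n : csum (fun k => w k + v k)%C n = (csum w n + csum v n)%C.
Proof. induction n; simpl; [ring|rewrite IHn; ring]. Qed.

Lemma csum_minus w v n : csum (fun k => w k - v k)%C n = (csum w n - csum v n)%C.
Proof. induction n; simpl; [ring|rewrite IHn; ring]. Qed.

Lemma csum_scal c w n : csum (fun k => c * w k)%C n = (c * csum w n)%C.
Proof. induction n; simpl; [ring|rewrite IHn; ring]. Qed.

Lemma csum_shift w n : csum w (S n) = (w O + csum (fun k => w (S k)) n)%C.
Proof. induction n; simpl in *; [ring|rewrite IHn; ring]. Qed.

Lemma csum_swap (w : nat -> nat -> C) n m :
  csum (fun j => csum (w j) m) n = csum (fun k => csum (fun j => w j k) n) m.
Proof.
  induction n; simpl; [symmetry; apply csum_0|]. rewrite IHn, <- csum_plus. reflexivity.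
Qed.

Fixpoint rsum (w : nat -> R) (n : nat) : R :=
  match n with O => 0 | S n => rsum w n + w n end.

Lemma csum_bound w v n : (forall k, (k < n)%nat -> Cmod (w k) <= v k) -> Cmod (csum w n) <= rsum v n.
Proof.
  induction n; intros H; simpl; [rewrite Cmod_0; lra|].
  eapply Rle_trans; [apply Cmod_triangle|]. apply Rplus_le_compat; auto.
Qed.

Lemma csum_bound_const w B n : (forall k, (k < n)%nat -> Cmod (w k) <= B) -> Cmod (csum w n) <= INR n * B.
Proof.
  intros H. eapply Rle_trans; [apply (csum_bound w (fun _ => B)); auto|].
  clear H. induction n; [simpl; lra|]. rewrite S_INR. simpl rsum. lra.
Qed.

Lemma rsum_geo q n : q <> 1 -> rsum (fun k => q ^ k) n = (1 - q ^ n) / (1 - q).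
Proof. intros H. induction n; simpl; [field; lra|rewrite IHn; field; lra]. Qed.

Lemma rsum_scal c w n : rsum (fun k => c * w k) n = c * rsum w n.
Proof. induction n; simpl; [ring|rewrite IHn; ring]. Qed.

Lemma cser_unique w l l' : cser w l -> cser w l' -> l = l'.
Proof.
  intros H H'. enough (l - l' = RtoC 0)%C as E by (replace l with (l - l' + l')%C by ring; rewrite E; ring).
  apply Cmod_small_0. intros e He.
  destruct (H (e/2)) as [N HN]; [lra|]. destruct (H' (e/2)) as [N' HN']; [lra|].
  specialize (HN (N + N')%nat ltac:(lia)). specialize (HN' (N + N')%nat ltac:(lia)).
  pose proof (Cmod_tri_sub l (csum w (N + N')) l'). rewrite (Cmod_sub_sym l (csum w (N + N'))) in H0. lra.
Qed.

Lemma cser_ext w v l : (forall k, w k = v k) -> cser w l -> cser v l.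
Proof.
  intros E H e He. destruct (H e He) as [N HN]. exists N. intros n Hn.
  rewrite <- (csum_ext w v) by auto. auto.
Qed.

Lemma cser_plus w v l m : cser w l -> cser v m -> cser (fun k => w k + v k)%C (l + m)%C.
Proof.
  intros H H' e He. destruct (H (e/2)) as [N HN]; [lra|]. destruct (H' (e/2)) as [N' HN']; [lra|].
  exists (N + N')%nat. intros n Hn. rewrite csum_plus.
  replace (csum w n + csum v n - (l + m))%C with ((csum w n - l) + (csum v n - m))%C by ring.
  eapply Rle_lt_trans; [apply Cmod_triangle|].
  specialize (HN n ltac:(lia)). specialize (HN' n ltac:(lia)). lra.
Qed.

Lemma cser_scal c w l : cser w l -> cser (fun k => c * w k)%C (c * l)%C.
Proof.
  intros H e He. destruct (H (e / (Cmod c + 1))) as [N HN].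
  { apply Rdiv_lt_0_compat; auto. pose proof (Cmod_ge_0 c); lra. }
  exists N. intros n Hn. rewrite csum_scal.
  replace (c * csum w n - c * l)%C with (c * (csum w n - l))%C by ring. rewrite Cmod_mult.
  specialize (HN n Hn). pose proof (Cmod_ge_0 c). pose proof (Cmod_ge_0 (csum w n - l)).
  apply Rle_lt_trans with ((Cmod c + 1) * Cmod (csum w n - l)); [nra|].
  apply Rmult_lt_reg_l with (/ (Cmod c + 1)); [apply Rinv_0_lt_compat; lra|].
  rewrite <- Rmult_assoc, Rinv_l, Rmult_1_l by lra. rewrite Rmult_comm. auto.
Qed.

Lemma cser_minus w v l m : cser w l -> cser v m -> cser (fun k => w k - v k)%C (l - m)%C.
Proof.
  intros H H'. pose proof (cser_plus _ _ _ _ H (cser_scal (-(1)) _ _ H')) as A.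
  replace (l - m)%C with (l + -(1) * m)%C by ring.
  eapply cser_ext; [|apply A]. intros; simpl; ring.
Qed.

Lemma cser_shift w l : cser w l -> cser (fun k => w (S k)) (l - w O)%C.
Proof.
  intros H e He. destruct (H e He) as [N HN]. exists N. intros n Hn.
  specialize (HN (S n) ltac:(lia)). rewrite csum_shift in HN.
  replace (csum (fun k => w (S k)) n - (l - w 0%nat))%C with (w 0%nat + csum (fun k => w (S k)) n - l)%C by ring.
  auto.
Qed.

Lemma cser_finite w n : (forall k, (n <= k)%nat -> w k = RtoC 0) -> cser w (csum w n).
Proof.
  intros H e He. exists n. intros m Hm. replace m with (n + (m - n))%nat by lia.
  induction (m - n)%nat as [|d IH].
  - rewrite Nat.add_0_r. replace (csum w n - csum w n)%C with (RtoC 0) by ring. rewrite Cmod_0; auto.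
  - rewrite Nat.add_succ_r. simpl. rewrite H by lia. rewrite Cplus_0_r. auto.
Qed.

(** The rate [e] need not be monotone: all terms beyond [N] are within [e N] of the [N]-th one. The
    limit inherits the same rate, which the tail estimates for series rely on. *)
Lemma cauchy_C (s : nat -> C) (e : nat -> R) :
  (forall n m, (n <= m)%nat -> Cmod (s m - s n) <= e n) ->
  (forall d, 0 < d -> exists N, e N < d) ->
  exists l, forall n, Cmod (s n - l) <= e n.
Proof.
  intros H He.
  assert (Hc : forall p : C -> R, (forall x y, Rabs (p x - p y) <= Cmod (x - y)) ->
     exists l, Un_cv (fun n => p (s n)) l).
  { intros p Hp. destruct (Rcomplete.R_complete (fun n => p (s n))) as [l Hl]; [|exists l; auto].
    intros d Hd. destruct (He (d/2)) as [N HN]; [lra|]. exists N. intros n m Hn Hm.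
    unfold Rdist. specialize (Hp (s n) (s m)).
    pose proof (Cmod_tri_sub (s n) (s N) (s m)). rewrite (Cmod_sub_sym (s N)) in H0.
    pose proof (H N n ltac:(lia)). pose proof (H N m ltac:(lia)). lra. }
  destruct (Hc Re) as [a Ha].
  { intros. replace (Re x - Re y) with (Re (x - y)%C) by (unfold Re; simpl; ring). apply re_le_Cmod. }
  destruct (Hc Im) as [b Hb].
  { intros. replace (Im x - Im y) with (Im (x - y)%C) by (unfold Im; simpl; ring). apply im_le_Cmod. }
  exists (a, b). intros n. apply le_epsilon. intros d Hd.
  destruct (Ha (d/2)) as [N1 H1]; [lra|]. destruct (Hb (d/2)) as [N2 H2]; [lra|].
  set (m := (n + N1 + N2)%nat). specialize (H1 m ltac:(unfold m; lia)). specialize (H2 m ltac:(unfold m; lia)).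
  unfold Rdist in *.
  pose proof (Cmod_tri_sub (s n) (s m) (a, b)). rewrite (Cmod_sub_sym (s n) (s m)) in H0.
  pose proof (H n m ltac:(unfold m; lia)).
  pose proof (Cmod_le_re_im (s m - (a, b))). simpl in H4. unfold Re, Im, Rminus in *. lra.
Qed.

Lemma pow_small q d : 0 <= q < 1 -> 0 < d -> exists N, q ^ N < d.
Proof.
  intros Hq Hd. destruct (pow_lt_1_zero q) with (y := d) as [N HN]; auto.
  { rewrite Rabs_right; lra. }
  exists N. specialize (HN N (Nat.le_refl _)). rewrite Rabs_right in HN; auto.
  apply Rle_ge, pow_le; lra.
Qed.

Lemma csum_geo_tail w B q n m : 0 <= q < 1 -> (forall k, Cmod (w k) <= B * q ^ k) -> (n <= m)%nat ->
  Cmod (csum w m - csum w n) <= B * q ^ n / (1 - q).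
Proof.
  intros Hq H Hnm. assert (HB : 0 <= B). { specialize (H O). simpl in H. pose proof (Cmod_ge_0 (w O)). lra. }
  (* Subtracting the tail beyond [m] makes the bound telescope in the induction on [m - n]. *)
  enough (Cmod (csum w m - csum w n) <= B * q ^ n / (1 - q) - B * q ^ m / (1 - q)).
  { assert (0 <= B * q ^ m / (1 - q)).
    { apply Rmult_le_pos; [apply Rmult_le_pos; auto; apply pow_le; lra|]. apply Rlt_le, Rinv_0_lt_compat; lra. }
    lra. }
  replace m with (n + (m - n))%nat by lia. induction (m - n)%nat as [|d IH].
  - rewrite Nat.add_0_r. replace (csum w n - csum w n)%C with (RtoC 0) by ring. rewrite Cmod_0; lra.
  - rewrite Nat.add_succ_r. simpl csum.
    replace (csum w (n + d) + w (n + d)%nat - csum w n)%C with (csum w (n + d) - csum w n + w (n + d)%nat)%C by ring.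
    eapply Rle_trans; [apply Cmod_triangle|]. specialize (H (n + d)%nat).
    replace (B * q ^ S (n + d) / (1 - q)) with (B * q ^ (n + d) / (1 - q) - B * q ^ (n + d)) by (simpl; field; lra).
    lra.
Qed.

Lemma cser_geo w B q : 0 <= q < 1 -> (forall k, Cmod (w k) <= B * q ^ k) ->
  exists l, cser w l /\ Cmod l <= B / (1 - q) /\ forall n, Cmod (csum w n - l) <= B * q ^ n / (1 - q).
Proof.
  intros Hq H. assert (HB : 0 <= B). { specialize (H O). simpl in H. pose proof (Cmod_ge_0 (w O)). lra. }
  destruct (cauchy_C (csum w) (fun n => B * q ^ n / (1 - q))) as [l Hl].
  - intros. apply csum_geo_tail; auto.
  - intros d Hd. destruct (pow_small q (d * (1 - q) / (B + 1))) as [N HN]; auto.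
    { apply Rdiv_lt_0_compat; nra. }
    exists N. apply Rmult_lt_reg_r with (1 - q); [lra|].
    unfold Rdiv at 1. rewrite Rmult_assoc, Rinv_l, Rmult_1_r by lra.
    apply Rle_lt_trans with ((B + 1) * q ^ N). { pose proof (pow_le q N ltac:(lra)); nra. }
    apply Rmult_lt_reg_r with (/ (B + 1)); [apply Rinv_0_lt_compat; lra|].
    rewrite (Rmult_comm (B + 1)), Rmult_assoc, Rinv_r, Rmult_1_r by lra. auto.
  - exists l. repeat split; auto.
    + intros e He. destruct (pow_small q (e * (1 - q) / (B + 1))) as [N HN]; auto.
      { apply Rdiv_lt_0_compat; nra. }
      exists N. intros n Hn. eapply Rle_lt_trans; [apply Hl|].
      apply Rmult_lt_reg_r with (1 - q); [lra|].
      unfold Rdiv at 1. rewrite Rmult_assoc, Rinv_l, Rmult_1_r by lra.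
      apply Rle_lt_trans with ((B + 1) * q ^ N).
      { pose proof (pow_le q n ltac:(lra)).
        assert (q ^ n <= q ^ N). { replace n with (N + (n - N))%nat by lia. rewrite pow_add.
          pose proof (pow_le q N ltac:(lra)). assert (q ^ (n - N) <= 1) by (rewrite <- (pow1 (n - N)); apply pow_incr; lra). nra. }
        nra. }
      apply Rmult_lt_reg_r with (/ (B + 1)); [apply Rinv_0_lt_compat; lra|].
      rewrite (Rmult_comm (B + 1)), Rmult_assoc, Rinv_r, Rmult_1_r by lra. auto.
    + specialize (Hl O). simpl in Hl. replace (0 - l)%C with (- l)%C in Hl by ring. rewrite Cmod_opp, Rmult_1_r in Hl. auto.
Qed.

Lemma Cmult_cancel_l (a x y : C) : a <> 0 -> (a * x)%C = (a * y)%C -> x = y.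
Proof. intros Ha E. apply (f_equal (fun z => / a * z)%C) in E. rewrite !Cmult_assoc, Cinv_l, !Cmult_1_l in E; auto. Qed.

(** * Integrals of complex-valued functions of a real variable *)

Definition ccont_at (u : R -> C) (t : R) : Prop :=
  forall e, 0 < e -> exists d, 0 < d /\ forall s, Rabs (s - t) < d -> Cmod (u s - u t) < e.

Definition ccont (u : R -> C) : Prop := forall t, ccont_at u t.

(** [RInt] is total, so [CInt] is too; its rules are stated under continuity, which supplies
    integrability. *)
Definition CInt (u : R -> C) (a b : R) : C :=
  (RInt (fun t => Re (u t)) a b, RInt (fun t => Im (u t)) a b).

Definition ccont_on (u : R -> C) a b : Prop := forall t, a <= t <= b -> ccont_at u t.

Lemma ccont_at_lip (p : C -> R) u t : (forall x y : C, Rabs (p x - p y) <= Cmod (x - y)) ->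
  ccont_at u t -> continuous (fun s => p (u s)) t.
Proof.
  intros Hp H. apply filterlim_locally. intros [e He]. destruct (H e He) as [d [Hd HH]].
  exists (mkposreal d Hd). intros s Hs. simpl.
  eapply Rle_lt_trans; [apply Hp|]. apply HH. apply Hs.
Qed.

Lemma re_lip (x y : C) : Rabs (Re x - Re y) <= Cmod (x - y).
Proof. replace (Re x - Re y) with (Re (x - y)%C) by (unfold Re; simpl; ring). apply re_le_Cmod. Qed.

Lemma im_lip (x y : C) : Rabs (Im x - Im y) <= Cmod (x - y).
Proof. replace (Im x - Im y) with (Im (x - y)%C) by (unfold Im; simpl; ring). apply im_le_Cmod. Qed.

Lemma ccont_ex u a b : a <= b -> ccont_on u a b ->
  ex_RInt (fun t => Re (u t)) a b /\ ex_RInt (fun t => Im (u t)) a b.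
Proof.
  intros Hab H. split; apply (ex_RInt_continuous (V := R_CompleteNormedModule)); intros z Hz;
    rewrite Rmin_left, Rmax_right in Hz by auto; apply ccont_at_lip; auto using re_lip, im_lip.
Qed.

Lemma CInt_ext u v a b : a <= b -> (forall t, a < t < b -> u t = v t) -> CInt u a b = CInt v a b.
Proof.
  intros Hab H. unfold CInt. f_equal; apply RInt_ext; intros x Hx;
    rewrite Rmin_left, Rmax_right in Hx by auto; rewrite H; auto.
Qed.

Lemma CInt_plus u v a b : a <= b -> ccont_on u a b -> ccont_on v a b ->
  CInt (fun t => u t + v t)%C a b = (CInt u a b + CInt v a b)%C.
Proof.
  intros Hab Hu Hv. destruct (ccont_ex u a b) as [E1 E2]; auto. destruct (ccont_ex v a b) as [E3 E4]; auto.
  apply C_eq; simpl; [apply (RInt_plus (V := R_CompleteNormedModule) (fun t => Re (u t)) (fun t => Re (v t)))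
    | apply (RInt_plus (V := R_CompleteNormedModule) (fun t => Im (u t)) (fun t => Im (v t)))]; auto.
Qed.

Lemma CInt_scal c u a b : a <= b -> ccont_on u a b -> CInt (fun t => c * u t)%C a b = (c * CInt u a b)%C.
Proof.
  intros Hab Hu. destruct (ccont_ex u a b) as [E1 E2]; auto. destruct c as [x y].
  apply C_eq; simpl.
  - rewrite <- (RInt_scal (V := R_CompleteNormedModule) _ a b x) by auto.
    rewrite <- (RInt_scal (V := R_CompleteNormedModule) _ a b y) by auto.
    rewrite <- (RInt_minus (V := R_CompleteNormedModule)); [reflexivity| |];
    apply (ex_RInt_scal (V := R_CompleteNormedModule)); auto.
  - rewrite <- (RInt_scal (V := R_CompleteNormedModule) _ a b x) by auto.
    rewrite <- (RInt_scal (V := R_CompleteNormedModule) _ a b y) by auto.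
    rewrite <- (RInt_plus (V := R_CompleteNormedModule)); [| |];
    try (apply (ex_RInt_scal (V := R_CompleteNormedModule)); auto).
    apply RInt_ext; intros; reflexivity.
Qed.

Lemma CInt_Chasles u a b c : a <= b -> b <= c -> ccont_on u a c ->
  CInt u a c = (CInt u a b + CInt u b c)%C.
Proof.
  intros Hab Hbc Hu. destruct (ccont_ex u a b) as [E1 E2]; auto; [intros t Ht; apply Hu; lra|].
  destruct (ccont_ex u b c) as [E3 E4]; auto; [intros t Ht; apply Hu; lra|].
  apply C_eq; simpl; symmetry; apply (RInt_Chasles (V := R_CompleteNormedModule)); auto.
Qed.

Lemma CInt_const c a b : CInt (fun _ => c) a b = (c * (b - a))%C.
Proof.
  apply C_eq; simpl; rewrite (RInt_const (V := R_CompleteNormedModule)); unfold scal; simpl; unfold mult; simpl; unfold Re, Im; ring.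
Qed.

(** Multiplying by the unimodular number [c] turns the integral into its modulus, so that only the
    real part of the integrand has to be compared with [M]. *)
Lemma CInt_bound u a b M : a <= b -> ccont_on u a b -> (forall t, a <= t <= b -> Cmod (u t) <= M) ->
  Cmod (CInt u a b) <= M * (b - a).
Proof.
  intros Hab Hu HM. set (I := CInt u a b).
  assert (0 <= M). { eapply Rle_trans; [apply Cmod_ge_0|apply (HM a); lra]. }
  destruct (Req_dec (Cmod I) 0) as [E|E]; [rewrite E; nra|].
  assert (E' : RtoC (Cmod I) <> 0) by (intros A; apply RtoC_inj in A; auto).
  set (c := (Cconj I / Cmod I)%C).
  assert (Hc : Cmod c = 1).
  { unfold c. rewrite Cmod_div, Cmod_conj, Cmod_R, Rabs_right by (auto; apply Rle_ge, Cmod_ge_0). field; auto. }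
  assert (HI : (c * I)%C = RtoC (Cmod I)).
  { unfold c. replace (Cconj I / Cmod I * I)%C with ((I * Cconj I) / Cmod I)%C by (field; auto).
    rewrite <- Cmod2_conj, RtoC_pow. simpl. field; auto. }
  assert (Hcu : ccont_on (fun t => c * u t)%C a b).
  { intros t Ht e He. destruct (Hu t Ht e He) as [d [Hd H0]]. exists d; split; auto. intros s Hs.
    replace (c * u s - c * u t)%C with (c * (u s - u t))%C by ring. rewrite Cmod_mult, Hc, Rmult_1_l. auto. }
  unfold I in HI at 1. rewrite <- CInt_scal in HI by auto.
  replace (Cmod I) with (Re (CInt (fun t => c * u t)%C a b)) by (rewrite HI; reflexivity).
  unfold CInt, Re at 1, fst. destruct (ccont_ex _ a b Hab Hcu) as [E1 _].
  replace (M * (b - a)) with (RInt (fun _ => M) a b).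
  2:{ rewrite (RInt_const (V := R_CompleteNormedModule)). unfold scal; simpl; unfold mult; simpl; ring. }
  apply RInt_le; auto. { apply (ex_RInt_const (V := R_CompleteNormedModule)). }
  intros x Hx. eapply Rle_trans; [apply Rle_abs|]. eapply Rle_trans; [apply re_le_Cmod|].
  rewrite Cmod_mult, Hc, Rmult_1_l. apply HM; lra.
Qed.

Lemma ccont_at_const c t : ccont_at (fun _ => c) t.
Proof. intros e He. exists 1; split; [lra|]. intros. replace (c - c)%C with (RtoC 0) by ring. rewrite Cmod_0; auto. Qed.

Lemma ccont_at_plus u v t : ccont_at u t -> ccont_at v t -> ccont_at (fun s => u s + v s)%C t.
Proof.
  intros Hu Hv e He. destruct (Hu (e/2)) as [d [Hd H]]; [lra|]. destruct (Hv (e/2)) as [d' [Hd' H']]; [lra|].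
  exists (Rmin d d'); split; [apply Rmin_pos; auto|]. intros s Hs.
  specialize (H s (Rlt_le_trans _ _ _ Hs (Rmin_l _ _))). specialize (H' s (Rlt_le_trans _ _ _ Hs (Rmin_r _ _))).
  replace (u s + v s - (u t + v t))%C with ((u s - u t) + (v s - v t))%C by ring.
  eapply Rle_lt_trans; [apply Cmod_triangle|]. lra.
Qed.

Lemma ccont_at_mult u v t : ccont_at u t -> ccont_at v t -> ccont_at (fun s => u s * v s)%C t.
Proof.
  intros Hu Hv e He.
  set (A := Cmod (u t) + 1). set (B := Cmod (v t) + 1).
  assert (0 < A) by (unfold A; pose proof (Cmod_ge_0 (u t)); lra).
  assert (0 < B) by (unfold B; pose proof (Cmod_ge_0 (v t)); lra).
  destruct (Hu (Rmin 1 (e/(2*B)))) as [d [Hd H1]]. { apply Rmin_pos; [lra|]. apply Rdiv_lt_0_compat; lra. }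
  destruct (Hv (e/(2*A))) as [d' [Hd' H2]]. { apply Rdiv_lt_0_compat; lra. }
  exists (Rmin d d'); split; [apply Rmin_pos; auto|]. intros s Hs.
  specialize (H1 s (Rlt_le_trans _ _ _ Hs (Rmin_l _ _))). specialize (H2 s (Rlt_le_trans _ _ _ Hs (Rmin_r _ _))).
  replace (u s * v s - u t * v t)%C with (u s * (v s - v t) + (u s - u t) * v t)%C by ring.
  eapply Rle_lt_trans; [apply Cmod_triangle|]. rewrite !Cmod_mult.
  assert (Cmod (u s) <= A). { unfold A. pose proof (Cmod_le_add (u s) (u t)). pose proof (Rmin_l 1 (e/(2*B))). lra. }
  assert (Cmod (u s - u t) < e/(2*B)) by (eapply Rlt_le_trans; [apply H1|apply Rmin_r]).
  pose proof (Cmod_ge_0 (v s - v t)). pose proof (Cmod_ge_0 (u s - u t)). pose proof (Cmod_ge_0 (u s)).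
  assert (Cmod (u s) * Cmod (v s - v t) <= A * Cmod (v s - v t)) by nra.
  assert (A * Cmod (v s - v t) < A * (e/(2*A))) by nra.
  assert (Cmod (u s - u t) * Cmod (v t) <= Cmod (u s - u t) * B) by (unfold B; nra).
  assert (Cmod (u s - u t) * B < e/(2*B) * B) by nra.
  replace (A * (e/(2*A))) with (e/2) in * by (field; lra). replace (e/(2*B)*B) with (e/2) in * by (field; lra). lra.
Qed.

Lemma ccont_at_ext u v t : (forall s, u s = v s) -> ccont_at u t -> ccont_at v t.
Proof. intros E H e He. destruct (H e He) as [d [Hd HH]]. exists d; split; auto. intros. rewrite <- !E; auto. Qed.

Lemma ccont_at_minus u v t : ccont_at u t -> ccont_at v t -> ccont_at (fun s => u s - v s)%C t.
Proof.
  intros Hu Hv. apply ccont_at_ext with (fun s => u s + -(1) * v s)%C; [intros; ring|].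
  apply ccont_at_plus; auto. apply ccont_at_mult; auto. apply ccont_at_const.
Qed.

Lemma ccont_at_ei k t : ccont_at (fun s => ei (k * s)) t.
Proof.
  intros e He. exists (e / (Rabs k + 1)). pose proof (Rabs_pos k). split; [apply Rdiv_lt_0_compat; lra|].
  intros s Hs. eapply Rle_lt_trans; [apply ei_lip|].
  replace (k * s - k * t) with (k * (s - t)) by ring. rewrite Rabs_mult.
  pose proof (Rabs_pos (s - t)).
  apply Rle_lt_trans with ((Rabs k + 1) * Rabs (s - t)); [nra|].
  apply Rmult_lt_reg_l with (/ (Rabs k + 1)); [apply Rinv_0_lt_compat; lra|].
  rewrite <- Rmult_assoc, Rinv_l, Rmult_1_l by lra. rewrite Rmult_comm. auto.
Qed.

Lemma ccont_at_csum (w : nat -> R -> C) n t : (forall k, ccont_at (w k) t) -> ccont_at (fun s => csum (fun k => w k s) n) t.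
Proof. intros H. induction n; simpl; [apply ccont_at_const|apply ccont_at_plus; auto]. Qed.

Lemma ccont_at_unif (u : R -> C) t :
  (forall e, 0 < e -> exists v, ccont_at v t /\ exists d, 0 < d /\ forall s, Rabs (s - t) < d -> Cmod (u s - v s) <= e) -> ccont_at u t.
Proof.
  intros H e He. destruct (H (e/4)) as [v [Hv [d [Hd Huv]]]]; [lra|].
  destruct (Hv (e/4)) as [d' [Hd' Hv']]; [lra|]. exists (Rmin d d'); split; [apply Rmin_pos; auto|]. intros s Hs.
  specialize (Hv' s (Rlt_le_trans _ _ _ Hs (Rmin_r _ _))). pose proof (Huv s (Rlt_le_trans _ _ _ Hs (Rmin_l _ _))).
  specialize (Huv t ltac:(replace (t - t) with 0 by ring; rewrite Rabs_R0; auto)).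
  pose proof (Cmod_tri_sub (u s) (v s) (u t)). pose proof (Cmod_tri_sub (v s) (v t) (u t)).
  rewrite (Cmod_sub_sym (v t)) in H2. lra.
Qed.

(** * Averages over the circle *)

(** For [u t = h (r * ei t)] this is the contour integral of [h z / z] over [|z| = r] divided by
    [2 * PI * Ci], normalised so that constants are their own average. *)
Definition avg (u : R -> C) : C := (CInt u 0 (2 * PI) / (2 * PI))%C.

Lemma twoPI_pos : 0 < 2 * PI. Proof. pose proof PI_RGT_0; lra. Qed.

Lemma twoPI_nz : (2 * PI)%C <> 0.
Proof. pose proof twoPI_pos. rewrite <- RtoC_mult. intros A; apply RtoC_inj in A; lra. Qed.

Lemma PI_nzC : RtoC PI <> 0.
Proof. pose proof PI_RGT_0. intros A; apply RtoC_inj in A; lra. Qed.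

Lemma avg_ext u v : (forall t, u t = v t) -> avg u = avg v.
Proof. intros H. unfold avg. rewrite (CInt_ext u v); auto. pose proof twoPI_pos; lra. Qed.

Lemma avg_plus u v : ccont u -> ccont v -> avg (fun t => u t + v t)%C = (avg u + avg v)%C.
Proof.
  intros. pose proof twoPI_pos. unfold avg. rewrite CInt_plus; [|lra|intros t _; auto..]. field. apply PI_nzC.
Qed.

Lemma avg_scal c u : ccont u -> avg (fun t => c * u t)%C = (c * avg u)%C.
Proof. intros. pose proof twoPI_pos. unfold avg. rewrite CInt_scal; [|lra|intros t _; auto]. field. apply PI_nzC. Qed.

Lemma avg_minus u v : ccont u -> ccont v -> avg (fun t => u t - v t)%C = (avg u - avg v)%C.
Proof.
  intros. rewrite (avg_ext _ (fun t => u t + -(1) * v t)%C) by (intros; ring).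
  rewrite avg_plus, avg_scal; auto. { ring. } intros t. apply ccont_at_mult; [apply ccont_at_const|auto].
Qed.

Lemma avg_const c : avg (fun _ => c) = c.
Proof. unfold avg. rewrite CInt_const, RtoC_mult. field. apply PI_nzC. Qed.

Lemma avg_bound u M : ccont u -> (forall t, Cmod (u t) <= M) -> Cmod (avg u) <= M.
Proof.
  intros Hu HM. pose proof twoPI_pos as HP. unfold avg. rewrite Cmod_div by apply twoPI_nz.
  rewrite <- RtoC_mult, Cmod_R, Rabs_right by lra.
  pose proof (CInt_bound u 0 (2*PI) M ltac:(lra) ltac:(intros t _; auto) ltac:(auto)).
  apply Rmult_le_reg_r with (2 * PI); auto. unfold Rdiv. rewrite Rmult_assoc, Rinv_l, Rmult_1_r by lra. lra.
Qed.

Lemma avg_close u v e : ccont u -> ccont v -> (forall t, Cmod (u t - v t) <= e) -> Cmod (avg u - avg v) <= e.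
Proof.
  intros Hu Hv H. rewrite <- avg_minus by auto. apply avg_bound; auto. intros t; apply ccont_at_minus; auto.
Qed.

Lemma avg_csum (w : nat -> R -> C) n : (forall k, ccont (w k)) ->
  avg (fun t => csum (fun k => w k t) n) = csum (fun k => avg (w k)) n.
Proof.
  intros H. induction n; simpl; [apply avg_const|]. rewrite avg_plus, IHn; auto.
  intros t. apply ccont_at_csum. intros; apply H.
Qed.

Lemma CInt_comp_plus u a b c : a <= b -> ccont u -> CInt (fun t => u (t + c)) a b = CInt u (a + c) (b + c).
Proof.
  intros Hab Hu.
  assert (H : forall p : C -> R, (forall x y, Rabs (p x - p y) <= Cmod (x - y)) ->
    RInt (fun t => p (u (t + c))) a b = RInt (fun t => p (u t)) (a + c) (b + c)).
  { intros p Hp. replace (a + c) with (1 * a + c) by ring. replace (b + c) with (1 * b + c) by ring.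
    rewrite <- (RInt_comp_lin (V := R_CompleteNormedModule) (fun t => p (u t)) 1 c a b).
    - apply RInt_ext. intros. unfold scal; simpl; unfold mult; simpl. rewrite !Rmult_1_l. reflexivity.
    - apply (ex_RInt_continuous (V := R_CompleteNormedModule)). intros z _. apply ccont_at_lip; auto. }
  apply C_eq; simpl; apply H; auto using re_lip, im_lip.
Qed.

Lemma avg_shift u c : ccont u -> (forall t, u (t + 2 * PI) = u t) -> avg (fun t => u (t + c)) = avg u.
Proof.
  intros Hu Hper. unfold avg. f_equal. pose proof twoPI_pos.
  assert (Hpos : forall c, 0 <= c -> CInt (fun t => u (t + c)) 0 (2 * PI) = CInt u 0 (2 * PI)).
  { clear c. intros c Hc. rewrite CInt_comp_plus by (auto; lra).
    pose proof (CInt_Chasles u 0 (0 + c) (2 * PI + c) ltac:(lra) ltac:(lra) ltac:(intros t _; auto)) as E1.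
    pose proof (CInt_Chasles u 0 (2 * PI) (2 * PI + c) ltac:(lra) ltac:(lra) ltac:(intros t _; auto)) as E2.
    assert (E3 : CInt u (2 * PI) (2 * PI + c) = CInt u 0 (0 + c)).
    { replace (2 * PI) with (0 + 2 * PI) at 1 by ring. replace (2 * PI + c) with (c + 2 * PI) by ring.
      rewrite <- CInt_comp_plus by auto. rewrite Rplus_0_l. apply CInt_ext; auto. }
    rewrite E3, E1 in E2.
    apply (f_equal (fun x => x - CInt u 0 (0 + c)))%C in E2.
    transitivity (CInt u 0 (0 + c) + CInt u (0 + c) (2 * PI + c) - CInt u 0 (0 + c))%C; [ring|].
    rewrite E2. ring. }
  destruct (Rle_dec 0 c) as [Hc|Hc]; [auto|].
  assert (Hu' : ccont (fun t => u (t + c))).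
  { intros t e He. destruct (Hu (t + c) e He) as [d [Hd H0]]. exists d; split; auto. intros s Hs. apply H0.
    replace (s + c - (t + c)) with (s - t) by ring; auto. }
  assert (H2 : CInt (fun t => u (t + c + - c)) 0 (2 * PI) = CInt (fun t => u (t + c)) 0 (2 * PI)).
  { pose proof (CInt_comp_plus (fun t => u (t + c)) 0 (2 * PI) (- c) ltac:(lra) Hu') as E.
    transitivity (CInt u 0 (2 * PI)).
    - apply CInt_ext; [lra|]. intros. f_equal; ring.
    - rewrite CInt_comp_plus by (auto; lra).
      pose proof (CInt_Chasles u (0 + c) 0 (2 * PI + c) ) as E1.
      (* For negative [c] the window of integration is moved by whole periods until the shift is
         nonnegative and [Hpos] applies. *)
      assert (Hp2 : forall k : nat, CInt u (0 + c) (2 * PI + c) = CInt u (0 + c + INR k * (2 * PI)) (2 * PI + c + INR k * (2*PI))).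
      { induction k as [|k IH]. { simpl. rewrite Rmult_0_l, !Rplus_0_r. auto. }
        rewrite IH. rewrite S_INR.
        replace (0 + c + (INR k + 1) * (2*PI)) with (0 + c + INR k * (2*PI) + 2*PI) by ring.
        replace (2*PI + c + (INR k + 1) * (2*PI)) with (2*PI + c + INR k * (2*PI) + 2*PI) by ring.
        rewrite <- (CInt_comp_plus u _ _ (2*PI)) by (auto; lra).
        apply CInt_ext; auto. lra. }
      destruct (nfloor_ex (- c / (2*PI))) as [k [Hk1 Hk2]].
      { apply Rmult_le_pos; [lra|]. apply Rlt_le, Rinv_0_lt_compat; lra. }
      rewrite (Hp2 (S k)).
      replace (0 + c + INR (S k) * (2*PI)) with (0 + (c + INR (S k) * (2*PI))) by ring.
      replace (2*PI + c + INR (S k) * (2*PI)) with (2*PI + (c + INR (S k) * (2*PI))) by ring.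
      rewrite <- CInt_comp_plus by (auto; lra). symmetry. apply Hpos.
      rewrite S_INR. apply Rmult_lt_compat_r with (r := 2*PI) in Hk2; [|lra].
      unfold Rdiv in Hk2. rewrite Rmult_assoc, Rinv_l in Hk2 by lra. lra. }
  rewrite <- H2. apply CInt_ext; [lra|]. intros. f_equal; ring.
Qed.

(** A shift by [PI / m] leaves the average unchanged and multiplies it by [ei PI = -1]. *)
Lemma avg_ei (m : Z) : m <> 0%Z -> avg (fun t => ei (IZR m * t)) = 0.
Proof.
  intros Hm. set (A := avg _).
  assert (HA : A = (ei (IZR m * (PI / IZR m)) * A)%C).
  { unfold A at 2. rewrite <- avg_scal by (intros t; apply ccont_at_ei).
    transitivity (avg (fun t => ei (IZR m * (t + PI / IZR m)))); [symmetry; apply avg_shift with (u := fun t => ei (IZR m * t))|].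
    3:{ apply avg_ext. intros t. rewrite <- ei_plus. f_equal. ring. }
    - intros t; apply ccont_at_ei.
    - intros t. apply ei_Z_2pi. }
  replace (IZR m * (PI / IZR m)) with PI in HA by (field; apply not_0_IZR; auto).
  assert (ei PI = (-(1))%C) by (apply C_eq; simpl; [rewrite cos_PI|rewrite sin_PI]; ring).
  rewrite H in HA.
  apply C_eq; apply (f_equal Re) in HA as HR; apply (f_equal Im) in HA as HI; unfold Re, Im in *; simpl in *; lra.
Qed.

Lemma Ceq_sub (x y : C) : (x - y)%C = RtoC 0 -> x = y.
Proof. intros E. replace x with (x - y + y)%C by ring. rewrite E; ring. Qed.

Lemma Cmod_sub_diag (x : C) : Cmod (x - x) = 0.
Proof. replace (x - x)%C with (RtoC 0) by ring. apply Cmod_0. Qed.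

(** Left-endpoint sums on [N] equal arcs. They serve the interchange of two averages, for which an
    error bound by the oscillation [w] on one arc is enough. *)
Lemma riemann_approx u w N : ccont u -> (0 < N)%nat ->
  (forall s t, Rabs (s - t) <= 2 * PI / INR N -> Cmod (u s - u t) <= w) ->
  Cmod (avg u - csum (fun k => u (INR k * (2 * PI / INR N))) N / INR N) <= w.
Proof.
  intros Hu HN Hw. pose proof twoPI_pos. assert (HN' : 0 < INR N) by (apply lt_0_INR; auto).
  set (h := 2 * PI / INR N) in *. assert (Hh : 0 < h) by (apply Rdiv_lt_0_compat; auto).
  assert (G : forall n, Cmod (CInt u 0 (INR n * h) - h * csum (fun k => u (INR k * h)) n) <= w * (INR n * h)).
  { induction n as [|n IH].
    - assert (E : CInt u 0 0 = RtoC 0) by (unfold CInt; rewrite !(RInt_point (V := R_CompleteNormedModule)); reflexivity).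
      simpl. rewrite !Rmult_0_l, E, Cmult_0_r, Cmod_sub_diag. lra.
    - rewrite S_INR. pose proof (pos_INR n).
      rewrite (CInt_Chasles u 0 (INR n * h)%R) by (try nra; intros t _; auto). simpl csum.
      replace (CInt u 0 (INR n * h)%R + CInt u (INR n * h)%R ((INR n + 1) * h)%R - h * (csum (fun k => u (INR k * h)%R) n + u (INR n * h)%R))%C
        with ((CInt u 0 (INR n * h)%R - h * csum (fun k => u (INR k * h)%R) n) + (CInt u (INR n * h)%R ((INR n + 1) * h)%R - h * u (INR n * h)%R))%C by ring.
      eapply Rle_trans; [apply Cmod_triangle|].
      assert (Cmod (CInt u (INR n * h)%R ((INR n + 1) * h)%R - h * u (INR n * h)%R) <= w * h); [|lra].
      replace (h * u (INR n * h)%R)%C with (CInt (fun _ => u (INR n * h)%R) (INR n * h)%R ((INR n + 1) * h)%R).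
      2:{ rewrite CInt_const. replace (RtoC h) with (RtoC ((INR n + 1) * h)%R - RtoC (INR n * h)%R)%C.
          ring. rewrite <- RtoC_minus. f_equal; ring. }
      replace (CInt u (INR n * h)%R ((INR n + 1) * h)%R - CInt (fun _ => u (INR n * h)%R) (INR n * h)%R ((INR n + 1) * h)%R)%C
        with (CInt (fun t => u t + -(1) * u (INR n * h)%R)%C (INR n * h)%R ((INR n + 1) * h)%R).
      2:{ rewrite CInt_plus; [rewrite CInt_scal|..]; [ring| | |nra|..]; try nra; intros t _; auto; try apply ccont_at_mult; try apply ccont_at_const. }
      replace (w * h) with (w * ((INR n + 1) * h - INR n * h)) by ring.
      apply CInt_bound; [nra| |].
      + intros t _. apply ccont_at_plus; auto. apply ccont_at_const.
      + intros t Ht. replace (u t + -(1) * u (INR n * h)%R)%C with (u t - u (INR n * h)%R)%C by ring.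
        apply Hw. rewrite Rabs_right; lra. }
  specialize (G N). replace (INR N * h) with (2 * PI) in G by (unfold h; field; lra).
  assert (HNC : RtoC (INR N) <> 0) by (intros A; apply RtoC_inj in A; lra).
  unfold avg. replace (CInt u 0 (2*PI) / (2*PI) - csum (fun k => u (INR k * h)%R) N / INR N)%C
    with ((CInt u 0 (2*PI) - h * csum (fun k => u (INR k * h)%R) N) / (2 * PI))%C.
  2:{ unfold h. rewrite RtoC_div, RtoC_mult by lra. field. split; auto. apply PI_nzC. }
  rewrite Cmod_div by apply twoPI_nz. rewrite <- RtoC_mult, Cmod_R, Rabs_right by lra.
  apply Rmult_le_reg_r with (2 * PI); auto. unfold Rdiv. rewrite Rmult_assoc, Rinv_l, Rmult_1_r by lra. auto.
Qed.

Definition ucont2 (F : R -> R -> C) : Prop := forall e, 0 < e -> exists d, 0 < d /\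
  forall x x' y y', Rabs (x - x') <= d -> Rabs (y - y') <= d -> Cmod (F x y - F x' y') <= e.

Lemma ucont2_l F y : ucont2 F -> ccont (fun x => F x y).
Proof.
  intros H t e He. destruct (H (e/2)) as [d [Hd HH]]; [lra|]. exists d; split; auto. intros s Hs.
  eapply Rle_lt_trans; [apply HH; [lra|]|lra]. replace (y - y) with 0 by ring. rewrite Rabs_R0; lra.
Qed.

Lemma ucont2_sym F : ucont2 F -> ucont2 (fun x y => F y x).
Proof. intros H e He. destruct (H e He) as [d [Hd HH]]. exists d; split; auto. Qed.

Lemma ucont2_avg F : ucont2 F -> ccont (fun x => avg (fun y => F x y)).
Proof.
  intros H t e He. destruct (H (e/2)) as [d [Hd HH]]; [lra|]. exists d; split; auto. intros s Hs.
  eapply Rle_lt_trans; [apply avg_close with (e := e/2)|lra].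
  - apply (ucont2_l _ s (ucont2_sym _ H)).
  - apply (ucont2_l _ t (ucont2_sym _ H)).
  - intros. apply HH; [lra|]. replace (t0 - t0) with 0 by ring. rewrite Rabs_R0; lra.
Qed.

(** Both iterated averages are within [e / 2] of the same double Riemann sum, and finite sums
    commute. *)
Lemma avg_swap F : ucont2 F -> avg (fun x => avg (fun y => F x y)) = avg (fun y => avg (fun x => F x y)).
Proof.
  intros H.
  enough (E : forall e, 0 < e -> Cmod (avg (fun x => avg (fun y => F x y)) - avg (fun y => avg (fun x => F x y))) <= e).
  { apply Cmod_small_0 in E. apply Ceq_sub; auto. }
  intros e He. destruct (H (e/4)) as [d [Hd HH]]; [lra|]. pose proof twoPI_pos.
  destruct (nfloor_ex (2 * PI / d)) as [N [_ HN]]. { apply Rlt_le, Rdiv_lt_0_compat; auto. }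
  set (M := S N). assert (HM : 0 < INR M) by (apply lt_0_INR; unfold M; lia).
  assert (Hh : 2 * PI / INR M <= d).
  { apply Rmult_le_reg_r with (INR M); auto. unfold Rdiv. rewrite Rmult_assoc, Rinv_l, Rmult_1_r by lra.
    unfold M. rewrite S_INR. apply Rmult_lt_compat_r with (r := d) in HN; auto.
    unfold Rdiv in HN. rewrite Rmult_assoc, Rinv_l in HN by lra. lra. }
  assert (HMC : RtoC (INR M) <> 0) by (intros A; apply RtoC_inj in A; lra).
  assert (Z0 : forall a, Rabs (a - a) <= d) by (intros; replace (a - a) with 0 by ring; rewrite Rabs_R0; lra).
  assert (G : forall F, ucont2 F ->
     (forall x x' y y', Rabs (x - x') <= d -> Rabs (y - y') <= d -> Cmod (F x y - F x' y') <= e/4) ->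
     Cmod (avg (fun x => avg (fun y => F x y)) -
       csum (fun j => csum (fun k => F (INR j * (2*PI/INR M))%R (INR k * (2*PI/INR M))%R) M) M / (INR M * INR M)) <= e/2).
  { clear F H HH. intros F H HH.
    pose proof (riemann_approx (fun x => avg (fun y => F x y)) (e/4) M (ucont2_avg F H) ltac:(unfold M; lia)) as R1.
    assert (R2 : Cmod (csum (fun k => avg (fun y => F (INR k * (2*PI/INR M))%R y)) M / INR M -
       csum (fun j => csum (fun k => F (INR j * (2*PI/INR M))%R (INR k * (2*PI/INR M))%R) M) M / (INR M * INR M)) <= e/4).
    { replace (csum (fun k => avg (fun y => F (INR k * (2*PI/INR M))%R y)) M / INR M -
       csum (fun j => csum (fun k => F (INR j * (2*PI/INR M))%R (INR k * (2*PI/INR M))%R) M) M / (INR M * INR M))%C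
      with (csum (fun j => avg (fun y => F (INR j * (2*PI/INR M))%R y) - / INR M * csum (fun k => F (INR j * (2*PI/INR M))%R (INR k * (2*PI/INR M))%R) M) M / INR M)%C.
      2:{ rewrite csum_minus, csum_scal. field. auto. }
      rewrite Cmod_div, Cmod_R, Rabs_right by (auto; lra).
      apply Rle_div_l; [lra|]. rewrite (Rmult_comm (e/4)). apply csum_bound_const. intros j Hj.
      pose proof (riemann_approx (fun y => F (INR j * (2*PI/INR M))%R y) (e/4) M (ucont2_l _ _ (ucont2_sym _ H)) ltac:(unfold M; lia)) as R3.
      unfold Cdiv in R3. rewrite Cmult_comm in R3. apply R3. intros s t Hst. apply HH; auto. unfold Rdiv in *; lra. }
    assert (R1' := R1 ltac:(intros s t Hst; apply avg_close;
       [apply (ucont2_l _ s (ucont2_sym _ H))|apply (ucont2_l _ t (ucont2_sym _ H))|intros; apply HH; auto; unfold Rdiv in *; lra])).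
    eapply Rle_trans; [apply Cmod_tri_sub|]. apply Rle_trans with (e/4 + e/4); [|lra].
    apply Rplus_le_compat; [exact R1'|exact R2]. }
  pose proof (G F H HH) as G1. pose proof (G (fun x y => F y x) (ucont2_sym _ H) ltac:(intros; apply HH; auto)) as G2.
  cbv beta in G2.
  rewrite (csum_swap (fun j k => F (INR k * (2*PI/INR M))%R (INR j * (2*PI/INR M))%R)) in G2. rewrite Cmod_sub_sym in G2.
  eapply Rle_trans; [eapply Cmod_tri_sub|]. eapply Rle_trans; [apply Rplus_le_compat; [exact G1|exact G2]|lra].
Qed.

(** * Complex differentiability and Cauchy's theorem *)

Definition cder (f : C -> C) (z l : C) : Prop := forall e, 0 < e -> exists d, 0 < d /\
  forall w, Cmod (w - z) < d -> Cmod (f w - f z - l * (w - z)) <= e * Cmod (w - z).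

Definition cdiff f z := exists l, cder f z l.

Lemma cder_lip f z l : cder f z l -> exists d, 0 < d /\
  forall w, Cmod (w - z) < d -> Cmod (f w - f z) <= (Cmod l + 1) * Cmod (w - z).
Proof.
  intros H. destruct (H 1 ltac:(lra)) as [d [Hd HH]]. exists d; split; auto. intros w Hw.
  specialize (HH w Hw). pose proof (Cmod_le_add (f w - f z) (l * (w - z))). rewrite Cmod_mult in H0. lra.
Qed.

Lemma cdiff_cont f z : cdiff f z -> forall e, 0 < e -> exists d, 0 < d /\ forall w, Cmod (w - z) < d -> Cmod (f w - f z) < e.
Proof.
  intros [l H] e He. destruct (cder_lip _ _ _ H) as [d [Hd HH]]. pose proof (Cmod_ge_0 l).
  exists (Rmin d (e / (Cmod l + 1))). split; [apply Rmin_pos; auto; apply Rdiv_lt_0_compat; lra|].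
  intros w Hw. eapply Rle_lt_trans; [apply HH; eapply Rlt_le_trans; [apply Hw|apply Rmin_l]|].
  rewrite Rmult_comm. apply Rlt_div_r; [lra|]. eapply Rlt_le_trans; [apply Hw|apply Rmin_r].
Qed.

Lemma cder_ext_loc f g z l d : 0 < d -> (forall w, Cmod (w - z) < d -> f w = g w) -> cder f z l -> cder g z l.
Proof.
  intros Hd E H e He. destruct (H e He) as [d' [Hd' HH]]. exists (Rmin d d'); split; [apply Rmin_pos; auto|].
  intros w Hw. rewrite <- !E. { apply HH. eapply Rlt_le_trans; [apply Hw|apply Rmin_r]. }
  { rewrite Cmod_sub_diag; auto. } eapply Rlt_le_trans; [apply Hw|apply Rmin_l].
Qed.

Lemma cder_ext f g z l : (forall w, f w = g w) -> cder f z l -> cder g z l.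
Proof. intros E. apply (cder_ext_loc _ _ _ _ 1); auto. lra. Qed.

Lemma cdiff_ext f g z : (forall w, f w = g w) -> cdiff f z -> cdiff g z.
Proof. intros E [l H]. exists l. eapply cder_ext; eauto. Qed.

Lemma cdiff_ext_loc f g z d : 0 < d -> (forall w, Cmod (w - z) < d -> f w = g w) -> cdiff f z -> cdiff g z.
Proof. intros Hd E [l H]. exists l. eapply cder_ext_loc; eauto. Qed.

Lemma cder_const c z : cder (fun _ => c) z 0.
Proof.
  intros e He. exists 1; split; [lra|]. intros w Hw. replace (c - c - 0 * (w - z))%C with (RtoC 0) by ring.
  rewrite Cmod_0. pose proof (Cmod_ge_0 (w - z)); nra.
Qed.

Lemma cder_id z : cder (fun w => w) z 1.
Proof.
  intros e He. exists 1; split; [lra|]. intros w Hw. replace (w - z - 1 * (w - z))%C with (RtoC 0) by ring.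
  rewrite Cmod_0. pose proof (Cmod_ge_0 (w - z)); nra.
Qed.

Lemma cder_plus f g z l m : cder f z l -> cder g z m -> cder (fun w => f w + g w)%C z (l + m).
Proof.
  intros Hf Hg e He. destruct (Hf (e/2)) as [d [Hd H1]]; [lra|]. destruct (Hg (e/2)) as [d' [Hd' H2]]; [lra|].
  exists (Rmin d d'); split; [apply Rmin_pos; auto|]. intros w Hw.
  specialize (H1 w (Rlt_le_trans _ _ _ Hw (Rmin_l _ _))). specialize (H2 w (Rlt_le_trans _ _ _ Hw (Rmin_r _ _))).
  replace (f w + g w - (f z + g z) - (l + m) * (w - z))%C with ((f w - f z - l * (w - z)) + (g w - g z - m * (w - z)))%C by ring.
  eapply Rle_trans; [apply Cmod_triangle|]. lra.
Qed.

Lemma cder_comp f g z l m : cder f z l -> cder g (f z) m -> cder (fun w => g (f w)) z (m * l).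
Proof.
  intros Hf Hg e He.
  destruct (cder_lip _ _ _ Hf) as [d0 [Hd0 H0]].
  pose proof (Cmod_ge_0 l). pose proof (Cmod_ge_0 m).
  set (L := Cmod l + 1) in *. assert (0 < L) by (unfold L; lra).
  destruct (Hg (e / 2 / L)) as [d1 [Hd1 H1']]. { apply Rdiv_lt_0_compat; lra. }
  destruct (Hf (e / 2 / (Cmod m + 1))) as [d2 [Hd2 H2']]. { apply Rdiv_lt_0_compat; lra. }
  exists (Rmin d0 (Rmin d2 (d1 / L))). split. { repeat apply Rmin_pos; auto. apply Rdiv_lt_0_compat; lra. }
  intros w Hw. apply Rmin_Rgt in Hw as [Hw0 Hw]. apply Rmin_Rgt in Hw as [Hw2 Hw1].
  specialize (H0 w Hw0). specialize (H2' w Hw2).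
  assert (Hfw : Cmod (f w - f z) < d1).
  { eapply Rle_lt_trans; [apply H0|]. rewrite Rmult_comm. apply Rlt_div_r; auto. }
  specialize (H1' (f w) Hfw).
  replace (g (f w) - g (f z) - m * l * (w - z))%C with ((g (f w) - g (f z) - m * (f w - f z)) + m * (f w - f z - l * (w - z)))%C by ring.
  eapply Rle_trans; [apply Cmod_triangle|]. rewrite Cmod_mult. pose proof (Cmod_ge_0 (w - z)).
  assert (e / 2 / L * Cmod (f w - f z) <= e / 2 * Cmod (w - z)).
  { apply Rle_trans with (e / 2 / L * (L * Cmod (w - z))).
    - apply Rmult_le_compat_l; auto. apply Rlt_le, Rdiv_lt_0_compat; lra.
    - right. field. lra. }
  assert (Cmod m * Cmod (f w - f z - l * (w - z)) <= e / 2 * Cmod (w - z)).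
  { apply Rle_trans with ((Cmod m + 1) * (e / 2 / (Cmod m + 1) * Cmod (w - z))).
    - pose proof (Cmod_ge_0 (f w - f z - l * (w - z))). nra.
    - right. field. lra. }
  lra.
Qed.

Lemma cder_mult f g z l m : cder f z l -> cder g z m -> cder (fun w => f w * g w)%C z (l * g z + f z * m).
Proof.
  intros Hf Hg e He.
  destruct (cder_lip _ _ _ Hf) as [d0 [Hd0 H0]].
  pose proof (Cmod_ge_0 l). pose proof (Cmod_ge_0 m). pose proof (Cmod_ge_0 (f z)). pose proof (Cmod_ge_0 (g z)).
  set (A := Cmod (g z) + 1). set (B := Cmod (f z) + 1). set (L := Cmod l + 1) in *.
  assert (0 < A) by (unfold A; lra). assert (0 < B) by (unfold B; lra). assert (0 < L) by (unfold L; lra).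
  destruct (Hf (e / 3 / A)) as [d1 [Hd1 H1']]. { apply Rdiv_lt_0_compat; lra. }
  destruct (Hg (e / 3 / B)) as [d2 [Hd2 H2']]. { apply Rdiv_lt_0_compat; lra. }
  destruct (cdiff_cont g z (ex_intro _ _ Hg) (e / 3 / L)) as [d3 [Hd3 H3']]. { apply Rdiv_lt_0_compat; lra. }
  exists (Rmin d0 (Rmin d1 (Rmin d2 d3))). split. { repeat apply Rmin_pos; auto. }
  intros w Hw. apply Rmin_Rgt in Hw as [Hw0 Hw]. apply Rmin_Rgt in Hw as [Hw1 Hw]. apply Rmin_Rgt in Hw as [Hw2 Hw3].
  specialize (H0 w Hw0). specialize (H1' w Hw1). specialize (H2' w Hw2). specialize (H3' w Hw3).
  replace (f w * g w - f z * g z - (l * g z + f z * m) * (w - z))%C with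
    ((f w - f z - l * (w - z)) * g z + f z * (g w - g z - m * (w - z)) + (f w - f z) * (g w - g z))%C by ring.
  pose proof (Cmod_ge_0 (w - z)) as Hwz.
  assert (T1 : Cmod ((f w - f z - l * (w - z)) * g z) <= e / 3 * Cmod (w - z)).
  { rewrite Cmod_mult. pose proof (Cmod_ge_0 (f w - f z - l * (w - z))).
    apply Rle_trans with ((e / 3 / A * Cmod (w - z)) * A); [unfold A in *; nra|right; field; lra]. }
  assert (T2 : Cmod (f z * (g w - g z - m * (w - z))) <= e / 3 * Cmod (w - z)).
  { rewrite Cmod_mult. pose proof (Cmod_ge_0 (g w - g z - m * (w - z))).
    apply Rle_trans with (B * (e / 3 / B * Cmod (w - z))); [unfold B in *; nra|right; field; lra]. }
  assert (T3 : Cmod ((f w - f z) * (g w - g z)) <= e / 3 * Cmod (w - z)).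
  { rewrite Cmod_mult. pose proof (Cmod_ge_0 (f w - f z)). pose proof (Cmod_ge_0 (g w - g z)).
    apply Rle_trans with ((L * Cmod (w - z)) * (e / 3 / L)); [|right; field; lra].
    apply Rmult_le_compat; auto; lra. }
  eapply Rle_trans; [apply Cmod_triangle|]. eapply Rle_trans; [apply Rplus_le_compat_r, Cmod_triangle|]. lra.
Qed.

Lemma cder_inv z : z <> RtoC 0 -> cder (fun w => / w)%C z (- / (z * z)).
Proof.
  intros Hz e He. apply Cmod_gt_0 in Hz as Hz'. set (c := Cmod z) in *.
  exists (Rmin (c / 2) (e * (c * c * c) / 2)). split.
  { apply Rmin_pos; [lra|]. apply Rdiv_lt_0_compat; [|lra]. repeat apply Rmult_lt_0_compat; auto. }
  intros w Hw. apply Rmin_Rgt in Hw as [Hw1 Hw2].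
  assert (Hw : c / 2 <= Cmod w). { pose proof (Cmod_le_add z w). rewrite Cmod_sub_sym in H. unfold c in *; lra. }
  assert (Hw0 : w <> RtoC 0). { intros E. rewrite E, Cmod_0 in Hw. lra. }
  replace (/ w - / z - - / (z * z) * (w - z))%C with ((w - z) * (w - z) * / (w * z * z))%C by (field; auto).
  rewrite !Cmod_mult, Cmod_inv, !Cmod_mult by (repeat apply Cmult_neq_0; auto). fold c.
  pose proof (Cmod_ge_0 (w - z)).
  rewrite (Rmult_comm e). rewrite Rmult_assoc. apply Rmult_le_compat_l; auto.
  apply Rle_div_l; [repeat apply Rmult_lt_0_compat; lra|].
  apply Rle_trans with (e * (c * c * c) / 2); [lra|].
  apply Rle_trans with (e * (c / 2 * c * c)); [right; field|].
  apply Rmult_le_compat_l; [lra|]. repeat apply Rmult_le_compat_r; lra.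
Qed.

Lemma cdiff_const c z : cdiff (fun _ => c) z. Proof. eexists; apply cder_const. Qed.
Lemma cdiff_id z : cdiff (fun w => w) z. Proof. eexists; apply cder_id. Qed.
Lemma cdiff_plus f g z : cdiff f z -> cdiff g z -> cdiff (fun w => f w + g w)%C z.
Proof. intros [l H] [m H']. eexists; apply cder_plus; eauto. Qed.
Lemma cdiff_mult f g z : cdiff f z -> cdiff g z -> cdiff (fun w => f w * g w)%C z.
Proof. intros [l H] [m H']. eexists; apply cder_mult; eauto. Qed.
Lemma cdiff_opp f z : cdiff f z -> cdiff (fun w => - f w)%C z.
Proof.
  intros H. apply cdiff_ext with (fun w => -(1) * f w)%C; [intros; ring|]. apply cdiff_mult; auto. apply cdiff_const.
Qed.
Lemma cdiff_minus f g z : cdiff f z -> cdiff g z -> cdiff (fun w => f w - g w)%C z.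
Proof. intros H H'. apply cdiff_plus; auto. apply cdiff_opp; auto. Qed.
Lemma cdiff_comp f g z : cdiff f z -> cdiff g (f z) -> cdiff (fun w => g (f w)) z.
Proof. intros [l H] [m H']. eexists; apply cder_comp; eauto. Qed.
Lemma cdiff_inv f z : cdiff f z -> f z <> RtoC 0 -> cdiff (fun w => / f w)%C z.
Proof. intros H H'. apply (cdiff_comp f (fun w => / w)%C); auto. eexists; apply cder_inv; auto. Qed.
Lemma cdiff_div f g z : cdiff f z -> cdiff g z -> g z <> RtoC 0 -> cdiff (fun w => f w / g w)%C z.
Proof. intros. apply cdiff_mult; auto. apply cdiff_inv; auto. Qed.
Lemma cdiff_pow f n z : cdiff f z -> cdiff (fun w => f w ^ n)%C z.
Proof. intros H. induction n; simpl; [apply cdiff_const|apply cdiff_mult; auto]. Qed.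
Lemma cdiff_csum (w : nat -> C -> C) n z : (forall k, cdiff (w k) z) -> cdiff (fun t => csum (fun k => w k t) n) z.
Proof. intros H. induction n; simpl; [apply cdiff_const|apply cdiff_plus; auto]. Qed.

Lemma cdiff_ccont_at f u t : ccont_at u t -> cdiff f (u t) -> ccont_at (fun s => f (u s)) t.
Proof.
  intros Hu Hf e He. destruct (cdiff_cont _ _ Hf e He) as [d [Hd H]]. destruct (Hu d Hd) as [d' [Hd' H']].
  exists d'; split; auto.
Qed.

(** * Contour integrals over rectangles and Goursat's theorem *)

Definition rect (K : C -> C) x0 x1 y0 y1 : C :=
  (CInt (fun x => K (x, y0)) x0 x1 - CInt (fun x => K (x, y1)) x0 x1 +
   Ci * (CInt (fun y => K (x1, y)) y0 y1 - CInt (fun y => K (x0, y)) y0 y1))%C.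

Lemma Cmod_hor x x' y : Cmod ((x, y) - (x', y)) = Rabs (x - x').
Proof. replace ((x, y) - (x', y))%C with (RtoC (x - x')) by (apply C_eq; simpl; ring). apply Cmod_R. Qed.

Lemma Cmod_ver x y y' : Cmod ((x, y) - (x, y')) = Rabs (y - y').
Proof.
  replace ((x, y) - (x, y'))%C with (Ci * RtoC (y - y'))%C by (apply C_eq; simpl; ring).
  rewrite Cmod_mult, Cmod_Ci, Cmod_R. ring.
Qed.

Lemma hor_cont K x y : cdiff K (x, y) -> ccont_at (fun x => K (x, y)) x.
Proof. intros H. apply cdiff_ccont_at with (u := fun x => (x, y)); auto. intros e He. exists e; split; auto. intros. rewrite Cmod_hor; auto. Qed.

Lemma ver_cont K x y : cdiff K (x, y) -> ccont_at (fun y => K (x, y)) y.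
Proof. intros H. apply cdiff_ccont_at with (u := fun y => (x, y)); auto. intros e He. exists e; split; auto. intros. rewrite Cmod_ver; auto. Qed.

Lemma rect_split K x0 xm x1 y0 ym y1 : x0 <= xm <= x1 -> y0 <= ym <= y1 ->
  (forall x y, x0 <= x <= x1 -> y0 <= y <= y1 -> cdiff K (x, y)) ->
  rect K x0 x1 y0 y1 = (rect K x0 xm y0 ym + rect K xm x1 y0 ym + rect K x0 xm ym y1 + rect K xm x1 ym y1)%C.
Proof.
  intros Hx Hy H. unfold rect.
  rewrite (CInt_Chasles (fun x => K (x, y0)) x0 xm x1) by (try lra; intros t Ht; apply hor_cont, H; lra).
  rewrite (CInt_Chasles (fun x => K (x, y1)) x0 xm x1) by (try lra; intros t Ht; apply hor_cont, H; lra).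
  rewrite (CInt_Chasles (fun y => K (x0, y)) y0 ym y1) by (try lra; intros t Ht; apply ver_cont, H; lra).
  rewrite (CInt_Chasles (fun y => K (x1, y)) y0 ym y1) by (try lra; intros t Ht; apply ver_cont, H; lra).
  ring.
Qed.

Lemma rect_minus K L x0 x1 y0 y1 : x0 <= x1 -> y0 <= y1 ->
  (forall x y, x0 <= x <= x1 -> y0 <= y <= y1 -> cdiff K (x, y)) ->
  (forall z, cdiff L z) ->
  rect (fun z => K z - L z)%C x0 x1 y0 y1 = (rect K x0 x1 y0 y1 - rect L x0 x1 y0 y1)%C.
Proof.
  intros Hx Hy H HL.
  assert (G : forall (u v : R -> C) a b, a <= b -> ccont_on u a b -> ccont_on v a b -> CInt (fun t => u t - v t)%C a b = (CInt u a b - CInt v a b)%C).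
  { intros u v a b Hab Hu Hv. rewrite (CInt_ext _ (fun t => u t + -(1) * v t)%C) by (auto; intros; ring).
    rewrite CInt_plus, CInt_scal; auto. ring. intros t Ht. apply ccont_at_mult; auto. apply ccont_at_const. }
  unfold rect.
  rewrite (G (fun x => K (x, y0)) (fun x => L (x, y0))), (G (fun x => K (x, y1)) (fun x => L (x, y1))),
    (G (fun y => K (x1, y)) (fun y => L (x1, y))), (G (fun y => K (x0, y)) (fun y => L (x0, y))); auto;
    try (intros t Ht; first [apply hor_cont | apply ver_cont]; auto; apply H; lra).
  ring.
Qed.

Lemma RInt_affine p q a b : RInt (fun t => p + q * t) a b = p * (b - a) + q * (b ^ 2 - a ^ 2) / 2.
Proof.
  apply is_RInt_unique.
  replace (p * (b - a) + q * (b ^ 2 - a ^ 2) / 2) with (minus (p * b + q * b ^ 2 / 2) (p * a + q * a ^ 2 / 2)).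
  2:{ unfold minus, plus, opp; simpl. field. }
  apply (is_RInt_derive (fun t => p * t + q * t ^ 2 / 2)).
  - intros x _. auto_derive; auto. field.
  - intros x _. apply (ex_derive_continuous (fun t => p + q * t)). auto_derive; auto.
Qed.

Lemma CInt_affine c d a b : CInt (fun t => c + d * t)%C a b = (c * (b - a) + d * (b * b - a * a) / 2)%C.
Proof.
  apply C_eq; simpl.
  - rewrite (RInt_ext _ (fun t => Re c + Re d * t)) by (intros; unfold Re; simpl; ring).
    rewrite RInt_affine. unfold Re, Im; simpl. field.
  - rewrite (RInt_ext _ (fun t => Im c + Im d * t)) by (intros; unfold Im; simpl; ring).
    rewrite RInt_affine. unfold Re, Im; simpl. field.
Qed.

Lemma C_pair x y : (x, y) = (RtoC x + Ci * RtoC y)%C.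
Proof. apply C_eq; simpl; ring. Qed.

Lemma Ci2 : (Ci * Ci)%C = (-(1))%C.
Proof. apply C_eq; simpl; ring. Qed.

Lemma rect_affine c d x0 x1 y0 y1 : x0 <= x1 -> y0 <= y1 -> rect (fun z => c + d * z)%C x0 x1 y0 y1 = 0.
Proof.
  intros Hx Hy. unfold rect.
  rewrite (CInt_ext (fun x => c + d * (x, y0))%C (fun x => (c + d * (Ci * y0)) + d * x)%C) by (auto; intros; rewrite C_pair; ring).
  rewrite (CInt_ext (fun x => c + d * (x, y1))%C (fun x => (c + d * (Ci * y1)) + d * x)%C) by (auto; intros; rewrite C_pair; ring).
  rewrite (CInt_ext (fun y => c + d * (x1, y))%C (fun y => (c + d * x1) + (d * Ci) * y)%C) by (auto; intros; rewrite C_pair; ring).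
  rewrite (CInt_ext (fun y => c + d * (x0, y))%C (fun y => (c + d * x0) + (d * Ci) * y)%C) by (auto; intros; rewrite C_pair; ring).
  rewrite !CInt_affine.
  match goal with |- ?L = _ => replace L with (d * (1 + Ci * Ci) * ((y1 * y1 - y0 * y0) * 0 ))%C end.
  - rewrite Ci2; ring.
  - apply C_eq; unfold Cdiv, Cinv; simpl; field.
Qed.

Lemma rect_bound K x0 x1 y0 y1 M : x0 <= x1 -> y0 <= y1 ->
  (forall x y, x0 <= x <= x1 -> y0 <= y <= y1 -> cdiff K (x, y)) ->
  (forall x y, x0 <= x <= x1 -> y0 <= y <= y1 -> Cmod (K (x, y)) <= M) ->
  Cmod (rect K x0 x1 y0 y1) <= 2 * M * ((x1 - x0) + (y1 - y0)).
Proof.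
  intros Hx Hy H HM. unfold rect.
  eapply Rle_trans; [apply Cmod_triangle|]. rewrite Cmod_mult, Cmod_Ci, Rmult_1_l.
  pose proof (CInt_bound (fun x => K (x, y0)) x0 x1 M Hx ltac:(intros t Ht; apply hor_cont, H; lra) ltac:(intros; apply HM; lra)).
  pose proof (CInt_bound (fun x => K (x, y1)) x0 x1 M Hx ltac:(intros t Ht; apply hor_cont, H; lra) ltac:(intros; apply HM; lra)).
  pose proof (CInt_bound (fun y => K (x0, y)) y0 y1 M Hy ltac:(intros t Ht; apply ver_cont, H; lra) ltac:(intros; apply HM; lra)).
  pose proof (CInt_bound (fun y => K (x1, y)) y0 y1 M Hy ltac:(intros t Ht; apply ver_cont, H; lra) ltac:(intros; apply HM; lra)).
  pose proof (Cmod_tri_minus (CInt (fun x => K (x, y0)) x0 x1) (CInt (fun x => K (x, y1)) x0 x1)).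
  pose proof (Cmod_tri_minus (CInt (fun y => K (x1, y)) y0 y1) (CInt (fun y => K (x0, y)) y0 y1)). lra.
Qed.

Section Goursat.
Variables (K : C -> C) (x0 y0 a b : R).
Hypotheses (Ha : 0 <= a) (Hb : 0 <= b).
Hypothesis HK : forall x y, x0 <= x <= x0 + a -> y0 <= y <= y0 + b -> cdiff K (x, y).

Let Q (k : nat) (p : R * R) : C := rect K (fst p) (fst p + a / 2 ^ k) (snd p) (snd p + b / 2 ^ k).
Let eta := Cmod (Q 0 (x0, y0)).

(** One bisection step on lower left corners. It selects a quarter whose integral is at least
    [eta / 4 ^ S k]; the fourth quarter is the default, justified in [big] because the four
    integrals add up to the whole one. *)
Let next (k : nat) (p : R * R) : R * R :=
  let h := a / 2 ^ S k in let v := b / 2 ^ S k in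
  let big q := Rle_dec (eta / 4 ^ S k) (Cmod (Q (S k) q)) in
  if big p then p else if big (fst p + h, snd p) then (fst p + h, snd p)
  else if big (fst p, snd p + v) then (fst p, snd p + v) else (fst p + h, snd p + v).

Let pos := fix pos k := match k with O => (x0, y0) | S k => next k (pos k) end.

Let half t k : t / 2 ^ k = t / 2 ^ S k + t / 2 ^ S k.
Proof. pose proof (pow_lt 2 k ltac:(lra)). simpl. field. lra. Qed.

Let half_nn t k : 0 <= t -> 0 <= t / 2 ^ k.
Proof. intros. apply Rmult_le_pos; auto. apply Rlt_le, Rinv_0_lt_compat, pow_lt; lra. Qed.

Let step k : let p := pos k in let q := pos (S k) in
  (fst q = fst p \/ fst q = fst p + a / 2 ^ S k) /\ (snd q = snd p \/ snd q = snd p + b / 2 ^ S k).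
Proof.
  simpl. unfold next. repeat destruct Rle_dec; simpl; auto.
Qed.

Let inside k : (x0 <= fst (pos k) /\ fst (pos k) + a / 2 ^ k <= x0 + a) /\ (y0 <= snd (pos k) /\ snd (pos k) + b / 2 ^ k <= y0 + b).
Proof.
  induction k as [|k IH]; [simpl; lra|]. pose proof (step k) as [S1 S2].
  rewrite (half a k), (half b k) in IH. pose proof (half_nn a (S k) Ha). pose proof (half_nn b (S k) Hb).
  destruct S1 as [-> | ->]; destruct S2 as [-> | ->]; lra.
Qed.

Let big k : eta / 4 ^ k <= Cmod (Q k (pos k)).
Proof.
  induction k as [|k IH]; [simpl; unfold eta; lra|].
  pose proof (inside k) as Hin. simpl pos. unfold next. set (p := pos k) in *.
  repeat (destruct Rle_dec as [|]; [assumption|]).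
  apply Rnot_lt_le. intros Hlt.
  enough (Cmod (Q k p) < eta / 4 ^ k) by lra.
  unfold Q at 1. pose proof (half_nn a (S k) Ha). pose proof (half_nn b (S k) Hb).
  rewrite (rect_split K (fst p) (fst p + a / 2 ^ S k) (fst p + a / 2 ^ k) (snd p) (snd p + b / 2 ^ S k) (snd p + b / 2 ^ k));
    [|rewrite (half a k); lra|rewrite (half b k); lra|intros; apply HK; lra].
  replace (eta / 4 ^ k) with (eta / 4 ^ S k + eta / 4 ^ S k + eta / 4 ^ S k + eta / 4 ^ S k).
  2:{ pose proof (pow_lt 4 k ltac:(lra)). simpl. field. lra. }
  unfold Q in n, n0, n1, Hlt; simpl fst in *; simpl snd in *.
  replace (fst p + a / 2 ^ k) with (fst p + a / 2 ^ S k + a / 2 ^ S k) by (rewrite (half a k); lra).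
  replace (snd p + b / 2 ^ k) with (snd p + b / 2 ^ S k + b / 2 ^ S k) by (rewrite (half b k); lra).
  eapply Rle_lt_trans; [apply Cmod_triangle|]. eapply Rle_lt_trans; [apply Rplus_le_compat_r, Cmod_triangle|].
  eapply Rle_lt_trans; [apply Rplus_le_compat_r, Rplus_le_compat_r, Cmod_triangle|]. apply Rnot_le_lt in n, n0, n1. change (2 * 2 ^ k) with (2 ^ S k) in *. lra.
Qed.

Let mono n m : (n <= m)%nat ->
  (fst (pos n) <= fst (pos m) <= fst (pos n) + a / 2 ^ n) /\ (snd (pos n) <= snd (pos m) <= snd (pos n) + b / 2 ^ n).
Proof.
  intros Hnm. enough ((fst (pos n) <= fst (pos m) /\ fst (pos m) + a / 2 ^ m <= fst (pos n) + a / 2 ^ n) /\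
     (snd (pos n) <= snd (pos m) /\ snd (pos m) + b / 2 ^ m <= snd (pos n) + b / 2 ^ n)).
  { pose proof (half_nn a m Ha). pose proof (half_nn b m Hb). lra. }
  replace m with (n + (m - n))%nat by lia. induction (m - n)%nat as [|d IH].
  { rewrite Nat.add_0_r; lra. }
  rewrite Nat.add_succ_r. pose proof (step (n + d)) as [S1 S2].
  rewrite (half a (n + d)), (half b (n + d)) in IH.
  pose proof (half_nn a (S (n + d)) Ha). pose proof (half_nn b (S (n + d)) Hb).
  destruct S1 as [-> | ->]; destruct S2 as [-> | ->]; lra.
Qed.

Let pow2_small c d : 0 <= c -> 0 < d -> exists N, c / 2 ^ N < d.
Proof.
  intros Hc Hd. destruct (pow_small (/2) (d / (c + 1))) as [N HN]; [lra|apply Rdiv_lt_0_compat; lra|].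
  exists N. rewrite pow_inv in HN. apply Rlt_div_r in HN; [|lra]. unfold Rdiv.
  pose proof (Rinv_0_lt_compat _ (pow_lt 2 N ltac:(lra))). nra.
Qed.

(** The rectangles shrink to a point [z]. Subtracting from [K] its affine part at [z], whose contour
    integral is zero, leaves an integrand of size [e] times the diameter; the integral is then at
    most a multiple of [e / 4 ^ N], against the lower bound [eta / 4 ^ N]. *)
Lemma goursat_aux : eta = 0.
Proof.
  destruct (Rle_lt_or_eq_dec 0 eta) as [He|He]; [unfold eta; apply Cmod_ge_0| |auto]. exfalso.
  destruct (cauchy_C (fun n => (fst (pos n), snd (pos n))) (fun n => (a + b) / 2 ^ n)) as [z Hz].
  - intros n m Hnm. pose proof (mono n m Hnm). eapply Rle_trans; [apply Cmod_le_re_im|]. simpl Re; simpl Im.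
    rewrite !Rabs_right; unfold Rdiv in *; lra.
  - intros d Hd. apply pow2_small; lra.
  - assert (Hzin : forall k, fst (pos k) <= Re z <= fst (pos k) + a / 2 ^ k /\ snd (pos k) <= Im z <= snd (pos k) + b / 2 ^ k).
    { intros k.
      assert (G : forall d, 0 < d -> fst (pos k) - d <= Re z <= fst (pos k) + a / 2 ^ k + d /\ snd (pos k) - d <= Im z <= snd (pos k) + b / 2 ^ k + d).
      { intros d Hd. destruct (pow2_small (a + b) d ltac:(lra) Hd) as [N HN].
        pose proof (mono k (k + N) ltac:(lia)) as Hm. specialize (Hz (k + N)%nat).
        assert (Hs : (a + b) / 2 ^ (k + N) <= (a + b) / 2 ^ N).
        { apply Rmult_le_compat_l; [lra|]. apply Rinv_le_contravar; [apply pow_lt; lra|]. rewrite pow_add.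
          pose proof (pow_lt 2 N ltac:(lra)). assert (1 <= 2 ^ k) by (apply pow_R1_Rle; lra). nra. }
        pose proof (re_le_Cmod ((fst (pos (k + N)), snd (pos (k + N))) - z)) as R1.
        pose proof (im_le_Cmod ((fst (pos (k + N)), snd (pos (k + N))) - z)) as R2.
        simpl in R1, R2. unfold Re, Im in *. apply Rabs_le_between in R1. apply Rabs_le_between in R2. lra. }
      repeat split; apply le_epsilon; intros d Hd; specialize (G d Hd); lra. }
    destruct (HK (Re z) (Im z)) as [l Hl].
    { specialize (Hzin O). simpl in Hzin. unfold Rdiv in Hzin; rewrite Rinv_1, !Rmult_1_r in Hzin. lra. }
    { specialize (Hzin O). simpl in Hzin. unfold Rdiv in Hzin; rewrite Rinv_1, !Rmult_1_r in Hzin. lra. }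
    replace (Re z, Im z) with z in Hl by (destruct z; reflexivity).
    (* Small enough that the upper bound [2 * e * (a + b) ^ 2] stays below [eta]. *)
    set (e := eta / (4 * ((a + b) * (a + b)) + 1)).
    assert (Hden : 0 < 4 * ((a + b) * (a + b)) + 1) by nra.
    assert (0 < e) by (apply Rdiv_lt_0_compat; auto).
    destruct (Hl e H) as [d [Hd HH]]. destruct (pow2_small (a + b) d ltac:(lra) Hd) as [N HN].
    pose proof (big N) as HB. pose proof (inside N) as HI. set (p := pos N) in *. specialize (Hzin N). fold p in Hzin.
    pose proof (half_nn a N Ha). pose proof (half_nn b N Hb).
    assert (HQ : Q N p = rect (fun w => K w - (K z - l * z + l * w))%C (fst p) (fst p + a / 2 ^ N) (snd p) (snd p + b / 2 ^ N)).
    { rewrite rect_minus; try lra; try (intros; apply HK; lra).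
      - rewrite rect_affine by lra. unfold Q. ring.
      - intros. apply cdiff_plus; [apply cdiff_const|]. apply cdiff_mult; [apply cdiff_const|apply cdiff_id]. }
    assert (HQ2 : Cmod (Q N p) <= 2 * (e * ((a + b) / 2 ^ N)) * ((a + b) / 2 ^ N)).
    { rewrite HQ. replace ((a + b) / 2 ^ N) with ((fst p + a / 2 ^ N - fst p) + (snd p + b / 2 ^ N - snd p)) at 2 by (unfold Rdiv; ring).
      apply rect_bound; try lra.
      - intros. apply cdiff_minus; [apply HK; lra|].
        apply cdiff_plus; [apply cdiff_const|]. apply cdiff_mult; [apply cdiff_const|apply cdiff_id].
      - intros x y Hx Hy.
        assert (Hd2 : Cmod ((x, y) - z) <= (a + b) / 2 ^ N).
        { eapply Rle_trans; [apply Cmod_le_re_im|]. simpl. unfold Re, Im in *.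
          assert (Rabs (x + - fst z) <= a / 2 ^ N) by (apply Rabs_le; lra).
          assert (Rabs (y + - snd z) <= b / 2 ^ N) by (apply Rabs_le; lra). unfold Rdiv in *; lra. }
        specialize (HH (x, y) ltac:(lra)).
        replace (K (x, y) - (K z - l * z + l * (x, y)))%C with (K (x, y) - K z - l * ((x, y) - z))%C by ring.
        eapply Rle_trans; [apply HH|]. apply Rmult_le_compat_l; lra. }
    assert (Hc : eta / 4 ^ N <= 2 * e * ((a + b) * (a + b)) / 4 ^ N).
    { eapply Rle_trans; [apply HB|]. eapply Rle_trans; [apply HQ2|]. right.
      replace 4 with (2 * 2) at 1 by ring. rewrite Rpow_mult_distr. field. pose proof (pow_lt 2 N ltac:(lra)); lra. }
    apply Rmult_le_reg_r in Hc; [|apply Rinv_0_lt_compat, pow_lt; lra].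
    assert (e * (4 * ((a + b) * (a + b)) + 1) = eta) by (unfold e; field; lra). nra.
Qed.
End Goursat.

Theorem goursat K x0 x1 y0 y1 : x0 <= x1 -> y0 <= y1 ->
  (forall x y, x0 <= x <= x1 -> y0 <= y <= y1 -> cdiff K (x, y)) -> rect K x0 x1 y0 y1 = 0.
Proof.
  intros Hx Hy H. apply Cmod_eq_0.
  pose proof (goursat_aux K x0 y0 (x1 - x0) (y1 - y0) ltac:(lra) ltac:(lra)) as G.
  replace (x0 + (x1 - x0)) with x1 in G by ring. replace (y0 + (y1 - y0)) with y1 in G by ring.
  specialize (G H). simpl in G.
  replace (x0 + (x1 - x0) / 1) with x1 in G by field. replace (y0 + (y1 - y0) / 1) with y1 in G by field. exact G.
Qed.

(** * The complex exponential and circle averages of holomorphic functions *)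

Definition Cexp (z : C) : C := (RtoC (exp (Re z)) * ei (Im z))%C.

Lemma Cexp_plus z w : Cexp (z + w) = (Cexp z * Cexp w)%C.
Proof. unfold Cexp. unfold Re, Im; simpl. rewrite exp_plus, ei_plus, RtoC_mult. ring. Qed.

Lemma Cmod_Cexp z : Cmod (Cexp z) = exp (Re z).
Proof. unfold Cexp. rewrite Cmod_mult, Cmod_R, Cmod_ei, Rabs_right; [ring|]. apply Rle_ge, Rlt_le, exp_pos. Qed.

Lemma Cexp_im (t : R) : Cexp (Ci * t) = ei t.
Proof.
  unfold Cexp. replace (Re (Ci * t)) with 0 by (unfold Re; simpl; ring).
  replace (Im (Ci * t)) with t by (unfold Im; simpl; ring). rewrite exp_0. ring.
Qed.

(** The remainders of the real exponential, the cosine and the sine are estimated separately; they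
    add up to [4 * |h| ^ 2], and the constant [10] leaves room. *)
Lemma Cexp_small h : Cmod h <= 1/2 -> Cmod (Cexp h - 1 - h) <= 10 * Cmod h ^ 2.
Proof.
  intros Hh. destruct h as [a b]. pose proof (re_le_Cmod (a, b)) as Ra. pose proof (im_le_Cmod (a, b)) as Rb. simpl in Ra, Rb.
  pose proof (Cmod2_alt (a, b)) as E. simpl Re in E; simpl Im in E. rewrite E. clear E.
  assert (Ha : -(1/2) <= a <= 1/2) by (apply Rabs_le_between; lra).
  assert (Hb : -(1/2) <= b <= 1/2) by (apply Rabs_le_between; lra).
  assert (E1 : 0 <= exp a - 1 - a <= 2 * a ^ 2).
  { split. { pose proof (exp_ineq1_le a). lra. }
    pose proof (exp_ineq1_le (- a)). pose proof (exp_pos a).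
    assert (exp a * exp (- a) = 1) by (rewrite <- exp_plus; replace (a + - a) with 0 by ring; apply exp_0).
    assert (exp a * (1 - a) <= 1) by nra.
    assert (exp a <= 1 + a + 2 * a ^ 2); [|lra].
    apply Rmult_le_reg_r with (1 - a); [lra|]. nra. }
  assert (E2 : 0 <= 1 - cos b <= b ^ 2 / 2).
  { pose proof (COS_bound b). split; [lra|]. pose proof (ei_dist2 b 0) as D. pose proof (ei_lip b 0) as L. rewrite Rminus_0_r in *.
    pose proof (Cmod_ge_0 (ei b - ei 0)). rewrite <- (pow2_abs b). nra. }
  assert (E3 : Rabs (sin b) <= Rabs b).
  { pose proof (ei_lip b 0) as L. pose proof (im_le_Cmod (ei b - ei 0)) as L2. simpl in L2. rewrite sin_0, Rminus_0_r in *.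
    replace (sin b + - 0) with (sin b) in L2 by ring. lra. }
  assert (E4 : Rabs (sin b - b) <= b ^ 2).
  { destruct (MVT_gen (fun t => sin t - t) 0 b (fun t => cos t - 1)) as [c [Hc Hc2]].
    - intros x _. auto_derive; auto. ring.
    - intros x _. apply derivable_continuous_pt. apply derivable_pt_minus; [apply derivable_pt_sin|apply derivable_pt_id].
    - rewrite sin_0 in Hc2. replace (sin b - b) with ((cos c - 1) * b) by lra.
      rewrite Rabs_mult.
      assert (Hcb : c ^ 2 <= b ^ 2).
      { unfold Rmin, Rmax in Hc. destruct (Rle_dec 0 b); nra. }
      assert (Rabs (cos c - 1) <= c ^ 2 / 2).
      { pose proof (ei_dist2 c 0) as D. pose proof (ei_lip c 0) as L. rewrite Rminus_0_r in *.
        pose proof (Cmod_ge_0 (ei c - ei 0)). pose proof (COS_bound c). rewrite Rabs_left1 by lra. rewrite <- (pow2_abs c). nra. }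
      assert (Rabs b <= 1/2) by (apply Rabs_le; lra). pose proof (Rabs_pos b). pose proof (Rabs_pos (cos c - 1)). nra. }
  eapply Rle_trans; [apply Cmod_le_re_im|]. simpl.
  replace (exp a * cos b - 0 * sin b + - (1) + - a) with ((exp a - 1 - a) - exp a * (1 - cos b)) by ring.
  replace (exp a * sin b + 0 * cos b + - 0 + - b) with ((exp a - 1) * sin b + (sin b - b)) by ring.
  assert (HE : exp a <= 2) by nra.
  assert (F1 : Rabs ((exp a - 1 - a) - exp a * (1 - cos b)) <= 2 * a ^ 2 + b ^ 2).
  { pose proof (exp_pos a). apply Rabs_le. split; nra. }
  assert (F2 : Rabs ((exp a - 1) * sin b) <= a ^ 2 * 2 + b ^ 2 * 2).
  { rewrite Rabs_mult. assert (Rabs (exp a - 1) <= 2 * Rabs a).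
    { pose proof (pow2_abs a). assert (Rabs a <= 1/2) by (apply Rabs_le; lra). pose proof (Rabs_pos a).
      apply Rabs_le. pose proof (Rle_abs a). pose proof (Rle_abs (-a)). rewrite Rabs_Ropp in *. nra. }
    pose proof (Rabs_pos (sin b)). pose proof (Rabs_pos (exp a - 1)). pose proof (Rabs_pos a). pose proof (Rabs_pos b).
    rewrite <- (pow2_abs a), <- (pow2_abs b).
    apply Rle_trans with (2 * Rabs a * Rabs b). { apply Rmult_le_compat; auto. }
    pose proof (pow2_ge_0 (Rabs a - Rabs b)). nra. }
  pose proof (Rabs_triang ((exp a - 1) * sin b) (sin b - b)).
  pose proof (pow2_ge_0 a). pose proof (pow2_ge_0 b). simpl in *. lra.
Qed.

Lemma cder_Cexp z : cder Cexp z (Cexp z).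
Proof.
  intros e He. pose proof (exp_pos (Re z)) as Hp.
  exists (Rmin (1/2) (e / (10 * exp (Re z)))). split. { apply Rmin_pos; [lra|]. apply Rdiv_lt_0_compat; lra. }
  intros w Hw. apply Rmin_Rgt in Hw as [Hw1 Hw2].
  replace (Cexp w - Cexp z - Cexp z * (w - z))%C with (Cexp z * (Cexp (w - z) - 1 - (w - z)))%C.
  2:{ replace w with (z + (w - z))%C at 3 by ring. rewrite Cexp_plus. ring. }
  rewrite Cmod_mult, Cmod_Cexp. pose proof (Cexp_small (w - z) ltac:(lra)). pose proof (Cmod_ge_0 (w - z)).
  apply Rlt_div_r in Hw2; [|lra].
  apply Rle_trans with (exp (Re z) * (10 * Cmod (w - z) ^ 2)); [apply Rmult_le_compat_l; lra|]. nra.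
Qed.

(* In the coordinate [log z] the annulus is a rectangle whose horizontal sides cancel. *)
Theorem avg_annulus h r R : 0 < r -> r <= R ->
  (forall z, r <= Cmod z <= R -> cdiff h z) ->
  avg (fun t => h (r * ei t)%C) = avg (fun t => h (R * ei t)%C).
Proof.
  intros Hr HR H. pose proof twoPI_pos.
  assert (Hln : ln r <= ln R). { destruct HR as [HR|HR]; [left; apply ln_increasing; auto|right; f_equal; auto]. }
  pose proof (goursat (fun u => h (Cexp u)) (ln r) (ln R) 0 (2 * PI) Hln ltac:(lra)) as G.
  assert (Hexp : forall x y, x <= y -> exp x <= exp y).
  { intros x y [A|A]; [left; apply exp_increasing; auto|right; f_equal; auto]. }
  assert (G' : rect (fun u => h (Cexp u)) (ln r) (ln R) 0 (2 * PI) = 0).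
  { apply G. intros x y Hx Hy. apply cdiff_comp; [eexists; apply cder_Cexp|]. apply H. rewrite Cmod_Cexp. simpl.
    destruct Hx as [Hx1 Hx2]. apply Hexp in Hx1. apply Hexp in Hx2. rewrite exp_ln in Hx1, Hx2 by lra. auto. }
  clear G. unfold rect in G'.
  rewrite (CInt_ext (fun x => h (Cexp (x, 2 * PI))) (fun x => h (Cexp (x, 0)))) in G'; auto.
  2:{ intros x _. f_equal. unfold Cexp; simpl. f_equal. replace (2 * PI) with (0 + 2 * PI) by ring. apply ei_2pi. }
  assert (Ex : forall t s, 0 < s -> Cexp (ln s, t) = (s * ei t)%C).
  { intros t s Hs. unfold Cexp; simpl. rewrite exp_ln by auto. auto. }
  unfold avg. f_equal.
  rewrite (CInt_ext (fun y => h (Cexp (ln R, y))) (fun t => h (R * ei t)%C)) in G' by (try lra; intros; rewrite Ex; auto; lra).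
  rewrite (CInt_ext (fun y => h (Cexp (ln r, y))) (fun t => h (r * ei t)%C)) in G' by (try lra; intros; rewrite Ex; auto; lra).
  symmetry. apply Ceq_sub.
  match type of G' with (?A - ?A + Ci * ?B)%C = _ => assert (E : (Ci * B)%C = RtoC 0) by (rewrite <- G'; ring) end.
  apply (f_equal (fun x => - Ci * x))%C in E. rewrite Cmult_0_r in E. rewrite <- E.
  match goal with |- _ = (- Ci * (Ci * ?B))%C => replace (- Ci * (Ci * B))%C with (- (Ci * Ci) * B)%C by ring end.
  rewrite Ci2. ring.
Qed.

Lemma fun_choice {A B} (P : A -> B -> Prop) : (forall x, exists y, P x y) -> exists f, forall x, P x (f x).
Proof. intros H. exists (fun x => proj1_sig (constructive_indefinite_description _ (H x))). intros x. apply proj2_sig. Qed.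

(** * Fejér means *)

Definition mode (u : R -> C) (m : Z) : C := avg (fun t => u t * ei (- IZR m * t))%C.

(** The double sum meets a frequency [m] with [|m| < N] exactly [N - |m|] times, so division by [N]
    gives the Fejér weights [1 - |m| / N]. In this form it is also the mean of one-sided partial
    sums when the negative modes vanish. *)
Definition sigma (u : R -> C) (N : nat) (x : R) : C :=
  (csum (fun j => csum (fun k => mode u (Z.of_nat j - Z.of_nat k) * ei (IZR (Z.of_nat j - Z.of_nat k) * x))%C N) N / INR N)%C.

Lemma avg_re_le u v : ccont u -> ccont v -> (forall t, Re (u t) <= Re (v t)) -> Re (avg u) <= Re (avg v).
Proof.
  intros Hu Hv H. pose proof twoPI_pos as HP.
  assert (E : forall w, Re (avg w) = RInt (fun t => Re (w t)) 0 (2 * PI) / (2 * PI)).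
  { intros w. unfold avg. rewrite <- RtoC_mult. unfold Cdiv. rewrite <- RtoC_inv by lra.
    change (RInt (fun t => Re (w t)) 0 (2 * PI) * / (2 * PI) - RInt (fun t => Im (w t)) 0 (2 * PI) * 0 = RInt (fun t => Re (w t)) 0 (2 * PI) * / (2 * PI)). ring. }
  rewrite !E. apply Rmult_le_compat_r; [apply Rlt_le, Rinv_0_lt_compat; lra|].
  apply RInt_le; [lra| | |auto].
  - apply (ccont_ex u); [lra|intros t _; auto].
  - apply (ccont_ex v); [lra|intros t _; auto].
Qed.

(** A rotation takes the average of [u] to the nonnegative real axis, where real parts can be
    compared. *)
Lemma avg_dom u v : ccont u -> ccont v -> (forall t, Cmod (u t) <= Re (v t)) -> Cmod (avg u) <= Re (avg v).
Proof.
  intros Hu Hv H. destruct (polar (Cconj (avg u))) as [s Hs]. rewrite Cmod_conj in Hs.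
  assert (E : (ei s * avg u)%C = RtoC (Cmod (avg u))).
  { destruct (Req_dec (Cmod (avg u)) 0) as [E|E].
    - apply Cmod_eq_0 in E as E2. rewrite E2, Cmod_0. ring.
    - assert (E' : RtoC (Cmod (avg u)) <> 0) by (intros A; apply RtoC_inj in A; auto).
      apply Cmult_cancel_l with (RtoC (Cmod (avg u))); auto.
      rewrite Cmult_assoc, <- Hs, Cmult_comm, <- Cmod2_conj, RtoC_pow. simpl. ring. }
  rewrite <- avg_scal in E by auto. replace (Cmod (avg u)) with (Re (avg (fun t => ei s * u t)%C)) by (rewrite E; auto).
  apply avg_re_le; auto.
  - intros t. apply ccont_at_mult; auto. apply ccont_at_const.
  - intros t. eapply Rle_trans; [apply Rle_abs|]. eapply Rle_trans; [apply re_le_Cmod|].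
    rewrite Cmod_mult, Cmod_ei, Rmult_1_l. auto.
Qed.

Definition kron (m : Z) : C := if Z.eq_dec m 0 then RtoC 1 else RtoC 0.

Lemma avg_ei_kron m : avg (fun t => ei (IZR m * t)) = kron m.
Proof.
  unfold kron. destruct (Z.eq_dec m 0) as [->|H]; [|apply avg_ei; auto].
  rewrite <- (avg_const 1). apply avg_ext. intros. rewrite Rmult_0_l. apply ei_0.
Qed.

(** Counts the pairs [j, k < N] with [k = j + d]. For [d = 1] there are [N - 1] of them, except that
    [N = 0] gives none. *)
Lemma csum_kron d N : (d = 0 \/ d = 1)%Z ->
  csum (fun j => csum (fun k => kron (Z.of_nat j - Z.of_nat k + d)) N) N = RtoC (INR N - (if Nat.eq_dec N 0 then 0 else IZR d)).
Proof.
  intros Hd. induction N as [|N IH]; [simpl; f_equal; ring|].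
  rewrite S_INR. destruct (Nat.eq_dec (S N) 0) as [?|_]; [lia|].
  simpl csum. rewrite csum_plus, IH.
  assert (E2 : csum (fun k => kron (Z.of_nat N - Z.of_nat k + d)) N = 0).
  { apply csum_eq0. intros k Hk. unfold kron. destruct Z.eq_dec; auto. lia. }
  rewrite E2.
  assert (E3 : (csum (fun j => kron (Z.of_nat j - Z.of_nat N + d)) N + kron (Z.of_nat N - Z.of_nat N + d))%C =
     if Nat.eq_dec N 0 then RtoC (1 - IZR d) else 1).
  { replace (Z.of_nat N - Z.of_nat N + d)%Z with d by lia. destruct Nat.eq_dec as [->|HN].
    - simpl. unfold kron. destruct Hd as [-> | ->]; simpl; rewrite <- RtoC_plus; f_equal; ring.
    - destruct N as [|n]; [lia|]. simpl csum. rewrite csum_eq0.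
      + unfold kron. destruct Hd as [-> | ->]; repeat destruct Z.eq_dec; try lia; ring.
      + intros k Hk. unfold kron. destruct Z.eq_dec; auto; lia. }
  rewrite <- Cplus_assoc. rewrite Cplus_0_l, E3.
  destruct Nat.eq_dec; rewrite <- RtoC_plus; f_equal; subst; simpl; ring.
Qed.

Definition fker (N : nat) (x : R) : C :=
  (csum (fun j => csum (fun k => ei (IZR (Z.of_nat j - Z.of_nat k) * x)) N) N / INR N)%C.

(** The double sum is the product of the one-sided exponential sum [D] and its conjugate, so the
    kernel equals [|D| ^ 2 / N]. *)
Lemma fker_pos N x : (0 < N)%nat -> exists r, 0 <= r /\ fker N x = RtoC r.
Proof.
  intros HN. assert (HN' : 0 < INR N) by (apply lt_0_INR; auto).
  set (D := csum (fun j => ei (INR j * x)) N). exists (Cmod D ^ 2 / INR N). split.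
  { apply Rmult_le_pos; [apply pow2_ge_0|apply Rlt_le, Rinv_0_lt_compat; auto]. }
  rewrite RtoC_div by lra. unfold fker. f_equal. rewrite Cmod2_conj.
  assert (Ec : Cconj D = csum (fun k => ei (- (INR k * x))) N).
  { unfold D. generalize N. induction N0; simpl; [apply C_eq; simpl; ring|].
    rewrite <- IHN0. rewrite <- ei_conj. apply C_eq; simpl; ring. }
  rewrite Ec. rewrite Cmult_comm. unfold D. rewrite <- csum_scal. apply csum_ext. intros j _. rewrite Cmult_comm, <- csum_scal.
  apply csum_ext. intros k _. rewrite <- ei_plus. f_equal. rewrite minus_IZR, <- !INR_IZR_INZ. ring.
Qed.

Lemma fker_cont N x t : ccont_at (fun t => fker N (t - x)) t.
Proof.
  apply ccont_at_ext with (fun t => / INR N * csum (fun j => csum (fun k => ei (- (IZR (Z.of_nat j - Z.of_nat k) * x)) * ei (IZR (Z.of_nat j - Z.of_nat k) * t))%C N) N)%C.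
  { intros s. unfold fker, Cdiv. rewrite Cmult_comm. f_equal. apply csum_ext; intros j _. apply csum_ext; intros k _.
    rewrite <- ei_plus. f_equal; ring. }
  apply ccont_at_mult; [apply ccont_at_const|]. apply ccont_at_csum; intros j. apply ccont_at_csum; intros k.
  apply ccont_at_mult; [apply ccont_at_const|apply ccont_at_ei].
Qed.

Lemma ccont_mult u v : ccont u -> ccont v -> ccont (fun t => u t * v t)%C.
Proof. intros Hu Hv t. apply ccont_at_mult; auto. Qed.
Lemma ccont_ei k : ccont (fun t => ei (k * t)). Proof. intros t; apply ccont_at_ei. Qed.
Lemma ccont_const c : ccont (fun _ => c). Proof. intros t; apply ccont_at_const. Qed.

Lemma ccont_csum w n : (forall k, ccont (w k)) -> ccont (fun t => csum (fun k => w k t) n).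
Proof. intros H t. apply ccont_at_csum. intros; apply H. Qed.

Lemma sigma_ker u N x : ccont u -> sigma u N x = avg (fun t => u t * fker N (x - t))%C.
Proof.
  intros Hu.
  rewrite (avg_ext _ (fun t => / INR N * csum (fun j => csum (fun k => (u t * ei (- IZR (Z.of_nat j - Z.of_nat k) * t)) * ei (IZR (Z.of_nat j - Z.of_nat k) * x))%C N) N)%C).
  2:{ intros t. unfold fker. unfold Cdiv. rewrite Cmult_assoc, Cmult_comm. f_equal. rewrite <- csum_scal.
      apply csum_ext; intros j _. rewrite <- csum_scal. apply csum_ext; intros k _.
      rewrite <- Cmult_assoc, <- ei_plus. do 2 f_equal. ring. }
  assert (Hw : forall j k, ccont (fun t => u t * ei (- IZR (Z.of_nat j - Z.of_nat k) * t) * ei (IZR (Z.of_nat j - Z.of_nat k) * x))%C).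
  { intros. apply ccont_mult; [apply ccont_mult; auto; apply ccont_ei|apply ccont_const]. }
  rewrite avg_scal by (apply ccont_csum; intros; apply ccont_csum; auto).
  rewrite (avg_csum (fun j t => csum (fun k => u t * ei (- IZR (Z.of_nat j - Z.of_nat k) * t) * ei (IZR (Z.of_nat j - Z.of_nat k) * x))%C N)) by (intros; apply ccont_csum; auto).
  unfold sigma, Cdiv. rewrite Cmult_comm. f_equal. apply csum_ext; intros j _.
  rewrite (avg_csum (fun k t => u t * ei (- IZR (Z.of_nat j - Z.of_nat k) * t) * ei (IZR (Z.of_nat j - Z.of_nat k) * x))%C) by auto.
  apply csum_ext; intros k _. unfold mode. rewrite Cmult_comm, <- avg_scal.
  - apply avg_ext. intros; ring.
  - apply ccont_mult; auto; apply ccont_ei.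
Qed.

Lemma fker_sym N x : fker N (- x) = fker N x.
Proof.
  unfold fker. f_equal. rewrite csum_swap. apply csum_ext; intros j _. apply csum_ext; intros k _.
  f_equal. rewrite !minus_IZR. ring.
Qed.

(** The frequencies [0] and [1] suffice: together they give the average of the kernel against [1]
    and, in the real part, against [1 - cos]. *)
Lemma fker_avg N x (d : Z) : (d = 0 \/ d = 1)%Z -> (0 < N)%nat ->
  avg (fun t => fker N (t - x) * ei (IZR d * (t - x)))%C = RtoC (1 - IZR d / INR N).
Proof.
  intros Hd HN. assert (HN' : 0 < INR N) by (apply lt_0_INR; auto).
  assert (HNC : RtoC (INR N) <> 0) by (intros A; apply RtoC_inj in A; lra).
  rewrite (avg_ext _ (fun t => / INR N * csum (fun j => csum (fun k => ei (- (IZR (Z.of_nat j - Z.of_nat k + d) * x)) * ei (IZR (Z.of_nat j - Z.of_nat k + d) * t))%C N) N)%C).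
  2:{ intros t. unfold fker, Cdiv. rewrite (Cmult_comm _ (/ INR N)), <- Cmult_assoc. f_equal. rewrite Cmult_comm, <- csum_scal.
      apply csum_ext; intros j _. rewrite <- csum_scal. apply csum_ext; intros k _. rewrite <- !ei_plus. f_equal. rewrite !plus_IZR. ring. }
  assert (Hw : forall j k, ccont (fun t => ei (- (IZR (Z.of_nat j - Z.of_nat k + d) * x)) * ei (IZR (Z.of_nat j - Z.of_nat k + d) * t))%C).
  { intros. apply ccont_mult; [apply ccont_const|apply ccont_ei]. }
  rewrite avg_scal by (apply ccont_csum; intros; apply ccont_csum; auto).
  rewrite (avg_csum (fun j t => csum (fun k => ei (- (IZR (Z.of_nat j - Z.of_nat k + d) * x)) * ei (IZR (Z.of_nat j - Z.of_nat k + d) * t))%C N)) by (intros; apply ccont_csum; auto).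
  rewrite (csum_ext _ (fun j => csum (fun k => kron (Z.of_nat j - Z.of_nat k + d)) N)).
  2:{ intros j _. rewrite (avg_csum (fun k t => ei (- (IZR (Z.of_nat j - Z.of_nat k + d) * x)) * ei (IZR (Z.of_nat j - Z.of_nat k + d) * t))%C) by auto.
      apply csum_ext; intros k _. rewrite avg_scal by apply ccont_ei. rewrite avg_ei_kron. unfold kron. destruct Z.eq_dec as [E|E]; [|ring].
      rewrite E, Rmult_0_l, Ropp_0, ei_0. ring. }
  rewrite csum_kron by auto. destruct Nat.eq_dec; [lia|].
  rewrite !RtoC_minus, RtoC_div by lra. field. auto.
Qed.

(* Korovkin's trick: the kernel only needs to be tested against [1 - cos]. *)
Lemma fejer u x e K N : ccont u -> (0 < N)%nat ->
  (forall t, Cmod (u t - u x) <= e + K * (1 - cos (t - x))) -> Cmod (sigma u N x - u x) <= e + K / INR N.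
Proof.
  intros Hu HN H. assert (HN' : 0 < INR N) by (apply lt_0_INR; auto).
  assert (Hk : ccont (fun t => fker N (t - x))) by (intros t; apply fker_cont).
  rewrite sigma_ker by auto.
  replace (u x) with (avg (fun t => u x * (fker N (t - x) * ei (IZR 0 * (t - x))))%C) at 1.
  2:{ rewrite avg_scal.
      - rewrite fker_avg by auto. replace (1 - 0 / INR N) with 1 by (field; lra). ring.
      - apply ccont_mult; auto. intros t. apply ccont_at_ext with (fun _ => RtoC 1); [|apply ccont_at_const].
        intros; rewrite Rmult_0_l, ei_0; auto. }
  assert (Hone : forall t, ei (0 * t) = RtoC 1) by (intros; rewrite Rmult_0_l; apply ei_0).
  rewrite <- avg_minus.
  - eapply Rle_trans.
    (* The real part of this function is the kernel times [e + K * (1 - cos (t - x))]; with the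
       cosine written through [ei (1 * (t - x))] its average comes from [fker_avg]. *)
    + apply avg_dom with (v := (fun t => (RtoC e + RtoC K) * (fker N (t - x) * ei (IZR 0 * (t - x))) - RtoC K * (fker N (t - x) * ei (IZR 1 * (t - x))))%C).
      * intros t. apply ccont_at_ext with (fun t => u t * fker N (t - x) - u x * fker N (t - x))%C.
        { intros s. rewrite Hone, <- (fker_sym N (s - x)). replace (- (s - x)) with (x - s) by ring. ring. }
        apply ccont_at_minus; apply ccont_mult; auto. apply ccont_const.
      * intros t. apply ccont_at_ext with (fun t => (RtoC e + RtoC K) * fker N (t - x) - RtoC K * (fker N (t - x) * (ei (- x) * ei (1 * t))))%C.
        { intros s. rewrite Hone, <- ei_plus. replace (- x + 1 * s) with (1 * (s - x)) by ring. ring. }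
        apply ccont_at_minus; apply ccont_mult; auto using ccont_const.
        apply ccont_mult; auto. apply ccont_mult; [apply ccont_const|apply ccont_ei].
      * intros t. rewrite Hone, <- (fker_sym N (x - t)). replace (- (x - t)) with (t - x) by ring.
        destruct (fker_pos N (t - x) HN) as [r [Hr ->]].
        replace (u t * r - u x * (r * 1))%C with (r * (u t - u x))%C by ring.
        rewrite Cmod_mult, Cmod_R, Rabs_right by lra. unfold Re; simpl. rewrite Rmult_1_l. specialize (H t).
        apply Rle_trans with (r * (e + K * (1 - cos (t - x)))); [apply Rmult_le_compat_l; auto|right; ring].
    + assert (Hc0 : ccont (fun t => fker N (t - x) * ei (IZR 0 * (t - x)))%C).
      { intros t. apply ccont_at_ext with (fun t => fker N (t - x)); [|auto]. intros; rewrite Hone; ring. }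
      assert (Hc1 : ccont (fun t => fker N (t - x) * ei (IZR 1 * (t - x)))%C).
      { intros t. apply ccont_at_ext with (fun t => fker N (t - x) * (ei (- x) * ei (1 * t)))%C.
        { intros s. rewrite <- ei_plus. do 2 f_equal. ring. }
        apply ccont_mult; auto. apply ccont_mult; [apply ccont_const|apply ccont_ei]. }
      rewrite avg_minus by (apply ccont_mult; auto using ccont_const).
      rewrite !avg_scal, !fker_avg by auto. unfold Re; simpl. right. field. lra.
  - intros t. apply ccont_at_ext with (fun t => u t * fker N (t - x))%C; [|apply ccont_mult; auto].
    intros s. rewrite <- (fker_sym N (s - x)). do 2 f_equal. ring.
  - intros t. apply ccont_at_ext with (fun t => u x * fker N (t - x))%C; [|apply ccont_mult; auto; apply ccont_const].
    intros s. rewrite Hone. ring.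
Qed.

(** Continuity at [x] in the form consumed by [fejer]: the oscillation is below [e] near [x], and
    the multiple of [1 - cos] dominates it elsewhere. *)
Definition modulus_at (u : R -> C) (x : R) : Prop :=
  forall e, 0 < e -> exists K, 0 <= K /\ forall t, Cmod (u t - u x) <= e + K * (1 - cos (t - x)).

Lemma modulus_at_bounded u x M : (forall t, Cmod (u t) <= M) ->
  (forall e, 0 < e -> exists d, 0 < d /\ forall t, Cmod (ei t - ei x) < d -> Cmod (u t - u x) < e) -> modulus_at u x.
Proof.
  intros HM Hc e He. destruct (Hc e He) as [d [Hd H]].
  assert (HM0 : 0 <= M) by (eapply Rle_trans; [apply Cmod_ge_0|apply (HM x)]).
  assert (Hd2 : 0 < d ^ 2) by (apply pow_lt; auto).
  (* Where the chord is at least [d] one has [d ^ 2 <= 2 * (1 - cos)], so this constant makes the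
     second term at least [2 * M]. *)
  exists (4 * M / d ^ 2). split. { apply Rmult_le_pos; [lra|]. apply Rlt_le, Rinv_0_lt_compat; auto. }
  intros t. pose proof (COS_bound (t - x)) as Hcos.
  assert (0 <= 4 * M / d ^ 2 * (1 - cos (t - x))).
  { apply Rmult_le_pos; [|lra]. apply Rmult_le_pos; [lra|]. apply Rlt_le, Rinv_0_lt_compat; auto. }
  destruct (Rlt_dec (Cmod (ei t - ei x)) d) as [Hl|Hl]; [specialize (H t Hl); lra|].
  apply Rnot_lt_le in Hl. pose proof (ei_dist2 t x) as E.
  assert (d ^ 2 <= 2 * (1 - cos (t - x))) by (rewrite <- E; apply pow_incr; lra).
  pose proof (Cmod_tri_minus (u t) (u x)). pose proof (HM t). pose proof (HM x).
  enough (2 * M <= 4 * M / d ^ 2 * (1 - cos (t - x))) by lra.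
  replace (2 * M) with (4 * M / d ^ 2 * (d ^ 2 / 2)) by (field; lra).
  apply Rmult_le_compat_l; [|lra]. apply Rmult_le_pos; [lra|]. apply Rlt_le, Rinv_0_lt_compat; auto.
Qed.

Lemma csum_trunc w n m : (n <= m)%nat -> (forall k, (n <= k < m)%nat -> w k = RtoC 0) -> csum w m = csum w n.
Proof.
  intros Hnm H. replace m with (n + (m - n))%nat in * by lia. clear Hnm. induction (m - n)%nat as [|d IH].
  - rewrite Nat.add_0_r; auto.
  - rewrite Nat.add_succ_r. simpl. rewrite H by lia. rewrite IH; [ring|]. intros; apply H; lia.
Qed.

Lemma csum_rev w n : csum (fun k => w (n - k)%nat) (S n) = csum w (S n).
Proof.
  induction n as [|n IH]; [reflexivity|]. rewrite csum_shift.
  rewrite (csum_ext _ (fun k => w (n - k)%nat)) by (intros; f_equal; lia). rewrite IH.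
  change (csum w (S (S n))) with (csum w (S n) + w (S n))%C. rewrite Nat.sub_0_r. ring.
Qed.

Lemma inv_small e B : 0 < e -> 0 <= B -> exists N, (0 < N)%nat /\ B / INR N < e.
Proof.
  intros He HB. destruct (nfloor_ex (B / e)) as [N [_ HN]]. { apply Rmult_le_pos; auto. apply Rlt_le, Rinv_0_lt_compat; auto. }
  exists (S N). split; [lia|]. rewrite S_INR. pose proof (pos_INR N).
  apply Rlt_div_l; [lra|]. apply Rlt_div_l in HN; auto. lra.
Qed.

(** The Fejér means tend to [u x] by [fejer]. Since the negative modes vanish, they are also the
    means of the first [N] partial sums of the series; these approach the sum [l] geometrically, so
    their means approach it at rate [B2 / N]. Hence [l = u x]. *)
Lemma fourier_geo u x B q : ccont u -> modulus_at u x -> 0 <= q < 1 ->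
  (forall m, (m < 0)%Z -> mode u m = 0) -> (forall m, Cmod (mode u (Z.of_nat m)) <= B * q ^ m) ->
  cser (fun m => mode u (Z.of_nat m) * ei (INR m * x))%C (u x).
Proof.
  intros Hu Hmod Hq Hneg Hdec. set (w := fun m : nat => (mode u (Z.of_nat m) * ei (INR m * x))%C).
  destruct (cser_geo w B q Hq) as [l [Hl [_ Htail]]].
  { intros k. unfold w. rewrite Cmod_mult, Cmod_ei, Rmult_1_r. auto. }
  assert (HB : 0 <= B). { specialize (Hdec O). rewrite pow_O in Hdec. pose proof (Cmod_ge_0 (mode u (Z.of_nat 0))). lra. }
  replace (u x) with l; auto. apply Ceq_sub. apply Cmod_small_0. intros e He.
  destruct (Hmod (e / 2)) as [K [HK0 HK]]; [lra|].
  set (B2 := B / (1 - q) / (1 - q)).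
  assert (HB2 : 0 <= B2). { repeat apply Rmult_le_pos; auto; apply Rlt_le, Rinv_0_lt_compat; lra. }
  destruct (inv_small (e / 2) (K + B2)) as [N [HN HNe]]; [lra|lra|].
  assert (HN' : 0 < INR N) by (apply lt_0_INR; auto).
  assert (HNC : RtoC (INR N) <> 0) by (intros A; apply RtoC_inj in A; lra).
  pose proof (fejer u x (e / 2) K N Hu HN HK) as HF.
  assert (HS : Cmod (sigma u N x - l) <= B2 / INR N).
  { replace (sigma u N x - l)%C with (csum (fun j => csum w (S j) - l) N / INR N)%C.
    2:{ rewrite csum_minus. unfold sigma. rewrite (csum_ext (fun j => csum _ N) (fun j => csum w (S j))).
        - assert (Ec : csum (fun _ => l) N = (INR N * l)%C).
          { clear. induction N; [simpl; ring|]. rewrite S_INR. simpl csum. rewrite IHN, RtoC_plus. ring. }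
          rewrite Ec. field. auto.
        - intros j Hj. rewrite (csum_trunc _ (S j) N) by (try lia; intros k Hk; rewrite Hneg by lia; ring).
          rewrite <- csum_rev. apply csum_ext. intros k Hk. unfold w; cbv beta.
          replace (Z.of_nat j - Z.of_nat (j - k))%Z with (Z.of_nat k) by lia. rewrite (INR_IZR_INZ k). auto. }
    rewrite Cmod_div, Cmod_R, Rabs_right by (auto; lra). apply Rmult_le_compat_r; [apply Rlt_le, Rinv_0_lt_compat; auto|].
    eapply Rle_trans. { apply (csum_bound _ (fun j => B / (1 - q) * q ^ j)). intros k _. eapply Rle_trans; [apply Htail|].
      simpl. pose proof (pow_le q k ltac:(lra)). replace (B * (q * q ^ k) / (1 - q)) with (B / (1 - q) * (q * q ^ k)) by (field; lra).
      apply Rmult_le_compat_l; [|nra]. apply Rmult_le_pos; auto. apply Rlt_le, Rinv_0_lt_compat; lra. }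
    rewrite rsum_scal, rsum_geo by lra. unfold B2. unfold Rdiv at 2. rewrite <- Rmult_assoc.
    apply Rmult_le_compat_r; [apply Rlt_le, Rinv_0_lt_compat; lra|].
    pose proof (pow_le q N ltac:(lra)).
    assert (0 <= B / (1 - q)). { apply Rmult_le_pos; auto. apply Rlt_le, Rinv_0_lt_compat; lra. } nra. }
  pose proof (Cmod_tri_sub l (sigma u N x) (u x)). rewrite (Cmod_sub_sym l (sigma u N x)) in H.
  unfold Rdiv in *. rewrite Rmult_plus_distr_r in HNe. lra.
Qed.

(** * Power series *)

(** [P] restricts the points where the series has to represent [h]: all of them for holomorphic
    functions, the real ones for functions of a real variable, the nonzero ones when [h] is divided
    by [t]. The Cauchy bounds on the coefficients are part of the notion, which makes all tails
    explicit in [M] and [d]. *)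
Definition PSon (P : C -> Prop) (M d : R) (a : nat -> C) (h : C -> C) : Prop :=
  0 < d /\ (forall k, Cmod (a k) <= M / d ^ k) /\
  forall t, P t -> Cmod t < d -> cser (fun k => a k * t ^ k)%C (h t).

Lemma PSon_geo P M d a h t : PSon P M d a h -> Cmod t < d ->
  0 <= Cmod t / d < 1 /\ forall k, Cmod (a k * t ^ k) <= M * (Cmod t / d) ^ k.
Proof.
  intros [Hd [Ha _]] Ht. pose proof (Cmod_ge_0 t). split.
  - split; [apply Rmult_le_pos; auto; apply Rlt_le, Rinv_0_lt_compat; auto|]. apply Rlt_div_l; lra.
  - intros k. rewrite Cmod_mult, Cmod_pow. unfold Rdiv. rewrite Rpow_mult_distr, pow_inv.
    replace (M * (Cmod t ^ k * / d ^ k)) with (M / d ^ k * Cmod t ^ k) by (unfold Rdiv; ring).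
    apply Rmult_le_compat_r; auto. apply pow_le; auto.
Qed.

Lemma PSon_M P M d a h : PSon P M d a h -> 0 <= M.
Proof. intros [Hd [Ha _]]. specialize (Ha O). simpl in Ha. pose proof (Cmod_ge_0 (a O)). lra. Qed.

Lemma PSon_0 P M d a h t : PSon P M d a h -> P t -> Cmod t <= d / 2 -> Cmod (h t - a O) <= 2 * M * Cmod t / d.
Proof.
  intros H Pt Ht. pose proof (proj1 H) as Hd. destruct (PSon_geo _ _ _ _ _ t H ltac:(lra)) as [Hq Hg].
  pose proof (PSon_M _ _ _ _ _ H) as HM.
  destruct H as [_ [Ha H]]. specialize (H t Pt ltac:(lra)). apply cser_shift in H.
  destruct (cser_geo (fun k => a (S k) * t ^ S k)%C (M * (Cmod t / d)) (Cmod t / d) Hq) as [l [Hl [Hb _]]].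
  { intros k. eapply Rle_trans; [apply Hg|]. simpl. right; ring. }
  rewrite (cser_unique _ _ _ Hl H) in Hb. replace (a O * t ^ 0)%C with (a O) in Hb by (simpl; ring).
  eapply Rle_trans; [apply Hb|]. apply Rle_div_l; [lra|].
  set (q := Cmod t / d) in *. replace (2 * M * Cmod t / d) with (2 * M * q) by (unfold q; field; lra).
  assert (q <= 1/2).
  { unfold q. apply Rle_div_l; [exact Hd|lra]. }
  pose proof (Cmod_ge_0 t). assert (0 <= M * q) by nra. nra.
Qed.

Lemma PSon_shift P M d a h : (forall t, P t -> t <> RtoC 0) -> PSon P M d a h ->
  PSon P (M / d) d (fun k => a (S k)) (fun t => (h t - a O) / t)%C.
Proof.
  intros HP [Hd [Ha H]]. split; [auto|split].
  - intros k. eapply Rle_trans; [apply Ha|]. right. simpl. field. pose proof (pow_lt d k Hd). split; lra.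
  - intros t Pt Ht. specialize (H t Pt Ht). apply cser_shift in H.
    apply (cser_scal (/ t)) in H. replace ((h t - a O) / t)%C with (/ t * (h t - a O * t ^ 0))%C by (simpl; field; auto).
    eapply cser_ext; [|apply H]. intros k. simpl. field. auto.
Qed.

(** Zeros accumulating at the origin kill the constant term; the quotient by [t] has the same zeros,
    and the argument repeats. *)
Lemma PSon_zero P M d a h : PSon P M d a h -> (forall t, P t -> t <> RtoC 0 /\ h t = 0) ->
  (forall e, 0 < e -> exists t, P t /\ Cmod t < e) -> forall k, a k = 0.
Proof.
  intros H0 HP0 Hacc k.
  assert (Hzero : forall M a h, PSon P M d a h -> (forall t, P t -> t <> RtoC 0 /\ h t = 0) -> a O = 0).
  { clear H0 HP0 M a h k. intros M a h H HP.
    apply Cmod_small_0. intros e He. pose proof (proj1 H) as Hd. pose proof (PSon_M _ _ _ _ _ H) as HM.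
    destruct (Hacc (Rmin (d / 2) (e * d / (2 * M + 1)))) as [t [Pt Ht]].
    { apply Rmin_pos; [lra|]. apply Rdiv_lt_0_compat; nra. }
    apply Rmin_Rgt in Ht as [Ht1 Ht2]. pose proof (PSon_0 _ _ _ _ _ t H Pt ltac:(lra)) as B.
    rewrite (proj2 (HP t Pt)) in B. replace (0 - a O)%C with (- a O)%C in B by ring. rewrite Cmod_opp in B.
    eapply Rle_trans; [apply B|]. apply Rle_div_l; auto. apply Rlt_div_r in Ht2; [|lra]. pose proof (Cmod_ge_0 t). nra. }
  revert M a h H0 HP0. induction k as [|k IH]; intros M a h H HP; [eapply Hzero; eauto|].
  pose proof (Hzero M a h H HP) as a0.
  apply (IH (M / d) (fun k => a (S k)) (fun t => (h t - a O) / t)%C).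
  - apply PSon_shift; auto. intros t Pt. apply HP; auto.
  - intros t Pt. destruct (HP t Pt) as [T1 T2]. split; auto. rewrite T2, a0. field. auto.
Qed.

Lemma PSon_minus P M M' d a a' h h' : PSon P M d a h -> PSon P M' d a' h' ->
  PSon P (M + M') d (fun k => a k - a' k)%C (fun t => h t - h' t)%C.
Proof.
  intros [Hd [Ha H]] [_ [Ha' H']]. split; [auto|split].
  - intros k. eapply Rle_trans; [apply Cmod_tri_minus|]. unfold Rdiv. rewrite Rmult_plus_distr_r. apply Rplus_le_compat; [apply Ha|apply Ha'].
  - intros t Pt Ht. eapply cser_ext; [|apply cser_minus; [apply H|apply H']; eauto]. intros k; simpl; ring.
Qed.

Lemma PSon_mono (P P' : C -> Prop) M d M' d' a h : (forall t, P' t -> P t) -> M <= M' -> 0 < d' -> d' <= d ->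
  PSon P M d a h -> PSon P' M' d' a h.
Proof.
  intros HP HM Hd' Hdd H. pose proof (PSon_M _ _ _ _ _ H) as HM0. destruct H as [Hd [Ha H]]. split; [auto|split].
  - intros k. eapply Rle_trans; [apply Ha|]. unfold Rdiv. apply Rmult_le_compat; auto.
    + apply Rlt_le, Rinv_0_lt_compat, pow_lt; auto.
    + apply Rinv_le_contravar; [apply pow_lt; auto|]. apply pow_incr; lra.
  - intros t Pt Ht. apply H; auto. lra.
Qed.

(** * Taylor expansion, Cauchy's estimates and locally uniform limits *)

Lemma le_of_pow_lt x M R k : 0 < R -> 0 <= x -> (forall r, 0 < r < R -> x * r ^ k <= M) -> x * R ^ k <= M.
Proof.
  intros HR Hx H.
  (* Bernoulli's inequality for [r = R * (1 - s)]; then [s] tends to [0]. *)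
  assert (G : forall s, 0 < s < 1 -> x * R ^ k * (1 - INR k * s) <= M).
  { intros s Hs. eapply Rle_trans; [|apply (H (R * (1 - s))); split; nra]. rewrite Rpow_mult_distr, <- Rmult_assoc.
    apply Rmult_le_compat_l; [apply Rmult_le_pos; auto; apply pow_le; lra|].
    clear H. induction k as [|k IH]; [simpl; lra|]. rewrite S_INR. simpl. pose proof (pos_INR k).
    assert (0 <= (1 - s) ^ k) by (apply pow_le; lra). nra. }
  apply le_epsilon. intros e He. set (A := x * R ^ k) in *. assert (HA : 0 <= A) by (apply Rmult_le_pos; auto; apply pow_le; lra).
  pose proof (pos_INR k). set (s := Rmin (1/2) (e / (A * INR k + 1))).
  assert (Hs : 0 < s). { apply Rmin_pos; [lra|]. apply Rdiv_lt_0_compat; nra. }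
  pose proof (Rmin_l (1/2) (e / (A * INR k + 1))). pose proof (Rmin_r (1/2) (e / (A * INR k + 1))). fold s in H1, H2.
  specialize (G s ltac:(lra)). apply Rle_div_r in H2; [|nra]. nra.
Qed.

(** By [avg_annulus] the mode of index [k] on the circle of radius [r], divided by [r ^ k], does not
    depend on [r]; this defines the coefficients. The negative modes vanish, the others decay like
    [(r / rad) ^ k], and [fourier_geo] sums the series on each circle. The centre is treated
    separately. *)
Theorem taylor h c rad M : 0 < rad -> (forall z, Cmod (z - c) < rad -> cdiff h z) ->
  (forall z, Cmod (z - c) < rad -> Cmod (h z) <= M) ->
  exists a, PSon (fun _ => True) M rad a (fun t => h (c + t)%C).
Proof.
  intros HR Hd HM.
  assert (Hin : forall r t, 0 <= r < rad -> Cmod (c + r * ei t - c) < rad).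
  { intros r t Hr. replace (c + r * ei t - c)%C with (r * ei t)%C by ring. rewrite Cmod_mult, Cmod_R, Cmod_ei, Rabs_right; lra. }
  set (u := fun (r t : R) => h (c + r * ei t)%C).
  assert (Hu : forall r, 0 <= r < rad -> ccont (u r)).
  { intros r Hr t. unfold u. apply cdiff_ccont_at with (u := fun t => (c + r * ei t)%C); [|apply Hd; auto].
    apply ccont_at_plus; [apply ccont_at_const|apply ccont_at_mult; [apply ccont_at_const|]].
    apply ccont_at_ext with (fun s => ei (1 * s)); [intros; f_equal; ring|apply ccont_at_ei]. }
  assert (Hub : forall r t, 0 <= r < rad -> Cmod (u r t) <= M) by (intros; apply HM; auto).
  assert (Hrnz : forall r, 0 < r -> RtoC r <> 0) by (intros r Hr A; apply RtoC_inj in A; lra).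
  assert (Hpow : forall g r r', 0 < r < rad -> 0 < r' < rad -> (forall z, 0 < Cmod z < rad -> cdiff g z) ->
    avg (fun t => h (c + r * ei t) * g (r * ei t))%C = avg (fun t => h (c + r' * ei t) * g (r' * ei t))%C).
  { assert (A : forall g r r', 0 < r -> r <= r' -> r' < rad -> (forall z, 0 < Cmod z < rad -> cdiff g z) ->
      avg (fun t => h (c + r * ei t) * g (r * ei t))%C = avg (fun t => h (c + r' * ei t) * g (r' * ei t))%C).
    { intros g r r' H1 H2 H3 Hg. apply (avg_annulus (fun z => h (c + z) * g z)%C r r'); auto.
      intros z Hz. apply cdiff_mult; [|apply Hg; lra]. apply (cdiff_comp (fun z => c + z)%C h).
      - apply cdiff_plus; [apply cdiff_const|apply cdiff_id].
      - apply Hd. replace (c + z - c)%C with z by ring. lra. }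
    intros g r r' H1 H2 Hg. destruct (Rle_dec r r'); [apply A; auto; lra|symmetry; apply A; auto; lra]. }
  set (a := fun k : nat => (mode (u (rad / 2)%R) (Z.of_nat k) / (rad / 2)%R ^ k)%C).
  assert (Hpei : forall k r t, (0 < r) -> (/ (r * ei t) ^ k = / RtoC r ^ k * ei (- IZR (Z.of_nat k) * t))%C).
  { intros k r t Hr. rewrite Cpow_mult_l, ei_pow. rewrite <- INR_IZR_INZ.
    assert (ei (INR k * t) <> 0) by apply ei_nz. assert (RtoC r ^ k <> 0)%C by (apply Cpow_nz; auto).
    pose proof (ei_neg_mul (INR k * t)) as E. replace (- INR k * t) with (- (INR k * t)) by ring.
    replace (ei (- (INR k * t))) with (/ ei (INR k * t))%C; [field; auto|].
    apply Cmult_cancel_l with (ei (INR k * t)); auto. rewrite (Cmult_comm _ (ei (- _))), E. field; auto. }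
  assert (Ha : forall k r, 0 < r < rad -> mode (u r) (Z.of_nat k) = (a k * RtoC r ^ k)%C).
  { intros k r Hr.
    assert (E : forall r, 0 < r < rad -> avg (fun t => h (c + r * ei t) * / (r * ei t) ^ k)%C = (/ RtoC r ^ k * mode (u r) (Z.of_nat k))%C).
    { intros s Hs. unfold mode. rewrite <- avg_scal by (apply ccont_mult; [apply Hu; lra|apply ccont_ei]).
      apply avg_ext. intros t. rewrite Hpei by lra. unfold u. ring. }
    assert (RtoC r ^ k <> 0)%C by (apply Cpow_nz, Hrnz; lra).
    pose proof (Hpow (fun z => / z ^ k)%C r (rad/2) Hr ltac:(lra)) as E2. rewrite !E in E2 by lra.
    assert (E3 := E2 ltac:(intros z Hz; apply (cdiff_inv (fun z => z ^ k)%C); [apply cdiff_pow, cdiff_id|apply Cpow_nz; intros ->; rewrite Cmod_0 in Hz; lra])).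
    transitivity (RtoC r ^ k * (/ RtoC r ^ k * mode (u r) (Z.of_nat k)))%C; [field; auto|].
    rewrite E3. unfold a. unfold Cdiv; ring. }
  assert (Hneg : forall m r, 0 < r < rad -> (m < 0)%Z -> mode (u r) m = 0).
  { intros m r Hr Hm. set (l := Z.to_nat (- m)).
    assert (Hl : - IZR m = INR l) by (unfold l; rewrite INR_IZR_INZ, Z2Nat.id, opp_IZR by lia; auto).
    assert (E : forall r, 0 < r < rad -> avg (fun t => h (c + r * ei t) * (r * ei t) ^ l)%C = (RtoC r ^ l * mode (u r) m)%C).
    { intros s Hs. unfold mode. rewrite <- avg_scal by (apply ccont_mult; [apply Hu; lra|apply ccont_ei]).
      apply avg_ext. intros t. rewrite Cpow_mult_l, ei_pow, Hl. unfold u. ring. }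
    assert (Hrl : (RtoC r ^ l)%C <> 0) by (apply Cpow_nz, Hrnz; lra).
    apply Cmult_cancel_l with (RtoC r ^ l)%C; auto. rewrite Cmult_0_r. apply Cmod_small_0. intros e He.
    assert (HM0 : 0 <= M) by (eapply Rle_trans; [apply Cmod_ge_0|apply (Hub r 0); lra]).
    (* Moved to the radius [s], the average representing [r ^ l] times the mode is at most
       [M * s ^ l <= M * s]. *)
    set (s := Rmin (rad / 2) (Rmin 1 (e / (M + 1)))).
    assert (Hs : 0 < s). { repeat apply Rmin_pos; try lra. apply Rdiv_lt_0_compat; lra. }
    assert (s <= rad / 2) by apply Rmin_l. assert (s <= 1) by (eapply Rle_trans; [apply Rmin_r|apply Rmin_l]).
    assert (s <= e / (M + 1)) by (eapply Rle_trans; [apply Rmin_r|apply Rmin_r]).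
    rewrite <- E by auto. rewrite (Hpow (fun z => z ^ l)%C r s) by (try lra; intros; apply cdiff_pow, cdiff_id).
    apply avg_bound.
    - apply (ccont_mult (u s)); [apply Hu; lra|]. intros t. apply ccont_at_ext with (fun t => RtoC s ^ l * ei (INR l * t))%C.
      { intros; rewrite Cpow_mult_l, ei_pow; auto. } apply ccont_at_mult; [apply ccont_at_const|apply ccont_at_ei].
    - intros t. rewrite Cmod_mult, Cmod_pow, Cmod_mult, Cmod_R, Cmod_ei, Rabs_right, Rmult_1_r by lra.
      specialize (Hub s t ltac:(lra)). unfold u in Hub.
      assert (s ^ l <= s). { assert (1 <= l)%nat by (unfold l; lia). replace l with (S (l - 1)) by lia. simpl.
        assert (s ^ (l - 1) <= 1) by (rewrite <- (pow1 (l - 1)); apply pow_incr; lra). nra. }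
      assert (0 <= s ^ l) by (apply pow_le; lra). apply Rle_div_r in H1; [|lra].
      pose proof (Cmod_ge_0 (h (c + s * ei t)%C)). nra. }
  assert (Hab : forall k, Cmod (a k) <= M / rad ^ k).
  { intros k. apply Rle_div_r; [apply pow_lt; auto|]. apply le_of_pow_lt; auto; [apply Cmod_ge_0|].
    intros r Hr. pose proof (Ha k r Hr) as E. replace (Cmod (a k) * r ^ k) with (Cmod (a k * RtoC r ^ k)).
    2:{ rewrite Cmod_mult, Cmod_pow, Cmod_R, Rabs_right by lra. auto. }
    rewrite <- E. apply avg_bound; [apply ccont_mult; [apply Hu; lra|apply ccont_ei]|].
    intros t. rewrite Cmod_mult, Cmod_ei, Rmult_1_r. apply Hub; lra. }
  exists a. split; [auto|split; [auto|]]. intros t _ Ht.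
  destruct (Req_dec (Cmod t) 0) as [E|E].
  - apply Cmod_eq_0 in E. subst t. rewrite Cplus_0_r.
    replace (h c) with (a O).
    + pose proof (cser_finite (fun k => a k * 0 ^ k)%C 1) as F. unfold csum in F.
      replace (a O) with (0 + a 0%nat * 0 ^ 0)%C by (simpl; ring). apply F.
      intros k Hk. replace k with (S (k - 1)) by lia. rewrite Cpow_S. ring.
    + apply Ceq_sub. apply Cmod_small_0. intros e He.
      destruct (cdiff_cont h c ltac:(apply Hd; rewrite Cmod_sub_diag; auto) e He) as [d [Hdp Hc]].
      set (r := Rmin (d / 2) (rad / 2)). assert (0 < r) by (apply Rmin_pos; lra).
      assert (r <= d / 2) by apply Rmin_l. assert (r <= rad / 2) by apply Rmin_r.
      pose proof (Ha O r ltac:(lra)) as E. replace (a 0%nat * RtoC r ^ 0)%C with (a O) in E by (simpl; ring).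
      rewrite <- E. rewrite <- (avg_const (h c)). unfold mode. apply avg_close.
      * apply ccont_mult; [apply Hu; lra|apply ccont_ei].
      * apply ccont_const.
      * intros s. simpl IZR. rewrite Ropp_0, Rmult_0_l, ei_0, Cmult_1_r. apply Rlt_le, Hc.
        replace (c + r * ei s - c)%C with (r * ei s)%C by ring. rewrite Cmod_mult, Cmod_R, Cmod_ei, Rabs_right; lra.
  - pose proof (Cmod_ge_0 t) as Hp. destruct (polar t) as [s Hs]. set (r := Cmod t) in *.
    assert (Hr : 0 < r < rad) by lra.
    pose proof (fourier_geo (u r) s M (r / rad)) as G.
    replace (h (c + t)%C) with (u r s) by (unfold u; rewrite <- Hs; auto).
    eapply cser_ext; [|apply G].
    + intros k. simpl. rewrite Ha by auto. rewrite <- ei_pow. rewrite Hs. rewrite Cpow_mult_l. ring.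
    + apply Hu; lra.
    + apply modulus_at_bounded with M; [intros; apply Hub; lra|].
      intros e He. destruct (cdiff_cont h (c + r * ei s)%C ltac:(apply Hd, Hin; lra) e He) as [d [Hdp Hc]].
      exists (d / r). split; [apply Rdiv_lt_0_compat; lra|]. intros x Hx. apply Hc.
      replace (c + r * ei x - (c + r * ei s))%C with (r * (ei x - ei s))%C by ring.
      rewrite Cmod_mult, Cmod_R, Rabs_right by lra. apply Rlt_div_r in Hx; lra.
    + split; [apply Rmult_le_pos; [lra|apply Rlt_le, Rinv_0_lt_compat; lra]|]. apply Rlt_div_l; lra.
    + intros; apply Hneg; auto.
    + intros k. rewrite Ha by auto. rewrite Cmod_mult, Cmod_pow, Cmod_R, Rabs_right by lra.
      unfold Rdiv. rewrite Rpow_mult_distr, pow_inv. pose proof (Hab k). pose proof (pow_le r k ltac:(lra)). unfold Rdiv in *. nra.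
Qed.

Lemma PSon_1 P M d a h t : (forall t, P t -> t <> RtoC 0) -> PSon P M d a h -> P t -> Cmod t <= d / 2 ->
  Cmod (h t - a O - a 1%nat * t) <= 2 * M * Cmod t ^ 2 / d ^ 2.
Proof.
  intros HP H Pt Ht. pose proof (proj1 H) as Hd. pose proof (PSon_shift _ _ _ _ _ HP H) as H1.
  pose proof (PSon_0 _ _ _ _ _ t H1 Pt Ht) as B. specialize (HP t Pt).
  replace (h t - a 0%nat - a 1%nat * t)%C with (t * ((h t - a 0%nat) / t - a 1%nat))%C by (field; auto).
  rewrite Cmod_mult. pose proof (Cmod_ge_0 t).
  replace (2 * M * Cmod t ^ 2 / d ^ 2) with (Cmod t * (2 * (M / d) * Cmod t / d)) by (field; lra).
  apply Rmult_le_compat_l; auto.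
Qed.

(** Everything is read off the first two Taylor coefficients and the remainder. The bounds depend on
    [M] and [R] alone, so they pass to limits of sequences. *)
Lemma cauchy_der h c R M : 0 < R -> (forall z, Cmod (z - c) < R -> cdiff h z) ->
  (forall z, Cmod (z - c) < R -> Cmod (h z) <= M) ->
  exists l, cder h c l /\ Cmod l <= M / R /\
   (forall t, Cmod t <= R / 2 -> Cmod (h (c + t) - h c)%C <= 2 * M * Cmod t / R) /\
   (forall t, Cmod t <= R / 2 -> Cmod (h (c + t) - h c - l * t)%C <= 2 * M * Cmod t ^ 2 / R ^ 2).
Proof.
  intros HR Hd HM. destruct (taylor h c R M HR Hd HM) as [a Ha]. exists (a 1%nat).
  pose proof (PSon_M _ _ _ _ _ Ha) as HM0.
  assert (a0 : a O = h c).
  { apply Ceq_sub. apply Cmod_small_0. intros e He. pose proof (PSon_0 _ _ _ _ _ 0 Ha I) as B.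
    rewrite Cmod_0 in B. specialize (B ltac:(lra)). rewrite Cplus_0_r, Cmod_sub_sym in B.
    replace (2 * M * 0 / R) with 0 in B by (field; lra). lra. }
  assert (B1 : forall t, Cmod t <= R / 2 -> Cmod (h (c + t) - h c)%C <= 2 * M * Cmod t / R).
  { intros t Ht. rewrite <- a0. apply (PSon_0 _ _ _ _ _ t Ha I Ht). }
  assert (B2 : forall t, Cmod t <= R / 2 -> Cmod (h (c + t) - h c - a 1%nat * t)%C <= 2 * M * Cmod t ^ 2 / R ^ 2).
  { intros t Ht. rewrite <- a0. destruct (Req_dec (Cmod t) 0) as [E|E].
    - apply Cmod_eq_0 in E. subst t. rewrite Cplus_0_r, <- a0, Cmod_0. replace (a O - a O - a 1%nat * 0)%C with (RtoC 0) by ring.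
      rewrite Cmod_0. right. field. lra.
    - apply (PSon_1 (fun t => t <> RtoC 0) M R a (fun t => h (c + t)%C)); auto.
      + eapply PSon_mono; [| | | |apply Ha]; [intros; exact I|lra|lra|lra].
      + intros E2. subst. rewrite Cmod_0 in E. lra. }
  split; [|split; [|split]]; auto.
  - intros e He. exists (Rmin (R / 2) (e * R ^ 2 / (2 * M + 1))). pose proof (pow_lt R 2 HR). split.
    { apply Rmin_pos; [lra|]. apply Rdiv_lt_0_compat; nra. }
    intros w Hw. apply Rmin_Rgt in Hw as [Hw1 Hw2]. specialize (B2 (w - c)%C ltac:(lra)).
    replace (c + (w - c))%C with w in B2 by ring. eapply Rle_trans; [apply B2|]. apply Rle_div_l; auto.
    apply Rlt_div_r in Hw2; [|lra]. pose proof (Cmod_ge_0 (w - c)). nra.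
  - destruct Ha as [_ [Ha _]]. specialize (Ha 1%nat). simpl in Ha. rewrite Rmult_1_r in Ha. auto.
Qed.

Lemma cder_unique f z l l' : cder f z l -> cder f z l' -> l = l'.
Proof.
  intros H H'. apply Ceq_sub. apply Cmod_small_0. intros e He.
  destruct (H (e/2)) as [d [Hd H1]]; [lra|]. destruct (H' (e/2)) as [d' [Hd' H2]]; [lra|].
  set (r := Rmin d d' / 2). assert (0 < r) by (apply Rdiv_lt_0_compat; [apply Rmin_pos; auto|lra]).
  assert (r < d /\ r < d'). { pose proof (Rmin_l d d'). pose proof (Rmin_r d d'). unfold r in *. lra. }
  assert (Hm : Cmod (z + r - z) = r). { replace (z + r - z)%C with (RtoC r) by ring. rewrite Cmod_R, Rabs_right; lra. }
  specialize (H1 (z + r)%C ltac:(lra)). specialize (H2 (z + r)%C ltac:(lra)). rewrite Hm in *.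
  pose proof (Cmod_tri_minus (f (z + r)%C - f z - l' * (z + r - z)) (f (z + r)%C - f z - l * (z + r - z))) as T.
  replace (f (z + r) - f z - l' * (z + r - z) - (f (z + r) - f z - l * (z + r - z)))%C with ((l - l') * r)%C in T by ring.
  rewrite Cmod_mult, Cmod_R, Rabs_right in T by lra. apply Rmult_le_reg_r with r; auto. lra.
Qed.

(** The estimate for derivatives, applied to differences of approximants, makes their derivatives at
    [c] a Cauchy sequence; the common quadratic bound on the remainders then survives in the
    limit. *)
Theorem weierstrass h c R : 0 < R ->
  (forall e, 0 < e -> exists k, (forall z, Cmod (z - c) < R -> cdiff k z) /\ forall z, Cmod (z - c) < R -> Cmod (k z - h z) <= e) ->
  cdiff h c.
Proof.
  intros HR H.
  assert (H' : forall n : nat, exists k, (forall z, Cmod (z - c) < R -> cdiff k z) /\ forall z, Cmod (z - c) < R -> Cmod (k z - h z) <= / INR (S n)).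
  { intros n. apply H. apply Rinv_0_lt_compat, lt_0_INR. lia. }
  apply fun_choice in H' as [k Hk].
  assert (Hc : Cmod (c - c) < R) by (rewrite Cmod_sub_diag; auto).
  destruct (cdiff_cont (k O) c (proj1 (Hk O) c Hc) 1 ltac:(lra)) as [d [Hd Hd1]].
  set (r := Rmin d R). assert (Hr : 0 < r) by (apply Rmin_pos; auto).
  assert (r <= d /\ r <= R) as [Hr1 Hr2] by (split; [apply Rmin_l|apply Rmin_r]).
  assert (Hinv : forall n, 0 < / INR (S n) <= 1).
  { intros n. split; [apply Rinv_0_lt_compat, lt_0_INR; lia|]. rewrite <- Rinv_1. apply Rinv_le_contravar; [lra|].
    change 1 with (INR 1). apply le_INR. lia. }
  set (M := Cmod (k O c) + 3).
  assert (HM : forall n z, Cmod (z - c) < r -> Cmod (k n z) <= M).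
  { intros n z Hz. pose proof (proj2 (Hk n) z ltac:(lra)) as E1. pose proof (proj2 (Hk O) z ltac:(lra)) as E2. pose proof (Hd1 z ltac:(lra)) as E3.
    pose proof (Hinv n). pose proof (Hinv O). pose proof (Cmod_le_add (k n z) (h z)). pose proof (Cmod_le_add (h z) (k O z)) as E4.
    rewrite (Cmod_sub_sym (h z)) in E4. pose proof (Cmod_le_add (k O z) (k O c)). unfold M. lra. }
  assert (Hl : forall n, exists l, cder (k n) c l /\ forall t, Cmod t <= r / 2 -> Cmod (k n (c + t) - k n c - l * t)%C <= 2 * M * Cmod t ^ 2 / r ^ 2).
  { intros n. destruct (cauchy_der (k n) c r M Hr) as [l [H1 [_ [_ H2]]]].
    - intros z Hz. apply (Hk n). lra.
    - intros z Hz. apply HM; auto.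
    - exists l; auto. }
  apply fun_choice in Hl as [l Hl].
  destruct (cauchy_C l (fun n => 2 / INR (S n) / r)) as [L HL].
  - intros n m Hnm.
    destruct (cauchy_der (fun z => k m z - k n z)%C c r (2 / INR (S n)) Hr) as [l' [H1 [H2 _]]].
    + intros z Hz. apply cdiff_minus; apply Hk; lra.
    + intros z Hz. pose proof (proj2 (Hk n) z ltac:(lra)). pose proof (proj2 (Hk m) z ltac:(lra)).
      pose proof (Cmod_tri_sub (k m z) (h z) (k n z)) as E4. rewrite (Cmod_sub_sym (h z)) in E4.
      assert (/ INR (S m) <= / INR (S n)). { apply Rinv_le_contravar; [apply lt_0_INR; lia|apply le_INR; lia]. }
      unfold Rdiv. lra.
    + replace (l m - l n)%C with l'; auto. eapply cder_unique; [apply H1|].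
      replace (l m - l n)%C with (l m + -(1) * l n)%C by ring.
      apply cder_ext with (fun z => k m z + -(1) * k n z)%C; [intros; ring|].
      apply cder_plus; [apply Hl|]. replace (-(1) * l n)%C with (0 * k n c + -(1) * l n)%C by ring.
      apply (cder_mult (fun _ => (-(1))%C)); [apply cder_const|apply Hl].
  - intros e He. destruct (inv_small (e * r) 2) as [N [HN HN2]]; [nra|lra|]. exists N.
    apply Rlt_div_l; auto. eapply Rle_lt_trans; [|apply HN2]. apply Rmult_le_compat_l; [lra|].
    apply Rinv_le_contravar; [apply lt_0_INR; auto|apply le_INR; lia].
  - assert (B : forall t, Cmod t <= r / 2 -> Cmod (h (c + t) - h c - L * t)%C <= 2 * M * Cmod t ^ 2 / r ^ 2).
    { intros t Ht. apply le_epsilon. intros e He. pose proof (Cmod_ge_0 t).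
      destruct (inv_small e (2 + 2 / r * Cmod t)) as [N [HN HN2]]; [auto| |].
      { assert (0 <= 2 / r * Cmod t); [|lra]. apply Rmult_le_pos; auto. apply Rmult_le_pos; [lra|apply Rlt_le, Rinv_0_lt_compat; auto]. }
      pose proof (proj2 (Hk N) (c + t)%C ltac:(replace (c + t - c)%C with t by ring; lra)) as E1.
      pose proof (proj2 (Hk N) c Hc) as E2. pose proof (HL N) as E3. pose proof (proj2 (Hl N) t Ht) as E4.
      replace (h (c + t) - h c - L * t)%C with ((k N (c + t) - k N c - l N * t) - (k N (c + t) - h (c + t)) + (k N c - h c) + (l N - L) * t)%C by ring.
      eapply Rle_trans; [apply Cmod_triangle|]. rewrite Cmod_mult.
      eapply Rle_trans; [apply Rplus_le_compat_r, Cmod_triangle|].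
      eapply Rle_trans; [apply Rplus_le_compat_r, Rplus_le_compat_r, Cmod_tri_minus|].
      assert (HS : / INR (S N) <= / INR N). { apply Rinv_le_contravar; [apply lt_0_INR; auto|apply le_INR; lia]. }
      assert (Cmod (l N - L) * Cmod t <= 2 / r * Cmod t * / INR (S N)).
      { apply Rle_trans with (2 / INR (S N) / r * Cmod t); [apply Rmult_le_compat_r; auto|]. right. field. assert (INR (S N) <> 0) by (apply not_0_INR; lia). split; lra. }
      assert (2 / r * Cmod t * / INR (S N) <= 2 / r * Cmod t * / INR N).
      { apply Rmult_le_compat_l; auto. apply Rmult_le_pos; auto. apply Rmult_le_pos; [lra|apply Rlt_le, Rinv_0_lt_compat; auto]. }
      unfold Rdiv in HN2 at 1. rewrite Rmult_plus_distr_r in HN2. lra. }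
    assert (HM0 : 0 <= M) by (unfold M; pose proof (Cmod_ge_0 (k O c)); lra).
    exists L. intros e He. exists (Rmin (r / 2) (e * r ^ 2 / (2 * M + 1))). pose proof (pow_lt r 2 Hr). split.
    { apply Rmin_pos; [lra|]. apply Rdiv_lt_0_compat; nra. }
    intros w Hw. apply Rmin_Rgt in Hw as [Hw1 Hw2]. specialize (B (w - c)%C ltac:(lra)).
    replace (c + (w - c))%C with w in B by ring. eapply Rle_trans; [apply B|]. apply Rle_div_l; auto.
    apply Rlt_div_r in Hw2; [|lra]. pose proof (Cmod_ge_0 (w - c)). nra.
Qed.

(** * Analyticity of averages and analytic continuation *)

(** The constant coefficient is the limit of [u x t] as [t] tends to [0], uniformly in [x], hence
    continuous in [x]; division by [t] moves on to the next coefficient. *)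
Lemma PSon_avg_coef P : (forall t, P t -> t <> RtoC 0) -> (forall e, 0 < e -> exists t, P t /\ Cmod t < e) ->
  forall k M d (u : R -> C -> C) a, (forall x, PSon P M d (a x) (u x)) ->
  (forall t, P t -> Cmod t < d -> ccont (fun x => u x t)) -> ccont (fun x => a x k).
Proof.
  intros HP Hacc.
  assert (Base : forall M d (u : R -> C -> C) a, (forall x, PSon P M d (a x) (u x)) ->
    (forall t, P t -> Cmod t < d -> ccont (fun x => u x t)) -> ccont (fun x => a x O)).
  { intros M d u a H Hc x. pose proof (proj1 (H x)) as Hd. pose proof (PSon_M _ _ _ _ _ (H x)) as HM.
    apply ccont_at_unif. intros e He.
    destruct (Hacc (Rmin (d / 2) (e * d / (2 * M + 1)))) as [t [Pt Ht]].
    { apply Rmin_pos; [lra|]. apply Rdiv_lt_0_compat; nra. }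
    apply Rmin_Rgt in Ht as [Ht1 Ht2]. exists (fun x => u x t). split; [apply Hc; auto; lra|].
    exists 1; split; [lra|]. intros s _. rewrite Cmod_sub_sym. eapply Rle_trans; [apply (PSon_0 _ _ _ _ _ t (H s) Pt); lra|].
    apply Rle_div_l; auto. apply Rlt_div_r in Ht2; [|lra]. pose proof (Cmod_ge_0 t). nra. }
  induction k as [|k IH]; intros M d u a H Hc; [apply (Base M d u a); auto|].
  apply (IH (M / d) d (fun x t => (u x t - a x O) / t)%C (fun x k => a x (S k))).
  - intros x. apply PSon_shift; auto.
  - intros t Pt Ht x. apply (ccont_at_mult (fun x => u x t - a x O)%C); [|apply ccont_at_const].
    apply ccont_at_minus; [apply Hc; auto|apply (Base M d u a); auto].
Qed.

Lemma PSon_tail P M d a h t : PSon P M d a h -> P t -> Cmod t < d ->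
  forall n, Cmod (csum (fun k => a k * t ^ k)%C n - h t) <= M * (Cmod t / d) ^ n / (1 - Cmod t / d).
Proof.
  intros H Pt Ht n. destruct (PSon_geo _ _ _ _ _ t H Ht) as [Hq Hg].
  destruct (cser_geo _ _ _ Hq Hg) as [l [Hl [_ Hb]]]. destruct H as [_ [_ H]].
  rewrite (cser_unique _ _ _ (H t Pt Ht) Hl). apply Hb.
Qed.

Lemma cser_of_tail w l B q : 0 <= q < 1 -> 0 <= B -> (forall n, Cmod (csum w n - l) <= B * q ^ n) -> cser w l.
Proof.
  intros Hq HB H e He. destruct (pow_small q (e / (B + 1))) as [N HN]; auto. { apply Rdiv_lt_0_compat; lra. }
  exists N. intros n Hn. eapply Rle_lt_trans; [apply H|]. apply Rlt_div_r in HN; [|lra].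
  pose proof (pow_le q n ltac:(lra)).
  assert (q ^ n <= q ^ N).
  { replace n with (N + (n - N))%nat by lia. rewrite pow_add. pose proof (pow_le q N ltac:(lra)).
    assert (q ^ (n - N) <= 1) by (rewrite <- (pow1 (n - N)); apply pow_incr; lra). nra. }
  nra.
Qed.

(** All series share [M] and [d], so their tails are uniform in [x] and the expansion can be
    averaged term by term. *)
Lemma PSon_avg P M d (u : R -> C -> C) :
  (forall e, 0 < e -> exists t, P t /\ t <> RtoC 0 /\ Cmod t < e) ->
  (forall x, exists a, PSon P M d a (u x)) -> (forall t, P t -> Cmod t < d -> ccont (fun x => u x t)) ->
  exists b, PSon P M d b (fun t => avg (fun x => u x t)).
Proof.
  intros Hacc H Hc. apply fun_choice in H as [a Ha]. exists (fun k => avg (fun x => a x k)).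
  assert (Hk : forall k, ccont (fun x => a x k)).
  { intros k. apply (PSon_avg_coef (fun t => P t /\ t <> RtoC 0) (fun t H => proj2 H)) with M d u.
    - intros e He. destruct (Hacc e He) as [t Ht]. exists t. destruct Ht as [H1 [H2 H3]]. auto.
    - intros x. pose proof (proj1 (Ha x)). eapply PSon_mono; [| | | |apply Ha]; try lra. intros t [Pt _]; exact Pt.
    - intros t [Pt _] Ht. apply Hc; auto. }
  pose proof (proj1 (Ha 0)) as Hd. split; [auto|split].
  - intros k. apply avg_bound; auto. intros x. apply (Ha x).
  - intros t Pt Ht. destruct (PSon_geo _ _ _ _ _ t (Ha 0) Ht) as [Hq _]. pose proof (PSon_M _ _ _ _ _ (Ha 0)) as HM.
    apply cser_of_tail with (M / (1 - Cmod t / d)) (Cmod t / d); auto.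
    { apply Rmult_le_pos; auto. apply Rlt_le, Rinv_0_lt_compat; lra. }
    intros n. rewrite (csum_ext _ (fun k => avg (fun x => t ^ k * a x k)%C)).
    2:{ intros k _. rewrite avg_scal by auto. ring. }
    rewrite <- (avg_csum (fun k x => t ^ k * a x k)%C).
    2:{ intros k. apply ccont_mult; auto using ccont_const. }
    apply avg_close; auto.
    + apply ccont_csum. intros k. apply ccont_mult; auto using ccont_const.
    + intros x. rewrite (csum_ext _ (fun k => a x k * t ^ k)%C) by (intros; ring).
      eapply Rle_trans; [apply (PSon_tail _ _ _ _ _ t (Ha x) Pt Ht)|]. right. unfold Rdiv. ring.
Qed.

(** * Real-analytic functions of one variable and the identity theorem *)

Definition is_real (t : C) : Prop := t = RtoC (Re t).

Lemma is_real_R (r : R) : is_real r. Proof. reflexivity. Qed.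

(** Local power series: real analyticity of [F] at [x]. *)
Definition lps (F : R -> C) (x : R) : Prop :=
  exists M d a, PSon is_real M d a (fun t => F (x + Re t)).

Lemma lps_minus F G x : lps F x -> lps G x -> lps (fun y => F y - G y)%C x.
Proof.
  intros [M [d [a H]]] [M' [d' [a' H']]]. pose proof (proj1 H). pose proof (proj1 H').
  exists (M + M'), (Rmin d d'), (fun k => a k - a' k)%C.
  apply (PSon_minus is_real M M' (Rmin d d') a a' (fun t => F (x + Re t)) (fun t => G (x + Re t))).
  - eapply PSon_mono; [| | | |apply H]; auto; [lra|apply Rmin_pos; auto|apply Rmin_l].
  - eapply PSon_mono; [| | | |apply H']; auto; [lra|apply Rmin_pos; auto|apply Rmin_r].
Qed.

Lemma lps_ext_loc F G x d : 0 < d -> (forall y, Rabs (y - x) < d -> F y = G y) -> lps F x -> lps G x.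
Proof.
  intros Hd E [M [d' [a H]]]. pose proof (proj1 H). exists M, (Rmin d d'), a.
  assert (H2 : PSon is_real M (Rmin d d') a (fun t => F (x + Re t))).
  { eapply PSon_mono; [| | | |apply H]; auto; [lra|apply Rmin_pos; auto|apply Rmin_r]. }
  destruct H2 as [A [B D]]. split; [auto|split; [auto|]]. intros t Pt Ht. rewrite <- E; [apply D; auto|].
  replace (x + Re t - x) with (Re t) by ring. eapply Rle_lt_trans; [apply re_le_Cmod|].
  eapply Rlt_le_trans; [apply Ht|apply Rmin_l].
Qed.

Lemma lps_cont F x : lps F x -> ccont_at F x.
Proof.
  intros [M [d [a H]]] e He. pose proof (proj1 H) as Hd. pose proof (PSon_M _ _ _ _ _ H) as HM.
  assert (a0 : F x = a O).
  { apply Ceq_sub, Cmod_small_0. intros e' He'. pose proof (PSon_0 _ _ _ _ _ 0 H (is_real_R 0)) as B.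
    cbv beta in B. rewrite Cmod_0 in B. specialize (B ltac:(lra)). simpl in B. rewrite Rplus_0_r in B.
    replace (2 * M * 0 / d) with 0 in B by (field; lra). lra. }
  exists (Rmin (d / 2) (e * d / (2 * M + 1))). split.
  { apply Rmin_pos; [lra|]. apply Rdiv_lt_0_compat; nra. }
  intros s Hs. apply Rmin_Rgt in Hs as [H1 H2].
  assert (Hm : Cmod (RtoC (s - x)) = Rabs (s - x)) by apply Cmod_R.
  pose proof (PSon_0 _ _ _ _ _ (RtoC (s - x)) H (is_real_R _) ltac:(lra)) as B. cbv beta in B. simpl Re in B.
  replace (x + (s - x)) with s in B by ring. rewrite a0. eapply Rle_lt_trans; [apply B|]. rewrite Hm.
  apply Rlt_div_l; auto. apply Rlt_div_r in H2; [|lra]. pose proof (Rabs_pos (s - x)). nra.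
Qed.

Lemma lps_zero_near F x : lps F x -> (forall e, 0 < e -> exists y, y <> x /\ Rabs (y - x) < e /\ F y = 0) ->
  exists d, 0 < d /\ forall y, Rabs (y - x) < d -> F y = 0.
Proof.
  intros [M [d [a H]]] Hz. pose proof (proj1 H) as Hd. exists d. split; auto.
  assert (Ha : forall k, a k = 0).
  { apply (PSon_zero (fun t => is_real t /\ t <> RtoC 0 /\ F (x + Re t) = 0) M d a (fun t => F (x + Re t))).
    - eapply PSon_mono; [| | | |apply H]; [intros t Pt; apply Pt|lra|lra|lra].
    - intros t [_ Pt]. auto.
    - intros e He. destruct (Hz e He) as [y [Hy1 [Hy2 Hy3]]]. exists (RtoC (y - x)). split; [split; [reflexivity|split]|].
      + intros A. apply RtoC_inj in A. lra.
      + simpl. replace (x + (y - x)) with y by ring. auto.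
      + rewrite Cmod_R. auto. }
  intros y Hy. destruct H as [_ [_ H]]. specialize (H (RtoC (y - x)) eq_refl ltac:(rewrite Cmod_R; auto)).
  simpl Re in H. replace (x + (y - x)) with y in H by ring. eapply cser_unique; [apply H|].
  eapply cser_ext; [|apply (cser_finite (fun _ => RtoC 0) 0); auto]. intros k. simpl. rewrite Ha. ring.
Qed.

Lemma lps_refl F x : lps F x -> lps (fun y => F (- y)) (- x).
Proof.
  intros [M [d [a [Hd [Ha H]]]]]. exists M, d, (fun k => (-(1)) ^ k * a k)%C. split; [auto|split].
  - intros k. rewrite Cmod_mult, Cmod_pow, Cmod_opp, Cmod_1, pow1, Rmult_1_l. auto.
  - intros t Pt Ht. replace (- (- x + Re t)) with (x + Re (- t)%C) by (unfold Re; simpl; ring).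
    eapply cser_ext; [|apply (H (- t)%C)].
    + intros k. simpl. replace (- t)%C with (-(1) * t)%C by ring. rewrite Cpow_mult_l. ring.
    + unfold is_real in *. rewrite Pt. apply C_eq; simpl; ring.
    + rewrite Cmod_opp. auto.
Qed.

(** Let [s] be the supremum of the right ends of intervals [(u, x)] on which [F] vanishes. The zeros
    below [s] accumulate at [s], so [F] vanishes around [s], which pushes the supremum further
    unless [y] has been passed. *)
Lemma identity_right F lo hi u v : lo < u -> u < v -> v <= hi -> (forall x, lo < x < hi -> lps F x) ->
  (forall x, u < x < v -> F x = 0) -> forall y, u < y < hi -> F y = 0.
Proof.
  intros H1 H2 H3 HF Hz y Hy. destruct (Rlt_dec y v) as [Hv|Hv]; [apply Hz; lra|]. apply Rnot_lt_le in Hv.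
  apply NNPP. intros Hne.
  set (E := fun x => u < x <= y /\ forall z, u < z < x -> F z = 0).
  destruct (completeness E) as [s [Hs1 Hs2]].
  - exists y. intros x [Hx _]. lra.
  - exists v. split; [lra|auto].
  - assert (Hsv : v <= s) by (apply Hs1; split; [lra|auto]).
    assert (Hsy : s <= y) by (apply Hs2; intros x [Hx _]; lra).
    assert (Hbelow : forall z, u < z < s -> F z = 0).
    { intros z Hz'. apply NNPP. intros Hn.
      assert (s <= z); [|lra]. apply Hs2. intros x [Hx1 Hx2]. apply Rnot_lt_le. intros Hzx. apply Hn, Hx2. lra. }
    destruct (lps_zero_near F s) as [d [Hd Hd2]].
    + apply HF. lra.
    + intros e He. exists (s - Rmin (e / 2) ((s - u) / 2)).
      pose proof (Rmin_l (e / 2) ((s - u) / 2)). pose proof (Rmin_r (e / 2) ((s - u) / 2)).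
      assert (0 < Rmin (e / 2) ((s - u) / 2)) by (apply Rmin_pos; lra).
      split; [lra|split; [|apply Hbelow; lra]]. rewrite Rabs_left; lra.
    + destruct (Rlt_dec y (s + d)) as [Hy'|Hy'].
      * apply Hne. apply Hd2. rewrite Rabs_right; lra.
      * assert (s + d / 2 <= s); [|lra]. apply Hs1. split; [lra|]. intros z Hzz.
        destruct (Rlt_dec z s); [apply Hbelow; lra|]. apply Hd2. rewrite Rabs_right; lra.
Qed.

Theorem lps_identity F lo hi u v : lo <= u -> u < v -> v <= hi -> (forall x, lo < x < hi -> lps F x) ->
  (forall x, u < x < v -> F x = 0) -> forall y, lo < y < hi -> F y = 0.
Proof.
  intros H1 H2 H3 HF Hz y Hy. set (m := (u + v) / 2).
  (* Both continuations start strictly inside [(u, v)], because [identity_right] requires [lo < u].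
     The one to the left is obtained by reflection. *)
  destruct (Rlt_dec ((u + m) / 2) y) as [Hl|Hl].
  - apply (identity_right F lo hi ((u + m) / 2) v); auto; try (unfold m in *; lra). intros; apply Hz; unfold m in *; lra.
  - pose proof (identity_right (fun x => F (- x)) (- hi) (- lo) (- ((m + v) / 2)) (- u)) as G.
    rewrite <- (Ropp_involutive y). apply G; try (unfold m in *; lra).
    + intros x Hx. rewrite <- (Ropp_involutive x). apply lps_refl. apply HF; lra.
    + intros x Hx. apply Hz. unfold m in *; lra.
Qed.

Lemma taylor_local h c d : 0 < d -> (forall z, Cmod (z - c) < d -> cdiff h z) ->
  exists M d' a, d' <= d /\ PSon (fun _ => True) M d' a (fun t => h (c + t)%C).
Proof.
  intros Hd H. destruct (cdiff_cont h c ltac:(apply H; rewrite Cmod_sub_diag; auto) 1 ltac:(lra)) as [d1 [Hd1 Hc]].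
  destruct (taylor h c (Rmin d d1) (Cmod (h c) + 1)) as [a Ha].
  - apply Rmin_pos; auto.
  - intros z Hz. apply H. eapply Rlt_le_trans; [apply Hz|apply Rmin_l].
  - intros z Hz. specialize (Hc z ltac:(eapply Rlt_le_trans; [apply Hz|apply Rmin_r])). pose proof (Cmod_le_add (h z) (h c)). lra.
  - exists (Cmod (h c) + 1), (Rmin d d1), a. split; auto. apply Rmin_l.
Qed.

Lemma PSon_lps M d a h (x : R) : PSon (fun _ => True) M d a (fun t => h (x + t)%C) -> lps (fun y => h (RtoC y)) x.
Proof.
  intros [Hd [Ha H]]. exists M, d, a. split; [auto|split; [auto|]]. intros t Pt Ht.
  replace (RtoC (x + Re t)) with (x + t)%C; [apply H; auto|]. rewrite RtoC_plus. f_equal. apply Pt.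
Qed.

Lemma cdiff_lps h (x d : R) : 0 < d -> (forall z, Cmod (z - x) < d -> cdiff h z) -> lps (fun y => h (RtoC y)) x.
Proof. intros Hd H. destruct (taylor_local h x d Hd H) as [M [d' [a [_ Ha]]]]. eapply PSon_lps, Ha. Qed.

(** * Sums of power series *)

(** The value has a meaning only where the series converges; elsewhere [epsilon] returns an
    arbitrary number. *)
Definition pser (a : nat -> C) (t : C) : C := epsilon (inhabits (RtoC 0)) (fun l => cser (fun k => a k * t ^ k)%C l).

Lemma pser_eq a t l : cser (fun k => a k * t ^ k)%C l -> pser a t = l.
Proof. intros H. eapply cser_unique; [|apply H]. unfold pser. apply epsilon_spec. exists l; auto. Qed.

Lemma PSon_pser M d a : 0 < d -> (forall k, Cmod (a k) <= M / d ^ k) -> PSon (fun _ => True) M d a (pser a).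
Proof.
  intros Hd Ha. split; [auto|split; [auto|]]. intros t _ Ht.
  assert (H0 : PSon (fun _ => False) M d a (fun _ => 0)) by (split; [auto|split; [auto|tauto]]).
  destruct (PSon_geo _ _ _ _ _ t H0 Ht) as [Hq Hg]. destruct (cser_geo _ _ _ Hq Hg) as [l [Hl _]].
  rewrite (pser_eq _ _ _ Hl). auto.
Qed.

Lemma PSon_bound P M d a h t : PSon P M d a h -> P t -> Cmod t < d -> Cmod (h t) <= M / (1 - Cmod t / d).
Proof.
  intros H Pt Ht. pose proof (PSon_tail _ _ _ _ _ t H Pt Ht O) as B. simpl in B. rewrite Rmult_1_r in B.
  replace (0 - h t)%C with (- h t)%C in B by ring. rewrite Cmod_opp in B. auto.
Qed.

Lemma PSon_cdiff M d a h c : PSon (fun _ => True) M d a h -> Cmod c < d -> cdiff h c.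
Proof.
  intros H Hc. pose proof (proj1 H) as Hd. pose proof (PSon_M _ _ _ _ _ H) as HM. pose proof (Cmod_ge_0 c).
  set (r := (d - Cmod c) / 2). apply weierstrass with r; [unfold r; lra|]. intros e He.
  set (q := (Cmod c + r) / d).
  assert (Hq : 0 <= q < 1).
  { split; [apply Rmult_le_pos; [unfold r; lra|apply Rlt_le, Rinv_0_lt_compat; auto]|]. apply Rlt_div_l; unfold r; lra. }
  destruct (pow_small q (e * (1 - q) / (M + 1))) as [N HN]; auto. { apply Rdiv_lt_0_compat; nra. }
  exists (fun t => csum (fun k => a k * t ^ k)%C N). split.
  - intros z _. apply cdiff_csum. intros k. apply cdiff_mult; [apply cdiff_const|apply cdiff_pow, cdiff_id].
  - intros z Hz. assert (Hz2 : Cmod z <= Cmod c + r) by (pose proof (Cmod_le_add z c); lra).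
    eapply Rle_trans; [apply (PSon_tail _ _ _ _ _ z H I); unfold r in *; lra|].
    assert (Hzq : Cmod z / d <= q) by (apply Rmult_le_compat_r; [apply Rlt_le, Rinv_0_lt_compat; auto|auto]).
    assert (0 <= Cmod z / d) by (apply Rmult_le_pos; [apply Cmod_ge_0|apply Rlt_le, Rinv_0_lt_compat; auto]).
    apply Rle_trans with (M * q ^ N / (1 - q)).
    + apply Rmult_le_compat; [apply Rmult_le_pos; auto; apply pow_le; auto|apply Rlt_le, Rinv_0_lt_compat; lra| |].
      * apply Rmult_le_compat_l; auto. apply pow_incr; lra.
      * apply Rinv_le_contravar; lra.
    + apply Rle_div_l; [lra|]. apply Rlt_div_r in HN; [|lra]. pose proof (pow_le q N ltac:(lra)). nra.
Qed.

(** * Exponential decay of the Fourier coefficients of an analytic function *)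

Definition fdiff (h : R) (u : R -> C) (x : R) : C := (u (x + h)%R - u x)%C.

Fixpoint fdiffn (h : R) (n : nat) (u : R -> C) : R -> C :=
  match n with O => u | S n => fdiffn h n (fdiff h u) end.

(* Polynomials of degree less than [n], in Fréchet's sense. *)
Fixpoint polyn (n : nat) (g : R -> C) : Prop :=
  match n with O => forall y, g y = 0 | S n => forall h, polyn n (fdiff h g) end.

Lemma polyn_ext n : forall f g, (forall y, f y = g y) -> polyn n f -> polyn n g.
Proof.
  induction n; simpl; intros f g E H; [intros; rewrite <- E; auto|].
  intros h. apply IHn with (fdiff h f); auto. intros y. unfold fdiff. rewrite !E. auto.
Qed.

Lemma polyn_plus n : forall f g, polyn n f -> polyn n g -> polyn n (fun y => f y + g y)%C.
Proof.
  induction n; simpl; intros f g H H'; [intros; rewrite H, H'; ring|].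
  intros h. apply polyn_ext with (fun y => fdiff h f y + fdiff h g y)%C; auto. intros; unfold fdiff; ring.
Qed.

Lemma polyn_scal n c : forall f, polyn n f -> polyn n (fun y => c * f y)%C.
Proof.
  induction n; simpl; intros f H; [intros; rewrite H; ring|].
  intros h. apply polyn_ext with (fun y => c * fdiff h f y)%C; auto. intros; unfold fdiff; ring.
Qed.

Lemma polyn_shift n c : forall f, polyn n f -> polyn n (fun y => f (y + c)).
Proof.
  induction n; simpl; intros f H; [intros; apply H|].
  intros h. apply polyn_ext with (fun y => fdiff h f (y + c)); auto. intros; unfold fdiff. do 2 f_equal. ring.
Qed.

Lemma polyn_S n : forall f, polyn n f -> polyn (S n) f.
Proof.
  induction n; intros f H; simpl in *; [intros h y; unfold fdiff; rewrite !H; ring|].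
  intros h h'. apply (IHn (fdiff h f)). auto.
Qed.

Lemma polyn_mulX n x : forall g, polyn n g -> polyn (S n) (fun y => RtoC (y - x) * g y)%C.
Proof.
  induction n; intros g H.
  - simpl in *. intros h y. unfold fdiff. rewrite !H. ring.
  - intros h. apply polyn_ext with (fun y => RtoC (y - x) * fdiff h g y + RtoC h * g (y + h)%R)%C.
    + intros y. unfold fdiff. replace (RtoC (y + h - x)) with (RtoC (y - x) + RtoC h)%C by (rewrite <- RtoC_plus; f_equal; ring). ring.
    + apply polyn_plus; [apply IHn, H|]. apply polyn_scal. apply polyn_shift; auto.
Qed.

Lemma polyn_0 n : polyn n (fun _ => RtoC 0).
Proof. induction n; simpl; auto. intros h. apply polyn_ext with (fun _ => RtoC 0); auto. intros; unfold fdiff; ring. Qed.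

Lemma polyn_mono n m f : (n <= m)%nat -> polyn n f -> polyn m f.
Proof. intros H Hf. induction H; auto. apply polyn_S; auto. Qed.

Lemma polyn_pow x k : polyn (S k) (fun y => RtoC (y - x) ^ k)%C.
Proof.
  induction k.
  - simpl. intros h y. unfold fdiff. ring.
  - apply polyn_ext with (fun y => RtoC (y - x) * RtoC (y - x) ^ k)%C; [intros; auto|]. apply polyn_mulX; auto.
Qed.

Lemma polyn_csum a x n : polyn n (fun y => csum (fun k => a k * RtoC (y - x) ^ k)%C n).
Proof.
  enough (G : forall m, (m <= n)%nat -> polyn n (fun y => csum (fun k => a k * RtoC (y - x) ^ k)%C m)) by (apply G; auto).
  induction m; intros Hm; [apply polyn_0|]. simpl. apply polyn_plus; [apply IHm; lia|].
  apply polyn_scal. apply polyn_mono with (S m); auto. apply polyn_pow.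
Qed.

Lemma fdiffn_polyn h n : forall g, polyn n g -> forall y, fdiffn h n g y = 0.
Proof. induction n; simpl; auto. Qed.

Lemma fdiffn_minus h n : forall f g y, fdiffn h n (fun y => f y - g y)%C y = (fdiffn h n f y - fdiffn h n g y)%C.
Proof.
  induction n; simpl; intros f g y; auto. rewrite <- IHn.
  assert (E : forall f g, (forall y, f y = g y) -> forall y, fdiffn h n f y = fdiffn h n g y).
  { clear. induction n; simpl; intros f g E y; auto. apply IHn. intros; unfold fdiff; rewrite !E; auto. }
  apply E. intros; unfold fdiff; ring.
Qed.

Lemma fdiffn_bound h n : forall g x B, (forall j, (j <= n)%nat -> Cmod (g (x + INR j * h)) <= B) -> Cmod (fdiffn h n g x) <= 2 ^ n * B.
Proof.
  induction n; intros g x B H.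
  - specialize (H O (Nat.le_refl _)). simpl in *. rewrite Rmult_0_l, Rplus_0_r in H. lra.
  - simpl. replace (2 * 2 ^ n * B) with (2 ^ n * (2 * B)) by ring. apply IHn. intros j Hj. unfold fdiff.
    pose proof (H j ltac:(lia)). pose proof (H (S j) ltac:(lia)) as H1. rewrite S_INR in H1.
    replace (x + (INR j + 1) * h) with (x + INR j * h + h) in H1 by ring.
    pose proof (Cmod_tri_minus (g (x + INR j * h + h)%R) (g (x + INR j * h)%R)). lra.
Qed.

Lemma fdiff_ccont h u : ccont u -> ccont (fdiff h u).
Proof.
  intros Hu t. apply ccont_at_minus; auto. intros e He. destruct (Hu (t + h) e He) as [d [Hd H]].
  exists d; split; auto. intros s Hs. apply H. replace (s + h - (t + h)) with (s - t) by ring. auto.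
Qed.

Lemma mode_fdiffn m h n : forall u, ccont u -> (forall t, u (t + 2 * PI) = u t) ->
  mode (fdiffn h n u) m = ((ei (IZR m * h) - 1) ^ n * mode u m)%C.
Proof.
  induction n; intros u Hu Hp; [simpl; ring|]. simpl.
  rewrite IHn; [|apply fdiff_ccont; auto|].
  2:{ intros t. unfold fdiff. rewrite Hp. f_equal. rewrite <- (Hp (t + h)). f_equal; ring. }
  enough (E : mode (fdiff h u) m = ((ei (IZR m * h) - 1) * mode u m)%C) by (rewrite E; ring).
  unfold mode.
  set (v := fun t => (u t * ei (- IZR m * t))%C).
  assert (Hv : ccont v) by (apply ccont_mult; auto; apply ccont_ei).
  assert (Hvp : forall t, v (t + 2 * PI) = v t).
  { intros t. unfold v. rewrite Hp. f_equal. rewrite <- (opp_IZR m). apply ei_Z_2pi. }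
  rewrite (avg_ext _ (fun t => ei (IZR m * h) * v (t + h)%R - v t)%C).
  - rewrite avg_minus, avg_scal, avg_shift; auto; [ring| |];
      intros t; [|apply ccont_at_mult; [apply ccont_at_const|]];
      intros e He; destruct (Hv (t + h) e He) as [d [Hd H]]; exists d; split; auto; intros s Hs; apply H;
      replace (s + h - (t + h)) with (s - t) by ring; auto.
  - intros t. unfold v, fdiff.
    replace (ei (IZR m * h) * (u (t + h)%R * ei (- IZR m * (t + h))))%C with (u (t + h)%R * (ei (IZR m * h) * ei (- IZR m * (t + h))))%C by ring.
    rewrite <- ei_plus. replace (IZR m * h + - IZR m * (t + h)) with (- IZR m * t) by ring. ring.
Qed.

(** An [N]-th difference with step [PI / m] multiplies the mode of index [m] by [(-2) ^ N]. It also
    annihilates the Taylor polynomial of degree below [N], so it is at most [2 ^ N] times a Taylor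
    tail of order [2 ^ (-N)] as long as the nodes stay within [d / 2]. Hence the mode is at most
    [2 * M / 2 ^ N], with [N] proportional to [|m|]. *)
Theorem mode_decay d : 0 < d -> exists q, 0 < q < 1 /\ forall M u, ccont u -> (forall t, u (t + 2 * PI) = u t) ->
  (forall x, exists a, PSon is_real M d a (fun t => u (x + Re t))) ->
  forall m : Z, Cmod (mode u m) <= 4 * M * q ^ Z.abs_nat m.
Proof.
  (* The order of the difference will be about [|m| * d / (2 * PI)], so [2 ^ (-N)] is about
     [exp (- c * |m|)]. *)
  intros Hd. pose proof PI_RGT_0 as HPI. pose proof (ln_lt_2) as Hln2. set (c := ln 2 * d / (2 * PI)).
  assert (Hc : 0 < c). { unfold c. apply Rdiv_lt_0_compat; [|lra]. apply Rmult_lt_0_compat; lra. }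
  exists (exp (- c)). split. { split; [apply exp_pos|]. rewrite <- exp_0. apply exp_increasing; lra. }
  intros M u Hu Hp H m.
  assert (Hexp : forall n : nat, exp (- c) ^ n = exp (- c * INR n)).
  { induction n; [simpl; rewrite Rmult_0_r, exp_0; auto|]. rewrite S_INR. simpl. rewrite IHn, <- exp_plus. f_equal; ring. }
  destruct (H 0) as [a0 Ha0]. pose proof (PSon_M _ _ _ _ _ Ha0) as HM. clear a0 Ha0.
  destruct (Z.eq_dec m 0) as [->|Hm].
  { simpl. rewrite Rmult_1_r. apply Rle_trans with M; [|lra]. apply avg_bound; [apply ccont_mult; auto; apply ccont_ei|].
    intros t. rewrite Cmod_mult, Cmod_ei, Rmult_1_r. destruct (H t) as [a Ha].
    pose proof (PSon_bound _ _ _ _ _ 0 Ha (is_real_R 0) ltac:(rewrite Cmod_0; auto)) as B. cbv beta in B. rewrite Cmod_0 in B. simpl in B.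
    rewrite Rplus_0_r in B. replace (M / (1 - 0 / d)) with M in B by (field; lra). auto. }
  set (n := Z.abs_nat m). assert (Hn : 0 < INR n) by (apply lt_0_INR; unfold n; lia).
  assert (HmR : IZR m <> 0) by (apply not_0_IZR; auto).
  assert (HmA : Rabs (IZR m) = INR n) by (unfold n; rewrite <- abs_IZR, INR_IZR_INZ, Zabs2Nat.id_abs; auto).
  set (h := PI / IZR m).
  assert (Hh : Rabs h = PI / INR n).
  { unfold h, Rdiv. rewrite Rabs_mult, Rabs_inv, HmA, Rabs_right; lra. }
  (* With this order the nodes [x + j * h], [j <= N], stay within [d / 2] of [x]. *)
  destruct (nfloor_ex (INR n * d / (2 * PI))) as [N [HN1 HN2]].
  { apply Rmult_le_pos; [apply Rmult_le_pos; lra|apply Rlt_le, Rinv_0_lt_compat; lra]. }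
  assert (HNh : INR N * Rabs h / d <= 1/2).
  { rewrite Hh. apply Rle_div_l; auto. apply Rle_div_r in HN1; [|lra].
    apply Rmult_le_reg_r with (INR n); auto. replace (INR N * (PI / INR n) * INR n) with (INR N * PI) by (field; lra). lra. }
  pose proof (mode_fdiffn m h N u Hu Hp) as E.
  replace (IZR m * h) with PI in E by (unfold h; field; auto).
  replace (ei PI - 1)%C with (RtoC (-2)) in E by (apply C_eq; simpl; [rewrite cos_PI|rewrite sin_PI]; ring).
  assert (B : Cmod (mode (fdiffn h N u) m) <= 2 * M).
  { apply avg_bound.
    - apply ccont_mult; [|apply ccont_ei]. clear - Hu. revert u Hu. induction N; simpl; intros; auto. apply IHN, fdiff_ccont; auto.
    - intros x. rewrite Cmod_mult, Cmod_ei, Rmult_1_r. destruct (H x) as [a Ha].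
      set (p := fun y => csum (fun k => a k * RtoC (y - x) ^ k)%C N).
      replace (fdiffn h N u x) with (fdiffn h N (fun y => u y - p y)%C x).
      2:{ rewrite fdiffn_minus, (fdiffn_polyn h N p) by apply polyn_csum. ring. }
      replace (2 * M) with (2 ^ N * (M * (1/2) ^ N / (1 - 1/2))).
      2:{ replace 2 with (/ (1/2)) at 1 by field. rewrite pow_inv. field. apply pow_nonzero; lra. }
      apply fdiffn_bound. intros j Hj. unfold p.
      set (t := RtoC (INR j * h)).
      assert (Hjt : Cmod t / d <= 1/2).
      { unfold t. rewrite Cmod_R, Rabs_mult, (Rabs_right (INR j)) by (apply Rle_ge, pos_INR).
        eapply Rle_trans; [|apply HNh]. apply Rmult_le_compat_r; [apply Rlt_le, Rinv_0_lt_compat; auto|].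
        apply Rmult_le_compat_r; [apply Rabs_pos|]. apply le_INR; auto. }
      assert (0 <= Cmod t / d) by (apply Rmult_le_pos; [apply Cmod_ge_0|apply Rlt_le, Rinv_0_lt_compat; auto]).
      assert (Htd : Cmod t < d).
      { replace (Cmod t) with (Cmod t / d * d) by (field; lra). nra. }
      pose proof (PSon_tail _ _ _ _ _ t Ha (is_real_R _) Htd N) as T. cbv beta in T. rewrite Cmod_sub_sym in T.
      replace (Re t) with (INR j * h) in T by reflexivity.
      replace (x + INR j * h - x) with (INR j * h) by ring. eapply Rle_trans; [apply T|].
      apply Rmult_le_compat; [apply Rmult_le_pos; auto; apply pow_le; auto|apply Rlt_le, Rinv_0_lt_compat; lra| |].
      + apply Rmult_le_compat_l; auto. apply pow_incr; lra.
      + apply Rinv_le_contravar; lra. }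
  rewrite E, Cmod_mult, Cmod_pow, Cmod_R, Rabs_left in B by lra. replace (- -2) with 2 in B by ring.
  rewrite Hexp.
  assert (H2N : 2 ^ N = exp (INR N * ln 2)).
  { rewrite <- Rpower_pow by lra. reflexivity. }
  assert (Hk : / 2 ^ N <= 2 * exp (- c * INR n)).
  { rewrite H2N, <- exp_Ropp. rewrite <- (exp_ln 2) at 2 by lra. rewrite <- exp_plus.
    assert (- (INR N * ln 2) <= ln 2 + - c * INR n).
    { unfold c. replace (- (ln 2 * d / (2 * PI)) * INR n) with (- ln 2 * (INR n * d / (2 * PI))) by (field; lra). nra. }
    destruct H0 as [H0|H0]; [left; apply exp_increasing; auto|right; f_equal; auto]. }
  pose proof (pow_lt 2 N ltac:(lra)).
  apply Rle_trans with (2 * M * / 2 ^ N).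
  - apply Rmult_le_reg_l with (2 ^ N); auto. replace (2 ^ N * (2 * M * / 2 ^ N)) with (2 * M) by (field; lra). auto.
  - apply Rle_trans with (2 * M * (2 * exp (- c * INR n))); [apply Rmult_le_compat_l; lra|right; ring].
Qed.

(** * Holomorphic extension of real-analytic functions *)

(** Differentiability near [t] and not only at [t]: compositions with limits of polynomials are
    differentiated by [weierstrass], which needs a full disc. *)
Definition ldiff (g : C -> C) (t : C) : Prop := exists r, 0 < r /\ forall s, Cmod (s - t) < r -> cdiff g s.

Lemma ldiff_cdiff g t : ldiff g t -> cdiff g t.
Proof. intros [r [Hr H]]. apply H. rewrite Cmod_sub_diag; auto. Qed.

Lemma ldiff_all g t : (forall s, cdiff g s) -> ldiff g t.
Proof. intros H. exists 1; split; [lra|auto]. Qed.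

Lemma ldiff_2 (f g h : C -> C) t : (forall s, cdiff f s -> cdiff g s -> cdiff h s) -> ldiff f t -> ldiff g t -> ldiff h t.
Proof.
  intros H [r [Hr Hf]] [r' [Hr' Hg]]. exists (Rmin r r'); split; [apply Rmin_pos; auto|]. intros s Hs.
  apply H; [apply Hf|apply Hg]; eapply Rlt_le_trans; try apply Hs; [apply Rmin_l|apply Rmin_r].
Qed.

Lemma ldiff_plus f g t : ldiff f t -> ldiff g t -> ldiff (fun s => f s + g s)%C t.
Proof. apply ldiff_2. intros; apply cdiff_plus; auto. Qed.
Lemma ldiff_minus f g t : ldiff f t -> ldiff g t -> ldiff (fun s => f s - g s)%C t.
Proof. apply ldiff_2. intros; apply cdiff_minus; auto. Qed.
Lemma ldiff_mult f g t : ldiff f t -> ldiff g t -> ldiff (fun s => f s * g s)%C t.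
Proof. apply ldiff_2. intros; apply cdiff_mult; auto. Qed.
Lemma ldiff_const c t : ldiff (fun _ => c) t.
Proof. apply ldiff_all. intros; apply cdiff_const. Qed.

Lemma ldiff_cont g t : ldiff g t -> forall e, 0 < e -> exists d, 0 < d /\ forall s, Cmod (s - t) < d -> Cmod (g s - g t) < e.
Proof. intros H. apply cdiff_cont, ldiff_cdiff, H. Qed.

Lemma cdiff_near_nz g t : cdiff g t -> g t <> RtoC 0 -> exists d, 0 < d /\ forall s, Cmod (s - t) < d -> g s <> RtoC 0.
Proof.
  intros H H0. apply Cmod_gt_0 in H0. destruct (cdiff_cont _ _ H _ H0) as [d [Hd H1]].
  exists d; split; auto. intros s Hs E. specialize (H1 s Hs). rewrite E in H1.
  replace (0 - g t)%C with (- g t)%C in H1 by ring. rewrite Cmod_opp in H1. lra.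
Qed.

Lemma ldiff_div f g t : ldiff f t -> ldiff g t -> g t <> RtoC 0 -> ldiff (fun s => f s / g s)%C t.
Proof.
  intros [r [Hr Hf]] Hg H0. destruct (cdiff_near_nz g t (ldiff_cdiff _ _ Hg) H0) as [d [Hd H1]]. destruct Hg as [r' [Hr' Hg]].
  exists (Rmin d (Rmin r r')); split; [repeat apply Rmin_pos; auto|]. intros s Hs.
  apply Rmin_Rgt in Hs as [Hs1 Hs]. apply Rmin_Rgt in Hs as [Hs2 Hs3]. apply cdiff_div; auto.
Qed.

Lemma sum_n_S {G : AbelianMonoid} (a : nat -> G) n : sum_n a (S n) = plus (sum_n a n) (a (S n)).
Proof. apply sum_Sn. Qed.

Lemma sum_n_0 {G : AbelianMonoid} (a : nat -> G) : sum_n a 0 = a O.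
Proof. apply sum_O. Qed.

Lemma cdiff_sum_n (a : nat -> C -> C) n t : (forall k, cdiff (a k) t) ->
  cdiff (fun s => sum_n (G := C_AbelianMonoid) (fun k => a k s) n) t.
Proof.
  intros H. induction n.
  - apply cdiff_ext with (a O); auto. intros; rewrite sum_n_0; auto.
  - apply cdiff_ext with (fun s => sum_n (G := C_AbelianMonoid) (fun k => a k s) n + a (S n) s)%C.
    + intros; rewrite sum_n_S; auto.
    + apply cdiff_plus; auto.
Qed.

Lemma Cmod_sum_n (a : nat -> C) (b : nat -> R) n : (forall k, Cmod (a k) <= b k) ->
  Cmod (sum_n (G := C_AbelianMonoid) a n) <= sum_n (G := R_AbelianMonoid) b n.
Proof.
  intros H. induction n; [rewrite !sum_n_0; auto|]. rewrite !sum_n_S.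
  eapply Rle_trans; [apply Cmod_triangle|]. apply Rplus_le_compat; auto.
Qed.

Definition monom (c : nat -> nat -> nat -> C) (x y z : C) i j k : C := (c i j k * (x ^ i * y ^ j * z ^ k))%C.

Definition psum3 c N x y z : C := sum_n (G := C_AbelianMonoid) (degree_sum (G := C_AbelianMonoid) (monom c x y z)) N.

(** Absolute convergence at the one real point with all three displacements equal to [rho] majorises
    the series on the complex polydisc of radius [rho]. There the partial sums are Cauchy uniformly,
    and along holomorphic curves their limit is holomorphic by [weierstrass]. *)
Lemma real_analytic_extends g x0 y0 z0 : real_analytic_at g x0 y0 z0 ->
  exists rho M (G : C -> C -> C -> C), 0 < rho /\
   (forall x y z, Cmod x < rho -> Cmod y < rho -> Cmod z < rho -> Cmod (G x y z) <= M) /\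
   (forall x y z : R, Rabs (x - x0) < rho -> Rabs (y - y0) < rho -> Rabs (z - z0) < rho ->
      G (RtoC (x - x0)) (RtoC (y - y0)) (RtoC (z - z0)) = g x y z) /\
   (forall g1 g2 g3 t, ldiff g1 t -> ldiff g2 t -> ldiff g3 t ->
      Cmod (g1 t) < rho -> Cmod (g2 t) < rho -> Cmod (g3 t) < rho -> cdiff (fun s => G (g1 s) (g2 s) (g3 s)) t).
Proof.
  intros [c [r [Hr H]]]. set (rho := r / 2).
  assert (Hrho : 0 < rho) by (unfold rho; lra).
  set (B := fun i j k => Cmod (c i j k) * (rho ^ i * rho ^ j * rho ^ k)).
  set (b := degree_sum (G := R_AbelianMonoid) B).
  assert (Hb : exists L : R, is_lim_seq (sum_n b) L).
  { assert (E : Rabs (x0 + rho - x0) < r /\ Rabs (y0 + rho - y0) < r /\ Rabs (z0 + rho - z0) < r).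
    { repeat split; match goal with |- Rabs ?x < _ => replace x with rho by ring end; rewrite Rabs_right; unfold rho; lra. }
    destruct E as [E1 [E2 E3]]. destruct (H _ _ _ E1 E2 E3) as [[L HL] _]. exists L.
    eapply filterlim_ext; [|apply HL]. intros n. apply sum_n_ext. intros k. unfold b, degree_sum.
    apply sum_n_ext; intros i. apply sum_n_ext; intros j. unfold B.
    replace (x0 + rho - x0) with rho by ring. replace (y0 + rho - y0) with rho by ring. replace (z0 + rho - z0) with rho by ring.
    rewrite Cmod_mult, Cmod_R. f_equal. apply Rabs_right. apply Rle_ge. repeat apply Rmult_le_pos; apply pow_le; lra. }
  destruct Hb as [L HL].
  assert (Hbn : forall n, 0 <= b n).
  { intros n. eapply Rle_trans; [apply Cmod_ge_0|]. apply (Cmod_sum_n (fun i => sum_n (G := C_AbelianMonoid) (fun j => RtoC (B i j (n - i - j)%nat)) (n - i))).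
    intros i. apply Cmod_sum_n. intros j. rewrite Cmod_R, Rabs_right; [lra|]. apply Rle_ge. unfold B.
    repeat apply Rmult_le_pos; try apply pow_le; try lra. apply Cmod_ge_0. }
  assert (Hmono : forall n m, (n <= m)%nat -> sum_n b n <= sum_n b m).
  { intros n m Hnm. induction Hnm; [lra|]. rewrite sum_n_S. specialize (Hbn (S m)). unfold plus; simpl. lra. }
  assert (HBL : forall n, sum_n b n <= L).
  { intros n. apply (is_lim_seq_le_loc (fun _ => sum_n b n) (sum_n b) (Finite (sum_n b n)) (Finite L)); auto.
    - exists n. auto.
    - apply is_lim_seq_const. }
  assert (Hdeg : forall x y z, Cmod x < rho -> Cmod y < rho -> Cmod z < rho -> forall n,
    Cmod (degree_sum (G := C_AbelianMonoid) (monom c x y z) n) <= b n).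
  { intros x y z Hx Hy Hz n. unfold b, degree_sum. apply Cmod_sum_n; intros i. apply Cmod_sum_n; intros j.
    unfold monom, B. rewrite !Cmod_mult, !Cmod_pow. apply Rmult_le_compat_l; [apply Cmod_ge_0|].
    pose proof (Cmod_ge_0 x). pose proof (Cmod_ge_0 y). pose proof (Cmod_ge_0 z).
    apply Rmult_le_compat; try (apply pow_le; lra); [apply Rmult_le_pos; apply pow_le; lra| |apply pow_incr; lra].
    apply Rmult_le_compat; try (apply pow_le; lra); apply pow_incr; lra. }
  assert (Hcau : forall x y z, Cmod x < rho -> Cmod y < rho -> Cmod z < rho -> forall n m, (n <= m)%nat ->
    Cmod (psum3 c m x y z - psum3 c n x y z) <= sum_n b m - sum_n b n).
  { intros x y z Hx Hy Hz n m Hnm. induction Hnm; [rewrite Cmod_sub_diag; lra|]. unfold psum3 in *. rewrite !sum_n_S.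
    unfold plus; simpl.
    match goal with |- Cmod (?a + ?d - ?e) <= _ => replace (a + d - e)%C with ((a - e) + d)%C by ring end.
    eapply Rle_trans; [apply Cmod_triangle|]. specialize (Hdeg x y z Hx Hy Hz (S m)). lra. }
  assert (HG : forall p : C * C * C, exists l, Cmod (fst (fst p)) < rho -> Cmod (snd (fst p)) < rho -> Cmod (snd p) < rho ->
     forall n, Cmod (psum3 c n (fst (fst p)) (snd (fst p)) (snd p) - l) <= L - sum_n b n).
  { intros [[x y] z]. simpl. destruct (Rlt_dec (Cmod x) rho) as [Hx|Hx]; [|exists (RtoC 0); tauto].
    destruct (Rlt_dec (Cmod y) rho) as [Hy|Hy]; [|exists (RtoC 0); tauto].
    destruct (Rlt_dec (Cmod z) rho) as [Hz|Hz]; [|exists (RtoC 0); tauto].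
    destruct (cauchy_C (fun n => psum3 c n x y z) (fun n => L - sum_n b n)) as [l Hl].
    - intros n m Hnm. pose proof (Hcau x y z Hx Hy Hz n m Hnm). specialize (HBL m). lra.
    - intros d Hd. apply is_lim_seq_spec in HL. destruct (HL (mkposreal d Hd)) as [N HN]. exists N.
      specialize (HN N (Nat.le_refl _)). simpl in HN. apply Rabs_lt_between in HN. lra.
    - exists l. auto. }
  apply fun_choice in HG as [G HG].
  exists rho, (L + Cmod (psum3 c 0 0 0 0) + L + b O), (fun x y z => G (x, y, z)).
  assert (Hlim : forall d, 0 < d -> exists N, L - sum_n b N < d).
  { intros d Hd. apply is_lim_seq_spec in HL. destruct (HL (mkposreal d Hd)) as [N HN]. exists N.
    specialize (HN N (Nat.le_refl _)). simpl in HN. apply Rabs_lt_between in HN. lra. }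
  split; [auto|split; [|split]].
  - intros x y z Hx Hy Hz. pose proof (HG (x, y, z) Hx Hy Hz O) as B0. simpl in B0.
    pose proof (Hdeg x y z Hx Hy Hz O) as B1. unfold psum3 in B0 at 1. rewrite sum_n_0 in B0.
    pose proof (Cmod_le_add (G (x, y, z)) (degree_sum (G := C_AbelianMonoid) (monom c x y z) 0)) as B2.
    rewrite (Cmod_sub_sym (G _)) in B2. pose proof (Cmod_ge_0 (psum3 c 0 0 0 0)). rewrite sum_n_0 in B0. specialize (Hbn O).
    pose proof (HBL O). rewrite sum_n_0 in H1. lra.
  - intros x y z Hx Hy Hz. destruct (H x y z) as [_ Hs]; try (unfold rho in *; lra).
    assert (Hx' : Cmod (RtoC (x - x0)) < rho) by (rewrite Cmod_R; auto).
    assert (Hy' : Cmod (RtoC (y - y0)) < rho) by (rewrite Cmod_R; auto).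
    assert (Hz' : Cmod (RtoC (z - z0)) < rho) by (rewrite Cmod_R; auto).
    pose proof (HG (RtoC (x - x0), RtoC (y - y0), RtoC (z - z0)) Hx' Hy' Hz') as HG'. simpl in HG'.
    apply Ceq_sub, Cmod_small_0. intros e He.
    assert (Hs' : forall d, 0 < d -> exists N, forall n, (N <= n)%nat -> Cmod (psum3 c n (RtoC (x - x0)) (RtoC (y - y0)) (RtoC (z - z0)) - g x y z) < d).
    { intros d Hd. assert (Hd2 : 0 < d / 2) by lra.
      pose proof (proj1 (filterlim_locally _ _) Hs (mkposreal (d/2) Hd2)) as [N HN]. exists N. intros n Hn.
      (* Balls of the uniform structure are squares; passing to the modulus costs a factor [sqrt 2],
         absorbed by the [d / 2] above. *)
      specialize (HN n Hn). apply C_NormedModule_mixin_compat2 in HN. simpl in HN.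
      assert (sqrt 2 < 2). { rewrite <- (sqrt_Rsqr 2) at 2 by lra. apply sqrt_lt_1; unfold Rsqr; lra. }
      assert (E : psum3 c n (RtoC (x - x0)) (RtoC (y - y0)) (RtoC (z - z0)) =
        sum_n (G := C_AbelianMonoid) (degree_sum (G := C_AbelianMonoid) (fun i j k => (c i j k * RtoC ((x - x0) ^ i * (y - y0) ^ j * (z - z0) ^ k))%C)) n).
      { unfold psum3. apply sum_n_ext; intros m. unfold degree_sum. apply sum_n_ext; intros i. apply sum_n_ext; intros j.
        unfold monom. rewrite !RtoC_mult, !RtoC_pow. auto. }
      rewrite E. eapply Rlt_le_trans; [apply HN|]. nra. }
    destruct (Hs' (e/2)) as [N1 HN1]; [lra|]. destruct (Hlim (e/2)) as [N2 HN2]; [lra|].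
    specialize (HN1 (N1 + N2)%nat ltac:(lia)). specialize (HG' (N1 + N2)%nat). specialize (Hmono N2 (N1 + N2)%nat ltac:(lia)).
    pose proof (Cmod_tri_sub (G (RtoC (x - x0), RtoC (y - y0), RtoC (z - z0))) (psum3 c (N1 + N2) (RtoC (x - x0)) (RtoC (y - y0)) (RtoC (z - z0))) (g x y z)) as T.
    rewrite (Cmod_sub_sym (G _) (psum3 _ _ _ _ _)) in T. lra.
  - intros g1 g2 g3 t D1 D2 D3 B1 B2 B3.
    assert (Hnear : forall gg, ldiff gg t -> Cmod (gg t) < rho -> exists d, 0 < d /\ forall s, Cmod (s - t) < d -> Cmod (gg s) < rho /\ cdiff gg s).
    { intros gg D Bt. destruct (ldiff_cont gg t D (rho - Cmod (gg t))) as [d [Hd Hd2]]; [lra|]. destruct D as [r' [Hr' D]].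
      exists (Rmin d r'); split; [apply Rmin_pos; auto|]. intros s Hs. apply Rmin_Rgt in Hs as [Hs1 Hs2]. split; auto.
      specialize (Hd2 s Hs1). pose proof (Cmod_le_add (gg s) (gg t)). lra. }
    destruct (Hnear g1 D1 B1) as [d1 [Hd1 N1]]. destruct (Hnear g2 D2 B2) as [d2 [Hd2 N2]]. destruct (Hnear g3 D3 B3) as [d3 [Hd3 N3]].
    apply weierstrass with (Rmin d1 (Rmin d2 d3)); [repeat apply Rmin_pos; auto|]. intros e He.
    destruct (Hlim e He) as [N HN]. exists (fun s => psum3 c N (g1 s) (g2 s) (g3 s)). split.
    + intros s Hs. apply Rmin_Rgt in Hs as [Hs1 Hs]. apply Rmin_Rgt in Hs as [Hs2 Hs3].
      unfold psum3. apply (cdiff_sum_n (fun n s => degree_sum (G := C_AbelianMonoid) (monom c (g1 s) (g2 s) (g3 s)) n)). intros n.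
      unfold degree_sum. apply (cdiff_sum_n (fun i s => sum_n (G := C_AbelianMonoid) (fun j => monom c (g1 s) (g2 s) (g3 s) i j (n - i - j)) (n - i))). intros i.
      apply (cdiff_sum_n (fun j s => monom c (g1 s) (g2 s) (g3 s) i j (n - i - j))). intros j. unfold monom.
      apply cdiff_mult; [apply cdiff_const|]. apply cdiff_mult; [apply cdiff_mult|]; apply cdiff_pow; [apply N1|apply N2|apply N3]; auto.
    + intros s Hs. apply Rmin_Rgt in Hs as [Hs1 Hs]. apply Rmin_Rgt in Hs as [Hs2 Hs3].
      pose proof (HG (g1 s, g2 s, g3 s) (proj1 (N1 s Hs1)) (proj1 (N2 s Hs2)) (proj1 (N3 s Hs3)) N) as B4. simpl in B4. lra.
Qed.

(** * Uniform local extension from the sphere to its complexification *)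

(* The complexification of the sphere has coordinates [(z1, z2, w1, w2)], the sphere itself being [w = conj z]. *)
Definition near (d : R) (q1 q2 z1 z2 w1 w2 : C) : Prop :=
  Cmod (z1 - q1) < d /\ Cmod (z2 - q2) < d /\ Cmod (w1 - Cconj q1) < d /\ Cmod (w2 - Cconj q2) < d.

(** [E] treats the conjugate variables as independent and is prescribed only where they are
    conjugate and the point lies on the sphere. Holomorphy in four variables is stated along
    holomorphic curves, the form in which it is applied. *)
Definition ext_at (F : C -> C -> C) (d M : R) (q1 q2 : C) : Prop := exists E : C -> C -> C -> C -> C,
  (forall z1 z2 w1 w2, near d q1 q2 z1 z2 w1 w2 -> Cmod (E z1 z2 w1 w2) <= M) /\
  (forall z1 z2, Cmod z1 ^ 2 + Cmod z2 ^ 2 = 1 -> near d q1 q2 z1 z2 (Cconj z1) (Cconj z2) ->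
     E z1 z2 (Cconj z1) (Cconj z2) = F z1 z2) /\
  (forall g1 g2 g3 g4 t, ldiff g1 t -> ldiff g2 t -> ldiff g3 t -> ldiff g4 t ->
     near d q1 q2 (g1 t) (g2 t) (g3 t) (g4 t) -> cdiff (fun s => E (g1 s) (g2 s) (g3 s) (g4 s)) t).

Definition stereo (sg x y z : R) : C2 :=
  let s := x ^ 2 + y ^ 2 + z ^ 2 in
  ((2 * x / (1 + s), 2 * y / (1 + s)), (2 * z / (1 + s), sg * (s - 1) / (1 + s))).

Lemma stereo_inv sg (z1 z2 : C) : (sg = 1 \/ sg = -1) -> Cmod z1 ^ 2 + Cmod z2 ^ 2 = 1 -> 1 - sg * Im z2 <> 0 ->
  let D := 1 - sg * Im z2 in stereo sg (Re z1 / D) (Im z1 / D) (Re z2 / D) = (z1, z2).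
Proof.
  intros Hsg HS HD D. rewrite !Cmod2_alt in HS. destruct z1 as [a b], z2 as [c e]. simpl in *. unfold stereo.
  assert (Hs : 1 + ((a / D) ^ 2 + (b / D) ^ 2 + (c / D) ^ 2) = 2 / D).
  { apply Rmult_eq_reg_r with (D ^ 2); [|apply pow_nonzero; auto].
    replace ((1 + ((a / D) ^ 2 + (b / D) ^ 2 + (c / D) ^ 2)) * D ^ 2) with (D ^ 2 + (a ^ 2 + b ^ 2 + c ^ 2)) by (field; auto).
    replace (2 / D * D ^ 2) with (2 * D) by (field; auto). unfold D. destruct Hsg as [-> | ->]; nra. }
  rewrite Hs. f_equal; f_equal; try (field; auto).
  replace ((a / D) ^ 2 + (b / D) ^ 2 + (c / D) ^ 2 - 1) with (2 / D - 2) by lra. unfold D in *.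
  destruct Hsg as [-> | ->]; field; lra.
Qed.

(** The fourth real coordinate of the sphere, [Im z2], continued to independent [z2] and [w2]. *)
Definition X4 (z2 w2 : C) : C := ((z2 - w2) / (2 * Ci))%C.

Lemma Cmod_2 : Cmod 2 = 2. Proof. rewrite Cmod_R, Rabs_right; lra. Qed.

Lemma C2_nz : RtoC 2 <> 0. Proof. intros A; apply RtoC_inj in A; lra. Qed.

Lemma Ci_nz : Ci <> 0. Proof. intros A. pose proof Cmod_Ci as E. rewrite A, Cmod_0 in E. lra. Qed.

Lemma X4_conj z : X4 z (Cconj z) = RtoC (Im z).
Proof. unfold X4. rewrite im_alt'. field; apply Ci_nz. Qed.

Lemma Cmod_half x y : Cmod ((x + y) / 2) <= (Cmod x + Cmod y) / 2.
Proof.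
  rewrite Cmod_div by apply C2_nz. rewrite Cmod_2. pose proof (Cmod_triangle x y). lra.
Qed.

Lemma Cmod_half' x y : Cmod ((x - y) / (2 * Ci)) <= (Cmod x + Cmod y) / 2.
Proof.
  rewrite Cmod_div by (apply Cmult_neq_0; [apply C2_nz|apply Ci_nz]). rewrite Cmod_mult, Cmod_2, Cmod_Ci, Rmult_1_r.
  pose proof (Cmod_tri_minus x y). lra.
Qed.

Lemma quot_close (X D : C) (q d0 d : R) : Cmod (X - q) <= d -> Cmod (D - d0) <= d -> 1 <= d0 -> d <= 1/2 -> Rabs q <= 1 ->
  D <> 0 /\ Cmod (X / D - RtoC (q / d0)) <= 4 * d.
Proof.
  intros HX HD Hd0 Hd Hq. pose proof (Cmod_ge_0 (X - q)).
  assert (HDm : d0 / 2 <= Cmod D).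
  { pose proof (Cmod_le_add d0 D) as H0. rewrite (Cmod_sub_sym d0), Cmod_R, Rabs_right in H0; lra. }
  assert (D0 : D <> 0) by (intros E; rewrite E, Cmod_0 in HDm; lra).
  assert (d0C : RtoC d0 <> 0) by (intros A; apply RtoC_inj in A; lra).
  split; auto. rewrite RtoC_div by lra.
  replace (X / D - q / d0)%C with (((X - q) * d0 + q * (d0 - D)) / (D * d0))%C by (field; auto).
  rewrite Cmod_div, Cmod_mult, (Cmod_R d0), Rabs_right by (try apply Cmult_neq_0; auto; lra).
  apply Rle_div_l; [apply Rmult_lt_0_compat; lra|].
  eapply Rle_trans; [apply Cmod_triangle|]. rewrite !Cmod_mult, !Cmod_R, (Rabs_right d0), (Cmod_sub_sym d0) by lra.
  assert (Cmod (X - q) * d0 <= d * d0) by (apply Rmult_le_compat_r; lra).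
  assert (Rabs q * Cmod (D - d0) <= d). { pose proof (Rabs_pos q). pose proof (Cmod_ge_0 (D - d0)). nra. }
  assert (0 <= d) by lra.
  assert (d0 / 2 * d0 <= Cmod D * d0) by (apply Rmult_le_compat_r; lra).
  assert (4 * d * (d0 / 2 * d0) <= 4 * d * (Cmod D * d0)) by (apply Rmult_le_compat_l; lra).
  assert (d * 1 <= d * (d0 * d0)) by (apply Rmult_le_compat_l; nra).
  assert (d * d0 <= d * (d0 * d0)) by (apply Rmult_le_compat_l; nra). lra.
Qed.

(** The chart is projection from the pole farther from the point, so that the denominator [d0] is at
    least [1]. Its three real coordinates are rational in [z1], [z2] and their conjugates; with the
    conjugates freed they carry the power series of [f] to the complexified sphere. *)
Lemma ext_local f q1 q2 : real_analytic_on_sphere f -> Cmod q1 ^ 2 + Cmod q2 ^ 2 = 1 ->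
  exists d M, 0 < d /\ ext_at (fun z1 z2 => f (z1, z2)) d M q1 q2.
Proof.
  intros Hf Hq.
  assert (Hsg : exists sg, (sg = 1 \/ sg = -1) /\ 1 <= 1 - sg * Im q2).
  { destruct (Rle_dec (Im q2) 0); [exists 1|exists (-1)]; split; auto; lra. }
  destruct Hsg as [sg [Hsg Hd0]]. set (d0 := 1 - sg * Im q2) in *.
  set (x0 := Re q1 / d0). set (y0 := Im q1 / d0). set (z0 := Re q2 / d0).
  assert (Hg : real_analytic_at (fun x y z => f (stereo sg x y z)) x0 y0 z0).
  { destruct (Hf x0 y0 z0) as [Hn Hs]. destruct Hsg as [-> | ->].
    - assert (E : forall x y z, stereo 1 x y z = stereo_north x y z).
      { intros. unfold stereo, stereo_north. rewrite Rmult_1_l. auto. }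
      destruct Hn as [c [r [Hr H]]]. exists c, r. split; auto. intros. rewrite E. apply H; auto.
    - assert (E : forall x y z, stereo (-1) x y z = stereo_south x y z).
      { intros. unfold stereo, stereo_south. do 3 f_equal. ring. }
      destruct Hs as [c [r [Hr H]]]. exists c, r. split; auto. intros. rewrite E. apply H; auto. }
  apply real_analytic_extends in Hg as [rho [M [G [Hrho [HM [HG HD]]]]]].
  set (Dn := fun z2 w2 : C => (1 - sg * X4 z2 w2)%C).
  set (cx := fun z1 z2 w1 w2 : C => ((z1 + w1) / 2 / Dn z2 w2 - x0)%C).
  set (cy := fun z1 z2 w1 w2 : C => ((z1 - w1) / (2 * Ci) / Dn z2 w2 - y0)%C).
  set (cz := fun z1 z2 w1 w2 : C => ((z2 + w2) / 2 / Dn z2 w2 - z0)%C).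
  (* [quot_close] moves each chart coordinate by at most [4 * d <= rho / 2]. *)
  set (d := Rmin (1/2) (rho / 8)).
  assert (Hd : 0 < d) by (apply Rmin_pos; lra).
  assert (Hd1 : d <= 1/2) by apply Rmin_l. assert (Hd2 : d <= rho / 8) by apply Rmin_r.
  exists d, M. split; auto.
  assert (Hc : forall z1 z2 w1 w2, near d q1 q2 z1 z2 w1 w2 -> Dn z2 w2 <> 0 /\
    Cmod (cx z1 z2 w1 w2) < rho /\ Cmod (cy z1 z2 w1 w2) < rho /\ Cmod (cz z1 z2 w1 w2) < rho).
  { intros z1 z2 w1 w2 [N1 [N2 [N3 N4]]].
    assert (Hq1 : Cmod q1 <= 1). { pose proof (Cmod_ge_0 q1). pose proof (pow2_ge_0 (Cmod q2)). nra. }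
    assert (Hq2 : Cmod q2 <= 1). { pose proof (Cmod_ge_0 q2). pose proof (pow2_ge_0 (Cmod q1)). nra. }
    pose proof (re_le_Cmod q1). pose proof (im_le_Cmod q1). pose proof (re_le_Cmod q2).
    assert (HDd : Cmod (Dn z2 w2 - d0) <= d).
    { unfold Dn, d0. replace (1 - sg * X4 z2 w2 - RtoC (1 - sg * Im q2))%C with (- sg * (X4 z2 w2 - Im q2))%C.
      2:{ rewrite RtoC_minus, RtoC_mult. ring. }
      rewrite <- X4_conj. unfold X4.
      replace ((z2 - w2) / (2 * Ci) - (q2 - Cconj q2) / (2 * Ci))%C with (((z2 - q2) - (w2 - Cconj q2)) / (2 * Ci))%C by (field; apply Ci_nz).
      rewrite Cmod_mult, Cmod_opp, Cmod_R. replace (Rabs sg) with 1 by (destruct Hsg as [-> | ->]; [rewrite Rabs_right|rewrite Rabs_left]; lra).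
      eapply Rle_trans; [apply Rmult_le_compat_l; [lra|apply Cmod_half']|]. lra. }
    destruct (quot_close ((z1 + w1) / 2) (Dn z2 w2) (Re q1) d0 d) as [A1 A2]; auto; try lra.
    { replace ((z1 + w1) / 2 - Re q1)%C with (((z1 - q1) + (w1 - Cconj q1)) / 2)%C.
      - eapply Rle_trans; [apply Cmod_half|]. lra.
      - rewrite (re_alt q1). field. }
    destruct (quot_close ((z1 - w1) / (2 * Ci)) (Dn z2 w2) (Im q1) d0 d) as [_ A3]; auto; try lra.
    { replace ((z1 - w1) / (2 * Ci) - Im q1)%C with (((z1 - q1) - (w1 - Cconj q1)) / (2 * Ci))%C.
      - eapply Rle_trans; [apply Cmod_half'|]. lra.
      - rewrite <- X4_conj. unfold X4. field; apply Ci_nz. }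
    destruct (quot_close ((z2 + w2) / 2) (Dn z2 w2) (Re q2) d0 d) as [_ A4]; auto; try lra.
    { replace ((z2 + w2) / 2 - Re q2)%C with (((z2 - q2) + (w2 - Cconj q2)) / 2)%C.
      - eapply Rle_trans; [apply Cmod_half|]. lra.
      - rewrite (re_alt q2). field. }
    unfold cx, cy, cz, x0, y0, z0. repeat split; auto; lra. }
  exists (fun z1 z2 w1 w2 => G (cx z1 z2 w1 w2) (cy z1 z2 w1 w2) (cz z1 z2 w1 w2)). split; [|split].
  - intros z1 z2 w1 w2 N. destruct (Hc z1 z2 w1 w2 N) as [_ [A2 [A3 A4]]]. apply HM; auto.
  - intros z1 z2 HS N. destruct (Hc _ _ _ _ N) as [A1 [A2 [A3 A4]]].
    assert (HDR : Dn z2 (Cconj z2) = RtoC (1 - sg * Im z2)).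
    { unfold Dn. rewrite X4_conj, RtoC_minus, RtoC_mult. auto. }
    assert (HDz : 1 - sg * Im z2 <> 0) by (intros E; rewrite HDR, E in A1; auto).
    set (Dz := 1 - sg * Im z2) in *.
    assert (Ex : cx z1 z2 (Cconj z1) (Cconj z2) = RtoC (Re z1 / Dz - x0)).
    { unfold cx. rewrite HDR, <- re_alt, RtoC_minus, RtoC_div; auto. }
    assert (Ey : cy z1 z2 (Cconj z1) (Cconj z2) = RtoC (Im z1 / Dz - y0)).
    { unfold cy. rewrite HDR. change ((z1 - Cconj z1) / (2 * Ci))%C with (X4 z1 (Cconj z1)). rewrite X4_conj, RtoC_minus, RtoC_div; auto. }
    assert (Ez : cz z1 z2 (Cconj z1) (Cconj z2) = RtoC (Re z2 / Dz - z0)).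
    { unfold cz. rewrite HDR, <- re_alt, RtoC_minus, RtoC_div; auto. }
    rewrite Ex in A2 |- *. rewrite Ey in A3 |- *. rewrite Ez in A4 |- *. rewrite Cmod_R in A2, A3, A4.
    rewrite HG by auto. f_equal. apply stereo_inv; auto.
  - intros g1 g2 g3 g4 t L1 L2 L3 L4 N. destruct (Hc _ _ _ _ N) as [A1 [A2 [A3 A4]]].
    assert (K2 : (2 * Ci)%C <> 0) by (apply Cmult_neq_0; [apply C2_nz|apply Ci_nz]).
    assert (LD : ldiff (fun s => Dn (g2 s) (g4 s)) t).
    { apply ldiff_minus; [apply ldiff_const|]. apply ldiff_mult; [apply ldiff_const|]. unfold X4. apply ldiff_div; auto using ldiff_const, ldiff_minus. }
    pose proof C2_nz.
    apply HD; auto; apply ldiff_minus; auto using ldiff_const; apply ldiff_div; auto; apply ldiff_div; auto using ldiff_const, ldiff_plus, ldiff_minus.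
Qed.

Lemma ext_at_mono F d M d' M' q1 q2 q1' q2' : ext_at F d M q1 q2 -> Cmod (q1' - q1) <= d - d' -> Cmod (q2' - q2) <= d - d' -> M <= M' ->
  ext_at F d' M' q1' q2'.
Proof.
  intros [E [H1 [H2 H3]]] Hq1 Hq2 HM. exists E.
  assert (Hn : forall z1 z2 w1 w2, near d' q1' q2' z1 z2 w1 w2 -> near d q1 q2 z1 z2 w1 w2).
  { intros z1 z2 w1 w2 [N1 [N2 [N3 N4]]].
    assert (E1 : Cmod (Cconj q1' - Cconj q1) = Cmod (q1' - q1)) by (rewrite <- Cminus_conj; apply Cmod_conj).
    assert (E2 : Cmod (Cconj q2' - Cconj q2) = Cmod (q2' - q2)) by (rewrite <- Cminus_conj; apply Cmod_conj).
    repeat split.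
    - pose proof (Cmod_tri_sub z1 q1' q1). lra.
    - pose proof (Cmod_tri_sub z2 q2' q2). lra.
    - pose proof (Cmod_tri_sub w1 (Cconj q1') (Cconj q1)). lra.
    - pose proof (Cmod_tri_sub w2 (Cconj q2') (Cconj q2)). lra. }
  split; [|split]; auto. intros. eapply Rle_trans; [apply H1; auto|auto].
Qed.

Definition ext_unif F d M : Prop := 0 < d /\ forall q1 q2, Cmod q1 ^ 2 + Cmod q2 ^ 2 = 1 -> ext_at F d M q1 q2.

Lemma sphere_param q1 q2 : Cmod q1 ^ 2 + Cmod q2 ^ 2 = 1 -> exists x t s, - PI <= x <= PI /\ - PI <= t <= PI /\ - PI <= s <= PI /\
  q1 = (RtoC (cos x) * ei t)%C /\ q2 = (RtoC (sin x) * ei s)%C.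
Proof.
  intros H. destruct (polar_bd q1) as [t [Ht Ht2]]. destruct (polar_bd q2) as [s [Hs Hs2]].
  destruct (polar_unit (Cmod q1, Cmod q2)) as [x [Hx Hx2]].
  { unfold Cmod at 1. simpl. transitivity (sqrt 1); [f_equal|apply sqrt_1]. simpl in H. lra. }
  unfold ei in Hx2. injection Hx2 as E1 E2. exists x, t, s. rewrite <- E1, <- E2. auto.
Qed.

Lemma param_lip a a' t t' d : Rabs (a - a') <= d -> Rabs a' <= 1 -> Rabs (t - t') <= d ->
  Cmod (RtoC a * ei t - RtoC a' * ei t') <= 2 * d.
Proof.
  intros Ha Ha' Ht. replace (RtoC a * ei t - RtoC a' * ei t')%C with (RtoC (a - a') * ei t + RtoC a' * (ei t - ei t'))%C by (rewrite RtoC_minus; ring).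
  eapply Rle_trans; [apply Cmod_triangle|]. rewrite !Cmod_mult, !Cmod_R, Cmod_ei. pose proof (ei_lip t t').
  pose proof (Rabs_pos a'). pose proof (Cmod_ge_0 (ei t - ei t')). nra.
Qed.

Lemma cos_lip x y : Rabs (cos x - cos y) <= Rabs (x - y).
Proof. eapply Rle_trans; [|apply ei_lip]. apply (re_le_Cmod (ei x - ei y)). Qed.
Lemma sin_lip x y : Rabs (sin x - sin y) <= Rabs (x - y).
Proof. eapply Rle_trans; [|apply ei_lip]. apply (im_le_Cmod (ei x - ei y)). Qed.
Lemma Rabs_cos x : Rabs (cos x) <= 1. Proof. apply Rabs_le. pose proof (COS_bound x); lra. Qed.
Lemma Rabs_sin x : Rabs (sin x) <= 1. Proof. apply Rabs_le. pose proof (SIN_bound x); lra. Qed.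

Lemma sphere_cos_sin x t s : Cmod (RtoC (cos x) * ei t) ^ 2 + Cmod (RtoC (sin x) * ei s) ^ 2 = 1.
Proof.
  rewrite !Cmod_mult, !Cmod_R, !Cmod_ei, !Rmult_1_r, !pow2_abs. pose proof (sin2_cos2 x) as H. unfold Rsqr in H. simpl; lra.
Qed.

(** Compactness of the parameter cube that covers the sphere through [sphere_param], followed by
    transfer of the extension from a nearby base point. *)
Theorem ext_uniform f : real_analytic_on_sphere f -> exists d M, ext_unif (fun z1 z2 => f (z1, z2)) d M.
Proof.
  intros Hf. set (F := fun z1 z2 => f (z1, z2)).
  (* One gauge encodes both the radius [8 * d] and the bound [/ d]. A displacement of a base point
     by at most [2 * m], for a gauge value [m] no smaller than the final [d], then leaves the radius
     [4 * d]. *)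
  assert (Hg : forall p : Compactness.Tn 3 R, exists d : posreal,
     ext_at F (8 * d) (/ d) (RtoC (cos (fst p)) * ei (fst (snd p)))%C (RtoC (sin (fst p)) * ei (fst (snd (snd p))))%C).
  { intros p. destruct (ext_local f _ _ Hf (sphere_cos_sin (fst p) (fst (snd p)) (fst (snd (snd p))))) as [d [M [Hd HE]]].
    assert (Hpos : 0 < Rmin (d / 8) (/ (Rabs M + 1))).
    { pose proof (Rabs_pos M). apply Rmin_pos; [lra|apply Rinv_0_lt_compat; lra]. }
    exists (mkposreal _ Hpos). simpl. pose proof (Rmin_l (d / 8) (/ (Rabs M + 1))). pose proof (Rmin_r (d / 8) (/ (Rabs M + 1))).
    set (m := Rmin (d / 8) (/ (Rabs M + 1))) in *.
    eapply ext_at_mono; [apply HE| | |]; try (rewrite Cmod_sub_diag; lra).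
    pose proof (Rabs_pos M). apply Rinv_le_contravar in H0; auto. rewrite Rinv_inv in H0. pose proof (Rle_abs M). lra. }
  apply fun_choice in Hg as [g Hg].
  destruct (compactness_value 3 (- PI, (- PI, (- PI, tt))) (PI, (PI, (PI, tt))) g) as [d Hd].
  exists (4 * d), (/ d). split; [pose proof (cond_pos d); lra|]. intros q1 q2 Hq.
  destruct (sphere_param q1 q2 Hq) as [x [t [s [Hx [Ht [Hs [-> ->]]]]]]].
  (* The compactness statement provides its witness under a double negation. *)
  specialize (Hd (x, (t, (s, tt)))). apply NNPP. intros Hn. apply Hd; [simpl; auto|]. intros [[x' [t' [s' []]]] [_ [Hc Hle]]].
  apply Hn. specialize (Hg (x', (t', (s', tt)))). simpl in Hc, Hg. set (m := pos (g (x', (t', (s', tt))))) in *.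
  change (d <= m) in Hle. pose proof (cond_pos d). eapply ext_at_mono; [apply Hg| | |apply Rinv_le_contravar; auto].
  - eapply Rle_trans; [apply param_lip with (d := m); [|apply Rabs_cos|lra]|]; [eapply Rle_trans; [apply cos_lip|lra]|]. lra.
  - eapply Rle_trans; [apply param_lip with (d := m); [|apply Rabs_sin|lra]|]; [eapply Rle_trans; [apply sin_lip|lra]|]. lra.
Qed.

(** The conjugate variables are transformed by the conjugate matrix, which preserves the real
    sphere. Each new coordinate mixes two old ones with coefficients of modulus at most [1], hence
    the radius [d / 2]. *)
Lemma ext_unif_rot F d M (a b : C) : Cmod a ^ 2 + Cmod b ^ 2 = 1 -> ext_unif F d M ->
  ext_unif (fun u1 u2 => F (a * u1 - Cconj b * u2) (b * u1 + Cconj a * u2))%C (d / 2) M.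
Proof.
  intros Hab [Hd H].
  assert (Hsph : forall u1 u2, Cmod (a * u1 - Cconj b * u2) ^ 2 + Cmod (b * u1 + Cconj a * u2) ^ 2 = (Cmod u1 ^ 2 + Cmod u2 ^ 2)).
  { intros u1 u2. apply RtoC_inj. rewrite RtoC_plus, !Cmod2_conj.
    replace ((a * u1 - Cconj b * u2) * Cconj (a * u1 - Cconj b * u2) + (b * u1 + Cconj a * u2) * Cconj (b * u1 + Cconj a * u2))%C
      with ((a * Cconj a + b * Cconj b) * (u1 * Cconj u1 + u2 * Cconj u2))%C.
    - rewrite <- !Cmod2_conj, <- !RtoC_plus, <- RtoC_mult, Hab. f_equal. ring.
    - rewrite Cminus_conj, Cplus_conj, !Cmult_conj, !Cconj_conj. ring. }
  assert (Ha : Cmod a <= 1). { pose proof (Cmod_ge_0 a). pose proof (pow2_ge_0 (Cmod b)). nra. }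
  assert (Hb : Cmod b <= 1). { pose proof (Cmod_ge_0 b). pose proof (pow2_ge_0 (Cmod a)). nra. }
  split; [lra|]. intros q1 q2 Hq. destruct (H _ _ (eq_trans (Hsph q1 q2) Hq)) as [E [E1 [E2 E3]]].
  exists (fun u1 u2 v1 v2 => E (a * u1 - Cconj b * u2) (b * u1 + Cconj a * u2) (Cconj a * v1 - b * v2) (Cconj b * v1 + a * v2))%C.
  assert (L : forall c c' x y : C, Cmod c <= 1 -> Cmod c' <= 1 -> Cmod x < d / 2 -> Cmod y < d / 2 -> Cmod (c * x + c' * y) < d).
  { intros c c' x y Hc Hc' Hx Hy. eapply Rle_lt_trans; [apply Cmod_triangle|]. rewrite !Cmod_mult.
    pose proof (Cmod_ge_0 c). pose proof (Cmod_ge_0 c'). pose proof (Cmod_ge_0 x). pose proof (Cmod_ge_0 y). nra. }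
  assert (Hn : forall u1 u2 v1 v2, near (d / 2) q1 q2 u1 u2 v1 v2 ->
    near d (a * q1 - Cconj b * q2) (b * q1 + Cconj a * q2) (a * u1 - Cconj b * u2) (b * u1 + Cconj a * u2) (Cconj a * v1 - b * v2) (Cconj b * v1 + a * v2)).
  { intros u1 u2 v1 v2 [N1 [N2 [N3 N4]]]. unfold near. rewrite Cminus_conj, Cplus_conj, !Cmult_conj, !Cconj_conj. repeat split.
    - replace (a * u1 - Cconj b * u2 - (a * q1 - Cconj b * q2))%C with (a * (u1 - q1) + (- Cconj b) * (u2 - q2))%C by ring.
      apply L; auto. rewrite Cmod_opp, Cmod_conj; auto.
    - replace (b * u1 + Cconj a * u2 - (b * q1 + Cconj a * q2))%C with (b * (u1 - q1) + Cconj a * (u2 - q2))%C by ring.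
      apply L; auto. rewrite Cmod_conj; auto.
    - replace (Cconj a * v1 - b * v2 - (Cconj a * Cconj q1 - b * Cconj q2))%C with (Cconj a * (v1 - Cconj q1) + (- b) * (v2 - Cconj q2))%C by ring.
      apply L; auto. rewrite Cmod_conj; auto. rewrite Cmod_opp; auto.
    - replace (Cconj b * v1 + a * v2 - (Cconj b * Cconj q1 + a * Cconj q2))%C with (Cconj b * (v1 - Cconj q1) + a * (v2 - Cconj q2))%C by ring.
      apply L; auto. rewrite Cmod_conj; auto. }
  split; [|split].
  - intros; apply E1; auto.
  - intros u1 u2 HS N. apply Hn in N.
    replace (Cconj a * Cconj u1 - b * Cconj u2)%C with (Cconj (a * u1 - Cconj b * u2)) in * by (rewrite Cminus_conj, !Cmult_conj, Cconj_conj; auto).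
    replace (Cconj b * Cconj u1 + a * Cconj u2)%C with (Cconj (b * u1 + Cconj a * u2)) in * by (rewrite Cplus_conj, !Cmult_conj, Cconj_conj; auto).
    apply E2; auto. rewrite Hsph. auto.
  - intros g1 g2 g3 g4 t L1 L2 L3 L4 N. apply E3; [| | | |apply Hn; auto];
      auto using ldiff_plus, ldiff_minus, ldiff_mult, ldiff_const.
Qed.

(* Cauchy's estimates along complex segments. *)
Lemma ext_unif_lip F d M : ext_unif F d M -> exists L, 0 <= L /\ forall z1 z2 y1 y2,
  Cmod z1 ^ 2 + Cmod z2 ^ 2 = 1 -> Cmod y1 ^ 2 + Cmod y2 ^ 2 = 1 -> Cmod (F y1 y2 - F z1 z2) <= L * (Cmod (y1 - z1) + Cmod (y2 - z2)).
Proof.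
  intros [Hd H].
  assert (HM : 0 <= M).
  { destruct (H 1 0) as [E [E1 _]]. { rewrite Cmod_1, Cmod_0; ring. }
    eapply Rle_trans; [apply Cmod_ge_0|apply (E1 1 0 (Cconj 1) (Cconj 0))]. unfold near. rewrite !Cmod_sub_diag; auto. }
  assert (Hsmall : forall z1 z2, Cmod z1 ^ 2 + Cmod z2 ^ 2 = 1 -> near d z1 z2 z1 z2 (Cconj z1) (Cconj z2)).
  { intros. unfold near. rewrite !Cmod_sub_diag; auto. }
  assert (HB : forall z1 z2, Cmod z1 ^ 2 + Cmod z2 ^ 2 = 1 -> Cmod (F z1 z2) <= M).
  { intros z1 z2 HS. destruct (H z1 z2 HS) as [E [E1 [E2 _]]]. rewrite <- E2; auto. }
  exists (4 * M / d). split. { apply Rmult_le_pos; [lra|apply Rlt_le, Rinv_0_lt_compat; auto]. }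
  intros z1 z2 y1 y2 HS HS'. set (r := Cmod (y1 - z1) + Cmod (y2 - z2)).
  pose proof (Cmod_ge_0 (y1 - z1)). pose proof (Cmod_ge_0 (y2 - z2)).
  destruct (Rlt_dec r (d / 2)) as [Hr|Hr].
  2:{ apply Rnot_lt_le in Hr. apply Rle_trans with (2 * M).
      - eapply Rle_trans; [apply Cmod_tri_minus|]. pose proof (HB _ _ HS). pose proof (HB _ _ HS'). lra.
      - replace (2 * M) with (4 * M / d * (d / 2)) by (field; lra). apply Rmult_le_compat_l; auto.
        apply Rmult_le_pos; [lra|apply Rlt_le, Rinv_0_lt_compat; auto]. }
  destruct (Req_dec r 0) as [Hr0|Hr0].
  { assert (E1 : y1 = z1) by (apply Ceq_sub, Cmod_eq_0; unfold r in *; lra).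
    assert (E2 : y2 = z2) by (apply Ceq_sub, Cmod_eq_0; unfold r in *; lra). subst. rewrite Cmod_sub_diag, Hr0. lra. }
  assert (Hrp : 0 < r) by (unfold r in *; lra).
  assert (HrC : RtoC r <> 0) by (intros A; apply RtoC_inj in A; lra).
  destruct (H z1 z2 HS) as [E [E1 [E2 E3]]].
  (* The straight path from [z] to [y] leaves the sphere but stays in the domain of [E]. The last
     two variables follow the conjugate path, so both ends are points of the real sphere, where [E]
     is [F]. *)
  set (k1 := ((y1 - z1) / r)%C). set (k2 := ((y2 - z2) / r)%C).
  assert (Hk1 : Cmod k1 <= 1). { unfold k1. rewrite Cmod_div, Cmod_R, Rabs_right by (auto; lra). apply Rle_div_l; auto. unfold r; lra. }
  assert (Hk2 : Cmod k2 <= 1). { unfold k2. rewrite Cmod_div, Cmod_R, Rabs_right by (auto; lra). apply Rle_div_l; auto. unfold r; lra. }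
  set (g := fun z k t : C => (z + t * k)%C).
  assert (Hg : forall z k t, ldiff (g z k) t) by (intros; apply ldiff_plus; [apply ldiff_const|apply ldiff_mult; [apply ldiff_all; intros; apply cdiff_id|apply ldiff_const]]).
  assert (Hgn : forall z k t, Cmod k <= 1 -> Cmod t < d -> Cmod (g z k t - z) < d).
  { intros z k t Hk Ht. unfold g. replace (z + t * k - z)%C with (t * k)%C by ring. rewrite Cmod_mult.
    pose proof (Cmod_ge_0 t). pose proof (Cmod_ge_0 k). nra. }
  assert (Hgnear : forall t, Cmod t < d -> near d z1 z2 (g z1 k1 t) (g z2 k2 t) (g (Cconj z1) (Cconj k1) t) (g (Cconj z2) (Cconj k2) t)).
  { intros t Ht. repeat split; apply Hgn; auto; rewrite Cmod_conj; auto. }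
  destruct (cauchy_der (fun t => E (g z1 k1 t) (g z2 k2 t) (g (Cconj z1) (Cconj k1) t) (g (Cconj z2) (Cconj k2) t)) 0 d M Hd) as [l [_ [_ [HL _]]]].
  - intros t Ht. replace (t - 0)%C with t in Ht by ring. apply E3; auto.
  - intros t Ht. replace (t - 0)%C with t in Ht by ring. apply E1; auto.
  - specialize (HL (RtoC r)). rewrite Cmod_R, Rabs_right in HL by lra. specialize (HL ltac:(lra)).
    assert (G1 : forall y z : C, g z ((y - z) / r)%C (0 + r)%C = y) by (intros; unfold g; field; auto).
    assert (G2 : forall y z : C, g (Cconj z) (Cconj ((y - z) / r))%C (0 + r)%C = Cconj y).
    { intros. unfold g. rewrite Cdiv_conj, Cminus_conj by auto. replace (Cconj r) with (RtoC r) by (apply C_eq; simpl; ring). field; auto. }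
    assert (G3 : forall z k, g z k 0 = z) by (intros; unfold g; ring).
    unfold k1, k2 in HL. rewrite !G1, !G2, !G3 in HL. rewrite E2 in HL; auto.
    + rewrite E2 in HL; auto. eapply Rle_trans; [apply HL|]. replace (2 * M * r / d) with (2 * M / d * r) by (field; lra).
      apply Rmult_le_compat_r; [lra|]. apply Rmult_le_compat_r; [apply Rlt_le, Rinv_0_lt_compat; auto|lra].
    + specialize (Hgnear r). rewrite Cmod_R, Rabs_right in Hgnear by lra. unfold k1, k2 in Hgnear.
      rewrite <- (Cplus_0_l r) in Hgnear. rewrite Cplus_0_l in Hgnear at 1.
      specialize (Hgnear ltac:(lra)).
      assert (G1' : forall y z : C, g z ((y - z) / r)%C r = y) by (intros; unfold g; field; auto).
      assert (G2' : forall y z : C, g (Cconj z) (Cconj ((y - z) / r))%C r = Cconj y).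
      { intros. rewrite <- (G2 y z). rewrite Cplus_0_l. auto. }
      rewrite Cplus_0_l in Hgnear. rewrite !G1', !G2' in Hgnear. auto.
Qed.

(** * Moment conditions on circles *)

Lemma ex_derive_cdiff (h : C -> C) z : ex_derive (K := C_AbsRing) (V := C_NormedModule) h z -> cdiff h z.
Proof.
  intros [l [_ H]]. exists l. intros e He. specialize (H z (fun P HP => HP) (mkposreal e He)).
  destruct H as [d H]. exists d. split; [apply cond_pos|]. intros w Hw. specialize (H w Hw).
  unfold norm in H; simpl in H. unfold minus, plus, opp, scal in H; simpl in H. unfold mult in H; simpl in H.
  replace (h w - h z - l * (w - z))%C with (h w + - h z + - ((w + - z) * l))%C by ring. exact H.
Qed.

Lemma continuous_on_eps (D : C2 -> Prop) (g : C2 -> C) z :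
  continuous_on (T := prod_UniformSpace C_UniformSpace C_UniformSpace) (U := C_UniformSpace) D g -> D z ->
  forall e, 0 < e -> exists d, 0 < d /\ forall y, D y -> Cmod (fst y - fst z) < d -> Cmod (snd y - snd z) < d -> Cmod (g y - g z) < e.
Proof.
  intros H Hz e He. specialize (H z Hz).
  assert (He2 : 0 < e / 2) by lra.
  pose proof (proj1 (filterlim_locally _ _) H (mkposreal _ He2)) as [d Hd]. exists d. split; [apply cond_pos|].
  intros y Dy H1 H2. specialize (Hd y).
  assert (HB : ball (M := prod_UniformSpace C_UniformSpace C_UniformSpace) z d y).
  { repeat split.
    - eapply Rle_lt_trans; [apply (re_le_Cmod (fst y - fst z))|auto].
    - eapply Rle_lt_trans; [apply (im_le_Cmod (fst y - fst z))|auto].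
    - eapply Rle_lt_trans; [apply (re_le_Cmod (snd y - snd z))|auto].
    - eapply Rle_lt_trans; [apply (im_le_Cmod (snd y - snd z))|auto]. }
  specialize (Hd HB Dy). destruct Hd as [B1 B2]. eapply Rle_lt_trans; [apply Cmod_le_re_im|].
  simpl in B1, B2.
  replace e with (e / 2 + e / 2) by lra. apply Rplus_lt_compat; [apply B1|apply B2].
Qed.

(** [tau] maps the unit disc into the disc cut out by the line, boundary to boundary. On a smaller
    circle the moments vanish because the radius can be shrunk to [0]; the passage to radius [1]
    uses the continuity of the extension up to the boundary, made uniform by compactness. *)
Theorem line_moments f a v (tau : C -> C) (l : nat) : extends_along_line f a v ->
  (forall x, Cmod x <= 1 -> cdiff tau x) ->
  (forall x, Cmod x < 1 -> in_ball (line_pt a v (tau x))) ->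
  (forall x, Cmod x = 1 -> in_sphere (line_pt a v (tau x))) -> (0 < l)%nat ->
  avg (fun t => f (line_pt a v (tau (ei t))) * ei (INR l * t))%C = 0.
Proof.
  intros [g [Hc [Hd Hf]]] Htau Hin Hsp Hl.
  set (h := fun x => g (line_pt a v (tau x))).
  assert (Hhd : forall x, Cmod x < 1 -> cdiff h x).
  { intros x Hx. apply (cdiff_comp tau (fun s => g (line_pt a v s))); [apply Htau; lra|].
    apply ex_derive_cdiff. apply Hd. auto. }
  assert (Hcl : forall x, Cmod x <= 1 -> in_closed_ball (line_pt a v (tau x))).
  { intros x [Hx|Hx]; unfold in_closed_ball; [left; apply Hin; auto|right; apply Hsp; auto]. }
  assert (Hhc : forall x, Cmod x <= 1 -> forall e, 0 < e -> exists d, 0 < d /\ forall y, Cmod y <= 1 -> Cmod (y - x) < d -> Cmod (h y - h x) < e).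
  { intros x Hx e He.
    destruct (continuous_on_eps _ _ (line_pt a v (tau x)) Hc) with (e := e) as [d [Hd0 H0]]; auto.
    { split; [exists (tau x); auto|apply Hcl; auto]. }
    set (c := 1 + Cmod (fst v) + Cmod (snd v)).
    pose proof (Cmod_ge_0 (fst v)). pose proof (Cmod_ge_0 (snd v)).
    destruct (cdiff_cont tau x (Htau x Hx) (d / c)) as [d' [Hd' T1]]. { apply Rdiv_lt_0_compat; unfold c; lra. }
    exists d'. split; auto. intros y Hy Hxy. specialize (T1 y Hxy). apply Rlt_div_r in T1; [|unfold c; lra].
    pose proof (Cmod_ge_0 (tau y - tau x)).
    apply H0; [split; [exists (tau y); auto|apply Hcl; auto]| |]; unfold line_pt; simpl.
    - replace (fst a + tau y * fst v - (fst a + tau x * fst v))%C with ((tau y - tau x) * fst v)%C by ring. rewrite Cmod_mult. unfold c in T1. nra.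
    - replace (snd a + tau y * snd v - (snd a + tau x * snd v))%C with ((tau y - tau x) * snd v)%C by ring. rewrite Cmod_mult. unfold c in T1. nra. }
  assert (Hcirc : forall r t, 0 <= r <= 1 -> Cmod (r * ei t) = r).
  { intros. rewrite Cmod_mult, Cmod_R, Cmod_ei, Rabs_right; lra. }
  assert (Hcont : forall r, 0 <= r <= 1 -> ccont (fun t => h (r * ei t)%C)).
  { intros r Hr t e He. destruct (Hhc (r * ei t)%C ltac:(rewrite Hcirc; lra) e He) as [d [Hd0 H0]].
    exists d. split; auto. intros s Hs. apply H0; [rewrite Hcirc; lra|].
    replace (r * ei s - r * ei t)%C with (r * (ei s - ei t))%C by ring. rewrite Cmod_mult, Cmod_R, Rabs_right by lra.
    pose proof (ei_lip s t). pose proof (Cmod_ge_0 (ei s - ei t)). nra. }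
  assert (Hin0 : forall r, 0 < r < 1 -> avg (fun t => h (r * ei t) * ei (INR l * t))%C = 0).
  { intros r Hr.
    assert (Hrl : RtoC r <> 0) by (intros A; apply RtoC_inj in A; lra).
    assert (Hpow : forall s, 0 < s < 1 -> avg (fun t => h (s * ei t) * (s * ei t) ^ l)%C = (RtoC s ^ l * avg (fun t => h (s * ei t) * ei (INR l * t)))%C).
    { intros s Hs. rewrite <- avg_scal by (apply ccont_mult; [apply Hcont; lra|apply ccont_ei]).
      apply avg_ext. intros t. rewrite Cpow_mult_l, ei_pow. ring. }
    apply Cmult_cancel_l with (RtoC r ^ l)%C; [apply Cpow_nz; auto|]. rewrite Cmult_0_r, <- Hpow by auto.
    apply Cmod_small_0. intros e He.
    destruct (Hhc 0 ltac:(rewrite Cmod_0; lra) 1 ltac:(lra)) as [d [Hd0 H0]].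
    set (B := Cmod (h 0) + 1). pose proof (Cmod_ge_0 (h 0)).
    set (s := Rmin (Rmin r (d / 2)) (e / B)).
    assert (Hs : 0 < s). { repeat apply Rmin_pos; try lra. apply Rdiv_lt_0_compat; unfold B; lra. }
    assert (s <= r) by (eapply Rle_trans; [apply Rmin_l|apply Rmin_l]).
    assert (s <= d / 2) by (eapply Rle_trans; [apply Rmin_l|apply Rmin_r]).
    assert (s <= e / B) by apply Rmin_r. apply Rle_div_r in H3; [|unfold B; lra].
    rewrite <- (avg_annulus (fun x => h x * x ^ l)%C s r); auto.
    2:{ intros z Hz. apply cdiff_mult; [apply Hhd; lra|apply cdiff_pow, cdiff_id]. }
    apply avg_bound.
    - apply (ccont_mult (fun t => h (s * ei t)%C)); [apply Hcont; lra|].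
      intros t. apply ccont_at_ext with (fun t => RtoC s ^ l * ei (INR l * t))%C; [intros; rewrite Cpow_mult_l, ei_pow; auto|].
      apply ccont_at_mult; [apply ccont_at_const|apply ccont_at_ei].
    - intros t. rewrite Cmod_mult, Cmod_pow, Hcirc by lra.
      specialize (H0 (s * ei t)%C ltac:(rewrite Hcirc; lra)). replace (s * ei t - 0)%C with (s * ei t)%C in H0 by ring.
      rewrite Hcirc in H0 by lra. specialize (H0 ltac:(lra)). pose proof (Cmod_le_add (h (s * ei t)%C) (h 0)).
      assert (s ^ l <= s). { replace l with (S (l - 1)) by lia. simpl.
        assert (s ^ (l - 1) <= 1) by (rewrite <- (pow1 (l - 1)); apply pow_incr; lra). nra. }
      assert (0 <= s ^ l) by (apply pow_le; lra). pose proof (Cmod_ge_0 (h (s * ei t)%C)). unfold B in *.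
      assert (Cmod (h (s * ei t)%C) * s ^ l <= (Cmod (h 0) + 1) * s) by (apply Rmult_le_compat; lra). lra. }
  rewrite (avg_ext _ (fun t => h (1 * ei t) * ei (INR l * t))%C).
  2:{ intros t. rewrite Cmult_1_l. unfold h. rewrite Hf; auto; [exists (tau (ei t)); auto|apply Hsp, Cmod_ei]. }
  apply Cmod_small_0. intros e He.
  (* The factor [3] lets one gauge disc contain both [ei t] and [r * ei t] for all [t] close to its
     centre. *)
  assert (Hgauge : forall t, exists d : posreal, forall y, Cmod y <= 1 -> Cmod (y - ei t) < 3 * d -> Cmod (h y - h (ei t)) < e / 2).
  { intros t. destruct (Hhc (ei t) ltac:(rewrite Cmod_ei; lra) (e / 2) ltac:(lra)) as [d [Hd0 H0]].
    assert (Hd3 : 0 < d / 3) by lra. exists (mkposreal _ Hd3). simpl. intros y Hy Hy2. apply H0; auto. lra. }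
  apply fun_choice in Hgauge as [dl Hdl].
  destruct (compactness_value_1d (- PI) PI dl) as [d Hdv]. pose proof (cond_pos d) as Hdp.
  set (r := Rmax (1/2) (1 - d)).
  assert (Hr1 : 1/2 <= r) by apply Rmax_l. assert (Hr2 : 1 - d <= r) by apply Rmax_r.
  assert (Hr3 : r < 1) by (apply Rmax_lub_lt; lra).
  replace (avg (fun t => h (1 * ei t) * ei (INR l * t))%C) with (avg (fun t => h (1 * ei t) * ei (INR l * t))%C - avg (fun t => h (r * ei t) * ei (INR l * t))%C)%C.
  2:{ rewrite (Hin0 r) by lra. ring. }
  apply avg_close.
  - apply ccont_mult; [apply Hcont; lra|apply ccont_ei].
  - apply ccont_mult; [apply Hcont; lra|apply ccont_ei].
  - intros t0. destruct (polar_unit (ei t0) (Cmod_ei t0)) as [t [Ht Ht2]].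
    replace (h (1 * ei t0) * ei (INR l * t0) - h (r * ei t0) * ei (INR l * t0))%C with ((h (1 * ei t0) - h (r * ei t0)) * ei (INR l * t0))%C by ring.
    rewrite Cmod_mult, Cmod_ei, Rmult_1_r, Ht2, Cmult_1_l. apply NNPP. intros Hn.
    apply (Hdv t Ht). intros [s [Hs [Hs2 Hs3]]]. apply Hn.
    pose proof (ei_lip t s) as Hlip.
    pose proof (Hdl s (ei t) ltac:(rewrite Cmod_ei; lra) ltac:(lra)) as K1.
    assert (K2 : Cmod (h (r * ei t)%C - h (ei s)) < e / 2).
    { apply Hdl; [rewrite Hcirc; lra|]. eapply Rle_lt_trans; [apply (Cmod_tri_sub _ (ei t))|].
      replace (r * ei t - ei t)%C with (RtoC (r - 1) * ei t)%C by (rewrite RtoC_minus; ring).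
      rewrite Cmod_mult, Cmod_R, Cmod_ei, Rabs_left by lra. lra. }
    pose proof (Cmod_tri_sub (h (ei t)) (h (ei s)) (h (r * ei t)%C)) as T. rewrite (Cmod_sub_sym (h (ei s))) in T. lra.
Qed.

(** * Lipschitz functions on tori and on the sphere, and the lines through the origin *)

Definition lip2 (F : R -> R -> C) : Prop := exists L B, 0 <= L /\ (forall x y, Cmod (F x y) <= B) /\
  forall x y x' y', Cmod (F x y - F x' y') <= L * (Rabs (x - x') + Rabs (y - y')).

Lemma lip2_ucont F : lip2 F -> ucont2 F.
Proof.
  intros [L [B [HL [HB H]]]] e He. exists (e / (2 * L + 1)). split; [apply Rdiv_lt_0_compat; lra|].
  intros x x' y y' Hx Hy. eapply Rle_trans; [apply H|]. set (d := e / (2 * L + 1)) in *.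
  assert (d * (2 * L + 1) = e) by (unfold d; field; lra). pose proof (Rabs_pos (x - x')). nra.
Qed.

(** Here the bound [B] in [lip2] matters: the Lipschitz constant of a product involves the sizes of
    the factors. *)
Lemma lip2_mult F G : lip2 F -> lip2 G -> lip2 (fun x y => F x y * G x y)%C.
Proof.
  intros [L [B [HL [HB H]]]] [L' [B' [HL' [HB' H']]]].
  assert (0 <= B) by (eapply Rle_trans; [apply Cmod_ge_0|apply (HB 0 0)]).
  assert (0 <= B') by (eapply Rle_trans; [apply Cmod_ge_0|apply (HB' 0 0)]).
  exists (B * L' + L * B'), (B * B'). split; [nra|]. split.
  - intros. rewrite Cmod_mult. apply Rmult_le_compat; auto using Cmod_ge_0.
  - intros x y x' y'. replace (F x y * G x y - F x' y' * G x' y')%C with (F x y * (G x y - G x' y') + (F x y - F x' y') * G x' y')%C by ring.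
    eapply Rle_trans; [apply Cmod_triangle|]. rewrite !Cmod_mult, Rmult_plus_distr_r. apply Rplus_le_compat.
    + rewrite Rmult_assoc. apply Rmult_le_compat; auto using Cmod_ge_0.
    + replace (L * B' * (Rabs (x - x') + Rabs (y - y'))) with ((L * (Rabs (x - x') + Rabs (y - y'))) * B') by ring.
      apply Rmult_le_compat; auto using Cmod_ge_0.
Qed.

Lemma lip2_ei k m : lip2 (fun x y => ei (k * x + m * y)).
Proof.
  exists (Rabs k + Rabs m), 1. pose proof (Rabs_pos k). pose proof (Rabs_pos m). split; [lra|]. split; [intros; rewrite Cmod_ei; lra|].
  intros x y x' y'. eapply Rle_trans; [apply ei_lip|].
  replace (k * x + m * y - (k * x' + m * y')) with (k * (x - x') + m * (y - y')) by ring.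
  eapply Rle_trans; [apply Rabs_triang|]. rewrite !Rabs_mult. pose proof (Rabs_pos (x - x')). pose proof (Rabs_pos (y - y')). nra.
Qed.

Lemma lip2_ext F G : (forall x y, F x y = G x y) -> lip2 F -> lip2 G.
Proof. intros E [L [B [H1 [H2 H3]]]]. exists L, B. repeat split; auto; intros; rewrite <- ?E; auto. Qed.

Definition sph_lip (F : C -> C -> C) (L B : R) : Prop := 0 <= L /\ forall z1 z2,
  Cmod z1 ^ 2 + Cmod z2 ^ 2 = 1 -> Cmod (F z1 z2) <= B /\
  forall y1 y2, Cmod y1 ^ 2 + Cmod y2 ^ 2 = 1 -> Cmod (F y1 y2 - F z1 z2) <= L * (Cmod (y1 - z1) + Cmod (y2 - z2)).

Lemma Cmod_le_1 z w : Cmod z ^ 2 + Cmod w ^ 2 = 1 -> Cmod z <= 1 /\ Cmod w <= 1.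
Proof.
  intros H. pose proof (Cmod_ge_0 z). pose proof (Cmod_ge_0 w). pose proof (pow2_ge_0 (Cmod z)). pose proof (pow2_ge_0 (Cmod w)). split; nra.
Qed.

Lemma Cmod_ei_mul z t : Cmod (z * ei t) = Cmod z.
Proof. rewrite Cmod_mult, Cmod_ei; ring. Qed.

Lemma sph_lip2 F L B z1 z2 : sph_lip F L B -> Cmod z1 ^ 2 + Cmod z2 ^ 2 = 1 -> lip2 (fun x y => F (z1 * ei x) (z2 * ei y))%C.
Proof.
  intros [HL H] HS. assert (Hs : forall x y, Cmod (z1 * ei x) ^ 2 + Cmod (z2 * ei y) ^ 2 = 1) by (intros; rewrite !Cmod_ei_mul; auto).
  destruct (Cmod_le_1 _ _ HS) as [B1 B2].
  exists L, B. split; auto. split; [intros; apply H; auto|]. intros x y x' y'. eapply Rle_trans; [apply H; auto|].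
  apply Rmult_le_compat_l; auto.
  replace (z1 * ei x - z1 * ei x')%C with (z1 * (ei x - ei x'))%C by ring. replace (z2 * ei y - z2 * ei y')%C with (z2 * (ei y - ei y'))%C by ring.
  rewrite !Cmod_mult. pose proof (ei_lip x x'). pose proof (ei_lip y y'). pose proof (Cmod_ge_0 (ei x - ei x')). pose proof (Cmod_ge_0 (ei y - ei y')).
  pose proof (Cmod_ge_0 z1). pose proof (Cmod_ge_0 z2). nra.
Qed.

(** With [s] the chord, [L * s <= e + L ^ 2 * s ^ 2 / (4 * e)] by the inequality between the
    arithmetic and geometric means, and [s ^ 2 = 2 * (1 - cos (t - x))]. *)
Lemma chord_modulus L e x t : 0 <= L -> 0 < e -> L * Cmod (ei t - ei x) <= e + L ^ 2 / (2 * e) * (1 - cos (t - x)).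
Proof.
  intros HL He. pose proof (ei_dist2 t x) as E. set (s := Cmod (ei t - ei x)) in *.
  replace (1 - cos (t - x)) with (s ^ 2 / 2) by lra.
  apply Rmult_le_reg_r with (4 * e); [lra|].
  replace ((e + L ^ 2 / (2 * e) * (s ^ 2 / 2)) * (4 * e)) with (4 * e ^ 2 + (L * s) ^ 2) by (field; lra).
  pose proof (pow2_ge_0 (L * s - 2 * e)). nra.
Qed.

(* The hypotheses describe extension in [z1] and in [z2], the conclusion extension along the line through [0] and [(z1, z2)]. *)
Theorem diagonal_moments (F : C -> C -> C) L B z1 z2 : sph_lip F L B -> Cmod z1 ^ 2 + Cmod z2 ^ 2 = 1 ->
  (forall y l, (0 < l)%nat -> avg (fun x => F (z1 * ei x) (z2 * ei y) * ei (INR l * x))%C = 0) ->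
  (forall x l, (0 < l)%nat -> avg (fun y => F (z1 * ei x) (z2 * ei y) * ei (INR l * y))%C = 0) ->
  forall l, (0 < l)%nat -> avg (fun t => F (z1 * ei t) (z2 * ei t) * ei (INR l * t))%C = 0.
Proof.
  intros HF HS H1 H2 l Hl. pose proof (sph_lip2 F L B z1 z2 HF HS) as Hl2.
  set (G := fun x y => F (z1 * ei x)%C (z2 * ei y)%C) in *. destruct HF as [HL HF].
  assert (Hcx : forall y, ccont (fun x => G x y)) by (intros y; apply ucont2_l, lip2_ucont; auto).
  assert (Hdiag : ccont (fun t => G t t)).
  { intros t e He. destruct (lip2_ucont _ Hl2 (e/2)) as [d [Hd Hd2]]; [lra|]. exists d. split; auto. intros s Hs.
    eapply Rle_lt_trans; [apply Hd2; lra|lra]. }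
  assert (Hlm : forall m, lip2 (fun x y => G y x * ei (- IZR m * y) * ei ((IZR m + INR l) * x))%C).
  { intros m. apply lip2_ext with (fun x y => G y x * ei ((IZR m + INR l) * x + - IZR m * y))%C.
    - intros x y. rewrite ei_plus. ring.
    - apply lip2_mult; [|apply lip2_ei]. destruct Hl2 as [L' [B' [A1 [A2 A3]]]]. exists L', B'. split; auto. split; auto.
      intros. rewrite Rplus_comm. apply A3. }
  (* Frequency [m] in the first variable: for [m < 0] it is absent by [H1]. For [m >= 0], exchanging
     the averages leaves the frequency [m + l > 0] in the second variable, which is absent by [H2].
     Fejér means in the first variable then give the claim on the diagonal. *)
  assert (Hterm : forall m, avg (fun t => mode (fun x => G x t) m * ei (IZR m * t) * ei (INR l * t))%C = 0).
  { intros m. destruct (Z_lt_dec m 0) as [Hm|Hm].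
    - rewrite (avg_ext _ (fun _ => RtoC 0)); [apply avg_const|]. intros t. unfold mode.
      replace (- IZR m) with (INR (Z.to_nat (- m))).
      2:{ rewrite INR_IZR_INZ, Z2Nat.id by lia. apply opp_IZR. }
      unfold G. rewrite H1 by lia. ring.
    - transitivity (avg (fun t => avg (fun x => G x t * ei (- IZR m * x) * ei ((IZR m + INR l) * t))%C)).
      { apply avg_ext. intros t. unfold mode.
        rewrite (avg_ext (fun x => G x t * ei (- IZR m * x) * ei ((IZR m + INR l) * t))%C (fun x => ei ((IZR m + INR l) * t) * (G x t * ei (- IZR m * x)))%C) by (intros; ring).
        rewrite avg_scal by (apply ccont_mult; auto; apply ccont_ei).
        rewrite Rmult_plus_distr_r, ei_plus. ring. }
      rewrite (avg_swap (fun t x => G x t * ei (- IZR m * x) * ei ((IZR m + INR l) * t))%C) by (apply lip2_ucont, Hlm).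
      rewrite (avg_ext _ (fun _ => RtoC 0)); [apply avg_const|]. intros x.
      rewrite (avg_ext _ (fun t => ei (- IZR m * x) * (G x t * ei (INR (Z.to_nat m + l) * t)))%C).
      + rewrite avg_scal. { unfold G. rewrite H2 by lia. ring. }
        apply ccont_mult; [|apply ccont_ei]. apply (ucont2_l (fun t x => G x t)), ucont2_sym, lip2_ucont; auto.
      + intros t. rewrite plus_INR, (INR_IZR_INZ (Z.to_nat m)), Z2Nat.id by lia. ring. }
  assert (Hmc : forall m, ccont (fun t => mode (fun x => G x t) m)).
  { intros m. unfold mode. apply (ucont2_avg (fun t x => G x t * ei (- IZR m * x))%C). apply lip2_ucont.
    apply lip2_ext with (fun t x => G x t * ei (0 * t + - IZR m * x))%C; [intros; do 2 f_equal; ring|].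
    apply lip2_mult; [|apply lip2_ei]. destruct Hl2 as [L' [B' [A1 [A2 A3]]]]. exists L', B'. split; auto. split; auto.
    intros. rewrite Rplus_comm. apply A3. }
  assert (Hsig : forall N, avg (fun t => sigma (fun x => G x t) N t * ei (INR l * t))%C = 0).
  { intros N. unfold sigma.
    rewrite (avg_ext _ (fun t => / INR N * csum (fun j => csum (fun k => mode (fun x => G x t) (Z.of_nat j - Z.of_nat k) *
       ei (IZR (Z.of_nat j - Z.of_nat k) * t) * ei (INR l * t)) N) N)%C).
    2:{ intros t. set (W := fun j k => (mode (fun x => G x t) (Z.of_nat j - Z.of_nat k) * ei (IZR (Z.of_nat j - Z.of_nat k) * t))%C).
        transitivity (/ INR N * (ei (INR l * t) * csum (fun j => csum (W j) N) N))%C; [unfold Cdiv, W; ring|]. f_equal.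
        rewrite <- csum_scal. apply csum_ext; intros. rewrite <- csum_scal. apply csum_ext; intros. unfold W. ring. }
    assert (Hw : forall m, ccont (fun t => mode (fun x => G x t) m * ei (IZR m * t) * ei (INR l * t))%C).
    { intros m. apply ccont_mult; [apply ccont_mult; [apply Hmc|apply ccont_ei]|apply ccont_ei]. }
    rewrite avg_scal by (apply ccont_csum; intros; apply ccont_csum; intros; apply Hw).
    rewrite (avg_csum (fun j t => csum (fun k => mode (fun x => G x t) (Z.of_nat j - Z.of_nat k) * ei (IZR (Z.of_nat j - Z.of_nat k) * t) * ei (INR l * t)) N)%C) by (intros; apply ccont_csum; auto).
    rewrite csum_eq0; [ring|]. intros j _.
    rewrite (avg_csum (fun k t => mode (fun x => G x t) (Z.of_nat j - Z.of_nat k) * ei (IZR (Z.of_nat j - Z.of_nat k) * t) * ei (INR l * t))%C) by auto.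
    apply csum_eq0. intros k _. apply Hterm. }
  apply Cmod_small_0. intros e He.
  destruct (inv_small (e / 2) (L ^ 2 / (2 * (e / 2)))) as [N [HN HN2]]; [lra| |].
  { apply Rmult_le_pos; [apply pow2_ge_0|apply Rlt_le, Rinv_0_lt_compat; lra]. }
  change (Cmod (avg (fun t => G t t * ei (INR l * t))%C) <= e).
  replace (avg (fun t => G t t * ei (INR l * t))%C) with (avg (fun t => G t t * ei (INR l * t))%C - avg (fun t => sigma (fun x => G x t) N t * ei (INR l * t))%C)%C by (rewrite Hsig; ring).
  apply avg_close.
  - apply ccont_mult; auto; apply ccont_ei.
  - apply ccont_mult; [|apply ccont_ei]. unfold sigma. apply ccont_mult; [|apply ccont_const].
    apply ccont_csum; intros j. apply ccont_csum; intros k. apply ccont_mult; [apply Hmc|apply ccont_ei].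
  - intros t.
    replace (G t t * ei (INR l * t) - sigma (fun x => G x t) N t * ei (INR l * t))%C with (- (sigma (fun x => G x t) N t - G t t) * ei (INR l * t))%C by ring.
    rewrite Cmod_mult, Cmod_ei, Rmult_1_r, Cmod_opp.
    eapply Rle_trans; [apply (fejer (fun x => G x t) t (e / 2) (L ^ 2 / (2 * (e / 2))) N); auto|lra].
    intros s. eapply Rle_trans; [|apply chord_modulus; auto; lra].
    unfold G. assert (HSt : forall x y, Cmod (z1 * ei x) ^ 2 + Cmod (z2 * ei y) ^ 2 = 1) by (intros; rewrite !Cmod_ei_mul; auto).
    eapply Rle_trans; [apply HF; auto|]. apply Rmult_le_compat_l; auto. rewrite Cmod_sub_diag.
    replace (z1 * ei s - z1 * ei t)%C with (z1 * (ei s - ei t))%C by ring. rewrite Cmod_mult.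
    pose proof (Cmod_ge_0 (ei s - ei t)). pose proof (proj1 (Cmod_le_1 _ _ HS)). nra.
Qed.

Lemma sph_lip_of_ext F d M : ext_unif F d M -> exists L, sph_lip F L M.
Proof.
  intros H. destruct (ext_unif_lip F d M H) as [L [HL HLip]]. exists L. split; auto. intros z1 z2 HS. split.
  - destruct H as [Hd H]. destruct (H z1 z2 HS) as [E [E1 [E2 _]]].
    assert (N : near d z1 z2 z1 z2 (Cconj z1) (Cconj z2)) by (unfold near; rewrite !Cmod_sub_diag; auto).
    rewrite <- E2; auto.
  - intros. apply HLip; auto.
Qed.

(** * Unitary rotations and an automorphism of the ball *)

Definition rot (a b u1 u2 : C) : C2 := ((a * u1 - Cconj b * u2)%C, (b * u1 + Cconj a * u2)%C).

Lemma normsq_rot a b u1 u2 : Cmod a ^ 2 + Cmod b ^ 2 = 1 -> normsq (rot a b u1 u2) = Cmod u1 ^ 2 + Cmod u2 ^ 2.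
Proof.
  intros Hab. unfold normsq, rot; simpl fst; simpl snd. apply RtoC_inj. rewrite RtoC_plus, !Cmod2_conj.
  replace ((a * u1 - Cconj b * u2) * Cconj (a * u1 - Cconj b * u2) + (b * u1 + Cconj a * u2) * Cconj (b * u1 + Cconj a * u2))%C
    with ((a * Cconj a + b * Cconj b) * (u1 * Cconj u1 + u2 * Cconj u2))%C.
  - rewrite <- !Cmod2_conj, <- !RtoC_plus, <- RtoC_mult, Hab. f_equal. ring.
  - rewrite Cminus_conj, Cplus_conj, !Cmult_conj, !Cconj_conj. ring.
Qed.

Lemma mobius_id (b : R) (x : C) : Cmod (1 + b * x) ^ 2 - Cmod (x + b) ^ 2 = (1 - b ^ 2) * (1 - Cmod x ^ 2).
Proof. rewrite !Cmod2_alt. destruct x as [u v]. unfold Re, Im; simpl. ring. Qed.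

Lemma mobius_den (b : R) (x : C) : 0 <= b < 1 -> Cmod x <= 1 -> (1 + b * x)%C <> 0.
Proof.
  intros Hb Hx E. assert (H : Cmod (b * x) = 1).
  { replace (b * x)%C with (-(1))%C; [rewrite Cmod_opp, Cmod_1; auto|]. apply Ceq_sub. replace (-(1) - b * x)%C with (- (1 + b * x))%C by ring. rewrite E; ring. }
  rewrite Cmod_mult, Cmod_R, Rabs_right in H by lra. pose proof (Cmod_ge_0 x). nra.
Qed.

(** The map [(x, y) -> ((x + b) / (1 + b * x), kap * y / (1 + b * x))] is the automorphism of the
    ball that moves [0] to [(b, 0)]; it sends the lines [y = const] to the lines through
    [(1 / b, 0)]. *)
Lemma mobius_sphere (b kap : R) (x y : C) : 0 <= b < 1 -> kap ^ 2 = 1 - b ^ 2 -> (1 + b * x)%C <> 0 ->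
  (Cmod ((x + b) / (1 + b * x)) ^ 2 + Cmod (kap * y / (1 + b * x)) ^ 2 - 1) * Cmod (1 + b * x) ^ 2 = (1 - b ^ 2) * (Cmod x ^ 2 + Cmod y ^ 2 - 1).
Proof.
  intros Hb Hk Hnz. rewrite !Cmod_div, Cmod_mult, Cmod_R by auto.
  assert (Cmod (1 + b * x) <> 0) by (intros E; apply Cmod_eq_0 in E; auto).
  pose proof (mobius_id b x) as E. pose proof (pow2_abs kap) as Ek.
  transitivity (Cmod (x + b) ^ 2 + Rabs kap ^ 2 * Cmod y ^ 2 - Cmod (1 + b * x) ^ 2); [field; auto|].
  rewrite Ek, Hk. lra.
Qed.

(** * Moment conditions supplied by the three families of lines *)

Section Setup.
Variables (f : C2 -> C) (p : C2).
Hypothesis f_analytic : real_analytic_on_sphere f.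
Hypothesis ext_z1 : forall a : C2, line_meets_ball a (RtoC 1, RtoC 0) -> extends_along_line f a (RtoC 1, RtoC 0).
Hypothesis ext_z2 : forall a : C2, line_meets_ball a (RtoC 0, RtoC 1) -> extends_along_line f a (RtoC 0, RtoC 1).

Lemma moment_z1 z1 z2 l : Cmod z1 ^ 2 + Cmod z2 ^ 2 = 1 -> (0 < l)%nat ->
  avg (fun t => f (z1 * ei t, z2)%C * ei (INR l * t))%C = 0.
Proof.
  (* For [z1 = 0] the line is tangent to the sphere and gives no condition, but then the integrand
     is a constant times a nontrivial exponential. *)
  intros HS Hl. destruct (Req_dec (Cmod z1) 0) as [E|E].
  - apply Cmod_eq_0 in E. subst z1. rewrite (avg_ext _ (fun t => f (RtoC 0, z2) * ei (INR l * t))%C) by (intros; rewrite Cmult_0_l; auto).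
    rewrite avg_scal by apply ccont_ei. rewrite INR_IZR_INZ, avg_ei by lia. ring.
  - pose proof (Cmod_ge_0 z1).
    pose proof (line_moments f (RtoC 0, z2) (RtoC 1, RtoC 0) (fun x => z1 * x)%C l) as G.
    assert (HL : forall x, line_pt (RtoC 0, z2) (RtoC 1, RtoC 0) (z1 * x) = ((z1 * x)%C, z2)).
    { intros. unfold line_pt; simpl. f_equal; ring. }
    rewrite <- G; auto.
    + apply avg_ext. intros t. rewrite HL. auto.
    + apply ext_z1. exists (RtoC 0). unfold in_ball, normsq, line_pt; simpl fst; simpl snd.
      replace (0 + 0 * 1)%C with (RtoC 0) by ring. replace (z2 + 0 * 0)%C with z2 by ring. rewrite Cmod_0. match goal with H : 0 <= Cmod ?z |- _ => assert (0 < Cmod z ^ 2) by (apply pow_lt; lra) end. simpl in *; lra.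
    + intros. apply cdiff_mult; [apply cdiff_const|apply cdiff_id].
    + intros x Hx. rewrite HL. unfold in_ball, normsq; simpl fst; simpl snd. rewrite Cmod_mult.
      pose proof (Cmod_ge_0 x). rewrite Rpow_mult_distr. assert (0 < Cmod z1 ^ 2) by (apply pow_lt; lra). assert (Cmod x ^ 2 < 1) by nra. nra.
    + intros x Hx. rewrite HL. unfold in_sphere, normsq; simpl fst; simpl snd. rewrite Cmod_mult, Hx, Rmult_1_r. auto.
Qed.

Lemma moment_z2 z1 z2 l : Cmod z1 ^ 2 + Cmod z2 ^ 2 = 1 -> (0 < l)%nat ->
  avg (fun t => f (z1, z2 * ei t)%C * ei (INR l * t))%C = 0.
Proof.
  intros HS Hl. destruct (Req_dec (Cmod z2) 0) as [E|E].
  - apply Cmod_eq_0 in E. subst z2. rewrite (avg_ext _ (fun t => f (z1, RtoC 0) * ei (INR l * t))%C) by (intros; rewrite Cmult_0_l; auto).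
    rewrite avg_scal by apply ccont_ei. rewrite INR_IZR_INZ, avg_ei by lia. ring.
  - pose proof (Cmod_ge_0 z2).
    pose proof (line_moments f (z1, RtoC 0) (RtoC 0, RtoC 1) (fun x => z2 * x)%C l) as G.
    assert (HL : forall x, line_pt (z1, RtoC 0) (RtoC 0, RtoC 1) (z2 * x) = (z1, (z2 * x)%C)).
    { intros. unfold line_pt; simpl. f_equal; ring. }
    rewrite <- G; auto.
    + apply avg_ext. intros t. rewrite HL. auto.
    + apply ext_z2. exists (RtoC 0). unfold in_ball, normsq, line_pt; simpl fst; simpl snd.
      replace (0 + 0 * 1)%C with (RtoC 0) by ring. replace (z1 + 0 * 0)%C with z1 by ring. rewrite Cmod_0. match goal with H : 0 <= Cmod ?z |- _ => assert (0 < Cmod z ^ 2) by (apply pow_lt; lra) end. simpl in *; lra.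
    + intros. apply cdiff_mult; [apply cdiff_const|apply cdiff_id].
    + intros x Hx. rewrite HL. unfold in_ball, normsq; simpl fst; simpl snd. rewrite Cmod_mult.
      pose proof (Cmod_ge_0 x). rewrite Rpow_mult_distr. assert (0 < Cmod z2 ^ 2) by (apply pow_lt; lra). assert (Cmod x ^ 2 < 1) by nra. nra.
    + intros x Hx. rewrite HL. unfold in_sphere, normsq; simpl fst; simpl snd. rewrite Cmod_mult, Hx, Rmult_1_r. auto.
Qed.

Lemma moment_0 z1 z2 l : Cmod z1 ^ 2 + Cmod z2 ^ 2 = 1 -> (0 < l)%nat ->
  avg (fun t => f (z1 * ei t, z2 * ei t)%C * ei (INR l * t))%C = 0.
Proof.
  intros HS Hl. destruct (ext_uniform f f_analytic) as [d [M HE]]. destruct (sph_lip_of_ext _ _ _ HE) as [L HLip].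
  apply (diagonal_moments (fun z1 z2 => f (z1, z2)) L M); auto.
  - intros y k Hk. apply (moment_z1 z1 (z2 * ei y)); auto. rewrite Cmod_ei_mul; auto.
  - intros x k Hk. apply (moment_z2 (z1 * ei x) z2); auto. rewrite Cmod_ei_mul; auto.
Qed.

Hypothesis p_outside : ~ in_closed_ball p.
Hypothesis ext_p : forall v : C2, v <> (RtoC 0, RtoC 0) -> line_meets_ball p v -> extends_along_line f p v.

(** The rotation takes [(1, 0)] to [p / |p|], and [b] is [1 / |p|]. In these coordinates the
    automorphism of [mobius_sphere] parametrises the circles cut out by the lines through [p]. *)
Theorem rotated_setup : exists al be b (fr : C -> C -> C) d M L,
  Cmod al ^ 2 + Cmod be ^ 2 = 1 /\ 0 < b < 1 /\ (forall u1 u2, fr u1 u2 = f (rot al be u1 u2)) /\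
  ext_unif fr d M /\ sph_lip fr L M /\
  (forall u1 u2 l, Cmod u1 ^ 2 + Cmod u2 ^ 2 = 1 -> (0 < l)%nat -> avg (fun t => fr (u1 * ei t) (u2 * ei t) * ei (INR l * t))%C = 0) /\
  (forall x y l, 0 < x < 1 -> Cmod y ^ 2 = 1 - x ^ 2 -> (0 < l)%nat ->
    avg (fun t => fr ((x * ei t + b) / (1 + b * (x * ei t))) (sqrt (1 - b ^ 2) * y / (1 + b * (x * ei t))) * ei (INR l * t))%C = 0).
Proof.
  set (a := sqrt (normsq p)).
  assert (Hp : 1 < normsq p) by (unfold in_closed_ball in p_outside; lra).
  assert (Ha2 : a * a = normsq p) by (apply sqrt_sqrt; lra).
  assert (Ha : 1 < a). { rewrite <- sqrt_1. apply sqrt_lt_1; lra. }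
  assert (HaC : RtoC a <> 0) by (intros A; apply RtoC_inj in A; lra).
  set (al := (fst p / a)%C). set (be := (snd p / a)%C). set (b := / a).
  assert (Hab : Cmod al ^ 2 + Cmod be ^ 2 = 1).
  { unfold al, be. rewrite !Cmod_div, Cmod_R, Rabs_right by (auto; lra).
    replace ((Cmod (fst p) / a) ^ 2 + (Cmod (snd p) / a) ^ 2) with (normsq p / (a * a)) by (unfold normsq; field; lra).
    rewrite Ha2. field. lra. }
  assert (Hb : 0 < b < 1).
  { unfold b. split; [apply Rinv_0_lt_compat; lra|]. rewrite <- Rinv_1. apply Rinv_lt_contravar; lra. }
  assert (Hbb : 0 < 1 - b ^ 2) by nra.
  destruct (ext_uniform f f_analytic) as [d [M HE]].
  pose proof (ext_unif_rot _ d M al be Hab HE) as HE2. cbv beta in HE2.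
  destruct (sph_lip_of_ext _ _ _ HE2) as [L HLip].
  exists al, be, b, (fun u1 u2 => f (rot al be u1 u2)), (d / 2), M, L.
  split; [auto|split; [auto|split; [auto|split; [exact HE2|split; [exact HLip|split]]]]].
  - intros u1 u2 l HS Hl. rewrite (avg_ext _ (fun t => f ((al * u1 - Cconj be * u2) * ei t, (be * u1 + Cconj al * u2) * ei t)%C * ei (INR l * t))%C).
    + apply moment_0; auto. pose proof (normsq_rot al be u1 u2 Hab) as E. unfold normsq, rot in E; simpl fst in E; simpl snd in E. lra.
    + intros t. do 2 f_equal. unfold rot. f_equal; ring.
  - intros x y l Hx Hy Hl. set (kap := sqrt (1 - b ^ 2)).
    assert (Hkap : kap ^ 2 = 1 - b ^ 2) by (unfold kap; rewrite <- Rsqr_pow2; apply Rsqr_sqrt; lra).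
    (* With this direction the affine parameter [/ (1 + b * (x * s))] of the line through [p] gives
       the image of [(x * s, y)] under the automorphism, because [a * b = 1]. *)
    set (v := rot al be (RtoC (b - a)) (kap * y)%C).
    assert (Hxb : forall s : C, Cmod s <= 1 -> Cmod (x * s) <= x).
    { intros s Hs. rewrite Cmod_mult, Cmod_R, Rabs_right by lra. pose proof (Cmod_ge_0 s). nra. }
    assert (Hden : forall s : C, Cmod s <= 1 -> (1 + b * (x * s))%C <> 0).
    { intros s Hs. apply mobius_den; [lra|]. specialize (Hxb s Hs). lra. }
    assert (HabC : (RtoC a * RtoC b)%C = 1) by (unfold b; rewrite <- RtoC_mult; f_equal; field; lra).
    assert (Hpt : forall s : C, Cmod s <= 1 -> line_pt p v (/ (1 + b * (x * s))) = rot al be ((x * s + b) / (1 + b * (x * s))) (kap * y / (1 + b * (x * s)))).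
    { intros s Hs. specialize (Hden s Hs).
      assert (E1 : ((x * s + b) / (1 + b * (x * s)))%C = (a + (b - a) / (1 + b * (x * s)))%C).
      { replace (x * s + b)%C with (a * (1 + b * (x * s)) + (b - a))%C; [field; auto|].
        transitivity (a + (a * b) * (x * s) + (b - a))%C; [ring|]. rewrite HabC. ring. }
      unfold line_pt, v, rot; simpl fst; simpl snd. rewrite E1, RtoC_minus.
      replace (fst p) with (al * a)%C by (unfold al; field; auto). replace (snd p) with (be * a)%C by (unfold be; field; auto).
      f_equal; field; auto. }
    assert (Hn : forall s : C, Cmod s <= 1 -> (normsq (line_pt p v (/ (1 + b * (x * s)))) - 1) * Cmod (1 + b * (x * s)) ^ 2 = (1 - b ^ 2) * (x ^ 2 * (Cmod s ^ 2 - 1))).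
    { intros s Hs. rewrite Hpt, normsq_rot by auto. rewrite mobius_sphere by (auto; lra). rewrite Hy, Cmod_mult, Cmod_R, Rabs_right by lra. ring. }
    assert (Hdp : forall s : C, Cmod s <= 1 -> 0 < Cmod (1 + b * (x * s)) ^ 2).
    { intros s Hs. apply pow_lt. apply Cmod_gt_0. auto. }
    pose proof (line_moments f p v (fun s => / (1 + b * (x * s)))%C l) as G. rewrite <- G; auto.
    + apply avg_ext. intros t. rewrite Hpt; auto. rewrite Cmod_ei; lra.
    + apply ext_p.
      * intros E. assert (E2 : normsq v = 0) by (rewrite E; unfold normsq; simpl fst; simpl snd; rewrite Cmod_0; ring).
        unfold v in E2. rewrite normsq_rot in E2 by auto. rewrite Cmod_R in E2. rewrite pow2_abs in E2.
        pose proof (pow2_ge_0 (Cmod (kap * y))). nra.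
      * exists (/ (1 + b * (x * 0)))%C. specialize (Hn 0). rewrite Cmod_0 in Hn. specialize (Hn ltac:(lra)).
        specialize (Hdp 0 ltac:(rewrite Cmod_0; lra)). unfold in_ball.
        assert (0 < (1 - b ^ 2) * x ^ 2) by (apply Rmult_lt_0_compat; auto; apply pow_lt; lra). nra.
    + intros s Hs. apply (cdiff_inv (fun s => 1 + b * (x * s))%C); auto.
      apply cdiff_plus; [apply cdiff_const|]. repeat (apply cdiff_mult; [apply cdiff_const|]). apply cdiff_id.
    + intros s Hs. specialize (Hn s ltac:(lra)). specialize (Hdp s ltac:(lra)). unfold in_ball.
      assert (0 < (1 - b ^ 2) * x ^ 2) by (apply Rmult_lt_0_compat; auto; apply pow_lt; lra).
      assert (Cmod s ^ 2 < 1). { pose proof (Cmod_ge_0 s). nra. }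
      assert ((1 - b ^ 2) * (x ^ 2 * (Cmod s ^ 2 - 1)) < 0) by nra. nra.
    + intros s Hs. specialize (Hn s ltac:(lra)). specialize (Hdp s ltac:(lra)). unfold in_sphere. rewrite Hs in Hn. nra.
Qed.
End Setup.

(** * Complex square roots and integer powers *)

(** The principal branch on the half-plane [0 < Re z], through the half-angle formula for its real
    part. *)
Definition Csqrt (z : C) : C :=
  let p := sqrt ((Cmod z + Re z) / 2) in (p, Im z / (2 * p)).

Lemma Csqrt_pos z : 0 < Re z -> 0 < Re (Csqrt z).
Proof. intros H. unfold Csqrt; simpl. apply sqrt_lt_R0. pose proof (Cmod_ge_0 z). lra. Qed.

Lemma Csqrt_sq z : 0 < Re z -> (Csqrt z * Csqrt z)%C = z.
Proof.
  intros H. pose proof (Csqrt_pos z H) as Hp. unfold Csqrt in *. simpl in Hp. set (p := sqrt ((Cmod z + Re z) / 2)) in *.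
  assert (Hpp : p * p = (Cmod z + Re z) / 2) by (apply sqrt_sqrt; pose proof (Cmod_ge_0 z); lra).
  pose proof (Cmod2_alt z) as E. apply C_eq; simpl.
  - replace (Im z / (2 * p) * (Im z / (2 * p))) with (Im z ^ 2 / (4 * (p * p))) by (field; lra).
    replace (Im z ^ 2) with ((Cmod z - Re z) * (Cmod z + Re z)) by nra. rewrite Hpp.
    field. pose proof (Cmod_ge_0 z). lra.
  - field. lra.
Qed.

Lemma Csqrt_lip z w : 0 < Re z -> 0 < Re w -> Cmod (Csqrt w - Csqrt z) * Re (Csqrt z) <= Cmod (w - z).
Proof.
  intros Hz Hw. assert (E : (w - z)%C = ((Csqrt w - Csqrt z) * (Csqrt w + Csqrt z))%C).
  { transitivity (Csqrt w * Csqrt w - Csqrt z * Csqrt z)%C; [rewrite !Csqrt_sq by auto; auto|ring]. }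
  rewrite E, Cmod_mult. apply Rmult_le_compat_l; [apply Cmod_ge_0|].
  eapply Rle_trans; [|apply re_le_Cmod]. pose proof (Csqrt_pos z Hz). pose proof (Csqrt_pos w Hw).
  unfold Re in *; simpl in *. rewrite Rabs_right; lra.
Qed.

Lemma Csqrt_R r : 0 < r -> Csqrt (RtoC r) = RtoC (sqrt r).
Proof.
  intros Hr. unfold Csqrt. rewrite Cmod_R, Rabs_right by lra. simpl. replace ((r + r) / 2) with r by field.
  apply C_eq; simpl; auto. unfold Rdiv. ring.
Qed.

Lemma Csqrt_cdiff z : 0 < Re z -> cdiff Csqrt z.
Proof.
  intros Hz. pose proof (Csqrt_pos z Hz) as Hp. set (s := Csqrt z) in *. set (p := Re s) in *.
  assert (Hs0 : s <> 0). { intros E. unfold p in Hp. rewrite E in Hp. simpl in Hp. lra. }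
  exists (/ (2 * s))%C. intros e He. exists (Rmin (Re z) (e * (2 * p * p * p))). split.
  { apply Rmin_pos; auto. repeat apply Rmult_lt_0_compat; auto; lra. }
  intros w Hw. apply Rmin_Rgt in Hw as [Hw1 Hw2].
  assert (Hwr : 0 < Re w). { pose proof (re_lip w z). pose proof (Rle_abs (-(Re w - Re z))). rewrite Rabs_Ropp in H0. lra. }
  pose proof (Csqrt_pos w Hwr) as Hq. set (t := Csqrt w) in *.
  pose proof (Csqrt_lip z w Hz Hwr) as HL. fold s t p in HL.
  assert (Hts : (t + s)%C <> 0). { intros A. apply (f_equal Re) in A. unfold p, Re in *; simpl in *. lra. }
  assert (E : (w - z)%C = ((t - s) * (t + s))%C).
  { transitivity (t * t - s * s)%C; [unfold t, s; rewrite !Csqrt_sq by auto; auto|ring]. }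
  fold s. replace (t - s - / (2 * s) * (w - z))%C with (- ((w - z) * (t - s)) / (2 * s * (t + s)))%C.
  2:{ rewrite E. field. split; auto. }
  assert (H2 : 2 * p * p <= Cmod (2 * s * (t + s))).
  { rewrite !Cmod_mult, Cmod_2. pose proof (re_le_Cmod s). fold p in H. rewrite Rabs_right in H by lra.
    pose proof (re_le_Cmod (t + s)) as H1. replace (Re (t + s)) with (Re t + p) in H1 by (unfold p, Re; simpl; ring).
    rewrite Rabs_right in H1 by lra. assert (p <= Cmod (t + s)) by lra. nra. }
  assert (Hpp : 0 < 2 * p * p) by (repeat apply Rmult_lt_0_compat; lra).
  rewrite Cmod_div, Cmod_opp, Cmod_mult by (intros A; rewrite A, Cmod_0 in H2; lra).
  apply Rle_div_l; [lra|].
  pose proof (Cmod_ge_0 (w - z)). pose proof (Cmod_ge_0 (t - s)).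
  assert (Cmod (t - s) * p <= e * (2 * p * p) * p) by nra.
  assert (Cmod (t - s) <= e * (2 * p * p)) by (apply Rmult_le_reg_r with p; auto).
  apply Rle_trans with (Cmod (w - z) * (e * (2 * p * p))); [apply Rmult_le_compat_l; auto|].
  replace (Cmod (w - z) * (e * (2 * p * p))) with (e * Cmod (w - z) * (2 * p * p)) by ring.
  apply Rmult_le_compat_l; [nra|auto].
Qed.

Lemma Csqrt_near_1 u : Cmod u <= 1/2 -> 0 < Re (1 - u) /\ Cmod (Csqrt (1 - u) - 1) <= Cmod u.
Proof.
  intros Hu. assert (HR : 0 < Re (1 - u)).
  { pose proof (re_le_Cmod u). pose proof (Rle_abs (Re u)). replace (Re (1 - u)) with (1 - Re u) by (unfold Re; simpl; ring). lra. }
  split; auto. pose proof (Csqrt_lip 1 (1 - u) ltac:(simpl; lra) HR) as H.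
  rewrite Csqrt_R, sqrt_1 in H by lra. simpl Re in H. rewrite Rmult_1_r in H.
  replace (1 - u - 1)%C with (- u)%C in H by ring. rewrite Cmod_opp in H. auto.
Qed.

Definition zp (c : C) (n : Z) : C := if Z_le_dec 0 n then (c ^ Z.to_nat n)%C else (/ c ^ Z.to_nat (- n))%C.

Lemma Cinv_nz (c : C) : c <> 0 -> (/ c)%C <> 0.
Proof.
  intros Hc E. assert (H : (c * / c)%C = 1) by (apply Cinv_r; auto). rewrite E, Cmult_0_r in H.
  apply RtoC_inj in H. lra.
Qed.

Lemma zp_nz (c : C) n : c <> 0 -> zp c n <> 0.
Proof. intros H. unfold zp. destruct Z_le_dec; [apply Cpow_nz; auto|]. apply Cinv_nz, Cpow_nz; auto. Qed.

Lemma zp_mult (c d : C) n : c <> 0 -> d <> 0 -> zp (c * d) n = (zp c n * zp d n)%C.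
Proof.
  intros Hc Hd. unfold zp. destruct Z_le_dec; rewrite Cpow_mult_l; auto.
  field. split; apply Cpow_nz; auto.
Qed.

Lemma zp_opp (c : C) n : c <> 0 -> (zp c n * zp c (- n))%C = 1.
Proof.
  intros Hc. unfold zp. pose proof (Cpow_nz c (Z.to_nat n) Hc). pose proof (Cpow_nz c (Z.to_nat (- n)) Hc).
  destruct (Z_le_dec 0 n) as [H1|H1], (Z_le_dec 0 (- n)) as [H2|H2]; try lia.
  - replace n with 0%Z by lia. simpl. ring.
  - rewrite Z.opp_involutive. field. auto.
  - field. auto.
Qed.

Lemma zp_ei t n : zp (ei t) n = ei (IZR n * t).
Proof.
  unfold zp. destruct Z_le_dec; rewrite ei_pow, INR_IZR_INZ, Z2Nat.id by lia; auto.
  apply Cmult_cancel_l with (ei (IZR (- n) * t)); [apply ei_nz|]. rewrite Cinv_r by apply ei_nz.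
  rewrite <- ei_plus, opp_IZR. rewrite <- ei_0. f_equal. ring.
Qed.

Lemma Cmod_zp (c : C) n : c <> 0 -> Cmod (zp c n) = if Z_le_dec 0 n then Cmod c ^ Z.to_nat n else / Cmod c ^ Z.to_nat (- n).
Proof.
  intros Hc. unfold zp. destruct Z_le_dec; [apply Cmod_pow|]. rewrite Cmod_inv, Cmod_pow; auto. apply Cpow_nz; auto.
Qed.

Lemma zp_cdiff g n t : cdiff g t -> g t <> 0 -> cdiff (fun s => zp (g s) n) t.
Proof.
  intros Hg H0. unfold zp. destruct Z_le_dec; [apply cdiff_pow; auto|].
  apply (cdiff_inv (fun s => g s ^ Z.to_nat (- n))%C); [apply cdiff_pow; auto|apply Cpow_nz; auto].
Qed.

Lemma zp_bound (c : C) n : 1/2 <= Cmod c <= 2 -> Cmod (zp c n) <= 2 ^ Z.abs_nat n.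
Proof.
  intros Hc. assert (c <> 0) by (intros E; rewrite E, Cmod_0 in Hc; lra). rewrite Cmod_zp by auto.
  destruct Z_le_dec.
  - replace (Z.abs_nat n) with (Z.to_nat n) by lia. apply pow_incr; lra.
  - replace (Z.abs_nat n) with (Z.to_nat (- n)) by lia. rewrite <- pow_inv. apply pow_incr. split.
    + apply Rlt_le, Rinv_0_lt_compat; lra.
    + replace 2 with (/ (1/2)) by field. apply Rinv_le_contravar; lra.
Qed.

(** * Fourier coefficients of the rotated function *)

(* The coordinates are rotated so that the exterior point is [(1 / b, 0)]; the last two conditions express extension along the lines
   through [0] and through [(1 / b, 0)]. *)
Definition setup (fr : C -> C -> C) (b d M L : R) : Prop :=
  0 < b < 1 /\ ext_unif fr d M /\ sph_lip fr L M /\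
  (forall u1 u2 l, Cmod u1 ^ 2 + Cmod u2 ^ 2 = 1 -> (0 < l)%nat -> avg (fun t => fr (u1 * ei t) (u2 * ei t) * ei (INR l * t))%C = 0) /\
  (forall x y l, 0 < x < 1 -> Cmod y ^ 2 = 1 - x ^ 2 -> (0 < l)%nat ->
    avg (fun t => fr ((x * ei t + b) / (1 + b * (x * ei t))) (sqrt (1 - b ^ 2) * y / (1 + b * (x * ei t))) * ei (INR l * t))%C = 0).

Definition fiber_coef (fr : C -> C -> C) (n : Z) (r t : R) : C :=
  avg (fun s => fr (r * ei t) (sqrt (1 - r ^ 2) * ei s) * ei (- IZR n * s))%C.

(* For [fr = u1 ^ j * u2 ^ n] this is [z ^ j] at [z = r * ei t]. *)
Definition scaled_coef (fr : C -> C -> C) (n : Z) (r t : R) : C := (zp (RtoC (sqrt (1 - r ^ 2))) (- n) * fiber_coef fr n r t)%C.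

Lemma lip2_shear F : lip2 F -> lip2 (fun x y => F x (y + x)).
Proof.
  intros [L [B [HL [HB H]]]]. exists (2 * L), B. split; [lra|split; [auto|]]. intros x y x' y'.
  eapply Rle_trans; [apply H|]. replace (2 * L * (Rabs (x - x') + Rabs (y - y'))) with (L * (2 * (Rabs (x - x') + Rabs (y - y')))) by ring.
  apply Rmult_le_compat_l; auto. replace (y + x - (y' + x')) with ((y - y') + (x - x')) by ring.
  pose proof (Rabs_triang (y - y') (x - x')). pose proof (Rabs_pos (y - y')). lra.
Qed.

Lemma circle_sphere r s t : 0 <= r <= 1 -> Cmod (r * ei s) ^ 2 + Cmod (sqrt (1 - r ^ 2) * ei t) ^ 2 = 1.
Proof.
  intros Hr. rewrite !Cmod_ei_mul, !Cmod_R, !pow2_abs. rewrite pow2_sqrt; [lra|nra].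
Qed.

Lemma circle_sphere0 r : 0 <= r <= 1 -> Cmod r ^ 2 + Cmod (sqrt (1 - r ^ 2)) ^ 2 = 1.
Proof. intros Hr. rewrite !Cmod_R, !pow2_abs. rewrite pow2_sqrt; [lra|nra]. Qed.

Lemma Cconj_R (r : R) : Cconj r = RtoC r.
Proof. apply C_eq; simpl; ring. Qed.

Lemma avg_0 u : (forall t, u t = RtoC 0) -> avg u = 0.
Proof. intros H. rewrite (avg_ext u (fun _ => RtoC 0)) by auto. apply avg_const. Qed.

Section Coefficients.
Context {fr : C -> C -> C} {b d M L : R} (S : setup fr b d M L).

Lemma fiber_coef_lip2 n r : 0 <= r <= 1 ->
  lip2 (fun t s => fr (r * ei t) (sqrt (1 - r ^ 2) * ei s) * ei (- IZR n * s))%C.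
Proof.
  intros Hr. destruct S as [_ [_ [HL _]]].
  apply lip2_mult; [apply (sph_lip2 _ _ _ r (sqrt (1 - r ^ 2)) HL), circle_sphere0; auto|].
  apply (lip2_ext (fun x y => ei (0 * x + - IZR n * y))); [|apply lip2_ei].
  intros x y. f_equal. ring.
Qed.

Lemma fiber_coef_cont_in n r t : 0 <= r <= 1 -> ccont (fun s => fr (r * ei t) (sqrt (1 - r ^ 2) * ei s) * ei (- IZR n * s))%C.
Proof.
  intros Hr. apply (ucont2_l (fun s t => fr (r * ei t) (sqrt (1 - r ^ 2) * ei s) * ei (- IZR n * s))%C t).
  apply ucont2_sym, lip2_ucont, fiber_coef_lip2; auto.
Qed.

Lemma fiber_coef_cont n r : 0 <= r <= 1 -> ccont (fiber_coef fr n r).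
Proof. intros Hr. apply (ucont2_avg (fun t s => fr (r * ei t) (sqrt (1 - r ^ 2) * ei s) * ei (- IZR n * s))%C). apply lip2_ucont, fiber_coef_lip2; auto. Qed.

Lemma fiber_coef_bound n r t : 0 <= r <= 1 -> Cmod (fiber_coef fr n r t) <= M.
Proof.
  intros Hr. apply avg_bound; [apply fiber_coef_cont_in; auto|]. intros s. rewrite Cmod_ei_mul.
  destruct S as [_ [_ [[_ H] _]]]. apply H, circle_sphere; auto.
Qed.

Lemma fiber_coef_period n r t : fiber_coef fr n r (t + 2 * PI) = fiber_coef fr n r t.
Proof. unfold fiber_coef. rewrite ei_2pi. auto. Qed.

(** Replacing [s] by [s + t] turns the average over [t] into one over a circle on a line through the
    origin, at frequency [- (j + n) > 0], where the moment vanishes. *)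
Lemma mode_fiber_coef_neg n r j : 0 <= r <= 1 -> (j + n < 0)%Z -> mode (fiber_coef fr n r) j = 0.
Proof.
  intros Hr Hjn. unfold mode, fiber_coef.
  set (F := fun t s => (fr (r * ei t) (sqrt (1 - r ^ 2) * ei s) * ei (- IZR n * s))%C).
  assert (HF : lip2 (fun t s => F t (s + t)%R * ei (- IZR j * t + 0 * s))%C).
  { apply lip2_mult; [apply (lip2_shear F), fiber_coef_lip2; auto|apply lip2_ei]. }
  rewrite (avg_ext _ (fun t => avg (fun s => F t (s + t)%R * ei (- IZR j * t + 0 * s))%C)).
  2:{ intros t. change (avg (F t) * ei (- IZR j * t) = avg (fun s => F t (s + t)%R * ei (- IZR j * t + 0 * s)))%C. rewrite <- (avg_shift (F t) t).
      - rewrite Cmult_comm, <- avg_scal.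
        + apply avg_ext. intros s. rewrite Cmult_comm. do 2 f_equal. ring.
        + apply (ucont2_l (fun s t => F t (s + t)%R) t). apply ucont2_sym, lip2_ucont, lip2_shear, fiber_coef_lip2; auto.
      - apply (fiber_coef_cont_in n r t Hr).
      - intros s. unfold F. rewrite ei_2pi, <- opp_IZR, ei_Z_2pi. auto. }
  rewrite (avg_swap _ (lip2_ucont _ HF)). apply avg_0. intros s.
  destruct S as [_ [_ [HL [M0 _]]]].
  rewrite (avg_ext _ (fun t => ei (- IZR n * s) * (fr (r * ei t) (sqrt (1 - r ^ 2) * ei s * ei t) * ei (INR (Z.to_nat (- (j + n))) * t)))%C).
  - rewrite avg_scal, M0; [ring|pose proof (circle_sphere r 0 s Hr) as X; rewrite ei_0, Cmult_1_r in X; auto|lia|].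
    apply ccont_mult; [|apply ccont_ei].
    apply (ucont2_l (fun t s' => fr (r * ei t) (sqrt (1 - r ^ 2) * ei s * ei t))%C 0).
    destruct HL as [HL0 HL]. apply lip2_ucont. exists (L * 2), M. split; [lra|split].
    + intros x y. apply HL. rewrite <- Cmult_assoc, <- ei_plus. apply circle_sphere; auto.
    + intros x y x' y'. eapply Rle_trans; [apply HL; rewrite <- Cmult_assoc, <- ei_plus; apply circle_sphere; auto|].
      rewrite Rmult_assoc. apply Rmult_le_compat_l; auto.
      pose proof (circle_sphere0 r Hr) as E. apply Cmod_le_1 in E as [E1 E2].
      replace (r * ei x - r * ei x')%C with (r * (ei x - ei x'))%C by ring.
      replace (sqrt (1 - r ^ 2) * ei s * ei x - sqrt (1 - r ^ 2) * ei s * ei x')%C with ((sqrt (1 - r ^ 2)) * ei s * (ei x - ei x'))%C by ring.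
      rewrite !Cmod_mult, Cmod_ei. pose proof (ei_lip x x'). pose proof (Cmod_ge_0 (ei x - ei x')).
      pose proof (Rabs_pos (y - y')). nra.
  - intros t. unfold F. rewrite INR_IZR_INZ, Z2Nat.id by lia. rewrite opp_IZR, plus_IZR.
    rewrite (Rplus_comm s t), ei_plus.
    replace (sqrt (1 - r ^ 2) * (ei t * ei s))%C with (sqrt (1 - r ^ 2) * ei s * ei t)%C by ring.
    replace (- IZR n * (t + s)) with (- IZR n * t + - IZR n * s) by ring.
    replace (- (IZR j + IZR n) * t) with (- IZR j * t + - IZR n * t) by ring.
    rewrite !ei_plus. replace (0 * s) with 0 by ring. rewrite ei_0. ring.
Qed.

(** For a holomorphic curve in the complexification whose real points lie on the sphere, [E] along
    the curve has a Taylor series that restricts to [fr] at real parameters. The bounds involve only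
    [M] and the bound on the holomorphic weight [k]. *)
Lemma curve_PSon q1 q2 (g1 g2 g3 g4 k : C -> C) e B : Cmod q1 ^ 2 + Cmod q2 ^ 2 = 1 -> 0 < e ->
  (forall t, Cmod t < e -> ldiff g1 t /\ ldiff g2 t /\ ldiff g3 t /\ ldiff g4 t /\ cdiff k t /\ Cmod (k t) <= B /\
     near d q1 q2 (g1 t) (g2 t) (g3 t) (g4 t)) ->
  (forall x : R, Rabs x < e -> Cmod (g1 x) ^ 2 + Cmod (g2 x) ^ 2 = 1 /\ g3 x = Cconj (g1 x) /\ g4 x = Cconj (g2 x)) ->
  exists a, PSon is_real (B * M) e a (fun t => k t * fr (g1 t) (g2 t))%C.
Proof.
  intros Hq He Hg Hx. destruct S as [_ [[_ HE] _]]. destruct (HE q1 q2 Hq) as [E [E1 [E2 E3]]].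
  destruct (taylor (fun t => k t * E (g1 t) (g2 t) (g3 t) (g4 t))%C 0 e (B * M) He) as [a Ha].
  - intros t Ht. replace (t - 0)%C with t in Ht by ring. destruct (Hg t Ht) as [H1 [H2 [H3 [H4 [H5 [_ H6]]]]]].
    apply cdiff_mult; auto.
  - intros t Ht. replace (t - 0)%C with t in Ht by ring. destruct (Hg t Ht) as [H1 [H2 [H3 [H4 [H5 [H7 H6]]]]]].
    rewrite Cmod_mult. apply Rmult_le_compat; auto using Cmod_ge_0.
  - exists a. destruct Ha as [A1 [A2 A3]]. split; [auto|split; [auto|]]. intros t Pt Ht.
    specialize (A3 t I Ht). cbv beta in A3. rewrite Cplus_0_l in A3.
    destruct (Hg t Ht) as [_ [_ [_ [_ [_ [_ H6]]]]]].
    rewrite Pt in *. rewrite Cmod_R in Ht. destruct (Hx _ Ht) as [X1 [X2 X3]]. rewrite X2, X3 in *.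
    rewrite E2 in A3; auto.
Qed.

Lemma Cexp_close h : Cmod h <= 1/2 -> Cmod (Cexp h - 1) <= 6 * Cmod h.
Proof.
  intros Hh. pose proof (Cexp_small h Hh). pose proof (Cmod_triangle (Cexp h - 1 - h) h) as T.
  replace (Cexp h - 1 - h + h)%C with (Cexp h - 1)%C in T by ring. pose proof (Cmod_ge_0 h). nra.
Qed.

Lemma real_acc e : 0 < e -> exists t, is_real t /\ t <> RtoC 0 /\ Cmod t < e.
Proof.
  intros He. exists (RtoC (e / 2)). split; [reflexivity|split].
  - intros A. apply RtoC_inj in A. lra.
  - rewrite Cmod_R, Rabs_right; lra.
Qed.

(** Turning the first coordinate through a complex angle stays in the uniform neighbourhood of the
    sphere, with a width independent of [n] and [r]; hence one rate [q] serves all coefficients. *)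
Lemma mode_fiber_coef_decay : exists q, 0 < q < 1 /\ forall n r j, 0 <= r <= 1 -> Cmod (mode (fiber_coef fr n r) j) <= 4 * M * q ^ Z.abs_nat j.
Proof.
  pose proof S as [_ [[Hd _] _]].
  (* [Cexp_close] needs [1/2] and loses a factor [6]. *)
  set (e := Rmin (1/2) (d / 6)). assert (He : 0 < e) by (apply Rmin_pos; lra).
  destruct (mode_decay e He) as [q [Hq H]]. exists q. split; auto. intros n r j Hr.
  apply H; [apply fiber_coef_cont; auto|intros; apply fiber_coef_period|]. intros x.
  apply (PSon_avg is_real M e (fun s t => fr (r * ei (x + Re t)) (sqrt (1 - r ^ 2) * ei s) * ei (- IZR n * s))%C).
  - apply real_acc.
  - intros s.
    destruct (curve_PSon (r * ei x) (sqrt (1 - r ^ 2) * ei s) (fun t => r * ei x * Cexp (Ci * t))%C (fun _ => sqrt (1 - r ^ 2) * ei s)%C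
      (fun t => r * ei (- x) * Cexp (- Ci * t))%C (fun _ => sqrt (1 - r ^ 2) * ei (- s))%C (fun _ => ei (- IZR n * s)) e 1) as [a Ha]; auto.
    + apply circle_sphere; auto.
    + intros t Ht. apply Rmin_Rgt in Ht as [Ht1 Ht2].
      assert (HC : forall c z, cdiff (fun t => Cexp (c * t)) z).
      { intros c z. apply (cdiff_comp (fun t => c * t)%C Cexp); [apply cdiff_mult; [apply cdiff_const|apply cdiff_id]|eexists; apply cder_Cexp]. }
      split; [apply ldiff_mult; [apply ldiff_const|apply ldiff_all; auto]|].
      split; [apply ldiff_const|]. split; [apply ldiff_mult; [apply ldiff_const|apply ldiff_all; auto]|].
      split; [apply ldiff_const|]. split; [apply cdiff_const|]. split; [rewrite Cmod_ei; lra|].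
      assert (Hz : forall y c, Cmod c = 1 -> Cmod (r * ei y * Cexp (c * t) - r * ei y) < d).
      { intros y c Hc. replace (r * ei y * Cexp (c * t) - r * ei y)%C with (r * ei y * (Cexp (c * t) - 1))%C by ring.
        rewrite Cmod_mult, Cmod_ei_mul, Cmod_R, Rabs_right by lra.
        pose proof (Cexp_close (c * t)) as E. rewrite Cmod_mult, Hc in E.
        pose proof (Cmod_ge_0 (Cexp (c * t) - 1)). pose proof (Cmod_ge_0 t). specialize (E ltac:(lra)). nra. }
      unfold near. rewrite !Cmult_conj, !ei_conj, !Cconj_R, !Cmod_sub_diag.
      split; [apply Hz, Cmod_Ci|]. split; auto. split; auto. apply Hz. rewrite Cmod_opp. apply Cmod_Ci.
    + intros y Hy. rewrite !Cexp_im.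
      replace (- Ci * y)%C with (Ci * RtoC (- y))%C by (rewrite RtoC_opp; ring). rewrite Cexp_im.
      rewrite <- !Cmult_assoc, <- !ei_plus, !Cmult_conj, !ei_conj, !Cconj_R.
      split; [apply circle_sphere; auto|]. split; auto. do 2 f_equal. ring.
    + exists a. rewrite Rmult_1_l in Ha. destruct Ha as [A1 [A2 A3]]. split; [auto|split; [auto|]]. intros t Pt Ht.
      specialize (A3 t Pt Ht). cbv beta in A3. rewrite Pt in *. rewrite Cexp_im, <- Cmult_assoc, <- ei_plus, Cmult_comm in A3. exact A3.
  - intros t _ _. apply fiber_coef_cont_in; auto.
Qed.

End Coefficients.

Lemma ldiff_loc g t d : 0 < d -> (forall s, Cmod (s - t) < d -> cdiff g s) -> ldiff g t.
Proof. intros Hd H. exists d. auto. Qed.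

Lemma zp_bound_at (c0 c : C) n : c0 <> 0 -> Cmod (c - c0) <= Cmod c0 / 2 -> c <> 0 /\ Cmod (zp c n) <= 2 ^ Z.abs_nat n * Cmod (zp c0 n).
Proof.
  intros H0 Hc. pose proof (Cmod_gt_0 c0) as [G _]. specialize (G H0).
  assert (E : c = (c / c0 * c0)%C) by (field; auto).
  assert (Hq : Cmod (c / c0 - 1) <= 1 / 2).
  { replace (c / c0 - 1)%C with ((c - c0) / c0)%C by (field; auto). rewrite Cmod_div by auto. apply Rle_div_l; lra. }
  assert (Hb : 1 / 2 <= Cmod (c / c0) <= 2).
  { pose proof (Cmod_triangle (c / c0 - 1) 1) as T1. pose proof (Cmod_triangle (c / c0) (1 - c / c0)) as T2.
    replace (c / c0 - 1 + 1)%C with (c / c0)%C in T1 by ring. replace (c / c0 + (1 - c / c0))%C with (RtoC 1) in T2 by ring.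
    rewrite (Cmod_sub_sym 1) in T2. rewrite Cmod_1 in *. lra. }
  assert (Hn : (c / c0)%C <> 0) by (intros A; rewrite A, Cmod_0 in Hb; lra).
  split.
  - intros A. apply Hn. rewrite A. field. auto.
  - rewrite E at 1. rewrite zp_mult, Cmod_mult by auto. apply Rmult_le_compat_r; [apply Cmod_ge_0|]. apply zp_bound; auto.
Qed.

(** * Dependence of the coefficients on the radius *)

Section Radius.
Context {fr : C -> C -> C} {b d M L : R} (S : setup fr b d M L).

Definition sqrt_shift (r : R) (t : C) : C := Csqrt (1 - (r + t) * (r + t)).

Lemma sqrt_shift_real r x : 0 < r + x < 1 -> sqrt_shift r x = RtoC (sqrt (1 - (r + x) ^ 2)).
Proof.
  intros H. unfold sqrt_shift. replace (1 - (r + x) * (r + x))%C with (RtoC (1 - (r + x) ^ 2)).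
  - apply Csqrt_R. nra.
  - rewrite RtoC_minus, RtoC_pow, RtoC_plus. ring.
Qed.

Lemma sqrt_shift_near r t : 0 < r < 1 -> 6 * Cmod t < 1 - r ^ 2 ->
  cdiff (sqrt_shift r) t /\ Cmod (sqrt_shift r t - sqrt (1 - r ^ 2)) * sqrt (1 - r ^ 2) <= 3 * Cmod t.
Proof.
  intros Hr Ht. set (w := (1 - (r + t) * (r + t))%C).
  assert (Hw : Cmod (w - (1 - r ^ 2)%R) <= 3 * Cmod t).
  { unfold w. rewrite RtoC_minus, RtoC_pow. replace (1 - (r + t) * (r + t) - (1 - r ^ 2))%C with (- (t * (2 * r + t)))%C by ring.
    rewrite Cmod_opp, Cmod_mult. pose proof (Cmod_triangle (2 * r) t) as T. rewrite Cmod_mult, Cmod_2, Cmod_R in T. rewrite Rabs_right in T by lra.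
    pose proof (Cmod_ge_0 t). assert (Cmod t <= 1) by nra. nra. }
  assert (Hre : 0 < Re w).
  { pose proof (re_lip w (1 - r ^ 2)%R) as H. change (Re (RtoC (1 - r ^ 2))) with (1 - r ^ 2) in H.
    pose proof (Rle_abs (- (Re w - (1 - r ^ 2)))) as H2. rewrite Rabs_Ropp in H2. pose proof (Cmod_ge_0 t). lra. }
  assert (H0 : 0 < 1 - r ^ 2) by nra.
  split.
  - unfold sqrt_shift. apply (cdiff_comp (fun t => 1 - (r + t) * (r + t))%C Csqrt); [|apply Csqrt_cdiff; auto].
    apply cdiff_minus; [apply cdiff_const|]. apply cdiff_mult; apply cdiff_plus; auto using cdiff_const, cdiff_id.
  - pose proof (Csqrt_lip (RtoC (1 - r ^ 2)) w H0 Hre) as HL. rewrite Csqrt_R in HL by auto.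
    change (Re (RtoC (sqrt (1 - r ^ 2)))) with (sqrt (1 - r ^ 2)) in HL. unfold sqrt_shift. fold w. lra.
Qed.

(** The radius is complexified together with the second coordinate [sqrt_shift]. Each integrand
    becomes a power series in the displacement with common constants, and both averages preserve
    this. The weight [kap] covers the integrals defining the coefficients at [0] and at [b]. *)
Lemma scaled_coef_lps (kap : C -> C) n r0 e0 B : 0 < r0 < 1 -> 0 < e0 ->
  (forall z, Rabs (Cmod z - r0) < e0 -> cdiff kap z /\ Cmod (kap z) <= B) ->
  lps (fun r => avg (fun t => kap (r * ei t) * scaled_coef fr n r t)%C) r0.
Proof.
  intros Hr He0 Hk. pose proof S as [_ [[Hd _] _]].
  set (p := sqrt (1 - r0 ^ 2)). assert (Hp0 : 0 < 1 - r0 ^ 2) by nra.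
  assert (Hpos : 0 < p) by (apply sqrt_lt_R0; auto). assert (Hpp : p * p = 1 - r0 ^ 2) by (apply sqrt_sqrt; lra).
  assert (Hp1 : p < 1) by nra.
  (* The entries keep, in this order, the radius in [(0, 1)], the circle in the domain of [kap], the
     root within half its value of [p], and the moved point within [d]. *)
  set (e := Rmin (Rmin r0 (1 - r0)) (Rmin e0 (Rmin (p * p / 6) (d * p / 3)))).
  assert (Hdp : 0 < d * p) by nra.
  assert (He : 0 < e) by (unfold e; repeat apply Rmin_pos; try lra; nra).
  assert (He' : forall t, Cmod t < e -> Cmod t < r0 /\ Cmod t < 1 - r0 /\ Cmod t < e0 /\ 6 * Cmod t < p * p /\ 3 * Cmod t < d * p).
  { intros t Ht. unfold e in Ht. apply Rmin_Rgt in Ht as [T1 T2]. apply Rmin_Rgt in T1 as [T1 T3].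
    apply Rmin_Rgt in T2 as [T2 T4]. apply Rmin_Rgt in T4 as [T4 T5]. repeat split; lra. }
  assert (Hkb : forall t s, Cmod t < e0 -> cdiff (fun t => kap ((r0 + t) * ei s))%C t /\ Cmod (kap ((r0 + t) * ei s))%C <= B).
  { intros t s Ht. destruct (Hk ((r0 + t) * ei s))%C as [K1 K2].
    { rewrite Cmod_ei_mul. eapply Rle_lt_trans; [|apply Ht].
      pose proof (Cmod_triangle r0 t) as T1. pose proof (Cmod_triangle (r0 + t) (- t)) as T2. rewrite Cmod_opp in T2.
      replace (r0 + t + - t)%C with (RtoC r0) in T2 by ring. rewrite Cmod_R, Rabs_right in * by lra. apply Rabs_le. lra. }
    split; auto. apply (cdiff_comp (fun t => (r0 + t) * ei s)%C kap); auto.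
    apply cdiff_mult; [apply cdiff_plus|]; auto using cdiff_const, cdiff_id. }
  set (W := B * (2 ^ Z.abs_nat (- n) * Cmod (zp p (- n)))).
  assert (Hq : forall t, Cmod t < e -> cdiff (sqrt_shift r0) t /\ sqrt_shift r0 t <> 0 /\ Cmod (sqrt_shift r0 t - p) < d /\
     Cmod (zp (sqrt_shift r0 t) (- n)) <= 2 ^ Z.abs_nat (- n) * Cmod (zp p (- n))).
  { intros t Ht. destruct (He' t Ht) as [T1 [T2 [T3 [T4 T5]]]]. destruct (sqrt_shift_near r0 t Hr ltac:(lra)) as [Q1 Q2]. fold p in Q2.
    assert (Q3 : Cmod (sqrt_shift r0 t - p) <= Cmod p / 2).
    { rewrite Cmod_R, Rabs_right by lra. apply Rmult_le_reg_r with p; lra. }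
    destruct (zp_bound_at p (sqrt_shift r0 t) (- n)) as [Q4 Q5]; auto.
    { intros A. apply RtoC_inj in A. lra. }
    repeat split; auto. apply Rmult_lt_reg_r with p; lra. }
  assert (Hreal : forall t, is_real t -> Cmod t < e -> 0 < r0 + Re t < 1).
  { intros t Pt Ht. rewrite Pt in Ht. rewrite Cmod_R in Ht. assert (H : Cmod (Re t) < e) by (rewrite Cmod_R; auto).
    destruct (He' _ H) as [T1 [T2 _]]. rewrite Cmod_R in *. apply Rabs_def2 in T1, T2. lra. }
  set (u := fun s t y => (kap ((r0 + t) * ei s) * zp (sqrt_shift r0 t) (- n) * ei (- IZR n * y) * fr ((r0 + t) * ei s) (sqrt_shift r0 t * ei y))%C).
  assert (Hu : forall s y, exists a, PSon is_real (W * M) e a (fun t => u s t y)).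
  { intros s y. apply (curve_PSon S (r0 * ei s) (p * ei y) (fun t => (r0 + t) * ei s)%C (fun t => sqrt_shift r0 t * ei y)%C
      (fun t => (r0 + t) * ei (- s))%C (fun t => sqrt_shift r0 t * ei (- y))%C
      (fun t => kap ((r0 + t) * ei s) * zp (sqrt_shift r0 t) (- n) * ei (- IZR n * y))%C); auto.
    - apply circle_sphere. lra.
    - intros t Ht. destruct (He' t Ht) as [T1 [T2 [T3 [T4 T5]]]]. destruct (Hq t Ht) as [Q1 [Q2 [Q3 Q4]]]. destruct (Hkb t s T3) as [K1 K2].
      assert (L1 : forall c, ldiff (fun t => (r0 + t) * c)%C t).
      { intros c. apply ldiff_all. intros z. apply cdiff_mult; [apply cdiff_plus|]; auto using cdiff_const, cdiff_id. }
      assert (L2 : forall c, ldiff (fun t => sqrt_shift r0 t * c)%C t).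
      { intros c. apply (ldiff_mult (sqrt_shift r0)); [|apply ldiff_const]. apply ldiff_loc with (e - Cmod t); [lra|]. intros z Hz.
        apply Hq. pose proof (Cmod_le_add z t). lra. }
      do 4 (split; auto). split; [|split].
      + apply cdiff_mult; [|apply cdiff_const]. apply cdiff_mult; auto. apply zp_cdiff; auto.
      + rewrite Cmod_ei_mul, Cmod_mult. apply Rmult_le_compat; auto using Cmod_ge_0.
      + assert (Z1 : forall c, Cmod ((r0 + t) * ei c - r0 * ei c) < d).
        { intros c. replace ((r0 + t) * ei c - r0 * ei c)%C with (t * ei c)%C by ring. rewrite Cmod_ei_mul. nra. }
        assert (Z2 : forall c, Cmod (sqrt_shift r0 t * ei c - p * ei c) < d).
        { intros c. replace (sqrt_shift r0 t * ei c - p * ei c)%C with ((sqrt_shift r0 t - p) * ei c)%C by ring. rewrite Cmod_ei_mul. auto. }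
        unfold near. rewrite !Cmult_conj, !ei_conj, !Cconj_R. auto.
    - intros x Hx. pose proof (Hreal x (is_real_R x) ltac:(rewrite Cmod_R; auto)) as H. simpl in H.
      rewrite sqrt_shift_real by auto. rewrite <- RtoC_plus. rewrite !Cmult_conj, !ei_conj, !Cconj_R. split; auto. apply circle_sphere. lra. }
  assert (Hg : forall s t, is_real t -> Cmod t < e -> u s t = fun y => (kap ((r0 + Re t)%R * ei s) * zp (sqrt (1 - (r0 + Re t) ^ 2)) (- n) *
      (fr ((r0 + Re t)%R * ei s) (sqrt (1 - (r0 + Re t) ^ 2) * ei y) * ei (- IZR n * y)))%C).
  { intros s t Pt Ht. pose proof (Hreal t Pt Ht) as H. unfold u. rewrite Pt. simpl Re. rewrite sqrt_shift_real by auto. rewrite <- RtoC_plus.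
    apply functional_extensionality. intros y. ring. }
  assert (Ha : forall s t, is_real t -> Cmod t < e -> avg (u s t) = (kap ((r0 + Re t)%R * ei s) * scaled_coef fr n (r0 + Re t) s)%C).
  { intros s t Pt Ht. pose proof (Hreal t Pt Ht) as H. rewrite (Hg s t Pt Ht), avg_scal; [unfold scaled_coef, fiber_coef; ring|].
    apply (fiber_coef_cont_in S). lra. }
  destruct (PSon_avg is_real (W * M) e (fun s t => avg (u s t))) as [a A].
  - apply real_acc.
  - intros s. apply (PSon_avg is_real (W * M) e (fun y t => u s t y)); [apply real_acc|intros y; apply Hu|].
    intros t Pt Ht. change (ccont (u s t)). rewrite (Hg s t Pt Ht). apply ccont_mult; [apply ccont_const|]. apply (fiber_coef_cont_in S).
    pose proof (Hreal t Pt Ht). lra.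
  - intros t Pt Ht. pose proof (Hreal t Pt Ht) as H. intros s.
    apply ccont_at_ext with (fun s => kap ((r0 + Re t)%R * ei s) * scaled_coef fr n (r0 + Re t) s)%C; [intros s'; symmetry; apply Ha; auto|].
    apply ccont_at_mult.
    + apply (cdiff_ccont_at kap (fun s => (r0 + Re t)%R * ei s)%C).
      * apply ccont_at_mult; [apply ccont_at_const|]. apply ccont_at_ext with (fun s => ei (1 * s)); [intros; f_equal; ring|apply ccont_at_ei].
      * apply Hk. rewrite Cmod_ei_mul, Cmod_R, (Rabs_right (r0 + Re t)) by lra. destruct (He' t Ht) as [_ [_ [T _]]].
        replace (r0 + Re t - r0) with (Re t) by ring. eapply Rle_lt_trans; [apply re_le_Cmod|auto].
    + apply ccont_at_mult; [apply ccont_at_const|apply (fiber_coef_cont S); lra].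
  - exists (W * M), e, a. destruct A as [A1 [A2 A3]]. split; [auto|split; [auto|]]. intros t Pt Ht.
    specialize (A3 t Pt Ht). cbv beta in A3. erewrite avg_ext; [apply A3|]. intros s. cbv beta. rewrite Ha; auto.
Qed.

(** For [n <= 0] the scaling factor is at most [1]. For [n > 0] let [p = sqrt (1 - r ^ 2)]: in the
    complexification the pair of second coordinates [(p * z, p / z)] is admissible for
    [1 <= |z| <= d / (2 * p)]. Moving the fibre integral from [|z| = 1] to the outer circle gains
    the factor [(2 * p / d) ^ n], which cancels the division by [p ^ n]. *)
Lemma scaled_coef_bounded n : exists r1 B, 0 < r1 < 1 /\ forall r t, r1 < r < 1 -> Cmod (scaled_coef fr n r t) <= B.
Proof.
  pose proof S as [_ [HE [HL _]]]. pose proof HE as [Hd HE'].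
  assert (Hcase : (n <= 0)%Z \/ (0 < n)%Z) by lia. destruct Hcase as [Hn|Hn].
  { exists (1/2), M. split; [lra|]. intros r t Hr. unfold scaled_coef. rewrite Cmod_mult.
    assert (0 < sqrt (1 - r ^ 2)) by (apply sqrt_lt_R0; nra).
    assert (sqrt (1 - r ^ 2) <= 1). { rewrite <- sqrt_1 at 2. apply sqrt_le_1_alt. nra. }
    rewrite Cmod_zp by (intros A; apply RtoC_inj in A; lra). destruct Z_le_dec; [|lia].
    rewrite Cmod_R, Rabs_right by lra.
    pose proof (fiber_coef_bound S n r t ltac:(lra)). pose proof (Cmod_ge_0 (fiber_coef fr n r t)).
    assert (sqrt (1 - r ^ 2) ^ Z.to_nat (- n) <= 1). { eapply Rle_trans; [apply (pow_incr _ 1); lra|rewrite pow1; lra]. }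
    pose proof (pow_le (sqrt (1 - r ^ 2)) (Z.to_nat (- n)) ltac:(lra)). nra. }
  (* [1 - r < c] gives [p ^ 2 < 2 * c <= d ^ 2 / 4], so [p <= d / 2], and moves the first coordinate
     by less than [d]. *)
  set (c := Rmin (1/2) (Rmin d (d ^ 2 / 8))). assert (Hc : 0 < c) by (unfold c; repeat apply Rmin_pos; try lra; apply Rdiv_lt_0_compat; [apply pow_lt; auto|lra]).
  assert (Hc1 : c <= 1/2) by apply Rmin_l. assert (Hc2 : c <= d) by (eapply Rle_trans; [apply Rmin_r|apply Rmin_l]).
  assert (Hc3 : c <= d ^ 2 / 8) by (eapply Rle_trans; [apply Rmin_r|apply Rmin_r]).
  exists (1 - c), (M * (2 / d) ^ Z.to_nat n). split; [lra|]. intros r t Hr.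
  set (p := sqrt (1 - r ^ 2)). assert (Hp0 : 0 < 1 - r ^ 2) by nra.
  assert (Hpos : 0 < p) by (apply sqrt_lt_R0; auto). assert (Hpp : p * p = 1 - r ^ 2) by (apply sqrt_sqrt; lra).
  assert (Hpd : p <= d / 2). { apply Rnot_lt_le. intros A. nra. }
  set (N := Z.to_nat n). set (R1 := d / (2 * p)).
  assert (HR : 1 <= R1). { apply Rle_div_r; lra. }
  destruct (HE' (ei t) 0) as [E [E1 [E2 E3]]]. { rewrite Cmod_ei, Cmod_0. ring. }
  assert (Hnear : forall z, 1 <= Cmod z <= R1 -> near d (ei t) 0 (r * ei t) (p * z) (r * ei (- t)) (p * / z)).
  { intros z Hz. assert (Hz0 : z <> 0) by (intros A; rewrite A, Cmod_0 in Hz; lra). unfold near. rewrite ei_conj, Cconj_R.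
    assert (Z1 : forall y, Cmod (r * ei y - ei y) < d).
    { intros y. replace (r * ei y - ei y)%C with (RtoC (r - 1) * ei y)%C by (rewrite RtoC_minus; ring). rewrite Cmod_ei_mul, Cmod_R.
      apply Rabs_def1; lra. }
    split; auto. split; [|split; auto].
    - replace (p * z - 0)%C with (p * z)%C by ring. rewrite Cmod_mult, Cmod_R, Rabs_right by lra.
      apply Rle_lt_trans with (p * R1); [nra|]. unfold R1. replace (p * (d / (2 * p))) with (d / 2) by (field; lra). lra.
    - replace (p * / z - 0)%C with (p * / z)%C by ring. rewrite Cmod_mult, Cmod_R, Rabs_right, Cmod_inv by (auto; lra).
      assert (/ Cmod z <= 1). { rewrite <- Rinv_1. apply Rinv_le_contravar; lra. }
      assert (0 < / Cmod z) by (apply Rinv_0_lt_compat; lra). nra. }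
  set (h := fun z => (E (r * ei t) (p * z) (r * ei (- t)) (p * / z) * / z ^ N)%C).
  assert (Hnz : forall z, 1 <= Cmod z <= R1 -> z <> 0) by (intros z Hz A; rewrite A, Cmod_0 in Hz; lra).
  assert (Hh : forall z, 1 <= Cmod z <= R1 -> cdiff h z).
  { intros z Hz. specialize (Hnz z Hz). apply cdiff_mult.
    - apply (E3 (fun _ => r * ei t)%C (fun z => p * z)%C (fun _ => r * ei (- t))%C (fun z => p * / z)%C); auto using ldiff_const.
      + apply ldiff_all. intros; apply cdiff_mult; auto using cdiff_const, cdiff_id.
      + apply ldiff_mult; [apply ldiff_const|]. apply (ldiff_loc _ _ (Cmod z)); [apply Cmod_gt_0; auto|]. intros s Hs.
        apply (cdiff_inv (fun s => s)); [apply cdiff_id|]. intros A. rewrite A in Hs.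
        replace (0 - z)%C with (- z)%C in Hs by ring. rewrite Cmod_opp in Hs. lra.
    - apply (cdiff_inv (fun z => z ^ N)%C); [apply cdiff_pow, cdiff_id|apply Cpow_nz; auto]. }
  pose proof (avg_annulus h 1 R1 ltac:(lra) HR Hh) as HA.
  assert (Hgp : fiber_coef fr n r t = avg (fun s => h (1 * ei s)%C)).
  { apply avg_ext. intros s. unfold h. rewrite Cmult_1_l, ei_pow.
    assert (Ei : (/ ei s)%C = ei (- s)). { apply Cmult_cancel_l with (ei s); [apply ei_nz|]. rewrite Cinv_r, Cmult_comm, ei_neg_mul by apply ei_nz. auto. }
    rewrite Ei. fold p. pose proof (E2 (r * ei t) (p * ei s))%C as X. rewrite !Cmult_conj, !ei_conj, !Cconj_R in X.
    rewrite X.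
    - f_equal. apply Cmult_cancel_l with (ei (INR N * s)); [apply ei_nz|]. rewrite Cinv_r by apply ei_nz.
      rewrite <- ei_plus. rewrite <- ei_0. f_equal. unfold N. rewrite INR_IZR_INZ, Z2Nat.id by lia. ring.
    - apply circle_sphere. lra.
    - rewrite <- Ei. apply Hnear. rewrite Cmod_ei. lra. }
  unfold scaled_coef. fold p. rewrite Cmod_mult, Hgp, HA. rewrite Cmod_zp by (intros A; apply RtoC_inj in A; lra).
  destruct Z_le_dec; [lia|]. rewrite Z.opp_involutive. fold N. rewrite Cmod_R, Rabs_right by lra.
  assert (HB : Cmod (avg (fun s => h (R1 * ei s)%C)) <= M * / R1 ^ N).
  { assert (Hm : forall s, 1 <= Cmod (R1 * ei s) <= R1). { intros s. rewrite Cmod_ei_mul, Cmod_R, Rabs_right; lra. }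
    apply avg_bound.
    - intros s. apply (cdiff_ccont_at h (fun s => R1 * ei s)%C); [|apply Hh; auto].
      apply ccont_at_mult; [apply ccont_at_const|]. apply ccont_at_ext with (fun s => ei (1 * s)); [intros; f_equal; ring|apply ccont_at_ei].
    - intros s. unfold h. rewrite Cmod_mult, Cmod_inv, Cmod_pow by (apply Cpow_nz; auto).
      rewrite (Cmod_ei_mul R1), Cmod_R, (Rabs_right R1) by lra.
      apply Rmult_le_compat_r; [apply Rlt_le, Rinv_0_lt_compat, pow_lt; lra|]. apply E1. auto. }
  replace (M * (2 / d) ^ N) with (/ p ^ N * (M * / R1 ^ N)).
  - apply Rmult_le_compat_l; auto. apply Rlt_le, Rinv_0_lt_compat, pow_lt; auto.
  - assert (HpN : p ^ N <> 0) by (apply pow_nonzero; lra).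
    replace (/ R1 ^ N) with ((2 / d) ^ N * p ^ N).
    + field. auto.
    + rewrite <- pow_inv, <- Rpow_mult_distr. f_equal. unfold R1. field. lra.
Qed.

End Radius.

(** * Holomorphic functions of two variables *)

Definition hol2 (g : C -> C -> C) (d B : R) : Prop :=
  (forall x y, Cmod x < d -> Cmod y < d -> Cmod (g x y) <= B) /\
  (forall g1 g2 t, ldiff g1 t -> ldiff g2 t -> Cmod (g1 t) < d -> Cmod (g2 t) < d -> cdiff (fun s => g (g1 s) (g2 s)) t).

Lemma zero_of_real h rad B : 0 < rad -> (forall z, Cmod z < rad -> cdiff h z) -> (forall z, Cmod z < rad -> Cmod (h z) <= B) ->
  (forall x : R, Rabs x < rad -> h x = 0) -> forall z, Cmod z < rad -> h z = 0.
Proof.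
  intros HR Hd HB Hx z Hz.
  destruct (taylor h 0 rad B HR) as [a Ha].
  - intros w Hw. apply Hd. replace w with (w - 0)%C by ring. auto.
  - intros w Hw. apply HB. replace w with (w - 0)%C by ring. auto.
  - assert (A : forall k, a k = 0).
    { apply (PSon_zero (fun t => is_real t /\ t <> RtoC 0 /\ Cmod t < rad) B rad a (fun t => h (0 + t)%C)).
      - eapply PSon_mono; [| | | |apply Ha]; [intros; exact I|lra|lra|lra].
      - intros t [Pt [Ht1 Ht2]]. split; auto. rewrite Cplus_0_l, Pt. apply Hx. rewrite Pt, Cmod_R in Ht2. auto.
      - intros e He. destruct (real_acc (Rmin e rad)) as [t [T1 [T2 T3]]]; [apply Rmin_pos; auto|].
        apply Rmin_Rgt in T3 as [T3 T4]. exists t. auto. }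
    destruct Ha as [_ [_ Ha]]. specialize (Ha z I Hz). cbv beta in Ha. rewrite Cplus_0_l in Ha.
    eapply cser_unique; [apply Ha|]. eapply cser_ext; [|apply (cser_finite (fun _ => RtoC 0) 0); auto].
    intros k. simpl. rewrite A. ring.
Qed.

Lemma ldiff_affine (c e : C) t : ldiff (fun s => c + e * s)%C t.
Proof. apply ldiff_all. intros s. apply cdiff_plus; [apply cdiff_const|]. apply cdiff_mult; auto using cdiff_const, cdiff_id. Qed.

(* The totally real plane [y = Cconj x] is a uniqueness set: with [x = s + i t] and [y = s - i t] it is given by real [s] and [t]. *)
Lemma hol2_unique g g' d B B' : hol2 g d B -> hol2 g' d B' -> 0 < d ->
  (forall x, Cmod x < d -> g x (Cconj x) = g' x (Cconj x)) ->
  forall x y, Cmod x < d / 2 -> Cmod y < d / 2 -> g x y = g' x y.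
Proof.
  intros [G1 G2] [G1' G2'] Hd Heq.
  set (k := fun s t : C => (g (s + Ci * t) (s - Ci * t) - g' (s + Ci * t) (s - Ci * t))%C).
  assert (Hb : forall s t c, Cmod c = 1 -> Cmod s < d / 2 -> Cmod t < d / 2 -> Cmod (s + c * t) < d).
  { intros s t c Hc Hs Ht. eapply Rle_lt_trans; [apply Cmod_triangle|]. rewrite Cmod_mult, Hc. lra. }
  assert (HCi : Cmod (- Ci) = 1) by (rewrite Cmod_opp; apply Cmod_Ci).
  assert (Em : forall s t : C, (s - Ci * t)%C = (s + - Ci * t)%C) by (intros; ring).
  assert (Hkb : forall s t, Cmod s < d / 2 -> Cmod t < d / 2 -> Cmod (k s t) <= B + B').
  { intros s t Hs Ht. unfold k. eapply Rle_trans; [apply Cmod_tri_minus|]. rewrite Em. apply Rplus_le_compat; [apply G1|apply G1']; apply Hb; auto using Cmod_Ci. }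
  assert (Kt : forall s t, Cmod s < d / 2 -> Cmod t < d / 2 -> cdiff (k s) t).
  { intros s t Hs Ht.
    assert (L1 : ldiff (fun t => s + Ci * t)%C t) by apply ldiff_affine.
    assert (L2 : ldiff (fun t => s - Ci * t)%C t) by (apply ldiff_minus; [apply ldiff_const|apply (ldiff_mult (fun _ => Ci)); [apply ldiff_const|apply ldiff_all; intros; apply cdiff_id]]).
    apply cdiff_minus; [apply (G2 _ _ t L1 L2)|apply (G2' _ _ t L1 L2)]; try rewrite Em; apply Hb; auto using Cmod_Ci. }
  assert (Ks : forall s t, Cmod s < d / 2 -> Cmod t < d / 2 -> cdiff (fun s => k s t) s).
  { intros s t Hs Ht.
    assert (L1 : ldiff (fun s => s + Ci * t)%C s) by (apply ldiff_plus; [apply ldiff_all; intros; apply cdiff_id|apply ldiff_const]).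
    assert (L2 : ldiff (fun s => s - Ci * t)%C s) by (apply ldiff_minus; [apply ldiff_all; intros; apply cdiff_id|apply ldiff_const]).
    apply cdiff_minus; [apply (G2 _ _ s L1 L2)|apply (G2' _ _ s L1 L2)]; try rewrite Em; apply Hb; auto using Cmod_Ci. }
  assert (K0 : forall s t, Cmod s < d / 2 -> Cmod t < d / 2 -> k s t = 0).
  { intros s t Hs Ht. apply (zero_of_real (fun s => k s t) (d / 2) (B + B')); auto; [lra|]. clear s Hs. intros s Hs.
    apply (zero_of_real (k s) (d / 2) (B + B')); auto; [lra|intros; apply Kt; auto; rewrite Cmod_R; auto|intros; apply Hkb; auto; rewrite Cmod_R; auto|].
    clear t Ht. intros t Ht. unfold k. replace (s - Ci * t)%C with (Cconj (s + Ci * t)).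
    - rewrite Heq; [ring|]. apply Hb; [apply Cmod_Ci| |]; rewrite Cmod_R; auto.
    - apply C_eq; simpl; ring. }
  intros x y Hx Hy. apply Ceq_sub.
  assert (E1 : ((x + y) / 2 + Ci * ((x - y) / (2 * Ci)))%C = x). { field. apply Ci_nz. }
  assert (E2 : ((x + y) / 2 - Ci * ((x - y) / (2 * Ci)))%C = y). { field. apply Ci_nz. }
  pose proof (K0 ((x + y) / 2)%C ((x - y) / (2 * Ci))%C) as K. unfold k in K. rewrite E1, E2 in K. apply K.
  - pose proof (Cmod_half x y). lra.
  - pose proof (Cmod_half' x y). lra.
Qed.

Lemma avg_cdiff (u : R -> C -> C) B t e : 0 < e -> (forall x s, Cmod (s - t) < e -> cdiff (u x) s) ->
  (forall x s, Cmod (s - t) < e -> Cmod (u x s) <= B) -> (forall s, Cmod (s - t) < e -> ccont (fun x => u x s)) ->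
  cdiff (fun s => avg (fun x => u x s)) t.
Proof.
  intros He Hd HB Hc.
  destruct (PSon_avg (fun _ => True) B e (fun x s => u x (t + s)%C)) as [a Ha].
  - intros e' He'. destruct (real_acc e' He') as [s [_ Hs]]. exists s. auto.
  - intros x. apply taylor; auto.
  - intros s _ Hs. apply Hc. replace (t + s - t)%C with s by ring. auto.
  - apply cdiff_ext with (fun s => avg (fun x => u x (t + (s - t)))%C).
    { intros s. apply avg_ext. intros x. f_equal. ring. }
    apply (cdiff_comp (fun s => s - t)%C (fun h => avg (fun x => u x (t + h))%C)).
    + apply cdiff_minus; auto using cdiff_id, cdiff_const.
    + replace (t - t)%C with (RtoC 0) by ring. eapply PSon_cdiff; [apply Ha|]. rewrite Cmod_0. auto.
Qed.

Lemma ldiff_near g t d : ldiff g t -> Cmod (g t) < d -> exists e, 0 < e /\ forall s, Cmod (s - t) < e -> ldiff g s /\ Cmod (g s) < d.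
Proof.
  intros Hg Hd. destruct (ldiff_cont g t Hg (d - Cmod (g t))) as [e1 [He1 H1]]; [lra|].
  destruct Hg as [r [Hr H]]. exists (Rmin r e1). split; [apply Rmin_pos; auto|]. intros s Hs. apply Rmin_Rgt in Hs as [Hs1 Hs2].
  split.
  - exists (r - Cmod (s - t)). split; [lra|]. intros w Hw. apply H. pose proof (Cmod_tri_sub w s t). lra.
  - specialize (H1 s Hs2). pose proof (Cmod_le_add (g s) (g t)). lra.
Qed.

Lemma hol2_avg (G : R -> C -> C -> C) d B : (forall x, hol2 (G x) d B) ->
  (forall y z, Cmod y < d -> Cmod z < d -> ccont (fun x => G x y z)) -> hol2 (fun y z => avg (fun x => G x y z)) d B.
Proof.
  intros H Hc. split.
  - intros y z Hy Hz. apply avg_bound; auto. intros x. apply (H x); auto.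
  - intros g1 g2 t L1 L2 B1 B2. destruct (ldiff_near g1 t d L1 B1) as [e1 [He1 H1]]. destruct (ldiff_near g2 t d L2 B2) as [e2 [He2 H2]].
    apply (avg_cdiff (fun x s => G x (g1 s) (g2 s)) B t (Rmin e1 e2)); [apply Rmin_pos; auto| | |];
      intros; match goal with K : _ < Rmin _ _ |- _ => apply Rmin_Rgt in K as [K1 K2] end;
      destruct (H1 _ K1); destruct (H2 _ K2); auto; apply (H x); auto.
Qed.

Lemma hol2_mult g g' d B B' : hol2 g d B -> hol2 g' d B' -> hol2 (fun x y => g x y * g' x y)%C d (B * B').
Proof.
  intros [G1 G2] [G1' G2']. split.
  - intros x y Hx Hy. rewrite Cmod_mult. apply Rmult_le_compat; auto using Cmod_ge_0.
  - intros g1 g2 t L1 L2 B1 B2. apply cdiff_mult; auto.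
Qed.

Lemma hol2_mono g d d' B : d' <= d -> hol2 g d B -> hol2 g d' B.
Proof. intros H [G1 G2]. split; intros; [apply G1|apply G2]; auto; lra. Qed.

(** In the applications [k] is [1] or [-1]; the latter is the circle run backwards, as the conjugate
    variable runs through it. *)
Lemma PSon_mode M d a h x (k : Z) m : PSon (fun _ => True) M d a h -> 0 < x < d -> k <> 0%Z ->
  ccont (fun t => h (x * ei (IZR k * t)))%C ->
  avg (fun t => h (x * ei (IZR k * t)) * ei (- IZR k * INR m * t))%C = (a m * x ^ m)%C.
Proof.
  intros Ha Hx Hk Hc. apply Ceq_sub, Cmod_small_0. intros e He.
  assert (Hm : forall t, Cmod (x * ei (IZR k * t)) = x). { intros t. rewrite Cmod_ei_mul, Cmod_R, Rabs_right; lra. }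
  pose proof (PSon_M _ _ _ _ _ Ha) as HM.
  destruct (PSon_geo _ _ _ _ _ x Ha) as [Hq _]; [rewrite Cmod_R, Rabs_right; lra|]. rewrite Cmod_R, Rabs_right in Hq by lra.
  destruct (pow_small (x / d) (e * (1 - x / d) / (M + 1))) as [N HN]; auto.
  { apply Rdiv_lt_0_compat; [apply Rmult_lt_0_compat; lra|lra]. }
  set (n := (N + S m)%nat).
  assert (Hn : (x / d) ^ n <= (x / d) ^ N).
  { unfold n. rewrite pow_add. pose proof (pow_le (x / d) N ltac:(lra)).
    assert ((x / d) ^ S m <= 1) by (rewrite <- (pow1 (S m)); apply pow_incr; lra). nra. }
  assert (E : avg (fun t => csum (fun j => a j * (x * ei (IZR k * t)) ^ j) n * ei (- IZR k * INR m * t))%C = (a m * x ^ m)%C).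
  { rewrite (avg_ext _ (fun t => csum (fun j => a j * x ^ j * ei (IZR (k * (Z.of_nat j - Z.of_nat m)) * t)) n)%C).
    2:{ intros t. rewrite Cmult_comm, <- csum_scal. apply csum_ext. intros j _. rewrite Cpow_mult_l, ei_pow.
        replace (IZR (k * (Z.of_nat j - Z.of_nat m)) * t) with (- IZR k * INR m * t + INR j * (IZR k * t)).
        - rewrite ei_plus. ring.
        - rewrite mult_IZR, minus_IZR, <- !INR_IZR_INZ. ring. }
    rewrite (avg_csum (fun j t => a j * x ^ j * ei (IZR (k * (Z.of_nat j - Z.of_nat m)) * t))%C).
    2:{ intros j. apply ccont_mult; [apply ccont_const|apply ccont_ei]. }
    rewrite (csum_ext _ (fun j => if Nat.eq_dec j m then a m * x ^ m else 0)%C).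
    - unfold n. rewrite (csum_trunc _ (S m)); [|lia|].
      + simpl. destruct Nat.eq_dec; [|lia]. rewrite csum_eq0; [ring|]. intros j Hj. destruct Nat.eq_dec; [lia|auto].
      + intros j Hj. destruct Nat.eq_dec; [lia|auto].
    - intros j _. rewrite avg_scal by apply ccont_ei. destruct Nat.eq_dec as [->|Hj].
      + rewrite (avg_ext _ (fun _ => RtoC 1)), avg_const; [ring|]. intros t. rewrite Z.sub_diag, Z.mul_0_r. rewrite <- ei_0. f_equal. ring.
      + rewrite avg_ei; [ring|]. intros A. apply Z.mul_eq_0 in A. lia. }
  rewrite <- E. eapply Rle_trans.
  - apply (avg_close _ _ (M * (x / d) ^ n / (1 - x / d))).
    + apply ccont_mult; [auto|apply ccont_ei].
    + apply ccont_mult; [|apply ccont_ei]. apply ccont_csum. intros j.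
      intros t. apply (cdiff_ccont_at (fun z => a j * z ^ j)%C (fun t => x * ei (IZR k * t))%C).
      * apply ccont_at_mult; [apply ccont_at_const|apply ccont_at_ei].
      * apply cdiff_mult; [apply cdiff_const|apply cdiff_pow, cdiff_id].
    + intros t. rewrite Cmod_sub_sym.
      replace (csum (fun j => a j * (x * ei (IZR k * t)) ^ j) n * ei (- IZR k * INR m * t) - h (x * ei (IZR k * t)) * ei (- IZR k * INR m * t))%C
        with ((csum (fun j => a j * (x * ei (IZR k * t)) ^ j) n - h (x * ei (IZR k * t))) * ei (- IZR k * INR m * t))%C by ring.
      rewrite Cmod_ei_mul. pose proof (PSon_tail _ _ _ _ _ (x * ei (IZR k * t))%C Ha I) as T. rewrite Hm in T. apply T. lra.
  - apply Rle_div_l; [lra|]. apply Rlt_div_r in HN; [|lra]. pose proof (pow_le (x / d) n ltac:(lra)). nra.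
Qed.

Lemma ccont_ei_plain : ccont ei.
Proof. intros t. apply ccont_at_ext with (fun s => ei (1 * s)); [intros; f_equal; ring|apply ccont_at_ei]. Qed.

(** Write [K] as the sum of [c i j * x ^ i * y ^ j]. On [(x * ei t, x * ei (- t))] the moment of
    frequency [l] picks the terms with [j = i + l], so the sum over [i] of
    [c i (i + l) * x ^ (2 * i)] vanishes for all small [x]. As a power series in [x ^ 2] it is zero,
    which leaves [j <= i]. *)
Lemma hol2_circle K d B : 0 < d -> hol2 K d B ->
  (forall x l, 0 < x < d -> (0 < l)%nat -> avg (fun t => K (x * ei t) (x * ei (- t)) * ei (INR l * t))%C = 0) ->
  exists (p : nat -> C -> C) (c : nat -> nat -> C),
    (forall y, Cmod y < d -> PSon (fun _ => True) B d (fun i => p i y) (fun x => K x y)) /\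
    (forall i y, Cmod y < d -> p i y = csum (fun j => c i j * y ^ j)%C (S i)).
Proof.
  intros Hd [K1 K2] Hcirc.
  assert (Lid : forall t, ldiff (fun s => s) t) by (intros; apply ldiff_all; intros; apply cdiff_id).
  assert (Hp : forall y, exists a, Cmod y < d -> PSon (fun _ => True) B d a (fun x => K x y)).
  { intros y. destruct (Rlt_dec (Cmod y) d) as [Hy|Hy]; [|exists (fun _ => RtoC 0); intros; lra].
    destruct (taylor (fun x => K x y) 0 d B Hd) as [a Ha].
    - intros x Hx. replace (x - 0)%C with x in Hx by ring. apply (K2 (fun s => s) (fun _ => y)); auto using ldiff_const.
    - intros x Hx. replace (x - 0)%C with x in Hx by ring. auto.
    - exists a. intros _. destruct Ha as [A1 [A2 A3]]. split; [auto|split; [auto|]]. intros t _ Ht.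
      specialize (A3 t I Ht). cbv beta in A3. rewrite Cplus_0_l in A3. auto. }
  apply fun_choice in Hp as [a Ha]. set (p := fun i y => a y i).
  set (x0 := d / 2).
  assert (Hm : forall x t, 0 < x < d -> Cmod (x * ei t) < d). { intros x t Hx. rewrite Cmod_ei_mul, Cmod_R, Rabs_right; lra. }
  assert (Hcurve : forall x k, ccont (fun t => x * ei (IZR k * t))%C). { intros x k. apply ccont_mult; [apply ccont_const|apply ccont_ei]. }
  assert (HKc : forall x y, 0 < x < d -> Cmod y < d -> ccont (fun t => K (x * ei (IZR 1 * t)) y)%C).
  { intros x y Hx Hy t. apply (cdiff_ccont_at (fun s => K s y) (fun t => x * ei (IZR 1 * t))%C); [apply Hcurve|].
    apply (K2 (fun s => s) (fun _ => y)); auto using ldiff_const. }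
  assert (Hpm : forall i y, Cmod y < d -> p i y = (/ x0 ^ i * avg (fun t => K (x0 * ei (IZR 1 * t)) y * ei (- IZR 1 * INR i * t)))%C).
  { intros i y Hy. assert (Hx0 : 0 < x0 < d) by (unfold x0; lra).
    rewrite (PSon_mode B d (a y) (fun x => K x y) x0 1 i); auto; [|lia].
    unfold p. field. apply Cpow_nz. intros A. apply RtoC_inj in A. lra. }
  assert (Hpd : forall i y, Cmod y < d -> cdiff (p i) y).
  { intros i y Hy. apply cdiff_ext_loc with (fun y => / x0 ^ i * avg (fun t => K (x0 * ei (IZR 1 * t)) y * ei (- IZR 1 * INR i * t)))%C (d - Cmod y).
    - lra.
    - intros w Hw. symmetry. apply Hpm. pose proof (Cmod_le_add w y). lra.
    - apply cdiff_mult; [apply cdiff_const|].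
      apply (avg_cdiff (fun t y => K (x0 * ei (IZR 1 * t)) y * ei (- IZR 1 * INR i * t))%C B y (d - Cmod y)); [lra| | |];
        intros; assert (Hs : Cmod s < d) by (pose proof (Cmod_le_add s y); lra); assert (Hx0 : 0 < x0 < d) by (unfold x0; lra).
      + apply cdiff_mult; [|apply cdiff_const]. apply (K2 (fun _ => x0 * ei (IZR 1 * x))%C (fun y => y)); auto using ldiff_const.
      + rewrite Cmod_ei_mul. auto.
      + apply ccont_mult; [auto|apply ccont_ei]. }
  assert (Hpb : forall i y, Cmod y < d -> Cmod (p i y) <= B / d ^ i). { intros i y Hy. destruct (Ha y Hy) as [_ [A _]]. apply A. }
  assert (Hc : forall i, exists c, PSon (fun _ => True) (B / d ^ i) d c (p i)).
  { intros i. destruct (taylor (p i) 0 d (B / d ^ i) Hd) as [c Hc].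
    - intros x Hx. replace (x - 0)%C with x in Hx by ring. auto.
    - intros x Hx. replace (x - 0)%C with x in Hx by ring. auto.
    - exists c. destruct Hc as [A1 [A2 A3]]. split; [auto|split; [auto|]]. intros t _ Ht.
      specialize (A3 t I Ht). cbv beta in A3. rewrite Cplus_0_l in A3. auto. }
  apply fun_choice in Hc as [c Hc].
  assert (Hdn : forall m, 0 < d ^ m) by (intros; apply pow_lt; auto).
  assert (HB : 0 <= B). { eapply PSon_M, (Ha 0). rewrite Cmod_0. auto. }
  (* Integrating the expansion along the circle of radius [x] isolates the coefficients [c i (i + l)]. *)
  assert (Hz : forall l, (0 < l)%nat -> forall i, c i (i + l)%nat = 0).
  { intros l Hl. apply (PSon_zero (fun t => exists x, 0 < x < d /\ t = RtoC (x ^ 2)) (B / d ^ l) (d ^ 2) (fun i => c i (i + l)%nat) (fun _ => RtoC 0)).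
    - split; [auto|split].
      + intros i. destruct (Hc i) as [_ [A _]]. specialize (A (i + l)%nat). rewrite pow_add in A.
        replace (B / d ^ l / (d ^ 2) ^ i) with (B / d ^ i / (d ^ i * d ^ l)); auto. rewrite <- pow_mult. simpl Nat.mul. rewrite Nat.add_0_r, pow_add. pose proof (Hdn i). pose proof (Hdn l). field. lra.
      + intros t [x [Hx ->]] _.
        assert (Hxq : 0 <= x / d < 1). { split; [apply Rle_div_r; lra|apply Rlt_div_l; lra]. }
        apply cser_of_tail with (B / (1 - x / d) / x ^ l) (x / d); auto.
        { assert (0 < x ^ l) by (apply pow_lt; lra). apply Rlt_le in H. apply Rmult_le_pos; [apply Rmult_le_pos; auto; apply Rlt_le, Rinv_0_lt_compat; lra|apply Rlt_le, Rinv_0_lt_compat, pow_lt; lra]. }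
        intros n. replace (csum (fun k => c k (k + l)%nat * RtoC (x ^ 2) ^ k) n - 0)%C with (csum (fun k => c k (k + l)%nat * RtoC (x ^ 2) ^ k) n)%C by ring.
        assert (E : (RtoC (x ^ l) * csum (fun k => c k (k + l)%nat * RtoC (x ^ 2) ^ k) n)%C =
          avg (fun t => csum (fun k => p k (x * ei (- t)) * (x * ei t) ^ k) n * ei (INR l * t))%C).
        { rewrite (avg_ext _ (fun t => csum (fun k => x ^ k * (p k (x * ei (IZR (-1) * t)) * ei (- IZR (-1) * INR (k + l) * t))) n)%C).
          2:{ intros t. rewrite Cmult_comm, <- csum_scal. apply csum_ext. intros k _. rewrite Cpow_mult_l, ei_pow.
              replace (IZR (-1) * t) with (- t) by ring. replace (- IZR (-1) * INR (k + l) * t) with (INR l * t + INR k * t) by (rewrite plus_INR; ring).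
              rewrite ei_plus. ring. }
          assert (Hpc : forall k, ccont (fun t => p k (x * ei (IZR (-1) * t)))%C).
          { intros k t. apply (cdiff_ccont_at (p k) (fun t => x * ei (IZR (-1) * t))%C); [apply Hcurve|]. apply Hpd. auto. }
          rewrite (avg_csum (fun k t => x ^ k * (p k (x * ei (IZR (-1) * t)) * ei (- IZR (-1) * INR (k + l) * t)))%C).
          2:{ intros k. apply ccont_mult; [apply ccont_const|]. apply ccont_mult; [auto|apply ccont_ei]. }
          rewrite <- csum_scal. apply csum_ext. intros k _.
          rewrite avg_scal by (apply ccont_mult; [auto|apply ccont_ei]).
          rewrite (PSon_mode (B / d ^ k) d (c k) (p k) x (-1) (k + l)); auto; [|lia].
          rewrite !RtoC_pow, <- Cpow_mult_r, Cpow_add_r. replace (2 * k)%nat with (k + k)%nat by lia. rewrite Cpow_add_r. ring. }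
        assert (Hxl : 0 < x ^ l) by (apply pow_lt; lra).
        assert (E2 : Cmod (RtoC (x ^ l) * csum (fun k => c k (k + l)%nat * RtoC (x ^ 2) ^ k)%C n) <= B * (x / d) ^ n / (1 - x / d)).
        { rewrite E. pose proof (Hcirc x l Hx Hl) as Z.
          replace (avg (fun t => csum (fun k => p k (x * ei (- t)) * (x * ei t) ^ k) n * ei (INR l * t)))%C with
            (avg (fun t => csum (fun k => p k (x * ei (- t)) * (x * ei t) ^ k) n * ei (INR l * t)) - avg (fun t => K (x * ei t) (x * ei (- t)) * ei (INR l * t)))%C by (rewrite Z; ring).
          assert (Hr : forall f : C -> C, (forall y, Cmod y < d -> cdiff f y) -> ccont (fun t => f (x * ei (- t)))%C).
          { intros f Hf t. apply (cdiff_ccont_at f (fun t => x * ei (- t))%C); [|apply Hf; auto].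
            apply ccont_at_ext with (fun t => x * ei (IZR (-1) * t))%C; [intros; do 2 f_equal; ring|apply Hcurve]. }
          apply avg_close.
          - apply ccont_mult; [|apply ccont_ei]. apply ccont_csum. intros k. apply ccont_mult; [apply Hr; auto|].
            intros t. apply (cdiff_ccont_at (fun z => z ^ k)%C (fun t => x * ei t)%C); [|apply cdiff_pow, cdiff_id].
            apply ccont_at_mult; [apply ccont_at_const|apply ccont_ei_plain].
          - apply ccont_mult; [|apply ccont_ei]. intros t.
            apply ccont_at_ext with (fun s => K (x * Cexp (Ci * RtoC s)) (x * Cexp (- Ci * RtoC s)))%C.
            { intros s. rewrite Cexp_im. replace (- Ci * s)%C with (Ci * RtoC (- s))%C by (rewrite RtoC_opp; ring). rewrite Cexp_im. auto. }
            assert (LC : forall c z, ldiff (fun s => x * Cexp (c * s))%C z).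
            { intros c' z. apply ldiff_mult; [apply ldiff_const|]. apply ldiff_all. intros s.
              apply (cdiff_comp (fun s => c' * s)%C Cexp); [apply cdiff_mult; [apply cdiff_const|apply cdiff_id]|eexists; apply cder_Cexp]. }
            apply (cdiff_ccont_at (fun s => K (x * Cexp (Ci * s)) (x * Cexp (- Ci * s)))%C RtoC).
            + intros e He. exists e. split; auto. intros s Hs. rewrite <- RtoC_minus, Cmod_R. auto.
            + apply (K2 (fun s => x * Cexp (Ci * s))%C (fun s => x * Cexp (- Ci * s))%C); auto.
              * rewrite Cexp_im; auto.
              * replace (- Ci * t)%C with (Ci * RtoC (- t))%C by (rewrite RtoC_opp; ring). rewrite Cexp_im. auto.
          - intros t. replace (csum (fun k => p k (x * ei (- t)) * (x * ei t) ^ k) n * ei (INR l * t) - K (x * ei t) (x * ei (- t)) * ei (INR l * t))%C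
              with ((csum (fun k => p k (x * ei (- t)) * (x * ei t) ^ k) n - K (x * ei t) (x * ei (- t))) * ei (INR l * t))%C by ring.
            rewrite Cmod_ei_mul. pose proof (PSon_tail _ _ _ _ _ (x * ei t)%C (Ha (x * ei (- t))%C (Hm x (- t) Hx)) I) as T.
            rewrite Cmod_ei_mul, Cmod_R, Rabs_right in T by lra. apply T. lra. }
        rewrite Cmod_mult, Cmod_R, Rabs_right in E2 by lra.
        replace (B / (1 - x / d) / x ^ l * (x / d) ^ n) with (B * (x / d) ^ n / (1 - x / d) / x ^ l) by (unfold Rdiv; ring).
        apply Rle_div_r; auto. lra.
    - intros t [x [Hx ->]]. split; auto. intros A. apply RtoC_inj in A. assert (0 < x ^ 2) by (apply pow_lt; lra). lra.
    - intros e He. set (x := Rmin (d / 2) (Rmin 1 (e / 2))). assert (0 < x) by (unfold x; repeat apply Rmin_pos; lra).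
      assert (x <= d / 2) by apply Rmin_l. assert (x <= 1) by (eapply Rle_trans; [apply Rmin_r|apply Rmin_l]).
      assert (x <= e / 2) by (eapply Rle_trans; [apply Rmin_r|apply Rmin_r]).
      exists (RtoC (x ^ 2)). split; [exists x; split; auto; lra|]. rewrite Cmod_R, Rabs_right by nra. nra. }
  exists p, c. split; [intros y Hy; apply Ha; auto|].
  intros i y Hy. destruct (Hc i) as [_ [_ A]]. eapply cser_unique; [apply A; auto|].
  apply cser_finite. intros k Hk. replace k with (i + (k - i))%nat by lia. rewrite Hz by lia. ring.
Qed.

(** * The local two-variable extension at the point [b] *)

Definition mob (b : R) (x : C) : C := ((x + b) / (1 + b * x))%C.

Lemma prod_close (x y : C) a c : Cmod (x - 1) <= a -> Cmod (y - 1) <= c -> Cmod (x * y - 1) <= a + c + a * c.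
Proof.
  intros Hx Hy. replace (x * y - 1)%C with ((x - 1) + (y - 1) + (x - 1) * (y - 1))%C by ring.
  pose proof (Cmod_triangle (x - 1 + (y - 1)) ((x - 1) * (y - 1))) as T1. pose proof (Cmod_triangle (x - 1) (y - 1)) as T2.
  rewrite Cmod_mult in T1. pose proof (Cmod_ge_0 (x - 1)). pose proof (Cmod_ge_0 (y - 1)). nra.
Qed.

Lemma den_close (b : R) (x : C) : 0 < b < 1 -> Cmod x <= 1/2 ->
  (1 + b * x)%C <> 0 /\ Cmod (/ (1 + b * x) - 1) <= 2 * Cmod x.
Proof.
  intros Hb Hx. assert (Hn : (1 + b * x)%C <> 0) by (apply mobius_den; lra).
  split; auto. replace (/ (1 + b * x) - 1)%C with (- (b * x) / (1 + b * x))%C by (field; auto).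
  rewrite Cmod_div, Cmod_opp, Cmod_mult, Cmod_R, Rabs_right by (auto; lra). apply Rle_div_l; [apply Cmod_gt_0; auto|].
  pose proof (Cmod_tri_sub (1 + b * x) 1 (- (b * x)%C)) as T. pose proof (Cmod_triangle (1 + b * x) (- (b * x))) as T2.
  replace (1 + b * x + - (b * x))%C with (RtoC 1) in T2 by ring. rewrite Cmod_1, Cmod_opp, Cmod_mult, Cmod_R, Rabs_right in T2 by lra.
  pose proof (Cmod_ge_0 x). nra.
Qed.

Lemma mob_conj b x : 0 < b < 1 -> Cmod x <= 1 -> mob b (Cconj x) = Cconj (mob b x).
Proof.
  intros Hb Hx. unfold mob. rewrite Cdiv_conj by (apply mobius_den; lra).
  rewrite !Cplus_conj, Cmult_conj, !Cconj_R. auto.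
Qed.

Section Local.
Context {fr : C -> C -> C} {b d M L : R} (S : setup fr b d M L).

Let kap := sqrt (1 - b ^ 2).

Lemma kap_pos : 0 < kap < 1 /\ kap * kap = 1 - b ^ 2.
Proof.
  destruct S as [Hb _]. assert (0 < 1 - b ^ 2) by nra. assert (E : kap * kap = 1 - b ^ 2) by (apply sqrt_sqrt; lra).
  assert (0 < kap) by (apply sqrt_lt_R0; auto). split; auto. nra.
Qed.

(** The second coordinate of the image of [(x, sqrt (1 - |x| ^ 2) * ei (y + s))] under the
    automorphism of the ball; the first one is [mob b x]. *)
Definition sphere_sec (x : C) (y s : R) : C := (kap * (sqrt (1 - Cmod x ^ 2) * ei (y + s)) / (1 + b * x))%C.

(** Small enough that the perturbations of exponential, root and denominator together move a point
    by less than [d]. *)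
Let del := Rmin (1/24) (d/24).

Lemma del_pos : 0 < del /\ del <= 1/24 /\ del <= d / 24.
Proof. destruct S as [_ [[Hd _] _]]. split; [apply Rmin_pos; lra|split; [apply Rmin_l|apply Rmin_r]]. Qed.

Lemma sphere_sec_sphere x t : Cmod x < 1 -> Cmod (mob b x) ^ 2 + Cmod (sphere_sec x t 0) ^ 2 = 1.
Proof.
  intros Hx. pose proof S as [Hb _]. pose proof kap_pos as [Hk Hkk].
  assert (Hn : (1 + b * x)%C <> 0) by (apply mobius_den; lra).
  assert (H1 : 0 <= 1 - Cmod x ^ 2) by (pose proof (Cmod_ge_0 x); nra).
  pose proof (mobius_sphere b kap x (sqrt (1 - Cmod x ^ 2) * ei (t + 0)) ltac:(lra) ltac:(nra) Hn) as E.
  rewrite Cmod_ei_mul, Cmod_R, pow2_abs, (pow2_sqrt _ H1) in E. unfold mob, sphere_sec.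
  pose proof (Cmod_gt_0 (1 + b * x)) as [G _]. specialize (G Hn).
  assert (G2 : 0 < Cmod (1 + b * x) ^ 2) by (apply pow_lt; auto).
  apply Rmult_eq_reg_r with (Cmod (1 + b * x) ^ 2); [|lra]. lra.
Qed.

(* For fixed [y] the point [(mob b x, sphere_sec x y s)] runs over the sphere near [(b, kap e^{iy})]; the parameter [s] moves the base point. *)
Lemma local_family y : exists G : R -> C -> C -> C,
  (forall s, Rabs s < del -> hol2 (G s) del M) /\
  (forall s x, Rabs s < del -> Cmod x < del -> G s x (Cconj x) = fr (mob b x) (sphere_sec x y s)) /\
  (forall x z, Cmod x < del -> Cmod z < del -> ccont_at (fun s => G s x z) 0).
Proof.
  pose proof S as [Hb [[Hd HE] _]]. pose proof kap_pos as [Hk Hkk]. pose proof del_pos as [D0 [D1 D2]].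
  destruct (HE b (kap * ei y)%C) as [E [E1 [E2 E3]]].
  { rewrite Cmod_ei_mul, !Cmod_R, !pow2_abs. nra. }
  (* The second coordinate with [|x| ^ 2] replaced by [x * z]. The angle has a fixed real part [c]
     and a complexified part [s]; [w] is whichever of the two variables occurs in the
     denominator. *)
  set (a2 := fun (c : R) (s x z w : C) => (kap * ei c * (Cexp s * (Csqrt (1 - x * z) * / (1 + b * w))))%C).
  assert (Hxz : forall x z, Cmod x < del -> Cmod z < del -> Cmod (x * z) <= Cmod x / 24).
  { intros x z Hx Hz. rewrite Cmod_mult. pose proof (Cmod_ge_0 x). nra. }
  assert (Hm : forall x, Cmod x < del -> Cmod (mob b x - b) < d).
  { intros x Hx. destruct (den_close b x Hb ltac:(lra)) as [Hn Hc]. unfold mob.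
    replace ((x + b) / (1 + b * x) - b)%C with (RtoC (1 - b ^ 2) * (x * (/ (1 + b * x) - 1) + x))%C by (rewrite RtoC_minus, RtoC_pow; field; auto).
    rewrite Cmod_mult, Cmod_R, Rabs_right by nra.
    pose proof (Cmod_triangle (x * (/ (1 + b * x) - 1)) x) as T. rewrite Cmod_mult in T.
    pose proof (Cmod_ge_0 x). pose proof (Cmod_ge_0 (x * (/ (1 + b * x) - 1) + x)).
    assert (Cmod (x * (/ (1 + b * x) - 1) + x) <= 2 * Cmod x) by nra. nra. }
  assert (Ha : forall c s x z w, Cmod s < del -> Cmod x < del -> Cmod z < del -> Cmod w < del -> Cmod (a2 c s x z w - kap * ei c) < d).
  { intros c s x z w Hs Hx Hz Hw. unfold a2. set (v := (Cexp s * (Csqrt (1 - x * z) * / (1 + b * w)))%C).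
    replace (kap * ei c * v - kap * ei c)%C with (kap * ei c * (v - 1))%C by ring.
    rewrite Cmod_mult, Cmod_ei_mul, Cmod_R, Rabs_right by lra.
    destruct (den_close b w Hb ltac:(lra)) as [_ V1].
    pose proof (Hxz x z Hx Hz) as V2'. destruct (Csqrt_near_1 (x * z) ltac:(lra)) as [_ V2].
    pose proof (Cexp_close s ltac:(lra)) as V3.
    pose proof (prod_close (Csqrt (1 - x * z)) (/ (1 + b * w)) (del / 24) (2 * del) ltac:(lra) ltac:(lra)) as P1.
    pose proof (prod_close (Cexp s) _ (6 * del) _ ltac:(lra) P1) as P2. fold v in P2.
    assert (Cmod (v - 1) < d). { eapply Rle_lt_trans; [apply P2|]. nra. }
    pose proof (Cmod_ge_0 (v - 1)). nra. }
  assert (Hnear : forall s x z, Cmod s < del -> Cmod x < del -> Cmod z < del ->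
    near d b (kap * ei y) (mob b x) (a2 y (Ci * s)%C x z x) (mob b z) (a2 (- y)%R (- Ci * s)%C x z z)).
  { intros s x z Hs Hx Hz. unfold near. rewrite Cmult_conj, ei_conj, !Cconj_R.
    split; [auto|split; [|split; [auto|]]]; apply Ha; auto; rewrite Cmod_mult, ?Cmod_opp, Cmod_Ci; lra. }
  exists (fun s x z => E (mob b x) (a2 y (Ci * s) x z x) (mob b z) (a2 (- y)%R (- Ci * s) x z z))%C.
  split; [|split].
  - intros s Hs. rewrite <- Cmod_R in Hs. split.
    + intros x z Hx Hz. apply E1, Hnear; auto.
    + intros g1 g2 t L1 L2 B1 B2.
      assert (Lden : forall g, ldiff g t -> ldiff (fun s => 1 + b * g s)%C t).
      { intros g Lg. apply (ldiff_plus (fun _ => 1)%C (fun s => b * g s)%C); [apply ldiff_const|apply (ldiff_mult (fun _ => RtoC b)); [apply ldiff_const|auto]]. }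
      assert (Hden : forall z, Cmod z < del -> (1 + b * z)%C <> 0) by (intros z Hz; apply mobius_den; lra).
      assert (Lm : forall g, ldiff g t -> Cmod (g t) < del -> ldiff (fun s => mob b (g s)) t).
      { intros g Lg Bg. apply (ldiff_div (fun s => g s + b)%C (fun s => 1 + b * g s)%C); auto. apply ldiff_plus; auto. apply ldiff_const. }
      assert (Ls : ldiff (fun s => Csqrt (1 - g1 s * g2 s))%C t).
      { destruct (ldiff_near g1 t del L1 B1) as [e1 [He1 H1]]. destruct (ldiff_near g2 t del L2 B2) as [e2 [He2 H2]].
        apply (ldiff_loc _ _ (Rmin e1 e2)); [apply Rmin_pos; auto|]. intros z Hz. apply Rmin_Rgt in Hz as [Hz1 Hz2].
        destruct (H1 z Hz1) as [A1 A2]. destruct (H2 z Hz2) as [A3 A4].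
        apply (cdiff_comp (fun s => 1 - g1 s * g2 s)%C Csqrt).
        - apply cdiff_minus; [apply cdiff_const|]. apply cdiff_mult; apply ldiff_cdiff; auto.
        - apply Csqrt_cdiff. apply Csqrt_near_1. pose proof (Hxz _ _ A2 A4). lra. }
      assert (La : forall c s g, ldiff g t -> Cmod (g t) < del -> ldiff (fun u => a2 c s (g1 u) (g2 u) (g u)) t).
      { intros c s' g Lg Bg. unfold a2. apply (ldiff_mult (fun _ => kap * ei c)%C); [apply ldiff_const|].
        apply (ldiff_mult (fun _ => Cexp s')); [apply ldiff_const|]. apply ldiff_mult; auto.
        pose proof (ldiff_div (fun _ => RtoC 1) (fun s => 1 + b * g s)%C t (ldiff_const _ _) (Lden g Lg) (Hden _ Bg)) as X.
        destruct X as [r [Hr X]]. exists r. split; auto. intros z Hz. eapply cdiff_ext; [|apply X; auto]. intros w. unfold Cdiv. ring. }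
      apply (E3 (fun u => mob b (g1 u)) (fun u => a2 y (Ci * s) (g1 u) (g2 u) (g1 u))%C (fun u => mob b (g2 u)) (fun u => a2 (- y)%R (- Ci * s) (g1 u) (g2 u) (g2 u))%C); auto.
  - intros s x Hs Hx. rewrite <- Cmod_R in Hs.
    assert (Hx1 : 0 < 1 - Cmod x ^ 2) by (pose proof (Cmod_ge_0 x); nra).
    assert (Es : Csqrt (1 - x * Cconj x) = RtoC (sqrt (1 - Cmod x ^ 2))).
    { rewrite <- Cmod2_conj. rewrite <- RtoC_minus. apply Csqrt_R. auto. }
    assert (Hd1 : (1 + b * x)%C <> 0) by (apply mobius_den; lra).
    assert (Ea : a2 y (Ci * s)%C x (Cconj x) x = sphere_sec x y s).
    { unfold a2, sphere_sec. rewrite Es, Cexp_im, ei_plus. field. auto. }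
    assert (Hcx : Cmod (Cconj x) < del) by (rewrite Cmod_conj; auto).
    assert (Ea' : a2 (- y)%R (- Ci * s)%C x (Cconj x) (Cconj x) = Cconj (sphere_sec x y s)).
    { unfold a2, sphere_sec. rewrite Es. replace (- Ci * s)%C with (Ci * RtoC (- s))%C by (rewrite RtoC_opp; ring). rewrite Cexp_im.
      rewrite Cdiv_conj, Cplus_conj, !Cmult_conj, ei_conj, !Cconj_R by auto. replace (- (y + s)) with (- y + - s) by ring.
      rewrite ei_plus. field. apply mobius_den; rewrite ?Cmod_conj; lra. }
    pose proof (Hnear s x (Cconj x) Hs Hx Hcx) as N. rewrite Ea, Ea', mob_conj in * by lra.
    apply E2; auto. rewrite <- (sphere_sec_sphere x (y + s)) by lra. do 2 f_equal. unfold sphere_sec. rewrite Rplus_0_r. auto.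
  - intros x z Hx Hz.
    apply (cdiff_ccont_at (fun s => E (mob b x) (a2 y (Ci * s) x z x) (mob b z) (a2 (- y)%R (- Ci * s) x z z))%C RtoC 0).
    + intros e He. exists e. split; auto. intros s Hs. rewrite <- RtoC_minus, Cmod_R. auto.
    + assert (LC : forall c k, ldiff (fun s => Cexp (c * s) * k)%C 0).
      { intros c k. apply (ldiff_mult (fun s => Cexp (c * s))%C); [|apply ldiff_const]. apply ldiff_all. intros s.
        apply (cdiff_comp (fun s => c * s)%C Cexp); [apply cdiff_mult; [apply cdiff_const|apply cdiff_id]|eexists; apply cder_Cexp]. }
      apply (E3 (fun _ => mob b x) (fun s => a2 y (Ci * s) x z x)%C (fun _ => mob b z) (fun s => a2 (- y)%R (- Ci * s) x z z)%C); auto using ldiff_const.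
      * apply (ldiff_mult (fun _ => kap * ei y)%C); [apply ldiff_const|apply LC].
      * apply (ldiff_mult (fun _ => kap * ei (- y))%C); [apply ldiff_const|apply LC].
      * apply Hnear; auto. rewrite Cmod_0. auto.
Qed.

(** The extensions are chosen separately for each [y], and choice gives no continuity in [y].
    Uniqueness on the totally real plane identifies the choice at [s] with the family chosen at [y],
    taken at the parameter [s - y]; that family is continuous in its parameter. The price is half
    the radius. *)
Lemma global_family : exists G : R -> C -> C -> C,
  (forall y, hol2 (G y) (del / 2) M) /\ (forall y x, Cmod x < del / 2 -> G y x (Cconj x) = fr (mob b x) (sphere_sec x y 0)) /\
  (forall x z, Cmod x < del / 2 -> Cmod z < del / 2 -> ccont (fun y => G y x z)).
Proof.
  pose proof del_pos as [D0 [D1 D2]].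
  pose proof (fun_choice _ local_family) as [F HF].
  exists (fun y => F y 0). assert (R0 : Rabs 0 < del) by (rewrite Rabs_R0; auto). split; [|split].
  - intros y. apply hol2_mono with del; [lra|]. apply (HF y); auto.
  - intros y x Hx. apply (HF y); auto. lra.
  - intros x z Hx Hz y. destruct (HF y) as [H1 [H2 H3]].
    assert (H : forall s, Rabs (s - y) < del -> F s 0 x z = F y (s - y) x z).
    { intros s Hs. destruct (HF s) as [H1' [H2' _]].
      apply (hol2_unique (F s 0) (F y (s - y)) del M M); auto. intros w Hw. rewrite H2, H2' by auto.
      f_equal. unfold sphere_sec. replace (y + (s - y)) with (s + 0) by ring. auto. }
    intros e He. destruct (H3 x z ltac:(lra) ltac:(lra) e He) as [d1 [Hd1 H4]].
    exists (Rmin d1 del). split; [apply Rmin_pos; auto|]. intros s Hs. apply Rmin_Rgt in Hs as [Hs1 Hs2].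
    rewrite H by auto. rewrite (H y) by (replace (y - y) with 0 by ring; auto). replace (y - y) with 0 by ring.
    apply H4. replace (s - y - 0) with (s - y) by ring. auto.
Qed.

End Local.

Lemma hol2_const c d : hol2 (fun _ _ => c) d (Cmod c).
Proof. split; intros; [lra|apply cdiff_const]. Qed.

Lemma hol2_weight n d : 0 < d <= 1/2 -> hol2 (fun x z => zp (Csqrt (1 - x * z)) n) d (2 ^ Z.abs_nat n).
Proof.
  intros Hd.
  assert (Hxz : forall x z, Cmod x < d -> Cmod z < d -> Cmod (x * z) <= 1/2).
  { intros x z Hx Hz. rewrite Cmod_mult. pose proof (Cmod_ge_0 x). pose proof (Cmod_ge_0 z). nra. }
  assert (Hb : forall x z, Cmod x < d -> Cmod z < d -> 1/2 <= Cmod (Csqrt (1 - x * z)) <= 2).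
  { intros x z Hx Hz. pose proof (Hxz x z Hx Hz) as H. destruct (Csqrt_near_1 (x * z) H) as [_ H1].
    pose proof (Cmod_triangle (Csqrt (1 - x * z) - 1) 1) as T1. pose proof (Cmod_triangle (Csqrt (1 - x * z)) (1 - Csqrt (1 - x * z))) as T2.
    replace (Csqrt (1 - x * z) - 1 + 1)%C with (Csqrt (1 - x * z)) in T1 by ring.
    replace (Csqrt (1 - x * z) + (1 - Csqrt (1 - x * z)))%C with (RtoC 1) in T2 by ring.
    rewrite (Cmod_sub_sym 1), Cmod_1 in *. lra. }
  split.
  - intros x z Hx Hz. apply zp_bound. auto.
  - intros g1 g2 t L1 L2 B1 B2. apply zp_cdiff.
    + apply (cdiff_comp (fun s => 1 - g1 s * g2 s)%C Csqrt).
      * apply cdiff_minus; [apply cdiff_const|]. apply cdiff_mult; apply ldiff_cdiff; auto.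
      * apply Csqrt_cdiff. apply Csqrt_near_1. auto.
    + intros A. pose proof (Hb _ _ B1 B2) as H. rewrite A, Cmod_0 in H. lra.
Qed.

(** * The Fourier coefficient as a holomorphic function of two variables at [b] *)

Section LocalK.
Context {fr : C -> C -> C} {b d M L : R} (S : setup fr b d M L).

Lemma den_low (x : C) : Cmod x <= 1 -> 1 - b <= Cmod (1 + b * x).
Proof.
  intros Hx. pose proof S as [Hb _]. pose proof (Cmod_triangle (1 + b * x) (- (b * x))) as T.
  replace (1 + b * x + - (b * x))%C with (RtoC 1) in T by ring. rewrite Cmod_1, Cmod_opp, Cmod_mult, Cmod_R, Rabs_right in T by lra.
  pose proof (Cmod_ge_0 x). nra.
Qed.

Lemma inv_den_lip (x y : C) : Cmod x <= 1 -> Cmod y <= 1 ->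
  Cmod (/ (1 + b * x) - / (1 + b * y)) <= / (1 - b) ^ 2 * Cmod (x - y).
Proof.
  intros Hx Hy. pose proof S as [Hb _]. pose proof (den_low x Hx). pose proof (den_low y Hy).
  assert (N1 : (1 + b * x)%C <> 0) by (apply mobius_den; lra). assert (N2 : (1 + b * y)%C <> 0) by (apply mobius_den; lra).
  replace (/ (1 + b * x) - / (1 + b * y))%C with (b * (y - x) / ((1 + b * x) * (1 + b * y)))%C by (field; auto).
  rewrite Cmod_div by (apply Cmult_neq_0; auto). rewrite !Cmod_mult, Cmod_R, Rabs_right, (Cmod_sub_sym y x) by lra.
  assert (0 < (1 - b) ^ 2) by (apply pow_lt; lra).
  assert ((1 - b) ^ 2 <= Cmod (1 + b * x) * Cmod (1 + b * y)) by nra.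
  rewrite (Rmult_comm (/ _)). apply Rmult_le_compat; [pose proof (Cmod_ge_0 (x - y)); nra|apply Rlt_le, Rinv_0_lt_compat; nra| |apply Rinv_le_contravar; auto].
  pose proof (Cmod_ge_0 (x - y)). nra.
Qed.

(** Denominators are at least [1 - b] in modulus, which gives all Lipschitz constants; the purpose
    is the interchange of averages over [t] and [y]. *)
Lemma sphere_sec_lip2 n x : 0 <= x < 1 -> lip2 (fun t y => fr (mob b (x * ei t)) (sphere_sec (b := b) (x * ei t) y 0) * ei (- IZR n * y))%C.
Proof.
  intros Hx. pose proof S as [Hb [_ [[HL0 HL] _]]]. destruct (kap_pos S) as [Hk Hkk].
  assert (Hm : forall t, Cmod (x * ei t) = x). { intros t. rewrite Cmod_ei_mul, Cmod_R, Rabs_right; lra. }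
  apply lip2_mult.
  2:{ apply (lip2_ext (fun x y => ei (0 * x + - IZR n * y))); [intros; f_equal; ring|apply lip2_ei]. }
  set (c := / (1 - b) ^ 2). assert (Hc : 0 < c) by (apply Rinv_0_lt_compat, pow_lt; lra).
  set (c1 := / (1 - b)). assert (Hc1 : 0 < c1) by (apply Rinv_0_lt_compat; lra).
  exists (L * (c + c + c1)), M. split; [apply Rmult_le_pos; lra|split].
  - intros t y. apply HL. apply (sphere_sec_sphere S); auto. rewrite Hm. lra.
  - intros t y t' y'. eapply Rle_trans.
    { apply HL; apply (sphere_sec_sphere S); auto; rewrite Hm; lra. }
    rewrite Rmult_assoc. apply Rmult_le_compat_l; auto.
    assert (Hd : Cmod (x * ei t - x * ei t') <= Rabs (t - t')).
    { replace (x * ei t - x * ei t')%C with (x * (ei t - ei t'))%C by ring. rewrite Cmod_mult, Cmod_R, Rabs_right by lra.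
      pose proof (ei_lip t t'). pose proof (Cmod_ge_0 (ei t - ei t')). nra. }
    assert (Hx1 : forall t, Cmod (x * ei t) <= 1) by (intros; rewrite Hm; lra).
    assert (Hden : forall t, (1 + b * (x * ei t))%C <> 0) by (intros; apply mobius_den; auto; lra).
    pose proof (inv_den_lip _ _ (Hx1 t) (Hx1 t')) as HI. fold c in HI.
    pose proof (Rabs_pos (t - t')). pose proof (Rabs_pos (y - y')).
    set (s := sqrt (1 - x ^ 2)). assert (Hs : 0 <= s <= 1).
    { split; [apply sqrt_pos|]. unfold s. rewrite <- sqrt_1 at 2. apply sqrt_le_1_alt. nra. }
    assert (A1 : Cmod (mob b (x * ei t) - mob b (x * ei t')) <= c * Rabs (t - t')).
    { unfold mob. replace ((x * ei t + b) / (1 + b * (x * ei t)) - (x * ei t' + b) / (1 + b * (x * ei t')))%C with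
        (RtoC (1 - b ^ 2) * (x * ei t - x * ei t') / ((1 + b * (x * ei t)) * (1 + b * (x * ei t'))))%C by (rewrite RtoC_minus, RtoC_pow; field; auto).
      pose proof (den_low _ (Hx1 t)). pose proof (den_low _ (Hx1 t')).
      rewrite Cmod_div by (apply Cmult_neq_0; auto). rewrite !Cmod_mult, Cmod_R, Rabs_right by nra. unfold c.
      assert (0 < (1 - b) ^ 2) by (apply pow_lt; lra). rewrite (Rmult_comm (/ _)).
      apply Rmult_le_compat; [pose proof (Cmod_ge_0 (x * ei t - x * ei t')); nra|apply Rlt_le, Rinv_0_lt_compat; nra| |apply Rinv_le_contravar; nra].
      pose proof (Cmod_ge_0 (x * ei t - x * ei t')). nra. }
    assert (A2 : Cmod (sphere_sec (b := b) (x * ei t) y 0 - sphere_sec (b := b) (x * ei t') y' 0) <= c * Rabs (t - t') + c1 * Rabs (y - y')).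
    { unfold sphere_sec. rewrite !Hm, !Rplus_0_r. fold s. set (k := sqrt (1 - b ^ 2)) in *.
      replace (k * (s * ei y) / (1 + b * (x * ei t)) - k * (s * ei y') / (1 + b * (x * ei t')))%C with
        (k * s * ((/ (1 + b * (x * ei t)) - / (1 + b * (x * ei t'))) * ei y + (ei y - ei y') * / (1 + b * (x * ei t'))))%C by (unfold Cdiv; ring).
      rewrite Cmod_mult, Cmod_mult, !Cmod_R, !Rabs_right by lra.
      pose proof (Cmod_triangle ((/ (1 + b * (x * ei t)) - / (1 + b * (x * ei t'))) * ei y) ((ei y - ei y') * / (1 + b * (x * ei t')))) as T.
      rewrite Cmod_ei_mul, Cmod_mult, Cmod_inv in T by auto.
      assert (/ Cmod (1 + b * (x * ei t')) <= c1). { apply Rinv_le_contravar; [lra|apply den_low; auto]. }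
      assert (0 < / Cmod (1 + b * (x * ei t'))). { apply Rinv_0_lt_compat. pose proof (den_low _ (Hx1 t')). lra. }
      pose proof (ei_lip y y'). pose proof (Cmod_ge_0 (ei y - ei y')).
      assert (Cmod (ei y - ei y') * / Cmod (1 + b * (x * ei t')) <= c1 * Rabs (y - y')) by nra.
      set (X := Cmod (_ + _)) in *. assert (0 <= X) by apply Cmod_ge_0. assert (0 <= k * s <= 1) by nra.
      assert (X <= c * Rabs (t - t') + c1 * Rabs (y - y')) by nra. nra. }
    nra.
Qed.

(** The automorphism multiplies the second coordinate by [k / (1 + b * x)]. The modulus of this
    factor gives [p * D = k * s], and its argument is absorbed by shifting the averaging variable;
    what remains of both is the power of [1 + b * x]. *)
Lemma sphere_sec_avg n x r t : 0 <= r < 1 -> Cmod x < 1 -> mob b x = (r * ei t)%C ->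
  (avg (fun y => fr (mob b x) (sphere_sec (b := b) x y 0) * ei (- IZR n * y)) * zp (sqrt (1 - Cmod x ^ 2)) (- n))%C =
  (zp (sqrt (1 - b ^ 2)) n * zp (1 + b * x) (- n) * scaled_coef fr n r t)%C.
Proof.
  intros Hr Hx Hm. pose proof S as [Hb _]. destruct (kap_pos S) as [Hk Hkk]. set (k := sqrt (1 - b ^ 2)) in *.
  assert (Hd : (1 + b * x)%C <> 0) by (apply mobius_den; lra).
  destruct (polar (1 + b * x)%C) as [w Hw]. set (D := Cmod (1 + b * x)) in *. assert (HD : 0 < D) by (apply Cmod_gt_0; auto).
  set (s := sqrt (1 - Cmod x ^ 2)). assert (Hs0 : 0 < 1 - Cmod x ^ 2) by (pose proof (Cmod_ge_0 x); nra).
  assert (Hs : 0 < s) by (apply sqrt_lt_R0; auto). assert (Hss : s * s = 1 - Cmod x ^ 2) by (apply sqrt_sqrt; lra).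
  set (p := sqrt (1 - r ^ 2)). assert (Hp0 : 0 < 1 - r ^ 2) by nra.
  assert (Hpos : 0 < p) by (apply sqrt_lt_R0; auto). assert (Hpp : p * p = 1 - r ^ 2) by (apply sqrt_sqrt; lra).
  assert (Hrel : p * D = k * s).
  { pose proof (mobius_id b x) as E. fold D in E. replace (x + b)%C with (mob b x * (1 + b * x))%C in E by (unfold mob; field; auto).
    rewrite Cmod_mult, Hm, Cmod_ei_mul, Cmod_R, Rabs_right in E by lra. fold D in E.
    assert ((p * D) * (p * D) = (k * s) * (k * s)) by nra. assert (0 < p * D) by nra. assert (0 < k * s) by nra.
    apply Rsqr_inj; unfold Rsqr; lra. }
  assert (Hsec : forall y, sphere_sec (b := b) x y 0 = (p * ei (y + - w))%C).
  { intros y. unfold sphere_sec. fold s k. rewrite Rplus_0_r, Hw, ei_plus.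
    assert (HDc : RtoC D <> 0) by (intros A; apply RtoC_inj in A; lra).
    assert (Ew : (ei (- w) * ei w)%C = 1) by apply ei_neg_mul.
    apply Cmult_cancel_l with (D * ei w)%C; [apply Cmult_neq_0; auto; apply ei_nz|].
    transitivity (RtoC k * s * ei y)%C; [field; split; [apply ei_nz|auto]|].
    replace (D * ei w * (p * (ei y * ei (- w))))%C with (RtoC p * D * ei y * (ei (- w) * ei w))%C by ring.
    rewrite Ew, Cmult_1_r, <- !RtoC_mult, Hrel. auto. }
  assert (Ha : avg (fun y => fr (mob b x) (sphere_sec (b := b) x y 0) * ei (- IZR n * y))%C = (ei (- IZR n * w) * fiber_coef fr n r t)%C).
  { unfold fiber_coef. fold p. rewrite <- (avg_shift (fun s => fr (r * ei t) (p * ei s) * ei (- IZR n * s))%C (- w)).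
    - rewrite <- avg_scal.
      + apply avg_ext. intros y. rewrite Hm, Hsec. replace (- IZR n * y) with (- IZR n * w + - IZR n * (y + - w)) by ring. rewrite (ei_plus (- IZR n * w)). ring.
      + intros y. pose proof (fiber_coef_cont_in S n r t ltac:(lra) (y + - w)) as G. intros e He. destruct (G e He) as [d' [Hd' G']].
        exists d'. split; auto. intros z Hz. apply G'. replace (z + - w - (y + - w)) with (z - y) by ring. auto.
    - apply (fiber_coef_cont_in S). lra.
    - intros y. rewrite ei_2pi, <- opp_IZR, ei_Z_2pi. auto. }
  rewrite Ha. unfold scaled_coef. fold p. rewrite Hw.
  assert (HR : forall a : R, 0 < a -> RtoC a <> 0) by (intros a Ha' A; apply RtoC_inj in A; lra).
  rewrite (zp_mult D (ei w)), zp_ei, opp_IZR by (auto; apply ei_nz).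
  assert (E1 : (zp p (- n) * zp D (- n))%C = (zp k (- n) * zp s (- n))%C).
  { rewrite <- !zp_mult, <- !RtoC_mult, Hrel by (apply HR; lra). auto. }
  replace (zp k n * (zp D (- n) * ei (- IZR n * w)) * (zp p (- n) * fiber_coef fr n r t))%C with
    (zp k n * (zp p (- n) * zp D (- n)) * ei (- IZR n * w) * fiber_coef fr n r t)%C by ring.
  rewrite E1. replace (zp k n * (zp k (- n) * zp s (- n)))%C with (zp s (- n) * (zp k n * zp k (- n)))%C by ring.
  rewrite zp_opp by (apply HR; lra). ring.
Qed.

(** On [z = Cconj x] the weight [zp (Csqrt (1 - x * z)) (- n)] depends only on [|x|], so the moment
    conditions from the lines through the exterior point pass to [K], and [hol2_circle] applies. *)
Theorem local_K n : exists e B K p c, 0 < e <= 1/24 /\ hol2 K e B /\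
  (forall x r t, 0 <= r < 1 -> Cmod x < e -> mob b x = (r * ei t)%C ->
     K x (Cconj x) = (zp (sqrt (1 - b ^ 2)) n * zp (1 + b * x) (- n) * scaled_coef fr n r t)%C) /\
  (forall y, Cmod y < e -> PSon (fun _ => True) B e (fun i => p i y) (fun x => K x y)) /\
  (forall i y, Cmod y < e -> p i y = csum (fun j => c i j * y ^ j)%C (Datatypes.S i)).
Proof.
  pose proof S as [Hb [_ [HL [_ Mp]]]]. destruct (del_pos S) as [D0 [D1 D2]]. destruct (global_family S) as [G [G1 [G2 G3]]].
  set (del := Rmin (1/24) (d/24)) in *. set (e := del / 2) in *. assert (He : 0 < e <= 1/24) by (unfold e; lra).
  set (K := fun x z => (avg (fun y => G y x z * ei (- IZR n * y)) * zp (Csqrt (1 - x * z)) (- n))%C).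
  assert (HK : hol2 K e (M * 1 * 2 ^ Z.abs_nat (- n))).
  { apply (hol2_mult (fun x z => avg (fun y => G y x z * ei (- IZR n * y)))%C).
    - apply (hol2_avg (fun y x z => G y x z * ei (- IZR n * y))%C).
      + intros y. apply (hol2_mult (G y) (fun _ _ => ei (- IZR n * y))); auto. rewrite <- (Cmod_ei (- IZR n * y)). apply hol2_const.
      + intros x z Hx Hz. apply ccont_mult; [auto|apply ccont_ei].
    - apply hol2_weight. lra. }
  assert (HKc : forall x, Cmod x < e -> K x (Cconj x) =
    (avg (fun y => fr (mob b x) (sphere_sec (b := b) x y 0) * ei (- IZR n * y)) * zp (sqrt (1 - Cmod x ^ 2)) (- n))%C).
  { intros x Hx. unfold K. rewrite <- Cmod2_conj, <- RtoC_minus, Csqrt_R by (pose proof (Cmod_ge_0 x); nra).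
    f_equal. apply avg_ext. intros y. rewrite G2 by auto. auto. }
  assert (Hcirc : forall x l, 0 < x < e -> (0 < l)%nat -> avg (fun t => K (x * ei t) (x * ei (- t)) * ei (INR l * t))%C = 0).
  { intros x l Hx Hl. assert (Hm : forall t, Cmod (x * ei t) = x). { intros t. rewrite Cmod_ei_mul, Cmod_R, Rabs_right; lra. }
    set (F := fun t y => (fr (mob b (x * ei t)) (sphere_sec (b := b) (x * ei t) y 0) * ei (- IZR n * y))%C).
    assert (HF : lip2 F) by (apply sphere_sec_lip2; lra).
    assert (HF2 : lip2 (fun t y => F t y * ei (INR l * t + 0 * y))%C) by (apply lip2_mult; [auto|apply lip2_ei]).
    set (w := zp (sqrt (1 - x ^ 2)) (- n)).
    rewrite (avg_ext _ (fun t => w * avg (fun y => F t y * ei (INR l * t + 0 * y)))%C).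
    2:{ intros t. replace (x * ei (- t))%C with (Cconj (x * ei t)) by (rewrite Cmult_conj, ei_conj, Cconj_R; auto).
        rewrite HKc, Hm by (rewrite Hm; lra). fold w. change (avg (fun y => fr (mob b (x * ei t)) (sphere_sec (x * ei t) y 0) * ei (- IZR n * y))%C) with (avg (F t)).
        rewrite (avg_ext (fun y => F t y * ei (INR l * t + 0 * y))%C (fun y => ei (INR l * t) * F t y)%C).
        - rewrite avg_scal; [ring|]. apply (ucont2_l (fun y t => F t y)). apply ucont2_sym, lip2_ucont; auto.
        - intros y. replace (INR l * t + 0 * y) with (INR l * t) by ring. ring. }
    rewrite avg_scal by (apply (ucont2_avg (fun t y => F t y * ei (INR l * t + 0 * y))%C); apply lip2_ucont; auto).
    rewrite (avg_swap _ (lip2_ucont _ HF2)), avg_0; [ring|]. intros y.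
    assert (Hy : Cmod (sqrt (1 - x ^ 2) * ei y) ^ 2 = 1 - x ^ 2).
    { rewrite Cmod_ei_mul, Cmod_R, pow2_abs. apply pow2_sqrt. nra. }
    pose proof (Mp x (sqrt (1 - x ^ 2) * ei y)%C l ltac:(lra) Hy Hl) as Z.
    set (u := fun t => (fr ((x * ei t + b) / (1 + b * (x * ei t))) (sqrt (1 - b ^ 2) * (sqrt (1 - x ^ 2) * ei y) / (1 + b * (x * ei t))) * ei (INR l * t))%C) in Z.
    assert (Eu : forall t, (F t y * ei (INR l * t + 0 * y))%C = (ei (- IZR n * y) * u t)%C).
    { intros t. unfold F, u, sphere_sec, mob. rewrite Hm, Rplus_0_r. replace (INR l * t + 0 * y) with (INR l * t) by ring. ring. }
    rewrite (avg_ext _ _ Eu), avg_scal, Z; [ring|].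
    intros t. apply ccont_at_ext with (fun t => ei (- (- IZR n * y)) * (F t y * ei (INR l * t + 0 * y)))%C.
    - intros s. rewrite Eu, Cmult_assoc, ei_neg_mul. ring.
    - apply ccont_at_mult; [apply ccont_at_const|]. apply (ucont2_l (fun t y => F t y * ei (INR l * t + 0 * y))%C y). apply lip2_ucont; auto. }
  destruct (hol2_circle K e _ ltac:(lra) HK Hcirc) as [p [c [H1 H2]]].
  exists e, (M * 1 * 2 ^ Z.abs_nat (- n)), K, p, c. do 2 (split; auto). split; auto.
  intros x r t Hr Hx Hm. rewrite HKc by auto. apply sphere_sec_avg; auto. lra.
Qed.

End LocalK.

(** * The comparison identity near [b] *)

Lemma geo_identity (y z : C) n : (y - z)%C <> 0 -> y <> 0 ->
  (csum (fun k => z ^ k / y ^ (S k)) n - / (y - z))%C = (- ((z / y) ^ n / (y - z)))%C.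
Proof.
  intros H1 H2. induction n as [|n IH]; cbn [csum].
  - simpl. field. auto.
  - replace (csum (fun k => z ^ k / y ^ S k) n + z ^ n / y ^ S n - / (y - z))%C with
      ((csum (fun k => z ^ k / y ^ S k) n - / (y - z)) + z ^ n / y ^ S n)%C by ring.
    rewrite IH. assert (E : forall m, ((z / y) ^ m = z ^ m / y ^ m)%C).
    { intros m. unfold Cdiv. rewrite Cpow_mult_l, Cpow_inv by auto. auto. }
    rewrite !E. cbn [Cpow]. assert (y ^ n <> 0)%C by (apply Cpow_nz; auto). field. auto.
Qed.

Lemma circle_far (r t : R) (z : C) : 0 < r -> Cmod z < r -> (r * ei t - z)%C <> 0 /\ r - Cmod z <= Cmod (r * ei t - z).
Proof.
  intros Hr Hz. pose proof (Cmod_triangle (r * ei t - z) z) as T. replace (r * ei t - z + z)%C with (r * ei t)%C in T by ring.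
  rewrite Cmod_ei_mul, Cmod_R, Rabs_right in T by lra. split; [|lra]. intros A. rewrite A, Cmod_0 in T. lra.
Qed.

Lemma ccont_circle f r : (forall t, cdiff f (RtoC r * ei t)%C) -> ccont (fun t => f (r * ei t)%C).
Proof.
  intros H t. apply (cdiff_ccont_at f (fun t => r * ei t)%C); auto. apply ccont_at_mult; [apply ccont_at_const|apply ccont_ei_plain].
Qed.

(** The geometric expansion of the Cauchy kernel about any interior point [c]; the boundary data [u]
    are merely continuous. The same integral can thus be expanded at [0] and at [b]. *)
Lemma cauchy_series u B r (c z : C) : ccont u -> (forall t, Cmod (u t) <= B) -> 0 < r -> Cmod c < r -> Cmod (z - c) < r - Cmod c ->
  cser (fun k => avg (fun t => u t * (r * ei t / (r * ei t - c) ^ S k)) * (z - c) ^ k)%C (avg (fun t => u t * (r * ei t / (r * ei t - z)))%C).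
Proof.
  intros Hu HB Hr Hc Hz. set (q := Cmod (z - c) / (r - Cmod c)).
  assert (Hq : 0 <= q < 1). { unfold q. pose proof (Cmod_ge_0 (z - c)). split; [apply Rle_div_r; lra|apply Rlt_div_l; lra]. }
  assert (Hzr : Cmod z < r). { pose proof (Cmod_le_add z c). lra. }
  assert (HB0 : 0 <= B) by (eapply Rle_trans; [apply Cmod_ge_0|apply (HB 0)]).
  assert (Hc1 : forall k, ccont (fun t => r * ei t / (r * ei t - c) ^ S k)%C).
  { intros k. apply (ccont_circle (fun y => y / (y - c) ^ S k)%C). intros t. apply cdiff_div; [apply cdiff_id| |].
    - apply cdiff_pow, cdiff_minus; auto using cdiff_id, cdiff_const.
    - apply Cpow_nz. apply circle_far; auto. }
  assert (Hc2 : ccont (fun t => r * ei t / (r * ei t - z))%C).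
  { apply (ccont_circle (fun y => y / (y - z))%C). intros t. apply cdiff_div; [apply cdiff_id| |].
    - apply cdiff_minus; auto using cdiff_id, cdiff_const.
    - apply circle_far; auto. }
  apply cser_of_tail with (B * r / (r - Cmod z)) q; auto.
  { apply Rle_div_r; [lra|]. nra. }
  intros n. rewrite (csum_ext _ (fun k => avg (fun t => (z - c) ^ k * (u t * (r * ei t / (r * ei t - c) ^ S k))))%C).
  2:{ intros k _. rewrite avg_scal; [ring|]. apply ccont_mult; auto. }
  rewrite <- (avg_csum (fun k t => (z - c) ^ k * (u t * (r * ei t / (r * ei t - c) ^ S k)))%C).
  2:{ intros k. apply ccont_mult; [apply ccont_const|]. apply ccont_mult; auto. }
  apply avg_close.
  - apply ccont_csum. intros k. apply ccont_mult; [apply ccont_const|]. apply ccont_mult; auto.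
  - apply ccont_mult; auto.
  - intros t. set (y := (r * ei t)%C). destruct (circle_far r t c Hr Hc) as [N1 F1]. destruct (circle_far r t z Hr Hzr) as [N2 F2].
    fold y in N1, N2, F1, F2.
    rewrite (csum_ext _ (fun k => (u t * y) * ((z - c) ^ k / (y - c) ^ S k))%C) by (intros; unfold Cdiv; ring).
    rewrite csum_scal. replace (u t * y * csum (fun k => (z - c) ^ k / (y - c) ^ S k) n - u t * (y / (y - z)))%C with
      (u t * y * (csum (fun k => (z - c) ^ k / (y - c) ^ S k) n - / ((y - c) - (z - c))))%C by (replace (y - c - (z - c))%C with (y - z)%C by ring; unfold Cdiv; ring).
    rewrite geo_identity; auto. 2:{ replace (y - c - (z - c))%C with (y - z)%C by ring. auto. }
    replace (y - c - (z - c))%C with (y - z)%C by ring.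
    rewrite !Cmod_mult, Cmod_opp, Cmod_div, Cmod_pow, Cmod_div by auto. unfold y at 1. rewrite Cmod_ei_mul, Cmod_R, Rabs_right by lra.
    replace (B * r / (r - Cmod z) * q ^ n) with (B * r * (q ^ n / (r - Cmod z))) by (unfold Rdiv; ring).
    assert (Hqn : 0 <= (Cmod (z - c) / Cmod (y - c)) ^ n <= q ^ n).
    { assert (0 <= Cmod (z - c) / Cmod (y - c)) by (apply Rle_div_r; [lra|rewrite Rmult_0_l; apply Cmod_ge_0]).
      split; [apply pow_le; auto|]. apply pow_incr. split; auto.
      unfold q, Rdiv. apply Rmult_le_compat_l; [apply Cmod_ge_0|]. apply Rinv_le_contravar; lra. }
    assert (0 < / Cmod (y - z)) by (apply Rinv_0_lt_compat; lra).
    assert (/ Cmod (y - z) <= / (r - Cmod z)) by (apply Rinv_le_contravar; lra).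
    apply Rmult_le_compat; [pose proof (Cmod_ge_0 (u t)); nra|unfold Rdiv; nra|apply Rmult_le_compat_r; auto; lra|unfold Rdiv; nra].
Qed.

(** The Taylor series at [c] vanishes, and the identity theorem on each diameter carries the zero
    through the disc. *)
Lemma zero_disc h c rad : 0 < rad -> (forall z, Cmod (z - c) < rad -> cdiff h z) ->
  (forall e, 0 < e -> exists z, z <> c /\ Cmod (z - c) < e /\ h z = 0) -> forall z, Cmod (z - c) < rad -> h z = 0.
Proof.
  intros Hr Hd Hz z Hzr.
  destruct (taylor_local h c rad Hr Hd) as [M0 [d0 [a [Hd0 Ha]]]].
  assert (A : forall k, a k = 0).
  { apply (PSon_zero (fun t => t <> RtoC 0 /\ h (c + t)%C = 0) M0 d0 a (fun t => h (c + t)%C)).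
    - eapply PSon_mono; [| | | |apply Ha]; [intros; exact I|lra|apply Ha|lra].
    - auto.
    - intros e He. destruct (Hz e He) as [y [H1 [H2 H3]]]. exists (y - c)%C. replace (c + (y - c))%C with y by ring. split; auto. split; auto.
      intros E. apply H1, Ceq_sub. auto. }
  assert (Hnear : forall t, Cmod t < d0 -> h (c + t)%C = 0).
  { intros t Ht. destruct Ha as [_ [_ Ha]]. specialize (Ha t I Ht). cbv beta in Ha.
    eapply cser_unique; [apply Ha|]. eapply cser_ext; [|apply (cser_finite (fun _ => RtoC 0) 0); auto]. intros k. simpl. rewrite A. ring. }
  destruct (polar (z - c)%C) as [t Ht].
  assert (Hm : forall y x : C, Cmod (c + y * ei t - (c + x * ei t)) = Cmod (y - x)).
  { intros y x. replace (c + y * ei t - (c + x * ei t))%C with ((y - x) * ei t)%C by ring. apply Cmod_ei_mul. }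
  assert (H := lps_identity (fun s => h (c + s * ei t)%C) (- rad) rad 0 (Rmin d0 rad)).
  replace z with (c + Cmod (z - c) * ei t)%C by (rewrite <- Ht; ring). apply H.
  - lra.
  - apply Rmin_pos; auto. apply Ha.
  - apply Rmin_r.
  - intros x Hx. assert (Hax : Rabs x < rad) by (apply Rabs_def1; lra).
    apply (cdiff_lps (fun s => h (c + s * ei t)%C) x (rad - Rabs x)); [lra|]. intros s Hs.
    apply (cdiff_comp (fun s => c + s * ei t)%C h).
    + apply cdiff_plus; [apply cdiff_const|]. apply cdiff_mult; auto using cdiff_const, cdiff_id.
    + apply Hd. replace (c + s * ei t - c)%C with (s * ei t)%C by ring. rewrite Cmod_ei_mul.
      pose proof (Cmod_le_add s x). rewrite Cmod_R in H0. lra.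
  - intros x Hx. pose proof (Rmin_l d0 rad). apply Hnear. rewrite Cmod_ei_mul, Cmod_R, Rabs_right; lra.
  - pose proof (Cmod_ge_0 (z - c)). lra.
Qed.

Section Comparison.
Context {fr : C -> C -> C} {b d M L : R} (S : setup fr b d M L) (n : Z).

Let N := Z.abs_nat n.

Definition circle_fun (r t : R) : C := (scaled_coef fr n r t * (r * ei t) ^ Z.abs_nat n)%C.
(* On the circle of radius [r], [circle_fun] is the boundary value of a holomorphic function, with Taylor coefficients [center_coef] at
   [0] and [b_coef] at [b]. *)
Definition center_coef (r : R) (m : nat) : C := (mode (circle_fun r) (Z.of_nat m) / r ^ m)%C.
Definition b_coef (k : nat) (r : R) : C := avg (fun t => circle_fun r t * (r * ei t / (r * ei t - b) ^ Datatypes.S k))%C.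

Lemma circle_fun_cont r : 0 <= r <= 1 -> ccont (circle_fun r).
Proof.
  intros Hr. apply ccont_mult; [apply ccont_mult; [apply ccont_const|apply (fiber_coef_cont S); auto]|].
  apply (ccont_circle (fun y => y ^ Z.abs_nat n)%C). intros t. apply cdiff_pow, cdiff_id.
Qed.

Lemma Cmod_circle_fun r t : 0 <= r <= 1 -> Cmod (circle_fun r t) <= Cmod (scaled_coef fr n r t).
Proof.
  intros Hr. unfold circle_fun. rewrite Cmod_mult, Cmod_pow, Cmod_ei_mul, Cmod_R, Rabs_right by lra.
  assert (r ^ Z.abs_nat n <= 1) by (rewrite <- (pow1 (Z.abs_nat n)); apply pow_incr; lra).
  pose proof (pow_le r (Z.abs_nat n) ltac:(lra)). pose proof (Cmod_ge_0 (scaled_coef fr n r t)). nra.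
Qed.

Lemma Cmod_scaled_coef r t : 0 <= r <= 1 -> Cmod (scaled_coef fr n r t) <= Cmod (zp (sqrt (1 - r ^ 2)) (- n)) * M.
Proof. intros Hr. unfold scaled_coef. rewrite Cmod_mult. apply Rmult_le_compat_l; [apply Cmod_ge_0|]. apply (fiber_coef_bound S); auto. Qed.

Lemma mode_circle_fun r m : 0 <= r <= 1 -> mode (circle_fun r) m = (zp (sqrt (1 - r ^ 2)) (- n) * r ^ N * mode (fiber_coef fr n r) (m - Z.of_nat N))%C.
Proof.
  intros Hr. unfold mode. rewrite <- avg_scal.
  - apply avg_ext. intros t. unfold circle_fun, scaled_coef. rewrite Cpow_mult_l, ei_pow. fold N.
    replace (- IZR (m - Z.of_nat N) * t) with (INR N * t + - IZR m * t) by (rewrite minus_IZR, <- INR_IZR_INZ; ring).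
    rewrite ei_plus. ring.
  - apply ccont_mult; [apply (fiber_coef_cont S); auto|apply ccont_ei].
Qed.

(** The modes of [fiber_coef] start at [- n], and multiplication by [z ^ |n|] shifts them by
    [|n| >= n]. *)
Lemma mode_circle_fun_neg r m : 0 <= r <= 1 -> (m < 0)%Z -> mode (circle_fun r) m = 0.
Proof. intros Hr Hm. rewrite mode_circle_fun, (mode_fiber_coef_neg S) by (auto; unfold N; lia). ring. Qed.

Lemma mode_circle_fun_decay : exists q, 0 < q < 1 /\ forall r, 0 < r < 1 -> exists B, forall m, Cmod (mode (circle_fun r) (Z.of_nat m)) <= B * q ^ m.
Proof.
  destruct (mode_fiber_coef_decay S) as [q [Hq H]]. exists q. split; auto. intros r Hr.
  exists (Cmod (zp (sqrt (1 - r ^ 2)) (- n) * r ^ N) * (4 * M * / q ^ N)). intros m.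
  rewrite mode_circle_fun by lra. rewrite Cmod_mult, Rmult_assoc. apply Rmult_le_compat_l; [apply Cmod_ge_0|].
  eapply Rle_trans; [apply H; lra|]. assert (HM : 0 <= M). { eapply Rle_trans; [apply Cmod_ge_0|apply (fiber_coef_bound S n 0 0); lra]. }
  replace (4 * M * / q ^ N * q ^ m) with (4 * M * (q ^ m / q ^ N)) by (unfold Rdiv; ring). apply Rmult_le_compat_l; [lra|]. apply Rle_div_r; [apply pow_lt; lra|].
  rewrite <- pow_add. set (k := (Z.abs_nat (Z.of_nat m - Z.of_nat N) + N)%nat). assert (Hk : (m <= k)%nat) by (unfold k; lia).
  replace k with (m + (k - m))%nat by lia. rewrite pow_add. pose proof (pow_le q m ltac:(lra)).
  assert (q ^ (k - m) <= 1) by (rewrite <- (pow1 (k - m)); apply pow_incr; lra). nra.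
Qed.

Lemma fiber_coef_lip r t x : 0 <= r <= 1 -> Cmod (fiber_coef fr n r t - fiber_coef fr n r x) <= L * Cmod (ei t - ei x).
Proof.
  intros Hr. pose proof S as [_ [_ [[HL0 HL] _]]]. apply avg_close; try apply (fiber_coef_cont_in S); auto. intros s.
  replace (fr (r * ei t) (sqrt (1 - r ^ 2) * ei s) * ei (- IZR n * s) - fr (r * ei x) (sqrt (1 - r ^ 2) * ei s) * ei (- IZR n * s))%C
    with ((fr (r * ei t) (sqrt (1 - r ^ 2) * ei s) - fr (r * ei x) (sqrt (1 - r ^ 2) * ei s)) * ei (- IZR n * s))%C by ring.
  rewrite Cmod_ei_mul. eapply Rle_trans; [apply HL; apply circle_sphere; auto|]. rewrite Cmod_sub_diag, Rplus_0_r.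
  replace (r * ei t - r * ei x)%C with (r * (ei t - ei x))%C by ring. rewrite Cmod_mult, Cmod_R, Rabs_right by lra.
  pose proof (Cmod_ge_0 (ei t - ei x)). apply Rmult_le_compat_l; auto. nra.
Qed.

Lemma circle_fun_modulus r x : 0 <= r <= 1 -> modulus_at (circle_fun r) x.
Proof.
  intros Hr. apply modulus_at_bounded with (Cmod (zp (sqrt (1 - r ^ 2)) (- n)) * M).
  - intros t. eapply Rle_trans; [apply Cmod_circle_fun; auto|apply Cmod_scaled_coef; auto].
  - intros e He. pose proof S as [_ [_ [[HL0 HL] _]]].
    set (w := zp (sqrt (1 - r ^ 2)) (- n)).
    assert (HM : 0 <= M). { eapply Rle_trans; [apply Cmod_ge_0|apply (fiber_coef_bound S n 0 0); lra]. }
    pose proof (Cmod_ge_0 w) as Hw.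
    destruct (cdiff_cont (fun y => y ^ N)%C (r * ei x)%C) with (e := e / (2 * (Cmod w * M + 1))) as [d1 [Hd1 H1]].
    { apply cdiff_pow, cdiff_id. } { apply Rdiv_lt_0_compat; nra. }
    exists (Rmin d1 (e / (2 * (Cmod w * L + 1)))). split.
    { apply Rmin_pos; auto. apply Rdiv_lt_0_compat; nra. }
    intros t Ht. apply Rmin_Rgt in Ht as [Ht1 Ht2]. unfold circle_fun, scaled_coef. fold N w.
    replace (w * fiber_coef fr n r t * (r * ei t) ^ N - w * fiber_coef fr n r x * (r * ei x) ^ N)%C with
      (w * (fiber_coef fr n r t * ((r * ei t) ^ N - (r * ei x) ^ N)) + w * ((fiber_coef fr n r t - fiber_coef fr n r x) * (r * ei x) ^ N))%C by ring.
    eapply Rle_lt_trans; [apply Cmod_triangle|]. rewrite !Cmod_mult.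
    assert (A1 : Cmod ((r * ei t) ^ N - (r * ei x) ^ N) < e / (2 * (Cmod w * M + 1))).
    { apply H1. replace (r * ei t - r * ei x)%C with (r * (ei t - ei x))%C by ring. rewrite Cmod_mult, Cmod_R, Rabs_right by lra.
      pose proof (Cmod_ge_0 (ei t - ei x)). nra. }
    pose proof (fiber_coef_bound S n r t Hr) as A2. pose proof (fiber_coef_lip r t x Hr) as A3.
    assert (A4 : Cmod ((r * ei x) ^ N) <= 1).
    { rewrite Cmod_pow, Cmod_ei_mul, Cmod_R, Rabs_right by lra. rewrite <- (pow1 N). apply pow_incr; lra. }
    apply Rlt_div_r in A1; [|nra]. apply Rlt_div_r in Ht2; [|nra].
    pose proof (Cmod_ge_0 (fiber_coef fr n r t)). pose proof (Cmod_ge_0 (fiber_coef fr n r t - fiber_coef fr n r x)). pose proof (Cmod_ge_0 ((r * ei x) ^ N)).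
    pose proof (Cmod_ge_0 ((r * ei t) ^ N - (r * ei x) ^ N)) as P1. pose proof (Cmod_ge_0 (ei t - ei x)) as P2.
    set (X := Cmod ((r * ei t) ^ N - (r * ei x) ^ N)) in *. set (Y := Cmod (ei t - ei x)) in *.
    assert (B1 : Cmod w * (Cmod (fiber_coef fr n r t) * X) <= Cmod w * M * X).
    { rewrite Rmult_assoc. apply Rmult_le_compat_l; auto. apply Rmult_le_compat_r; auto. }
    assert (B2 : Cmod w * (Cmod (fiber_coef fr n r t - fiber_coef fr n r x) * Cmod ((r * ei x) ^ N)) <= Cmod w * L * Y).
    { rewrite Rmult_assoc. apply Rmult_le_compat_l; auto. nra. }
    nra.
Qed.

(** Exponential decay of the modes gives convergence in a disc strictly larger than [|z| < r], so
    that identities on the circle can be continued across it. *)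
Lemma center_coef_PSon : exists q, 0 < q < 1 /\ forall r, 0 < r < 1 -> exists B, PSon (fun _ => True) B (r / q) (center_coef r) (pser (center_coef r)).
Proof.
  destruct mode_circle_fun_decay as [q [Hq H]]. exists q. split; auto. intros r Hr. destruct (H r Hr) as [B HB]. exists B.
  apply PSon_pser; [apply Rdiv_lt_0_compat; lra|]. intros m. unfold center_coef.
  assert (Hrm : 0 < r ^ m) by (apply pow_lt; lra).
  rewrite <- RtoC_pow, Cmod_div, Cmod_R, Rabs_right by (try lra; intros A; apply RtoC_inj in A; lra).
  replace (B / (r / q) ^ m) with (B * q ^ m / r ^ m).
  - unfold Rdiv. apply Rmult_le_compat_r; auto. apply Rlt_le, Rinv_0_lt_compat; auto.
  - unfold Rdiv. rewrite Rpow_mult_distr, pow_inv. assert (q ^ m <> 0) by (apply pow_nonzero; lra). field. split; auto. lra.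
Qed.

Lemma center_coef_circle r t : 0 < r < 1 -> pser (center_coef r) (r * ei t) = circle_fun r t.
Proof.
  intros Hr. apply pser_eq. destruct mode_circle_fun_decay as [q [Hq H]]. destruct (H r Hr) as [B HB].
  eapply cser_ext; [|apply (fourier_geo (circle_fun r) t B q)]; auto; try lra.
  - intros m. unfold center_coef. rewrite Cpow_mult_l, ei_pow. field. apply Cpow_nz. intros A. apply RtoC_inj in A. lra.
  - apply circle_fun_cont. lra.
  - apply circle_fun_modulus. lra.
  - intros m Hm. apply mode_circle_fun_neg; auto. lra.
Qed.

(** Inside the circle the series at [0] is the Cauchy integral of [circle_fun], and expanding this
    integral at [b] produces [b_coef]. *)
Lemma center_coef_inside r z : 0 < r < 1 -> Cmod z < r -> pser (center_coef r) z = avg (fun t => circle_fun r t * (r * ei t / (r * ei t - z)))%C.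
Proof.
  intros Hr Hz. apply pser_eq.
  assert (Hr0 : RtoC r <> 0) by (intros A; apply RtoC_inj in A; lra).
  eapply cser_ext; [|apply (cauchy_series (circle_fun r) (Cmod (zp (sqrt (1 - r ^ 2)) (- n)) * M) r 0 z)].
  - intros k. replace (z - 0)%C with z by ring. f_equal. unfold center_coef, mode.
    replace (avg (fun t => circle_fun r t * ei (- IZR (Z.of_nat k) * t)) / r ^ k)%C with (/ r ^ k * avg (fun t => circle_fun r t * ei (- IZR (Z.of_nat k) * t)))%C by (unfold Cdiv; ring).
    rewrite <- avg_scal by (apply ccont_mult; [apply circle_fun_cont; lra|apply ccont_ei]).
    apply avg_ext. intros t. replace (r * ei t - 0)%C with (r * ei t)%C by ring.
    rewrite <- INR_IZR_INZ. replace (- INR k * t) with (- (INR k * t)) by ring.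
    assert (E : (ei (- (INR k * t)) * ei t ^ k)%C = 1) by (rewrite ei_pow; apply ei_neg_mul).
    rewrite Cpow_mult_l. simpl Cpow. pose proof (ei_nz t). assert (r ^ k <> 0)%C by (apply Cpow_nz; auto).
    assert (ei t ^ k <> 0)%C by (apply Cpow_nz; auto).
    apply Cmult_cancel_l with (ei t ^ k * r ^ k)%C; [apply Cmult_neq_0; auto|].
    transitivity (circle_fun r t)%C.
    + field. auto.
    + replace (ei t ^ k * r ^ k * (/ r ^ k * (circle_fun r t * ei (- (INR k * t)))))%C with (ei (- (INR k * t)) * ei t ^ k * circle_fun r t * (r ^ k * / r ^ k))%C by ring.
      rewrite E, Cinv_r by auto. ring.
  - apply circle_fun_cont. lra.
  - intros t. eapply Rle_trans; [apply Cmod_circle_fun; lra|apply Cmod_scaled_coef; lra].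
  - lra.
  - rewrite Cmod_0. lra.
  - rewrite Cmod_0. replace (z - 0)%C with z by ring. lra.
Qed.

(** Besides [B] only the distance from [b] to the circle enters, so the bound survives the limit
    [r -> 1]. *)
Lemma b_coef_bound k r B : b < r < 1 -> (forall t, Cmod (scaled_coef fr n r t) <= B) -> Cmod (b_coef k r) <= B / (r - b) ^ Datatypes.S k.
Proof.
  intros Hr HB. pose proof S as [Hb _]. assert (Hbr : Cmod b < r) by (rewrite Cmod_R, Rabs_right; lra).
  assert (HB0 : 0 <= B) by (eapply Rle_trans; [apply Cmod_ge_0|apply (HB 0)]).
  apply avg_bound.
  - apply ccont_mult; [apply circle_fun_cont; lra|]. apply (ccont_circle (fun y => y / (y - b) ^ Datatypes.S k)%C). intros t.
    apply cdiff_div; [apply cdiff_id|apply cdiff_pow, cdiff_minus; auto using cdiff_id, cdiff_const|].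
    apply Cpow_nz, circle_far; auto; lra.
  - intros t. destruct (circle_far r t b ltac:(lra) Hbr) as [N1 F1]. rewrite Cmod_R, Rabs_right in F1 by lra.
    assert (N2 : ((r * ei t - b) ^ Datatypes.S k)%C <> 0) by (apply Cpow_nz; auto).
    rewrite Cmod_mult, Cmod_div, Cmod_pow, Cmod_ei_mul, Cmod_R, Rabs_right by (auto; lra).
    assert (P : 0 < (r - b) ^ Datatypes.S k) by (apply pow_lt; lra).
    assert (P2 : (r - b) ^ Datatypes.S k <= Cmod (r * ei t - b) ^ Datatypes.S k) by (apply pow_incr; lra).
    pose proof (Cmod_circle_fun r t ltac:(lra)). pose proof (HB t). pose proof (Cmod_ge_0 (circle_fun r t)).
    unfold Rdiv. apply Rmult_le_compat; auto; [|lra|].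
    + apply Rmult_le_pos; [lra|]. apply Rlt_le, Rinv_0_lt_compat. lra.
    + assert (/ Cmod (r * ei t - b) ^ Datatypes.S k <= / (r - b) ^ Datatypes.S k) by (apply Rinv_le_contravar; auto).
      assert (0 < / Cmod (r * ei t - b) ^ Datatypes.S k) by (apply Rinv_0_lt_compat; lra). nra.
Qed.

Lemma b_coef_PSon r : b < r < 1 -> exists B, PSon (fun _ => True) B (r - b) (fun k => b_coef k r) (fun t => pser (center_coef r) (b + t)).
Proof.
  intros Hr. pose proof S as [Hb _]. set (B := Cmod (zp (sqrt (1 - r ^ 2)) (- n)) * M). exists (B / (r - b)). split; [lra|split].
  - intros k. eapply Rle_trans; [apply (b_coef_bound k r B); auto; intros; apply Cmod_scaled_coef; lra|]. right. simpl. assert (P : (r - b) ^ k <> 0) by (apply pow_nonzero; lra). field. split; auto; lra.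
  - intros t _ Ht. assert (Hbm : Cmod b = b) by (rewrite Cmod_R, Rabs_right; lra).
    assert (Hbt : Cmod (b + t) < r) by (pose proof (Cmod_triangle b t); lra).
    rewrite center_coef_inside by (auto; lra).
    eapply cser_ext; [|apply (cauchy_series (circle_fun r) B r b (b + t))].
    + intros k. unfold b_coef. replace (b + t - b)%C with t by ring. auto.
    + apply circle_fun_cont. lra.
    + intros s. eapply Rle_trans; [apply Cmod_circle_fun; lra|apply Cmod_scaled_coef; lra].
    + lra.
    + lra.
    + replace (b + t - b)%C with t by ring. lra.
Qed.

End Comparison.

(** * The coordinate exchanging [0] and [b], and the comparison of both expansions *)

Lemma ei_neq_1 t : 0 < t < 3 -> ei t <> RtoC 1.
Proof.
  intros Ht A. apply (f_equal Im) in A. simpl in A. assert (0 < sin t); [|lra].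
  apply sin_gt_0; [lra|]. pose proof PI2_3_2. lra.
Qed.

Definition phi (b : R) (z : C) : C := ((z - b) / (1 - b * z))%C.

Lemma phi_close (b : R) (z : C) : 0 < b < 1 -> Cmod (z - b) <= (1 - b ^ 2) / 2 ->
  (1 - b * z)%C <> 0 /\ Cmod (phi b z) <= 2 * Cmod (z - b) / (1 - b ^ 2).
Proof.
  intros Hb Hz. assert (Hk : 0 < 1 - b ^ 2) by nra.
  assert (Hd : (1 - b ^ 2) / 2 <= Cmod (1 - b * z)).
  { pose proof (Cmod_triangle (1 - b * z) (b * (z - b))) as T.
    replace (1 - b * z + b * (z - b))%C with (RtoC (1 - b ^ 2)) in T by (rewrite RtoC_minus, RtoC_pow; ring).
    rewrite Cmod_mult, !Cmod_R, !Rabs_right in T by lra. pose proof (Cmod_ge_0 (z - b)). nra. }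
  assert (Hn : (1 - b * z)%C <> 0) by (intros A; rewrite A, Cmod_0 in Hd; lra). split; auto.
  unfold phi. rewrite Cmod_div by auto. apply Rle_div_l; [lra|].
  replace (2 * Cmod (z - b) / (1 - b ^ 2) * Cmod (1 - b * z)) with (Cmod (z - b) * (Cmod (1 - b * z) / ((1 - b ^ 2) / 2))) by (field; lra).
  rewrite <- (Rmult_1_r (Cmod (z - b))) at 1. apply Rmult_le_compat_l; [apply Cmod_ge_0|]. apply Rle_div_r; lra.
Qed.

Lemma mob_phi (b : R) (z : C) : 0 < b < 1 -> (1 - b * z)%C <> 0 -> (1 + b * phi b z)%C = ((1 - b ^ 2) / (1 - b * z))%C /\
  mob b (phi b z) = z.
Proof.
  intros Hb Hz. assert (Hk : (1 - b ^ 2)%C <> 0).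
  { rewrite <- RtoC_pow, <- RtoC_minus. intros A. apply RtoC_inj in A. nra. }
  assert (E : (1 + b * phi b z)%C = ((1 - b ^ 2) / (1 - b * z))%C) by (unfold phi; field; auto).
  split; auto. unfold mob. rewrite E. unfold phi. field. auto.
Qed.

Lemma phi_conj (b : R) (z : C) : (1 - b * z)%C <> 0 -> Cconj (phi b z) = phi b (Cconj z).
Proof. intros H. unfold phi. rewrite Cdiv_conj, !Cminus_conj, Cmult_conj, !Cconj_R by auto. auto. Qed.

Section Star.
Context {fr : C -> C -> C} {b d M L : R} (S : setup fr b d M L) (n : Z).

(** Converts [K], taken in the coordinate [phi b z], into [circle_fun]: the power of [z] times the
    inverse of the factor relating [K] to [scaled_coef]. *)
Definition mobius_factor (z : C) : C := (z ^ Z.abs_nat n * zp (sqrt (1 - b ^ 2)) (- n) * zp (1 + b * phi b z) n)%C.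

Lemma mobius_factor_cdiff z : (1 - b * z)%C <> 0 -> cdiff mobius_factor z.
Proof.
  intros Hz. pose proof S as [Hb _]. assert (Hk : (1 - b ^ 2)%C <> 0).
  { rewrite <- RtoC_pow, <- RtoC_minus. intros A. apply RtoC_inj in A. nra. }
  apply cdiff_mult; [apply cdiff_mult; [apply cdiff_pow, cdiff_id|apply cdiff_const]|].
  apply zp_cdiff.
  - apply cdiff_plus; [apply cdiff_const|]. apply cdiff_mult; [apply cdiff_const|]. unfold phi.
    apply cdiff_div; auto; apply cdiff_minus; auto using cdiff_id, cdiff_const. apply cdiff_mult; auto using cdiff_id, cdiff_const.
  - destruct (mob_phi b z Hb Hz) as [-> _]. intros A. apply Hk. apply Cmult_cancel_l with (/ (1 - b * z))%C; [apply Cinv_nz; auto|].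
    rewrite Cmult_0_r, <- A. unfold Cdiv. ring.
Qed.

Lemma mobius_factor_b : mobius_factor b <> 0.
Proof.
  pose proof S as [Hb _]. destruct (kap_pos S) as [Hk _]. unfold mobius_factor. replace (phi b b) with (RtoC 0).
  - assert (HR : forall a : R, 0 < a -> RtoC a <> 0) by (intros a Ha A; apply RtoC_inj in A; lra).
    repeat apply Cmult_neq_0; [apply Cpow_nz, HR; lra|apply zp_nz, HR; lra|apply zp_nz].
    replace (1 + b * 0)%C with (RtoC 1) by ring. apply HR. lra.
  - unfold phi. unfold Cdiv. replace (b - b)%C with (RtoC 0) by ring. ring.
Qed.

(* Both sides are holomorphic near [r] and agree on the circle of radius [r], where [r ^ 2 / z = Cconj z]. *)
Lemma center_b_comparison K e B : 0 < e -> hol2 K e B ->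
  (forall x r t, 0 <= r < 1 -> Cmod x < e -> mob b x = (r * ei t)%C ->
     K x (Cconj x) = (zp (sqrt (1 - b ^ 2)) n * zp (1 + b * x) (- n) * scaled_coef fr n r t)%C) ->
  exists del, 0 < del /\ forall r, b < r < 1 -> r < b + del -> forall z, Cmod (z - b) < del ->
    z <> 0 /\ Cmod (phi b z) < e /\ Cmod (phi b (r ^ 2 / z)) < e /\
    pser (center_coef (fr := fr) n r) z = (mobius_factor z * K (phi b z) (phi b (r ^ 2 / z)))%C.
Proof.
  intros He [K1 K2] HK. pose proof S as [Hb _]. destruct (center_coef_PSon S n) as [q [Hq HP]]. destruct (kap_pos S) as [Hkp _].
  assert (Hk : 0 < 1 - b ^ 2) by nra.
  (* [e0] keeps [phi b] below [e]; [e1], chosen next, keeps both [z] and its reflection [r ^ 2 / z]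
     within [e0] of [b]. *)
  set (e0 := Rmin ((1 - b ^ 2) / 2) (e * (1 - b ^ 2) / 4)). assert (He0 : 0 < e0) by (apply Rmin_pos; [lra|nra]).
  set (e1 := Rmin (b / 2) (b * e0 / 8)). assert (He1 : 0 < e1) by (apply Rmin_pos; nra).
  assert (H0 : forall z, Cmod (z - b) < e0 -> (1 - b * z)%C <> 0 /\ Cmod (phi b z) < e).
  { intros z Hz. apply Rmin_Rgt in Hz as [Z1 Z2]. destruct (phi_close b z Hb) as [P1 P2]; [lra|]. split; auto.
    eapply Rle_lt_trans; [apply P2|]. apply Rlt_div_l; nra. }
  assert (H1 : forall z r, b < r < 1 -> r < b + e1 -> Cmod (z - b) < e1 -> z <> 0 /\ Cmod (z - b) < e0 /\ Cmod (r ^ 2 / z - b) < e0).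
  { intros z r Hr1 Hr2 Hz. pose proof (Rmin_l (b / 2) (b * e0 / 8)). pose proof (Rmin_r (b / 2) (b * e0 / 8)). fold e1 in H, H1.
    assert (Hzb : b / 2 <= Cmod z).
    { pose proof (Cmod_le_add b z) as T. rewrite Cmod_R, Rabs_right, Cmod_sub_sym in T by lra. lra. }
    assert (Hz0 : z <> 0) by (intros A; rewrite A, Cmod_0 in Hzb; lra). split; auto. split; [nra|].
    replace (r ^ 2 / z - b)%C with ((RtoC (r ^ 2 - b ^ 2) - b * (z - b)) / z)%C by (rewrite RtoC_minus, !RtoC_pow; field; auto).
    rewrite Cmod_div by auto. apply Rlt_div_l; [lra|].
    eapply Rle_lt_trans; [apply Cmod_tri_minus|]. rewrite Cmod_mult, !Cmod_R, !Rabs_right by nra.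
    assert (b * Cmod (z - b) <= 1 * e1) by (apply Rmult_le_compat; try lra; apply Cmod_ge_0).
    assert (r ^ 2 - b ^ 2 <= 2 * e1) by nra. nra. }
  (* The disc of radius [2 * del] about [r] must stay within [e1] of [b] and inside the disc
     [|z| < r / q] where the series at [0] converges. *)
  set (del := Rmin (e1 / 4) (b * (1 / q - 1) / 4)).
  assert (Hdel : 0 < del). { apply Rmin_pos; [lra|]. assert (1 < 1 / q) by (apply Rlt_div_r; lra). nra. }
  assert (D1 : del <= e1 / 4) by apply Rmin_l. assert (D2 : del <= b * (1 / q - 1) / 4) by apply Rmin_r.
  exists del. split; auto. intros r Hr Hrd z Hz.
  assert (Hrb : Cmod (r - b) = r - b) by (rewrite <- RtoC_minus, Cmod_R, Rabs_right; lra).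
  assert (Hdisc : forall y, Cmod (y - r) < 2 * del -> Cmod (y - b) < e1).
  { intros y Hy. pose proof (Cmod_tri_sub y r b). lra. }
  destruct (H1 z r Hr ltac:(lra) ltac:(lra)) as [Z1 [Z2 Z3]]. destruct (H0 z Z2) as [Z4 Z5]. destruct (H0 _ Z3) as [Z6 Z7].
  do 3 (split; auto). apply Ceq_sub.
  apply (zero_disc (fun z => pser (center_coef (fr := fr) n r) z - mobius_factor z * K (phi b z) (phi b (r ^ 2 / z)))%C r (2 * del)); [lra| | |].
  - intros y Hy. destruct (H1 y r Hr ltac:(lra) (Hdisc y Hy)) as [Y1 [Y2 Y3]]. destruct (H0 y Y2) as [Y4 Y5]. destruct (H0 _ Y3) as [Y6 Y7].
    apply cdiff_minus.
    + destruct (HP r ltac:(lra)) as [B' HB']. eapply PSon_cdiff; [apply HB'|].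
      pose proof (Cmod_le_add y r) as T. rewrite Cmod_R, Rabs_right in T by lra.
      assert (b * (1 / q - 1) <= r * (1 / q - 1)) by (assert (1 < 1 / q) by (apply Rlt_div_r; lra); nra).
      replace (r / q) with (r + r * (1 / q - 1)) by (field; lra). lra.
    + apply cdiff_mult; [apply mobius_factor_cdiff; auto|].
      assert (Lphi : forall g, ldiff g y -> (1 - b * g y)%C <> 0 -> ldiff (fun s => phi b (g s)) y).
      { intros g Lg Hg. apply (ldiff_div (fun s => g s - b)%C (fun s => 1 - b * g s)%C); auto.
        - apply ldiff_minus; auto. apply ldiff_const.
        - apply (ldiff_minus (fun _ => 1)%C (fun s => b * g s)%C); [apply ldiff_const|apply (ldiff_mult (fun _ => RtoC b)); [apply ldiff_const|auto]]. }
      assert (Lid : ldiff (fun s => s) y) by (apply ldiff_all; intros; apply cdiff_id).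
      apply (K2 (fun s => phi b s) (fun s => phi b (r ^ 2 / s))%C); auto.
      apply (Lphi (fun s => r ^ 2 / s)%C); auto. apply ldiff_div; auto. apply ldiff_const.
  (* Points [r * ei t] of the circle with small [t > 0] accumulate at [r] and differ from it. *)
  - intros e' He'. set (t := Rmin 1 (Rmin (e' / 2) del)). assert (Ht : 0 < t) by (unfold t; repeat apply Rmin_pos; lra).
    assert (T1 : t <= 1) by apply Rmin_l. assert (T2 : t <= e' / 2) by (eapply Rle_trans; [apply Rmin_r|apply Rmin_l]).
    assert (T3 : t <= del) by (eapply Rle_trans; [apply Rmin_r|apply Rmin_r]).
    assert (Hr0 : RtoC r <> 0) by (intros A; apply RtoC_inj in A; lra).
    assert (Hdist : Cmod (r * ei t - r) <= t).
    { replace (r * ei t - r)%C with (r * (ei t - ei 0))%C by (rewrite ei_0; ring). rewrite Cmod_mult, Cmod_R, Rabs_right by lra.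
      pose proof (ei_lip t 0). rewrite Rminus_0_r, Rabs_right in H by lra. pose proof (Cmod_ge_0 (ei t - ei 0)). nra. }
    exists (r * ei t)%C. split; [|split; [lra|]].
    + intros A. apply (ei_neq_1 t); [lra|]. apply Cmult_cancel_l with (RtoC r); auto. rewrite A. ring.
    + set (y := (r * ei t)%C). destruct (H1 y r Hr ltac:(lra) (Hdisc y ltac:(unfold y; lra))) as [Y1 [Y2 Y3]]. destruct (H0 y Y2) as [Y4 Y5].
      assert (Ec : (r ^ 2 / y)%C = Cconj y).
      { unfold y. rewrite Cmult_conj, ei_conj, Cconj_R. apply Cmult_cancel_l with (r * ei t)%C; auto.
        transitivity (r ^ 2)%C; [field; split; [apply ei_nz|auto]|].
        replace (r * ei t * (r * ei (- t)))%C with (r ^ 2 * (ei (- t) * ei t))%C by ring. rewrite ei_neg_mul. ring. }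
      rewrite Ec, <- phi_conj by auto. destruct (mob_phi b y Hb Y4) as [M1 M2].
      rewrite (HK (phi b y) r t) by (auto; lra). unfold y at 1. rewrite center_coef_circle by (try apply S; lra). fold y.
      unfold circle_fun, mobius_factor. fold y.
      assert (G1 : (zp (sqrt (1 - b ^ 2)) (- n) * zp (sqrt (1 - b ^ 2)) n)%C = 1).
      { rewrite Cmult_comm. apply zp_opp. intros A; apply RtoC_inj in A; lra. }
      assert (G2 : (zp (1 + b * phi b y) n * zp (1 + b * phi b y) (- n))%C = 1).
      { apply zp_opp. apply mobius_den; [lra|]. assert (e <= 1 \/ 1 < e) as [E1|E1] by lra; [lra|].
        destruct (phi_close b y Hb) as [_ P2]; [apply Rmin_Rgt in Y2; lra|]. eapply Rle_trans; [apply P2|]. apply Rle_div_l; [lra|].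
        apply Rmin_Rgt in Y2. lra. }
      replace (y ^ Z.abs_nat n * zp (sqrt (1 - b ^ 2)) (- n) * zp (1 + b * phi b y) n * (zp (sqrt (1 - b ^ 2)) n * zp (1 + b * phi b y) (- n) * scaled_coef fr n r t))%C with
        (y ^ Z.abs_nat n * (zp (sqrt (1 - b ^ 2)) (- n) * zp (sqrt (1 - b ^ 2)) n) * (zp (1 + b * phi b y) n * zp (1 + b * phi b y) (- n)) * scaled_coef fr n r t)%C by ring.
      rewrite G1, G2. ring.
  - pose proof (Cmod_tri_sub z b r) as T. rewrite (Cmod_sub_sym b r), Hrb in T. lra.
Qed.

Lemma Cmod_near_circle r (z : C) e : Rabs (Cmod z - r) < e -> r - e < Cmod z < r + e.
Proof. intros H. apply Rabs_def2 in H. lra. Qed.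

Lemma b_coef_lps k r : b < r < 1 -> lps (b_coef (fr := fr) (b := b) n k) r.
Proof.
  intros Hr. pose proof S as [Hb _]. set (N := Z.abs_nat n).
  apply lps_ext_loc with (fun r : R => avg (fun t => (r * ei t) ^ N * (r * ei t / (r * ei t - b) ^ Datatypes.S k) * scaled_coef fr n r t)%C) 1; [lra| |].
  { intros y _. apply avg_ext. intros t. unfold circle_fun. fold N. ring. }
  set (e0 := (r - b) / 2).
  apply (scaled_coef_lps S (fun z => z ^ N * (z / (z - b) ^ Datatypes.S k))%C n r e0 (2 ^ N * (2 / e0 ^ Datatypes.S k))); [lra|unfold e0; lra|].
  intros z Hz. apply Cmod_near_circle in Hz.
  assert (Hzb : e0 <= Cmod (z - b)).
  { pose proof (Cmod_le_add z b) as T. rewrite Cmod_R, Rabs_right in T by lra. unfold e0 in *. lra. }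
  assert (He0 : 0 < e0) by (unfold e0; lra).
  assert (Hn : (z - b)%C <> 0) by (intros A; rewrite A, Cmod_0 in Hzb; lra).
  assert (Hn2 : ((z - b) ^ Datatypes.S k)%C <> 0) by (apply Cpow_nz; auto).
  split.
  - apply cdiff_mult; [apply cdiff_pow, cdiff_id|]. apply cdiff_div; auto; [apply cdiff_id|apply cdiff_pow, cdiff_minus; auto using cdiff_id, cdiff_const].
  - assert (Cmod z <= 2) by (unfold e0 in *; lra).
    rewrite Cmod_mult, Cmod_div, !Cmod_pow by auto. assert (P : 0 < e0 ^ Datatypes.S k) by (apply pow_lt; auto).
    assert (P2 : e0 ^ Datatypes.S k <= Cmod (z - b) ^ Datatypes.S k) by (apply pow_incr; lra).
    apply Rmult_le_compat; [apply pow_le, Cmod_ge_0|apply Rmult_le_pos; [apply Cmod_ge_0|apply Rlt_le, Rinv_0_lt_compat; lra]|apply pow_incr; split; auto; apply Cmod_ge_0|].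
    apply Rmult_le_compat; [apply Cmod_ge_0|apply Rlt_le, Rinv_0_lt_compat; lra|auto|apply Rinv_le_contravar; auto].
Qed.

Lemma center_coef_avg m r : 0 < r < 1 -> center_coef (fr := fr) n r m = avg (fun t => (r * ei t) ^ Z.abs_nat n / (r * ei t) ^ m * scaled_coef fr n r t)%C.
Proof.
  intros Hr. assert (Hr0 : RtoC r <> 0) by (intros A; apply RtoC_inj in A; lra).
  unfold center_coef, mode. unfold Cdiv. rewrite Cmult_comm, <- avg_scal by (apply ccont_mult; [apply (circle_fun_cont S); lra|apply ccont_ei]).
  apply avg_ext. intros t. unfold circle_fun. rewrite <- INR_IZR_INZ. replace (- INR m * t) with (- (INR m * t)) by ring.
  assert (E : (ei (- (INR m * t)))%C = (/ ei t ^ m)%C).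
  { rewrite ei_pow. apply Cmult_cancel_l with (ei (INR m * t)); [apply ei_nz|]. rewrite Cinv_r, Cmult_comm by apply ei_nz. apply ei_neg_mul. }
  rewrite E, (Cpow_mult_l _ _ m). assert (RtoC r ^ m <> 0)%C by (apply Cpow_nz; auto). assert (ei t ^ m <> 0)%C by (apply Cpow_nz, ei_nz).
  field. auto.
Qed.

Lemma center_coef_lps m r : 0 < r < 1 -> lps (fun r => center_coef (fr := fr) n r m) r.
Proof.
  intros Hr. set (N := Z.abs_nat n).
  apply lps_ext_loc with (fun r : R => avg (fun t => (r * ei t) ^ N / (r * ei t) ^ m * scaled_coef fr n r t)%C) (Rmin r (1 - r)); [apply Rmin_pos; lra| |].
  { intros y Hy. apply Rmin_Rgt in Hy as [Y1 Y2]. apply Rabs_def2 in Y1, Y2. symmetry. apply center_coef_avg. lra. }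
  set (e0 := r / 2).
  apply (scaled_coef_lps S (fun z => z ^ N / z ^ m)%C n r e0 (2 ^ N * / e0 ^ m)); [lra|unfold e0; lra|].
  intros z Hz. apply Cmod_near_circle in Hz. assert (He0 : 0 < e0) by (unfold e0; lra).
  assert (Hzb : e0 <= Cmod z) by (unfold e0 in *; lra).
  assert (Hn : z <> 0) by (intros A; rewrite A, Cmod_0 in Hzb; lra).
  assert (Hn2 : (z ^ m)%C <> 0) by (apply Cpow_nz; auto).
  split.
  - apply cdiff_div; auto; apply cdiff_pow, cdiff_id.
  - assert (Cmod z <= 2) by (unfold e0 in *; lra).
    rewrite Cmod_div, !Cmod_pow by auto. assert (P : 0 < e0 ^ m) by (apply pow_lt; auto).
    assert (P2 : e0 ^ m <= Cmod z ^ m) by (apply pow_incr; lra).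
    apply Rmult_le_compat; [apply pow_le, Cmod_ge_0|apply Rlt_le, Rinv_0_lt_compat; lra|apply pow_incr; split; auto; apply Cmod_ge_0|apply Rinv_le_contravar; auto].
Qed.

End Star.

(** * The coefficients do not depend on the radius *)

Lemma PSon_lead P M d a h t k : PSon P M d a h -> (forall j, (j < k)%nat -> a j = RtoC 0) -> P t -> Cmod t <= d / 2 ->
  Cmod (h t - a k * t ^ k) <= 2 * M * (Cmod t / d) ^ S k.
Proof.
  intros H Ha Pt Ht. pose proof (proj1 H) as Hd. pose proof (PSon_M _ _ _ _ _ H) as HM.
  assert (Hq : Cmod t / d <= 1 / 2) by (apply Rle_div_l; lra).
  assert (Hq0 : 0 <= Cmod t / d) by (apply Rle_div_r; [lra|rewrite Rmult_0_l; apply Cmod_ge_0]).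
  pose proof (PSon_tail _ _ _ _ _ t H Pt ltac:(lra) (S k)) as T. cbn [csum] in T.
  rewrite csum_eq0 in T by (intros j Hj; rewrite Ha by auto; ring). rewrite Cplus_0_l in T.
  rewrite Cmod_sub_sym. eapply Rle_trans; [apply T|]. apply Rle_div_l; [lra|].
  pose proof (pow_le (Cmod t / d) (S k) Hq0). assert (0 <= M * (Cmod t / d) ^ S k) by nra. nra.
Qed.

Lemma lim_zero D C0 t0 : ccont_at D 0 -> 0 < t0 -> (forall t, 0 < t < t0 -> Cmod (D t) <= C0 * t) -> D 0 = 0.
Proof.
  intros Hc Ht H. apply Cmod_small_0. intros e He. destruct (Hc (e / 2)) as [d [Hd HD]]; [lra|].
  set (C1 := Rabs C0 + 1). assert (HC : 0 < C1) by (unfold C1; pose proof (Rabs_pos C0); lra).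
  set (t := Rmin (d / 2) (Rmin (t0 / 2) (e / (2 * C1)))).
  assert (0 < t) by (unfold t; repeat apply Rmin_pos; try lra; apply Rdiv_lt_0_compat; lra).
  assert (T1 : t <= d / 2) by apply Rmin_l. assert (T2 : t <= t0 / 2) by (eapply Rle_trans; [apply Rmin_r|apply Rmin_l]).
  assert (T3 : t <= e / (2 * C1)) by (eapply Rle_trans; [apply Rmin_r|apply Rmin_r]).
  specialize (HD t). rewrite Rminus_0_r, Rabs_right in HD by lra. specialize (HD ltac:(lra)).
  specialize (H t ltac:(lra)). pose proof (Cmod_le_add (D 0) (D t)) as T. rewrite Cmod_sub_sym in T.
  assert (C0 * t <= C1 * t). { apply Rmult_le_compat_r; [lra|]. unfold C1. pose proof (Rle_abs C0). lra. }
  apply Rle_div_r in T3; [|lra]. nra.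
Qed.

Lemma sqrt_close x y : 0 <= x -> 0 < y -> Rabs (sqrt x - sqrt y) <= Rabs (x - y) / sqrt y.
Proof.
  intros Hx Hy. assert (0 < sqrt y) by (apply sqrt_lt_R0; auto). apply Rle_div_r; auto.
  rewrite <- (sqrt_sqrt x Hx) at 2. rewrite <- (sqrt_sqrt y) at 3 by lra.
  replace (sqrt x * sqrt x - sqrt y * sqrt y) with ((sqrt x - sqrt y) * (sqrt x + sqrt y)) by ring.
  rewrite Rabs_mult. apply Rmult_le_compat_l; [apply Rabs_pos|]. pose proof (sqrt_pos x). rewrite Rabs_right; lra.
Qed.

(** Dividing by [y ^ k] for large [y] shows that the leading coefficient vanishes; the constant one
    is left free. *)
Lemma poly_bounded k : forall (c : nat -> C) B Y, (forall y : R, Y < y -> Cmod (csum (fun j => c j * y ^ j)%C (S k)) <= B) ->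
  forall j, (1 <= j <= k)%nat -> c j = 0.
Proof.
  induction k as [|k IH]; intros c B Y H j Hj; [lia|].
  assert (Hlead : c (S k) = 0).
  { apply Cmod_small_0. intros e He. set (A := rsum (fun j => Cmod (c j)) (S k)).
    assert (HA : forall y, 1 <= y -> Cmod (csum (fun j => c j * y ^ j)%C (S k)) <= y ^ k * A).
    { intros y Hy. unfold A. rewrite <- rsum_scal. apply csum_bound. intros i Hi. rewrite Cmod_mult, Cmod_pow, Cmod_R, Rabs_right by lra.
      rewrite Rmult_comm. apply Rmult_le_compat_r; [apply Cmod_ge_0|]. apply Rle_pow; auto. lia. }
    assert (HA0 : 0 <= A). { specialize (HA 1 ltac:(lra)). rewrite pow1 in HA. pose proof (Cmod_ge_0 (csum (fun j => c j * 1 ^ j)%C (S k))). lra. }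
    set (y := Rmax 1 (Rmax (Y + 1) ((Rabs B + A) / e))).
    assert (Y1 : 1 <= y) by apply Rmax_l. assert (Y2 : Y + 1 <= y) by (eapply Rle_trans; [|apply Rmax_r]; apply Rmax_l).
    assert (Y3 : (Rabs B + A) / e <= y) by (eapply Rle_trans; [|apply Rmax_r]; apply Rmax_r).
    specialize (H y ltac:(lra)). cbn [csum] in H. specialize (HA y Y1). cbn [csum] in HA. set (s := (csum (fun j => c j * y ^ j) k + c k * y ^ k)%C) in *.
    pose proof (Cmod_triangle (s + c (S k) * y ^ S k) (- s)) as T. rewrite Cmod_opp in T.
    replace (s + c (S k) * y ^ S k + - s)%C with (c (S k) * y ^ S k)%C in T by ring.
    rewrite Cmod_mult, Cmod_pow, Cmod_R, Rabs_right in T by lra. simpl pow in T.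
    assert (1 <= y ^ k) by (apply pow_R1_Rle; auto). pose proof (Rle_abs B). apply Rle_div_l in Y3; auto.
    assert (T2 : Cmod (c (S k)) * y * y ^ k <= (Rabs B + A) * y ^ k) by (pose proof (Rabs_pos B); nra).
    apply Rmult_le_reg_r in T2; [|lra]. apply Rmult_le_reg_r with y; lra. }
  destruct (Nat.eq_dec j (S k)) as [->|Hjk]; auto.
  apply (IH c B Y); [|lia]. intros y Hy. specialize (H y Hy). cbn [csum] in *. rewrite Hlead in H.
  replace (csum (fun j => c j * y ^ j) k + c k * y ^ k)%C with (csum (fun j => c j * y ^ j) k + c k * y ^ k + 0 * y ^ S k)%C by ring. auto.
Qed.

Section Induction.
Context {fr : C -> C -> C} {b d M L : R} (S : setup fr b d M L) (n : Z).

Let bet := b_coef (fr := fr) (b := b) n.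
Let hr := center_coef (fr := fr) n.

Lemma scaled_coef_unif r2 : r2 < 1 -> exists B, 0 <= B /\ forall r t, 0 <= r <= r2 -> Cmod (scaled_coef fr n r t) <= B.
Proof.
  intros H2.
  exists ((1 + / sqrt (1 - r2 ^ 2) ^ Z.abs_nat n) * Rabs M).
  assert (HW : forall r, 0 <= r <= r2 -> 0 <= Cmod (zp (sqrt (1 - r ^ 2)) (- n)) <= 1 + / sqrt (1 - r2 ^ 2) ^ Z.abs_nat n).
  { intros r Hr. split; [apply Cmod_ge_0|]. assert (P2 : 0 < sqrt (1 - r2 ^ 2)) by (apply sqrt_lt_R0; nra).
    assert (P : sqrt (1 - r2 ^ 2) <= sqrt (1 - r ^ 2)) by (apply sqrt_le_1_alt; nra).
    assert (P1 : sqrt (1 - r ^ 2) <= 1). { rewrite <- sqrt_1 at 2. apply sqrt_le_1_alt. nra. }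
    assert (PI : 0 < / sqrt (1 - r2 ^ 2) ^ Z.abs_nat n) by (apply Rinv_0_lt_compat, pow_lt; auto).
    rewrite Cmod_zp by (intros A; apply RtoC_inj in A; lra). rewrite Cmod_R, Rabs_right by lra. destruct Z_le_dec.
    - assert (sqrt (1 - r ^ 2) ^ Z.to_nat (- n) <= 1); [|lra]. eapply Rle_trans; [apply (pow_incr _ 1); lra|rewrite pow1; lra].
    - replace (Z.to_nat (- - n)) with (Z.abs_nat n) by lia.
      assert (/ sqrt (1 - r ^ 2) ^ Z.abs_nat n <= / sqrt (1 - r2 ^ 2) ^ Z.abs_nat n); [|lra].
      apply Rinv_le_contravar; [apply pow_lt; auto|]. apply pow_incr; lra. }
  split.
  - apply Rmult_le_pos; [|apply Rabs_pos]. destruct (Rle_dec 0 r2) as [Hr|Hr]; [specialize (HW 0 ltac:(lra)); lra|].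
    destruct (Rlt_dec 0 (1 - r2 ^ 2)) as [Hp|Hp].
    + assert (0 < / sqrt (1 - r2 ^ 2) ^ Z.abs_nat n); [|lra]. apply Rinv_0_lt_compat, pow_lt, sqrt_lt_R0. auto.
    (* Here [r2 <= -1], so no radius qualifies and only the sign of the bound is at stake: the root
       is [0], and so is the inverse of [0]. *)
    + rewrite sqrt_neg_0 by lra. destruct (Z.abs_nat n); simpl; [lra|]. rewrite Rmult_0_l, Rinv_0. lra.
  - intros r t Hr. unfold scaled_coef. rewrite Cmod_mult. specialize (HW r Hr). apply Rmult_le_compat; try apply Cmod_ge_0; [apply HW|].
    eapply Rle_trans; [apply (fiber_coef_bound S); lra|apply Rle_abs].
Qed.

Context {K : C -> C -> C} {e B : R} {p : nat -> C -> C} {c : nat -> nat -> C} {del : R}.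
Hypothesis He : 0 < e.
Hypothesis Hp1 : forall y, Cmod y < e -> PSon (fun _ => True) B e (fun i => p i y) (fun x => K x y).
Hypothesis Hp2 : forall i y, Cmod y < e -> p i y = csum (fun j => c i j * y ^ j)%C (Datatypes.S i).
Hypothesis Hdel : 0 < del.
Hypothesis Hstar : forall r, b < r < 1 -> r < b + del -> forall z, Cmod (z - b) < del ->
    z <> 0 /\ Cmod (phi b z) < e /\ Cmod (phi b (r ^ 2 / z)) < e /\
    pser (hr r) z = (mobius_factor (b := b) n z * K (phi b z) (phi b (r ^ 2 / z)))%C.

(** Both expansions at once: subtracting two radii, respectively two arguments of [K], then cancels
    all terms of order below [k] on both sides. *)
Definition const_upto (k : nat) : Prop := forall j, (j < k)%nat ->
  (forall r r', b < r < 1 -> b < r' < 1 -> bet j r = bet j r') /\ (forall y, Cmod y < e -> p j y = p j 0).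

Lemma phi_w w : b < w < b + del -> w < 1 -> Cmod (phi b w) < e.
Proof.
  intros Hw Hw1. pose proof S as [Hb _]. destruct (Hstar w ltac:(lra) ltac:(lra) w) as [_ [H _]]; auto.
  rewrite <- RtoC_minus, Cmod_R, Rabs_right; lra.
Qed.

(** Take [z = b + t] and the radii with [r ^ 2 = z * w] and [r' ^ 2 = z * w'], so that [r ^ 2 / z]
    is [w] and [r' ^ 2 / z] is [w']. Subtracting the identities of [Hstar], the left side begins
    with a multiple of [t ^ k], the right side with one of [phi b z ^ k], and
    [phi b z = t / (1 - b * z)]. Division by [t ^ k] and [t -> 0] gives the claim. *)
Lemma b_coef_step k w w' : const_upto k -> b < w < b + del -> b < w' < b + del -> w < 1 -> w' < 1 ->
  (bet k (sqrt (b * w)) - bet k (sqrt (b * w')))%C = (mobius_factor (b := b) n b * (/ (1 - b * b)) ^ k * (p k (phi b w) - p k (phi b w')))%C.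
Proof.
  intros Hk Hw Hw' Hw1 Hw1'. pose proof S as [Hb _].
  assert (Hbb : (1 - b * b)%C <> 0). { rewrite <- RtoC_mult, <- RtoC_minus. intros A. apply RtoC_inj in A. nra. }
  set (qk := (p k (phi b w) - p k (phi b w'))%C).
  (* The defect of the claim with [b] replaced by [b + t]. It is continuous at [0], and
     [t ^ k * D t] is a difference of two remainders of order [k + 1], so [D t = O(t)]. *)
  set (D := fun t : R => (bet k (sqrt ((b + t) * w)) - bet k (sqrt ((b + t) * w')) - mobius_factor (b := b) n (b + t)%R * (/ (1 - b * (b + t)%R)) ^ k * qk)%C).
  assert (Hsb : forall v, b < v < 1 -> b < sqrt (b * v) < 1).
  { intros v Hv. split.
    - rewrite <- (sqrt_square b) at 1 by lra. apply sqrt_lt_1_alt. nra.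
    - rewrite <- sqrt_1. apply sqrt_lt_1_alt. nra. }
  assert (Hcb : forall v, b < v < 1 -> ccont_at (fun t => bet k (sqrt ((b + t) * v))) 0).
  { intros v Hv e' He'. destruct (lps_cont _ _ (b_coef_lps S n k (sqrt (b * v)) (Hsb v Hv)) e' He') as [d1 [Hd1 H1]].
    pose proof (Hsb v Hv) as Hs. exists (Rmin b (d1 * b)). split; [apply Rmin_pos; nra|]. intros s Hs'. rewrite Rminus_0_r in Hs'.
    apply Rmin_Rgt in Hs' as [S1 S2]. rewrite Rplus_0_r. apply H1. apply Rabs_def2 in S1.
    eapply Rle_lt_trans; [apply sqrt_close; nra|]. apply Rlt_div_l; [lra|].
    replace ((b + s) * v - b * v) with (s * v) by ring. rewrite Rabs_mult, (Rabs_right v) by lra. pose proof (Rabs_pos s). nra. }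
  assert (Hphi : forall v : R, b < v < 1 -> (1 - b * v)%C <> 0).
  { intros v Hv. rewrite <- RtoC_mult, <- RtoC_minus. intros A. apply RtoC_inj in A. nra. }
  assert (Hcr : ccont_at (fun t : R => RtoC (b + t)) 0).
  { intros e' He'. exists e'. split; auto. intros s Hs. rewrite <- RtoC_minus, Cmod_R. replace (b + s - (b + 0)) with (s - 0) by ring. auto. }
  assert (HbbR : (1 - b * RtoC (b + 0))%C <> 0) by (rewrite Rplus_0_r; auto).
  assert (HWc : ccont_at (fun t : R => mobius_factor (b := b) n (b + t)%R) 0).
  { apply (cdiff_ccont_at (mobius_factor (b := b) n) (fun t : R => RtoC (b + t)) 0 Hcr). apply (mobius_factor_cdiff S). auto. }
  assert (HD : ccont_at D 0).
  { apply ccont_at_minus; [apply ccont_at_minus; apply Hcb; lra|].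
    apply ccont_at_mult; [|apply ccont_at_const]. apply ccont_at_mult; auto.
    apply (cdiff_ccont_at (fun z => (/ (1 - b * z)) ^ k)%C (fun t : R => RtoC (b + t)) 0 Hcr).
    apply cdiff_pow. apply (cdiff_inv (fun z => 1 - b * z)%C); auto. apply cdiff_minus; [apply cdiff_const|].
    apply cdiff_mult; auto using cdiff_const, cdiff_id. }
  assert (D 0 = 0).
  2:{ unfold D in H. rewrite Rplus_0_r in H. apply Ceq_sub in H. auto. }
  set (m := Rmin w w'). set (mm := Rmax w w').
  assert (Hm : b < m) by (apply Rmin_glb_lt; lra). assert (Hm1 : m <= w /\ m <= w') by (split; [apply Rmin_l|apply Rmin_r]).
  assert (Hmm : mm < 1) by (apply Rmax_lub_lt; lra). assert (Hmm1 : w <= mm /\ w' <= mm) by (split; [apply Rmax_l|apply Rmax_r]).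
  destruct (scaled_coef_unif mm Hmm) as [B1 [HB1 HB1']].
  (* A lower bound, uniform in [t], for the distance from [b] to both moving circles; it makes the
     remainders of the expansions at [b] uniform. *)
  set (s0 := sqrt (b * m) - b). assert (Hs0 : 0 < s0) by (unfold s0; pose proof (Hsb m ltac:(lra)); lra).
  destruct (HWc 1 ltac:(lra)) as [d1 [Hd1 HW1]].
  pose proof (Hp1 _ (phi_w w Hw Hw1)) as Pw. pose proof (Hp1 _ (phi_w w' Hw' Hw1')) as Pw'.
  set (W0 := Cmod (mobius_factor (b := b) n (b + 0)%R) + 1). assert (HW0 : 0 < W0) by (unfold W0; pose proof (Cmod_ge_0 (mobius_factor (b := b) n (b + 0)%R)); lra).
  set (kk := 1 - b ^ 2). assert (Hkk : 0 < kk) by (unfold kk; nra).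
  set (t0 := Rmin (Rmin (s0 / 2) del) (Rmin (Rmin d1 (m - b)) (Rmin (kk / 2) (e * kk / 4)))).
  assert (Ht0 : 0 < t0). { unfold t0. repeat apply Rmin_pos; try lra. nra. }
  pose proof (PSon_M _ _ _ _ _ Pw) as HB.
  set (Q := 2 / kk).
  apply (lim_zero D (2 * (B1 / s0 + B1 / s0) / s0 ^ Datatypes.S k + W0 * (2 * (B + B) * (Q / e) ^ Datatypes.S k)) t0); auto.
  intros t Ht. destruct Ht as [Ht Htt]. unfold t0 in Htt. apply Rmin_Rgt in Htt as [Ta Tb]. apply Rmin_Rgt in Ta as [T1 T2]. apply Rmin_Rgt in Tb as [Tb Tc].
  apply Rmin_Rgt in Tb as [T3 T4]. apply Rmin_Rgt in Tc as [T5 T6].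
  set (z := RtoC (b + t)). set (x := phi b z).
  assert (Hzt : (z - b)%C = RtoC t) by (unfold z; rewrite RtoC_plus; ring).
  assert (Hzm : Cmod (z - b) = t) by (rewrite Hzt, Cmod_R, Rabs_right; lra).
  assert (Hr : forall v, b < v < b + del -> v < 1 -> m <= v <= mm -> let r := sqrt ((b + t) * v) in b < r < 1 /\ r < b + del /\ r <= mm /\ s0 <= r - b /\ (r ^ 2 / z)%C = v).
  { intros v Hv Hv1 Hvm r. assert (Hr2 : r * r = (b + t) * v) by (apply sqrt_sqrt; nra).
    assert (R1 : r <= v). { apply Rle_trans with (sqrt (v * v)); [apply sqrt_le_1_alt, Rmult_le_compat_r; lra|rewrite sqrt_square; lra]. }
    assert (R2 : s0 <= r - b). { unfold s0. assert (sqrt (b * m) <= r); [|lra]. apply sqrt_le_1_alt. nra. }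
    repeat split; try lra. rewrite <- RtoC_pow. replace (r ^ 2) with ((b + t) * v) by (rewrite <- Hr2; ring). unfold z. rewrite RtoC_mult. field.
    intros A. apply RtoC_inj in A. lra. }
  destruct (Hr w Hw Hw1 ltac:(lra)) as [R1 [R2 [R3 [R4 R5]]]]. destruct (Hr w' Hw' Hw1' ltac:(lra)) as [R1' [R2' [R3' [R4' R5']]]].
  set (r := sqrt ((b + t) * w)) in *. set (r' := sqrt ((b + t) * w')) in *.
  destruct (Hstar r R1 R2 z ltac:(lra)) as [Z1 [Z2 [Z3 Z4]]]. destruct (Hstar r' R1' R2' z ltac:(lra)) as [_ [_ [Z3' Z4']]].
  rewrite R5 in *. rewrite R5' in *. fold x in Z2, Z4, Z4'.
  assert (HPb : forall v, b < v < 1 -> v <= mm -> s0 <= v - b -> PSon (fun _ => True) (B1 / s0) s0 (fun j => bet j v) (fun t => pser (hr v) (b + t))).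
  { intros v Hv Hv2 Hv3. destruct (b_coef_PSon S n v Hv) as [B' [_ [_ HP]]]. split; [auto|split].
    - intros j. eapply Rle_trans; [apply (b_coef_bound S n j v B1 Hv); intros; apply HB1'; lra|].
      replace (B1 / s0 / s0 ^ j) with (B1 / s0 ^ Datatypes.S j) by (assert (s0 ^ j <> 0) by (apply pow_nonzero; lra); simpl; field; split; auto; lra).
      unfold Rdiv. apply Rmult_le_compat_l; auto. apply Rinv_le_contravar; [apply pow_lt; auto|]. apply pow_incr; lra.
    - intros s _ Hs. apply HP; auto. lra. }
  pose proof (PSon_minus _ _ _ _ _ _ _ _ (HPb r R1 R3 R4) (HPb r' R1' R3' R4')) as PL.
  assert (L1 := PSon_lead _ _ _ _ _ (RtoC t) k PL). cbv beta in L1.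
  assert (Hct : Cmod t = t) by (rewrite Cmod_R, Rabs_right; lra). rewrite Hct in L1.
  specialize (L1 ltac:(intros j Hj; rewrite (proj1 (Hk j Hj) r r') by auto; ring) I ltac:(lra)).
  pose proof (PSon_minus _ _ _ _ _ _ _ _ Pw Pw') as PR.
  assert (Hden : (1 - b * z)%C <> 0 /\ Cmod x <= Q * t).
  { destruct (phi_close b z Hb) as [X1 X2]; [fold kk; lra|]. split; auto. eapply Rle_trans; [apply X2|]. rewrite Hzm. fold kk. right. unfold Q. field. lra. }
  destruct Hden as [Hden Hx].
  assert (Hxe : Cmod x <= e / 2). { eapply Rle_trans; [apply Hx|]. unfold Q. replace (2 / kk * t) with (2 * t / kk) by (field; lra). apply Rle_div_l; lra. }
  assert (L2 := PSon_lead _ _ _ _ _ x k PR). cbv beta in L2.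
  specialize (L2 ltac:(intros j Hj; rewrite (proj2 (Hk j Hj) _ Z3), (proj2 (Hk j Hj) _ Z3'); ring) I Hxe). fold qk in L2.
  assert (Ez : (b + t)%C = z) by (unfold z; rewrite RtoC_plus; auto). rewrite Ez, Z4, Z4' in L1.
  assert (Ext : x = (/ (1 - b * z) * t)%C). { unfold x, phi. rewrite Hzt. unfold Cdiv. ring. }
  assert (HW : Cmod (mobius_factor (b := b) n z) <= W0).
  { specialize (HW1 t). rewrite Rminus_0_r, Rabs_right in HW1 by lra. specialize (HW1 ltac:(lra)). fold z in HW1.
    pose proof (Cmod_le_add (mobius_factor (b := b) n z) (mobius_factor (b := b) n (b + 0)%R)). unfold W0. lra. }
  set (U := (mobius_factor (b := b) n z * K x (phi b w) - mobius_factor (b := b) n z * K x (phi b w'))%C) in *.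
  assert (E : (t ^ k * D t)%C = ((mobius_factor (b := b) n z * (K x (phi b w) - K x (phi b w') - qk * x ^ k)) - (U - (bet k r - bet k r') * t ^ k))%C).
  { unfold D, U. fold r r' z. rewrite Ext at 3. rewrite Cpow_mult_l. ring. }
  assert (Htk : 0 < t ^ k) by (apply pow_lt; auto).
  apply Rmult_le_reg_l with (t ^ k); auto.
  replace (t ^ k * Cmod (D t)) with (Cmod (t ^ k * D t)%C) by (rewrite Cmod_mult, Cmod_pow, Hct; auto).
  rewrite E. eapply Rle_trans; [apply Cmod_tri_minus|]. rewrite Cmod_mult.
  assert (X1 : Cmod (mobius_factor (b := b) n z) * Cmod (K x (phi b w) - K x (phi b w') - qk * x ^ k) <= W0 * (2 * (B + B) * (Q * t / e) ^ Datatypes.S k)).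
  { apply Rmult_le_compat; auto; try apply Cmod_ge_0. eapply Rle_trans; [apply L2|]. apply Rmult_le_compat_l; [lra|]. apply pow_incr. split.
    - apply Rle_div_r; [lra|rewrite Rmult_0_l; apply Cmod_ge_0].
    - unfold Rdiv. apply Rmult_le_compat_r; auto. apply Rlt_le, Rinv_0_lt_compat; auto. }
  assert (F1 : (t / s0) ^ Datatypes.S k = t ^ k * t / s0 ^ Datatypes.S k) by (unfold Rdiv; rewrite Rpow_mult_distr, pow_inv; simpl; ring).
  assert (F2 : (Q * t / e) ^ Datatypes.S k = (Q / e) ^ Datatypes.S k * (t ^ k * t)).
  { replace (Q * t / e) with (Q / e * t) by (field; lra). rewrite Rpow_mult_distr. simpl (t ^ Datatypes.S k). ring. }
  rewrite F1 in L1. rewrite F2 in X1.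
  replace (t ^ k * ((2 * (B1 / s0 + B1 / s0) / s0 ^ Datatypes.S k + W0 * (2 * (B + B) * (Q / e) ^ Datatypes.S k)) * t)) with
    (W0 * (2 * (B + B) * ((Q / e) ^ Datatypes.S k * (t ^ k * t))) + 2 * (B1 / s0 + B1 / s0) * (t ^ k * t / s0 ^ Datatypes.S k)) by (unfold Rdiv; ring).
  apply Rplus_le_compat; auto.
Qed.

(* With [w = r ^ 2 / b] the last lemma reads [bet k r = const + polynomial (phi w)]; this persists on [(b, 1)] by analyticity, and
   boundedness as [r] tends to [1], where [phi w] tends to infinity, forces the polynomial to be constant. *)
Lemma b_coef_next k : const_upto k ->
  (forall r r', b < r < 1 -> b < r' < 1 -> bet k r = bet k r') /\ (forall y, Cmod y < e -> p k y = p k 0).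
Proof.
  intros Hk. pose proof S as [Hb _].
  set (h := Rmin del (1 - b)). assert (Hh : 0 < h) by (apply Rmin_pos; lra). assert (Hh1 : h <= del) by apply Rmin_l. assert (Hh2 : h <= 1 - b) by apply Rmin_r.
  set (w0 := b + h / 2). set (cc := (mobius_factor (b := b) n b * (/ (1 - b * b)) ^ k)%C).
  assert (Hcc : cc <> 0).
  { apply Cmult_neq_0; [apply (mobius_factor_b S)|]. apply Cpow_nz, Cinv_nz. rewrite <- RtoC_mult, <- RtoC_minus. intros A. apply RtoC_inj in A. nra. }
  set (poly := fun y : C => csum (fun j => c k j * y ^ j)%C (Datatypes.S k)).
  (* This is [phi b (z ^ 2 / b)] with the fractions cleared: holomorphic in the unit disc, with its
     poles at [1] and [-1]. *)
  set (yy := fun z : C => ((z * z - b * b) / (b * (1 - z * z)))%C).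
  set (G := fun z : C => (bet k (sqrt (b * w0)) + cc * (poly (yy z) - p k (phi b w0)))%C).
  assert (Hnz : forall z : C, Cmod z < 1 -> (b * (1 - z * z))%C <> 0).
  { intros z Hz. apply Cmult_neq_0; [intros A; apply RtoC_inj in A; lra|]. intros A.
    assert (E : (z * z)%C = 1) by (rewrite <- (Cplus_0_r (z * z)), <- A; ring). apply (f_equal Cmod) in E. rewrite Cmod_mult, Cmod_1 in E. pose proof (Cmod_ge_0 z). nra. }
  assert (HGd : forall z, Cmod z < 1 -> cdiff G z).
  { intros z Hz. apply cdiff_plus; [apply cdiff_const|]. apply cdiff_mult; [apply cdiff_const|]. apply cdiff_minus; [|apply cdiff_const].
    apply (cdiff_csum (fun j z => c k j * yy z ^ j)%C). intros j. apply cdiff_mult; [apply cdiff_const|]. apply cdiff_pow. unfold yy.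
    apply cdiff_div; [| |auto]; [apply cdiff_minus; [apply cdiff_mult; apply cdiff_id|apply cdiff_const]|].
    apply cdiff_mult; [apply cdiff_const|]. apply cdiff_minus; [apply cdiff_const|apply cdiff_mult; apply cdiff_id]. }
  assert (HFG : forall r, b < r < 1 -> bet k r = G r).
  { intros r Hr. apply Ceq_sub. apply (lps_identity (fun r => bet k r - G r)%C b 1 b (sqrt (b * (b + h)))); auto; try lra.
    - rewrite <- (sqrt_square b) at 1 by lra. apply sqrt_lt_1_alt. nra.
    - rewrite <- sqrt_1. apply sqrt_le_1_alt. nra.
    - intros x Hx. apply (lps_minus (bet k)); [apply (b_coef_lps S); auto|]. apply (cdiff_lps G x (1 - x)); [lra|]. intros z Hz. apply HGd.
      pose proof (Cmod_le_add z x) as T. rewrite Cmod_R, Rabs_right in T by lra. lra.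
    - intros x Hx. set (w := x ^ 2 / b).
      assert (Hx1 : x < 1). { assert (sqrt (b * (b + h)) <= 1); [|lra]. rewrite <- sqrt_1. apply sqrt_le_1_alt. nra. }
      assert (Hbw : b * w = x ^ 2) by (unfold w; field; lra).
      assert (Hxx : x ^ 2 < b * (b + h)).
      { rewrite <- (sqrt_sqrt (b * (b + h))) by nra. assert (0 < x) by lra. nra. }
      assert (Hw : b < w < b + h). { split; apply Rmult_lt_reg_l with b; nra. }
      assert (Es : sqrt (b * w) = x). { rewrite Hbw. apply sqrt_pow2. lra. }
      pose proof (b_coef_step k w w0 Hk ltac:(lra) ltac:(unfold w0; lra) ltac:(lra) ltac:(unfold w0; lra)) as E.
      rewrite Es in E. unfold G. rewrite (Hp2 k (phi b w)) in E by (apply phi_w; lra). fold cc in E.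
      replace (yy x) with (phi b w).
      + change (csum (fun j => c k j * phi b w ^ j)%C (Datatypes.S k)) with (poly (phi b w)) in E.
        replace (bet k x) with (bet k x - bet k (sqrt (b * w0)) + bet k (sqrt (b * w0)))%C by ring. rewrite E. ring.
      + unfold phi, yy, w. rewrite RtoC_div, RtoC_pow by lra. assert (Hb0 : RtoC b <> 0) by (intros A; apply RtoC_inj in A; lra).
        assert (HN := Hnz x ltac:(rewrite Cmod_R, Rabs_right; lra)).
        assert (HN2 : (1 - x * x)%C <> 0) by (intros A; apply HN; rewrite A; ring).
        field. exact (conj HN2 Hb0). }
  assert (Hpoly : forall j, (1 <= j <= k)%nat -> c k j = 0).
  { destruct (scaled_coef_bounded S n) as [r1 [B1 [Hr1 HB1]]].
    set (r2 := Rmax r1 ((1 + b) / 2)). assert (R1 : r1 <= r2) by apply Rmax_l. assert (R2 : (1 + b) / 2 <= r2) by apply Rmax_r.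
    assert (R3 : r2 < 1) by (apply Rmax_lub_lt; lra).
    assert (HB0 : 0 <= B1). { eapply Rle_trans; [apply Cmod_ge_0|apply (HB1 ((1 + r1) / 2) 0)]. lra. }
    set (B2 := B1 / ((1 - b) / 2) ^ Datatypes.S k + Cmod (bet k (sqrt (b * w0)))).
    apply (poly_bounded k (c k) (B2 / Cmod cc + Cmod (p k (phi b w0))) ((r2 ^ 2 - b ^ 2) / (b * (1 - r2 ^ 2)))).
    intros y Hy. assert (Hq : 0 < b * (1 - r2 ^ 2)) by (apply Rmult_lt_0_compat; nra). apply Rlt_div_l in Hy; [|auto].
    assert (Hy0 : 0 < y). { apply Rmult_lt_reg_r with (b * (1 - r2 ^ 2)); auto. nra. }
    (* The solution of [yy r = y]; it tends to [1] as [y] grows, so large arguments of the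
       polynomial are reached by admissible radii. *)
    set (r := sqrt ((b ^ 2 + b * y) / (1 + b * y))).
    assert (Hby : 0 < 1 + b * y) by nra.
    assert (Hrr : r ^ 2 = (b ^ 2 + b * y) / (1 + b * y)). { apply pow2_sqrt. apply Rlt_le, Rdiv_lt_0_compat; nra. }
    assert (Hr2 : r2 ^ 2 < r ^ 2). { rewrite Hrr. apply Rmult_lt_reg_r with (1 + b * y); [lra|]. replace ((b ^ 2 + b * y) / (1 + b * y) * (1 + b * y)) with (b ^ 2 + b * y) by (field; lra). lra. }
    assert (Hr0 : 0 <= r) by apply sqrt_pos.
    assert (Hr1' : r ^ 2 < 1). { rewrite Hrr. apply Rlt_div_l; [lra|]. nra. }
    assert (Hr : r2 < r < 1) by nra.
    assert (Ey : yy r = RtoC y).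
    { unfold yy. assert (Hd : (b * (1 - r * r))%C <> 0) by (apply Hnz; rewrite Cmod_R, Rabs_right; lra).
      apply Cmult_cancel_l with (b * (1 - r * r))%C; auto.
      transitivity (r * r - b * b)%C; [field; split; intros A; apply Hd; rewrite A; ring|].
      rewrite <- !RtoC_mult, <- !RtoC_minus, <- !RtoC_mult. f_equal. replace (r * r) with (r ^ 2) by ring. rewrite Hrr. field. lra. }
    pose proof (HFG r ltac:(lra)) as E. unfold G in E. rewrite Ey in E.
    assert (Hbb : Cmod (bet k r) <= B1 / ((1 - b) / 2) ^ Datatypes.S k).
    { eapply Rle_trans; [apply (b_coef_bound S n k r B1); [lra|]; intros; apply HB1; lra|].
      unfold Rdiv. apply Rmult_le_compat_l; auto. apply Rinv_le_contravar; [apply pow_lt; lra|]. apply pow_incr; lra. }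
    change (Cmod (poly y) <= B2 / Cmod cc + Cmod (p k (phi b w0))).
    replace (poly y) with ((bet k r - bet k (sqrt (b * w0))) / cc + p k (phi b w0))%C by (rewrite E; field; auto).
    eapply Rle_trans; [apply Cmod_triangle|]. apply Rplus_le_compat_r. rewrite Cmod_div by auto.
    unfold Rdiv. apply Rmult_le_compat_r; [apply Rlt_le, Rinv_0_lt_compat, Cmod_gt_0; auto|].
    eapply Rle_trans; [apply Cmod_tri_minus|]. unfold B2. lra. }
  assert (Hpc : forall y, poly y = c k O).
  { intros y. unfold poly. rewrite csum_shift. rewrite csum_eq0; [simpl; ring|]. intros j Hj. rewrite Hpoly by lia. ring. }
  split.
  - intros r r' Hr Hr'. rewrite !HFG by auto. unfold G. rewrite !Hpc. auto.
  - intros y Hy. rewrite !Hp2 by (auto; rewrite Cmod_0; auto). change (poly y = poly 0). rewrite !Hpc. auto.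
Qed.

Lemma b_coef_const k r r' : b < r < 1 -> b < r' < 1 -> bet k r = bet k r'.
Proof.
  assert (H : forall k, const_upto k).
  { clear k. induction k as [|k IH]; intros j Hj; [lia|]. destruct (Nat.eq_dec j k) as [->|]; [apply b_coef_next; auto|apply IH; lia]. }
  apply (H (Datatypes.S k) k). lia.
Qed.

(** For radii above [b] the equal coefficients at [b] make the two functions agree near [b], hence
    on the smaller disc, and so do their coefficients at [0]. Analyticity in the radius extends this
    from [(b, 1)] to [(0, 1)]. *)
Lemma center_coef_const m r r' : 0 < r < 1 -> 0 < r' < 1 -> hr r m = hr r' m.
Proof.
  pose proof S as [Hb _].
  assert (H : forall r r', b < r < 1 -> r <= r' < 1 -> hr r m = hr r' m).
  { clear r r'. intros r r' Hr Hr'. destruct (center_coef_PSon S n) as [q [Hq HP]].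
    destruct (HP r ltac:(lra)) as [B1 P1]. destruct (HP r' ltac:(lra)) as [B2 P2].
    assert (Hrq : r < r / q) by (apply Rlt_div_r; nra). assert (Hrq' : r < r' / q) by (apply Rlt_div_r; nra).
    set (F := fun z => (pser (hr r) z - pser (hr r') z)%C).
    assert (HF : forall z, Cmod z < r -> cdiff F z).
    { intros z Hz. apply cdiff_minus; eapply PSon_cdiff; [apply P1|lra|apply P2|lra]. }
    assert (HF0 : forall s : R, - r < s < r -> F s = 0).
    { apply (lps_identity (fun s : R => F s) (- r) r b r); try lra.
      - intros x Hx. apply (cdiff_lps F x (r - Rabs x)); [assert (Rabs x < r) by (apply Rabs_def1; lra); lra|].
        intros z Hz. apply HF. pose proof (Cmod_le_add z x) as T. rewrite Cmod_R in T. lra.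
      - intros x Hx. destruct (b_coef_PSon S n r Hr) as [B3 [_ [_ Q1]]]. destruct (b_coef_PSon S n r' ltac:(lra)) as [B4 [_ [_ Q2]]].
        assert (Hm : Cmod (x - b)%R = x - b) by (rewrite Cmod_R, Rabs_right; lra).
        specialize (Q1 (RtoC (x - b)) I ltac:(lra)). specialize (Q2 (RtoC (x - b)) I ltac:(lra)). cbv beta in Q1, Q2.
        rewrite <- RtoC_plus in Q1, Q2. replace (b + (x - b)) with x in Q1, Q2 by ring.
        unfold F. assert (E : pser (hr r) x = pser (hr r') x); [|rewrite E; ring].
        eapply cser_unique; [apply Q1|]. eapply cser_ext; [|apply Q2]. intros k. cbv beta.
        assert (E : b_coef n k r = b_coef n k r') by (apply (b_coef_const k); lra). rewrite E. auto. }
    pose proof (PSon_M _ _ _ _ _ P1). pose proof (PSon_M _ _ _ _ _ P2).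
    assert (P1' : PSon (fun t => is_real t /\ t <> RtoC 0 /\ Cmod t < r) B1 r (hr r) (pser (hr r))) by (eapply PSon_mono; [| | | |apply P1]; [intros; exact I|lra|lra|lra]).
    assert (P2' : PSon (fun t => is_real t /\ t <> RtoC 0 /\ Cmod t < r) B2 r (hr r') (pser (hr r'))) by (eapply PSon_mono; [| | | |apply P2]; [intros; exact I|lra|lra|lra]).
    pose proof (PSon_minus _ _ _ _ _ _ _ _ P1' P2') as P. apply Ceq_sub.
    apply (PSon_zero _ _ _ _ _ P).
    - intros t [T1 [T2 T3]]. split; auto. rewrite T1 in T3 |- *. rewrite Cmod_R in T3. apply Rabs_def2 in T3. apply HF0. lra.
    - intros e' He'. destruct (real_acc (Rmin e' r)) as [t [T1 [T2 T3]]]; [apply Rmin_pos; lra|]. apply Rmin_Rgt in T3 as [T3 T4]. exists t. auto. }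
  assert (H2 : forall r, 0 < r < 1 -> hr r m = hr ((1 + b) / 2) m).
  { clear r r'. intros r Hr. apply Ceq_sub. apply (lps_identity (fun r => hr r m - hr ((1 + b) / 2) m)%C 0 1 b 1); try lra.
    - intros x Hx. apply (lps_minus (fun r => hr r m)); [apply (center_coef_lps S); auto|].
      apply (cdiff_lps (fun _ => hr ((1 + b) / 2) m) x 1); [lra|]. intros; apply cdiff_const.
    - intros x Hx. destruct (Rle_dec x ((1 + b) / 2)); [rewrite (H x ((1 + b) / 2)) by lra; ring|rewrite (H ((1 + b) / 2) x) by lra; ring]. }
  intros Hr Hr'. rewrite (H2 r), (H2 r'); auto.
Qed.

End Induction.

Lemma small_zero (z : C) B e0 : 0 < e0 -> (forall e, 0 < e < e0 -> Cmod z <= B * e) -> z = 0.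
Proof.
  intros He0 H. apply Cmod_small_0. intros e He. set (B1 := Rabs B + 1). assert (HB : 0 < B1) by (unfold B1; pose proof (Rabs_pos B); lra).
  set (x := Rmin (e0 / 2) (e / B1)). assert (0 < x) by (apply Rmin_pos; [lra|apply Rdiv_lt_0_compat; auto]).
  assert (X1 : x <= e0 / 2) by apply Rmin_l. assert (X2 : x <= e / B1) by apply Rmin_r. apply Rle_div_r in X2; auto.
  specialize (H x ltac:(lra)). assert (B * x <= B1 * x). { apply Rmult_le_compat_r; [lra|]. unfold B1. pose proof (Rle_abs B). lra. } lra.
Qed.

(** * The Fourier coefficients on tori are monomials *)

Section Final.
Context {fr : C -> C -> C} {b d M L : R} (S : setup fr b d M L).

Lemma mode_circle_fun_const n m : exists c, forall r, 0 < r < 1 -> mode (circle_fun (fr := fr) n r) (Z.of_nat m) = (c * r ^ m)%C.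
Proof.
  destruct (local_K S n) as [e [B [K [p [c [He [HK [HK1 [Hp1 Hp2]]]]]]]]].
  destruct (center_b_comparison S n K e B ltac:(lra) HK HK1) as [del [Hdel Hstar]].
  exists (center_coef (fr := fr) n (1/2) m). intros r Hr.
  rewrite <- (center_coef_const S n (proj1 He) Hp1 Hp2 Hdel Hstar m r (1/2)) by lra.
  unfold center_coef. field. apply Cpow_nz. intros A. apply RtoC_inj in A. lra.
Qed.

(** Undoing the scaling, each mode is a constant [c] times powers of [r] and [sqrt (1 - r ^ 2)].
    When an exponent would be negative, boundedness of the modes forces [c = 0]. *)
Theorem mode_fiber_coef_monomial : exists a : nat -> nat -> C, forall (j n : Z) r, 0 < r < 1 ->
  mode (fiber_coef fr n r) j = if Z_le_dec 0 j then if Z_le_dec 0 n then (a (Z.to_nat j) (Z.to_nat n) * r ^ Z.to_nat j * sqrt (1 - r ^ 2) ^ Z.to_nat n)%C else 0 else 0.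
Proof.
  assert (HR : forall a : R, 0 < a -> RtoC a <> 0) by (intros a Ha A; apply RtoC_inj in A; lra).
  assert (Hs : forall r, 0 < r < 1 -> 0 < sqrt (1 - r ^ 2)) by (intros r Hr; apply sqrt_lt_R0; nra).
  assert (HM : 0 <= M). { eapply Rle_trans; [apply Cmod_ge_0|apply (fiber_coef_bound S 0 0 0); lra]. }
  assert (Hmb : forall n j r, 0 < r < 1 -> Cmod (mode (fiber_coef fr n r) j) <= M).
  { intros n j r Hr. apply avg_bound.
    - apply ccont_mult; [apply (fiber_coef_cont S); lra|apply ccont_ei].
    - intros t. rewrite Cmod_ei_mul. apply (fiber_coef_bound S). lra. }
  assert (H : forall n j, exists c, forall r, 0 < r < 1 ->
    mode (fiber_coef fr n r) j = if Z_le_dec 0 j then if Z_le_dec 0 n then (c * r ^ Z.to_nat j * sqrt (1 - r ^ 2) ^ Z.to_nat n)%C else 0 else 0).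
  { intros n j. set (N := Z.abs_nat n).
    destruct (Z_lt_dec (j + Z.of_nat N) 0) as [Hjn|Hjn].
    { exists 0. intros r Hr. destruct Z_le_dec; [lia|]. apply (mode_fiber_coef_neg S); [lra|lia]. }
    set (m := Z.to_nat (j + Z.of_nat N)). destruct (mode_circle_fun_const n m) as [c Hc].
    assert (E : forall r, 0 < r < 1 -> (zp (sqrt (1 - r ^ 2)) (- n) * r ^ N * mode (fiber_coef fr n r) j)%C = (c * r ^ m)%C).
    { intros r Hr. rewrite <- Hc by auto. rewrite (mode_circle_fun S) by lra. fold N. replace (Z.of_nat m - Z.of_nat N)%Z with j by lia. auto. }
    assert (HC0 : c = 0 -> forall r, 0 < r < 1 -> mode (fiber_coef fr n r) j = 0).
    { intros -> r Hr. specialize (E r Hr). apply Cmult_cancel_l with (zp (sqrt (1 - r ^ 2)) (- n) * r ^ N)%C.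
      - apply Cmult_neq_0; [apply zp_nz; auto|apply Cpow_nz, HR; lra].
      - rewrite E. ring. }
    assert (Hbd : forall r, 0 < r < 1 -> Cmod c * r ^ m <= Cmod (zp (sqrt (1 - r ^ 2)) (- n)) * r ^ N * M).
    { intros r Hr. specialize (E r Hr). apply (f_equal Cmod) in E. rewrite !Cmod_mult, !Cmod_pow, (Cmod_R r), Rabs_right in E by lra.
      rewrite <- E. apply Rmult_le_compat_l; auto. apply Rmult_le_pos; [apply Cmod_ge_0|apply pow_le; lra]. }
    destruct (Z_le_dec 0 j) as [Hj|Hj].
    - destruct (Z_le_dec 0 n) as [Hn|Hn].
      + exists c. intros r Hr. specialize (E r Hr). pose proof (Hs r Hr) as Hsr.
        apply Cmult_cancel_l with (zp (sqrt (1 - r ^ 2)) (- n) * r ^ N)%C.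
        * apply Cmult_neq_0; [apply zp_nz; auto|apply Cpow_nz, HR; lra].
        * rewrite E. replace m with (Z.to_nat j + N)%nat by lia. rewrite Cpow_add_r.
          pose proof (zp_opp (sqrt (1 - r ^ 2)) n (HR _ Hsr)) as Z. unfold zp at 1 in Z. destruct Z_le_dec; [|lia].
          transitivity (c * (r ^ Z.to_nat j * r ^ N) * (sqrt (1 - r ^ 2) ^ Z.to_nat n * zp (sqrt (1 - r ^ 2)) (- n)))%C; [rewrite Z; ring|ring].
      (* For [n < 0] let [s = sqrt (1 - r ^ 2)] tend to [0]: the bound on [c] contains the factor
         [s ^ (- n)], while [r] stays at least [1/2]. *)
      + exists 0. apply HC0. apply (small_zero c (2 ^ m * M) (1/2)); [lra|]. intros s Hs0.
        set (r := sqrt (1 - s ^ 2)). assert (Hrr : r ^ 2 = 1 - s ^ 2) by (apply pow2_sqrt; nra).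
        assert (Hr0 : 0 <= r) by apply sqrt_pos. assert (Hr : 1/2 <= r < 1) by nra.
        specialize (Hbd r ltac:(lra)). replace (1 - r ^ 2) with (s ^ 2) in Hbd by lra. rewrite sqrt_pow2 in Hbd by lra.
        rewrite Cmod_zp in Hbd by (apply HR; lra). destruct Z_le_dec in Hbd; [|lia]. rewrite Cmod_R, Rabs_right in Hbd by lra.
        assert (S1 : s ^ Z.to_nat (- n) <= s).
        { replace (Z.to_nat (- n)) with (Datatypes.S (Z.to_nat (- n) - 1)) by lia. simpl.
          assert (s ^ (Z.to_nat (- n) - 1) <= 1) by (eapply Rle_trans; [apply (pow_incr _ 1); lra|rewrite pow1; lra]). nra. }
        assert (S2 : 0 <= r ^ N <= 1). { split; [apply pow_le; lra|]. eapply Rle_trans; [apply (pow_incr _ 1); lra|rewrite pow1; lra]. }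
        assert (S3 : (/ 2) ^ m <= r ^ m) by (apply pow_incr; lra). rewrite pow_inv in S3.
        assert (S4 : 0 < 2 ^ m) by (apply pow_lt; lra).
        assert (S5 : 0 <= s ^ Z.to_nat (- n)) by (apply pow_le; lra).
        assert (Cmod c * / 2 ^ m <= s * M).
        { eapply Rle_trans; [apply Rmult_le_compat_l; [apply Cmod_ge_0|apply S3]|]. eapply Rle_trans; [apply Hbd|]. apply Rmult_le_compat_r; auto. nra. }
        apply Rmult_le_reg_r with (/ 2 ^ m); [apply Rinv_0_lt_compat; auto|]. replace (2 ^ m * M * s * / 2 ^ m) with (s * M) by (field; lra). auto.
    (* For [j < 0] let [r] tend to [0]: here [N > m], and cancelling [r ^ m] leaves a positive power
       of [r] in the bound. *)
    - exists 0. apply HC0. apply (small_zero c (2 ^ N * M) (1/2)); [lra|]. intros r Hr.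
      specialize (Hbd r ltac:(lra)).
      assert (Hw : Cmod (zp (sqrt (1 - r ^ 2)) (- n)) <= 2 ^ N).
      { replace N with (Z.abs_nat (- n)) by lia. apply zp_bound. rewrite Cmod_R, Rabs_right by (apply Rle_ge, sqrt_pos).
        assert (Hq : sqrt (1 - r ^ 2) ^ 2 = 1 - r ^ 2) by (apply pow2_sqrt; nra). pose proof (sqrt_pos (1 - r ^ 2)). split; nra. }
      replace N with (m + Datatypes.S (N - m - 1))%nat in Hbd at 1 by lia. rewrite pow_add in Hbd.
      assert (Hrm : 0 < r ^ m) by (apply pow_lt; lra).
      apply Rmult_le_reg_r with (r ^ m); auto. eapply Rle_trans; [apply Hbd|].
      assert (S1 : 0 <= r ^ Datatypes.S (N - m - 1) <= r).
      { split; [apply pow_le; lra|]. simpl. assert (r ^ (N - m - 1) <= 1) by (eapply Rle_trans; [apply (pow_incr _ 1); lra|rewrite pow1; lra]). nra. }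
      set (y := r ^ Datatypes.S (N - m - 1)) in *. set (w := Cmod (zp (sqrt (1 - r ^ 2)) (- n))) in *.
      assert (0 <= w) by apply Cmod_ge_0. assert (w * y <= 2 ^ N * r) by (apply Rmult_le_compat; lra).
      replace (w * (r ^ m * y) * M) with (w * y * (r ^ m * M)) by ring. replace (2 ^ N * M * r * r ^ m) with (2 ^ N * r * (r ^ m * M)) by ring.
      apply Rmult_le_compat_r; auto. apply Rmult_le_pos; lra. }
  assert (H2 : forall jn : nat * nat, exists c, forall r, 0 < r < 1 ->
    mode (fiber_coef fr (Z.of_nat (snd jn)) r) (Z.of_nat (fst jn)) = (c * r ^ fst jn * sqrt (1 - r ^ 2) ^ snd jn)%C).
  { intros [j n]. destruct (H (Z.of_nat n) (Z.of_nat j)) as [c Hc]. exists c. intros r Hr. cbn [fst snd]. rewrite (Hc r Hr).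
    do 2 (destruct Z_le_dec; [|lia]). rewrite !Nat2Z.id. auto. }
  apply fun_choice in H2 as [a Ha]. exists (fun j n => a (j, n)). intros j n r Hr.
  destruct (H n j) as [c Hc]. destruct (Z_le_dec 0 j) as [Hj|Hj]; [destruct (Z_le_dec 0 n) as [Hn|Hn]|]; try (apply Hc; auto).
  specialize (Ha (Z.to_nat j, Z.to_nat n) r Hr). simpl fst in Ha. simpl snd in Ha. rewrite !Z2Nat.id in Ha by auto. auto.
Qed.

End Final.

(** * Polynomial approximation on the sphere *)

Definition jcont (P : C -> C -> C) : Prop := forall u1 u2 e, 0 < e -> exists d, 0 < d /\
  forall w1 w2, Cmod (w1 - u1) < d -> Cmod (w2 - u2) < d -> Cmod (P w1 w2 - P u1 u2) < e.

(** Stands for the polynomials through two of their properties, joint continuity and holomorphy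
    along holomorphic curves; it is closed under the operations that build the Fejér means. *)
Definition pol (P : C -> C -> C) : Prop := jcont P /\
  forall g1 g2 t, cdiff g1 t -> cdiff g2 t -> cdiff (fun s => P (g1 s) (g2 s)) t.

Lemma pol_const c : pol (fun _ _ => c).
Proof.
  split; [|intros; apply cdiff_const]. intros u1 u2 e He. exists 1. split; [lra|]. intros. rewrite Cmod_sub_diag. auto.
Qed.

Lemma pol_fst : pol (fun x _ => x).
Proof. split; [|auto]. intros u1 u2 e He. exists e. auto. Qed.

Lemma pol_snd : pol (fun _ y => y).
Proof. split; [|auto]. intros u1 u2 e He. exists e. auto. Qed.

Lemma pol_plus P Q : pol P -> pol Q -> pol (fun x y => P x y + Q x y)%C.
Proof.
  intros [HP1 HP2] [HQ1 HQ2]. split; [|intros; apply cdiff_plus; auto]. intros u1 u2 e He.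
  destruct (HP1 u1 u2 (e / 2)) as [d1 [Hd1 H1]]; [lra|]. destruct (HQ1 u1 u2 (e / 2)) as [d2 [Hd2 H2]]; [lra|].
  exists (Rmin d1 d2). split; [apply Rmin_pos; auto|]. intros w1 w2 Hw1 Hw2. apply Rmin_Rgt in Hw1 as [A1 A2]. apply Rmin_Rgt in Hw2 as [A3 A4].
  replace (P w1 w2 + Q w1 w2 - (P u1 u2 + Q u1 u2))%C with ((P w1 w2 - P u1 u2) + (Q w1 w2 - Q u1 u2))%C by ring.
  eapply Rle_lt_trans; [apply Cmod_triangle|]. specialize (H1 w1 w2 A1 A3). specialize (H2 w1 w2 A2 A4). lra.
Qed.

Lemma pol_mult P Q : pol P -> pol Q -> pol (fun x y => P x y * Q x y)%C.
Proof.
  intros [HP1 HP2] [HQ1 HQ2]. split; [|intros; apply cdiff_mult; auto]. intros u1 u2 e He.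
  set (p := Cmod (P u1 u2)). set (q := Cmod (Q u1 u2)). assert (0 <= p) by apply Cmod_ge_0. assert (0 <= q) by apply Cmod_ge_0.
  destruct (HP1 u1 u2 (e / (2 * (q + 1)))) as [d1 [Hd1 H1]]. { apply Rdiv_lt_0_compat; lra. }
  destruct (HQ1 u1 u2 (Rmin 1 (e / (2 * (p + 1))))) as [d2 [Hd2 H2]]. { apply Rmin_pos; [lra|apply Rdiv_lt_0_compat; lra]. }
  exists (Rmin d1 d2). split; [apply Rmin_pos; auto|]. intros w1 w2 Hw1 Hw2. apply Rmin_Rgt in Hw1 as [A1 A2]. apply Rmin_Rgt in Hw2 as [A3 A4].
  specialize (H1 w1 w2 A1 A3). specialize (H2 w1 w2 A2 A4). apply Rmin_Rgt in H2 as [H2 H3].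
  replace (P w1 w2 * Q w1 w2 - P u1 u2 * Q u1 u2)%C with ((P w1 w2 - P u1 u2) * Q w1 w2 + P u1 u2 * (Q w1 w2 - Q u1 u2))%C by ring.
  eapply Rle_lt_trans; [apply Cmod_triangle|]. rewrite !Cmod_mult. fold p.
  pose proof (Cmod_le_add (Q w1 w2) (Q u1 u2)). fold q in H4. apply Rlt_div_r in H1; [|lra]. apply Rlt_div_r in H3; [|lra].
  pose proof (Cmod_ge_0 (P w1 w2 - P u1 u2)). pose proof (Cmod_ge_0 (Q w1 w2 - Q u1 u2)). nra.
Qed.

Lemma pol_pow P n : pol P -> pol (fun x y => P x y ^ n)%C.
Proof. intros HP. induction n as [|n IH]; simpl; [apply pol_const|apply pol_mult; auto]. Qed.

Lemma pol_csum (w : nat -> C -> C -> C) n : (forall k, pol (w k)) -> pol (fun x y => csum (fun k => w k x y) n).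
Proof. intros H. induction n as [|n IH]; simpl; [apply pol_const|apply pol_plus; auto]. Qed.

Section Approximation.
Context {fr : C -> C -> C} {b d M L : R} (S : setup fr b d M L).

(** Fejér means in the second variable, whose coefficients [fiber_coef] are in turn replaced by
    Fejér means in the first. Every term is then a monomial in [u1], [u2]. The errors do not depend
    on the torus because they come from the Lipschitz constant [L]. *)
Lemma approx_interior eps : 0 < eps -> exists P, pol P /\ forall r t s, 0 < r < 1 ->
  Cmod (P (r * ei t) (sqrt (1 - r ^ 2) * ei s) - fr (r * ei t) (sqrt (1 - r ^ 2) * ei s))%C <= eps.
Proof.
  intros He. destruct (mode_fiber_coef_monomial S) as [a Ha]. pose proof S as [_ [_ [[HL0 HL] _]]].
  set (term := fun (j n : Z) (u1 u2 : C) => if Z_le_dec 0 j then if Z_le_dec 0 n then (a (Z.to_nat j) (Z.to_nat n) * u1 ^ Z.to_nat j * u2 ^ Z.to_nat n)%C else 0 else 0).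
  assert (Hterm : forall j n, pol (term j n)).
  { intros j n. unfold term. destruct Z_le_dec; [destruct Z_le_dec|]; try apply pol_const.
    apply pol_mult; [apply pol_mult; [apply pol_const|apply (pol_pow (fun x _ => x)), pol_fst]|apply (pol_pow (fun _ y => y)), pol_snd]. }
  set (e1 := eps / 4). destruct (inv_small e1 (L ^ 2 / (2 * e1))) as [N [HN HNe]]; [unfold e1; lra| |].
  { apply Rle_div_r; [unfold e1; lra|]. nra. }
  assert (HN0 : 0 < INR N) by (apply lt_0_INR; auto).
  (* The outer mean adds [N ^ 2] coefficients and divides by [N], so coefficient errors are
     amplified by [N]. *)
  set (e2 := e1 / INR N). assert (He2 : 0 < e2) by (apply Rdiv_lt_0_compat; unfold e1; lra).
  destruct (inv_small e2 (L ^ 2 / (2 * e2))) as [N' [HN' HNe']]; auto. { apply Rle_div_r; [lra|]. nra. }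
  set (T := fun n u1 u2 => (csum (fun j => csum (fun k => term (Z.of_nat j - Z.of_nat k)%Z n u1 u2) N') N' * / INR N')%C).
  exists (fun u1 u2 => csum (fun j => csum (fun k => T (Z.of_nat j - Z.of_nat k)%Z u1 u2) N) N * / INR N)%C. split.
  { apply (pol_mult _ (fun _ _ => / INR N)%C); [|apply pol_const]. apply (pol_csum (fun j u1 u2 => csum (fun k => T (Z.of_nat j - Z.of_nat k)%Z u1 u2) N)). intros j.
    apply (pol_csum (fun k u1 u2 => T (Z.of_nat j - Z.of_nat k)%Z u1 u2)). intros k.
    apply (pol_mult _ (fun _ _ => / INR N')%C); [|apply pol_const]. apply (pol_csum (fun j' u1 u2 => csum (fun k' => term (Z.of_nat j' - Z.of_nat k')%Z (Z.of_nat j - Z.of_nat k)%Z u1 u2) N')). intros j'.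
    apply (pol_csum (fun k' u1 u2 => term (Z.of_nat j' - Z.of_nat k')%Z (Z.of_nat j - Z.of_nat k)%Z u1 u2)). intros k'. apply Hterm. }
  intros r t s Hr. set (p := sqrt (1 - r ^ 2)). set (F := fun s => fr (r * ei t)%C (p * ei s)%C).
  assert (Hterm2 : forall j n, term j n (r * ei t)%C (p * ei s)%C = (mode (fiber_coef fr n r) j * ei (IZR j * t) * ei (IZR n * s))%C).
  { intros j n. rewrite (Ha j n r Hr). unfold term. fold p. destruct Z_le_dec; [destruct Z_le_dec|]; try ring.
    rewrite !Cpow_mult_l, !ei_pow, !INR_IZR_INZ, !Z2Nat.id by auto. ring. }
  assert (HT : forall n, Cmod (T n (r * ei t)%C (p * ei s)%C - fiber_coef fr n r t * ei (IZR n * s)) <= e2 + L ^ 2 / (2 * e2) / INR N').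
  { intros n. replace (T n (r * ei t)%C (p * ei s)%C) with (sigma (fiber_coef fr n r) N' t * ei (IZR n * s))%C.
    - replace (sigma (fiber_coef fr n r) N' t * ei (IZR n * s) - fiber_coef fr n r t * ei (IZR n * s))%C with ((sigma (fiber_coef fr n r) N' t - fiber_coef fr n r t) * ei (IZR n * s))%C by ring.
      rewrite Cmod_ei_mul. apply fejer; auto; [apply (fiber_coef_cont S); lra|]. intros t'.
      eapply Rle_trans; [apply (fiber_coef_lip S); lra|]. apply chord_modulus; auto.
    - unfold T, sigma. transitivity (ei (IZR n * s) * csum (fun j => csum (fun k => mode (fiber_coef fr n r) (Z.of_nat j - Z.of_nat k) * ei (IZR (Z.of_nat j - Z.of_nat k) * t)) N') N' * / INR N')%C; [unfold Cdiv; ring|].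
      f_equal. rewrite <- csum_scal. apply csum_ext. intros j _. rewrite <- csum_scal. apply csum_ext. intros k _. rewrite Hterm2. ring. }
  assert (HFc : ccont F).
  { intros x. apply ccont_at_ext with (fun s => fr (r * ei t) (p * ei s) * ei (- IZR 0 * s))%C.
    - intros y. unfold F. replace (- IZR 0 * y) with 0 by (simpl; ring). rewrite ei_0. ring.
    - apply (fiber_coef_cont_in S). lra. }
  assert (HS : Cmod (sigma F N s - F s) <= e1 + L ^ 2 / (2 * e1) / INR N).
  { apply fejer; auto. intros s'. eapply Rle_trans; [|apply chord_modulus; auto; unfold e1; lra].
    eapply Rle_trans; [apply HL; apply circle_sphere; lra|]. apply Rmult_le_compat_l; auto. rewrite Cmod_sub_diag, Rplus_0_l.
    replace (p * ei s' - p * ei s)%C with (p * (ei s' - ei s))%C by ring. rewrite Cmod_mult, Cmod_R.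
    assert (Hp : 0 <= p <= 1). { split; [apply sqrt_pos|]. unfold p. rewrite <- sqrt_1 at 2. apply sqrt_le_1_alt. nra. }
    rewrite Rabs_right by lra. pose proof (Cmod_ge_0 (ei s' - ei s)). nra. }
  set (SS := (csum (fun j => csum (fun k => T (Z.of_nat j - Z.of_nat k)%Z (r * ei t) (p * ei s)) N) N * / INR N)%C).
  assert (HSS : Cmod (SS - sigma F N s) <= INR N * (e2 + L ^ 2 / (2 * e2) / INR N')).
  { unfold SS, sigma.
    replace (csum (fun j => csum (fun k => T (Z.of_nat j - Z.of_nat k)%Z (r * ei t) (p * ei s)) N) N * / INR N - csum (fun j => csum (fun k => mode F (Z.of_nat j - Z.of_nat k) * ei (IZR (Z.of_nat j - Z.of_nat k) * s)) N) N / INR N)%C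
      with (csum (fun j => csum (fun k => T (Z.of_nat j - Z.of_nat k)%Z (r * ei t) (p * ei s) - mode F (Z.of_nat j - Z.of_nat k) * ei (IZR (Z.of_nat j - Z.of_nat k) * s)) N) N * / INR N)%C.
    - rewrite Cmod_mult, Cmod_inv, Cmod_R, Rabs_right by (try lra; intros A; apply RtoC_inj in A; lra).
      apply Rmult_le_reg_r with (INR N); auto. rewrite Rmult_assoc, Rinv_l, Rmult_1_r by lra.
      rewrite Rmult_assoc, (Rmult_comm _ (INR N)). apply csum_bound_const. intros j _. apply csum_bound_const. intros k _. apply HT.
    - rewrite (csum_ext _ (fun j => csum (fun k => T (Z.of_nat j - Z.of_nat k)%Z (r * ei t) (p * ei s)) N - csum (fun k => mode F (Z.of_nat j - Z.of_nat k) * ei (IZR (Z.of_nat j - Z.of_nat k) * s)) N)%C) by (intros; apply csum_minus).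
      rewrite csum_minus. unfold Cdiv. ring. }
  pose proof (Cmod_tri_sub SS (sigma F N s) (F s)) as Tr. unfold SS in *. change (fr (r * ei t) (p * ei s)) with (F s).
  eapply Rle_trans; [apply Tr|].
  assert (HNN : INR N * (e2 + L ^ 2 / (2 * e2) / INR N') <= 2 * e1).
  { replace (2 * e1) with (INR N * (e2 + e2)) by (unfold e2; field; lra). apply Rmult_le_compat_l; lra. }
  replace eps with (2 * e1 + (e1 + e1)) by (unfold e1; field). lra.
Qed.

(** The degenerate tori [u1 = 0] and [u2 = 0] are reached by continuity: an excess of the error at
    such a point would persist at a nearby point of a proper torus. *)
Lemma approx_sphere eps : 0 < eps -> exists P, pol P /\ forall u1 u2, Cmod u1 ^ 2 + Cmod u2 ^ 2 = 1 -> Cmod (P u1 u2 - fr u1 u2) <= eps.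
Proof.
  intros He. destruct (approx_interior eps He) as [P [HP H]]. exists P. split; auto. intros u1 u2 Hu.
  assert (Hin : forall u1 u2, Cmod u1 ^ 2 + Cmod u2 ^ 2 = 1 -> 0 < Cmod u1 < 1 -> Cmod (P u1 u2 - fr u1 u2) <= eps).
  { intros w1 w2 Hw Hw1. destruct (polar w1) as [t Ht]. destruct (polar w2) as [s Hs]. rewrite Ht, Hs.
    replace (Cmod w2) with (sqrt (1 - Cmod w1 ^ 2)); [apply H; auto|]. replace (1 - Cmod w1 ^ 2) with (Cmod w2 ^ 2) by lra.
    apply sqrt_pow2, Cmod_ge_0. }
  destruct (sphere_param u1 u2 Hu) as [x [t [s [_ [_ [_ [E1 E2]]]]]]].
  pose proof S as [_ [_ [[HL0 HL] _]]]. destruct HP as [HP _].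
  apply Rnot_lt_le. intros Hlt. set (g := Cmod (P u1 u2 - fr u1 u2) - eps).
  assert (Hg : 0 < g) by (unfold g; lra). destruct (HP u1 u2 (g / 2)) as [d1 [Hd1 H1]]; [lra|].
  set (h0 := Rmin d1 (g / (4 * (L + 1)))). assert (Hh0 : 0 < h0) by (apply Rmin_pos; auto; apply Rdiv_lt_0_compat; lra).
  (* Both coordinates are nonzero exactly when [sin (2 * y)] is, and the zeros of that function are
     isolated. *)
  assert (Hy : exists y, Rabs (y - x) < h0 /\ cos y <> 0 /\ sin y <> 0).
  { set (h := Rmin (h0 / 2) 1). assert (Hh : 0 < h) by (apply Rmin_pos; lra). assert (Hh1 : h <= h0 / 2) by apply Rmin_l. assert (Hh2 : h <= 1) by apply Rmin_r.
    assert (Hsc : forall y, 0 < y < 3 -> sin y <> 0). { intros y Hy A. assert (0 < sin y); [|lra]. apply sin_gt_0; [lra|]. pose proof PI2_3_2. lra. }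
    assert (Hz : forall y z, 0 < z - y < 3/2 -> sin (2 * y) = 0 -> sin (2 * z) <> 0).
    { intros y z Hyz Ay Az. apply (Hsc (2 * (z - y))); [lra|]. replace (2 * (z - y)) with (2 * z - 2 * y) by ring. rewrite sin_minus, Ay, Az. ring. }
    assert (Hn : forall y, sin (2 * y) <> 0 -> cos y <> 0 /\ sin y <> 0).
    { intros y Hy. rewrite sin_2a in Hy. split; intros A; apply Hy; rewrite A; ring. }
    destruct (Req_dec (sin (2 * x)) 0) as [A|A].
    - exists (x + h). split; [replace (x + h - x) with h by ring; rewrite Rabs_right; lra|]. apply Hn. apply (Hz x); auto. lra.
    - exists x. split; [replace (x - x) with 0 by ring; rewrite Rabs_R0; auto|]. apply Hn; auto. }
  destruct Hy as [y [Hy1 [Hy2 Hy3]]]. apply Rmin_Rgt in Hy1 as [Y1 Y2].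
  set (w1 := (RtoC (cos y) * ei t)%C). set (w2 := (RtoC (sin y) * ei s)%C).
  assert (Hw : Cmod w1 ^ 2 + Cmod w2 ^ 2 = 1) by apply sphere_cos_sin.
  assert (D1 : Cmod (w1 - u1) <= Rabs (y - x)).
  { rewrite E1. unfold w1. replace (RtoC (cos y) * ei t - RtoC (cos x) * ei t)%C with (RtoC (cos y - cos x) * ei t)%C by (rewrite RtoC_minus; ring).
    rewrite Cmod_ei_mul, Cmod_R. apply cos_lip. }
  assert (D2 : Cmod (w2 - u2) <= Rabs (y - x)).
  { rewrite E2. unfold w2. replace (RtoC (sin y) * ei s - RtoC (sin x) * ei s)%C with (RtoC (sin y - sin x) * ei s)%C by (rewrite RtoC_minus; ring).
    rewrite Cmod_ei_mul, Cmod_R. apply sin_lip. }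
  assert (Hw1 : 0 < Cmod w1 < 1).
  { assert (A1 : Cmod w1 ^ 2 = cos y ^ 2) by (unfold w1; rewrite Cmod_ei_mul, Cmod_R; apply pow2_abs).
    assert (A2 : Cmod w2 ^ 2 = sin y ^ 2) by (unfold w2; rewrite Cmod_ei_mul, Cmod_R; apply pow2_abs).
    pose proof (Cmod_ge_0 w1). assert (0 < cos y ^ 2) by (apply pow2_gt_0; auto). assert (0 < sin y ^ 2) by (apply pow2_gt_0; auto). split; nra. }
  pose proof (Hin w1 w2 Hw Hw1) as B1. specialize (H1 w1 w2 ltac:(lra) ltac:(lra)).
  destruct (HL u1 u2 Hu) as [_ B2]. specialize (B2 w1 w2 Hw). apply Rlt_div_r in Y2; [|lra].
  pose proof (Cmod_tri_sub (P u1 u2) (P w1 w2) (fr u1 u2)) as T1. pose proof (Cmod_tri_sub (P w1 w2) (fr w1 w2) (fr u1 u2)) as T2.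
  rewrite (Cmod_sub_sym (P u1 u2) (P w1 w2)) in T1. pose proof (Rabs_pos (y - x)).
  assert (L * (Cmod (w1 - u1) + Cmod (w2 - u2)) <= L * (2 * Rabs (y - x))) by (apply Rmult_le_compat_l; lra).
  assert (Hg2 : Cmod (P u1 u2 - fr u1 u2) = eps + g) by (unfold g; ring). nra.
Qed.

End Approximation.

(** * Extension of uniform limits of polynomials *)

Lemma prod_ball_Cmod (z y : C2) d : ball (M := prod_UniformSpace C_UniformSpace C_UniformSpace) z d y ->
  Cmod (fst y - fst z) < 2 * d /\ Cmod (snd y - snd z) < 2 * d.
Proof.
  intros [[A1 A2] [B1 B2]]. change (Rabs (Re (fst y - fst z)) < d) in A1. change (Rabs (Im (fst y - fst z)) < d) in A2.
  change (Rabs (Re (snd y - snd z)) < d) in B1. change (Rabs (Im (snd y - snd z)) < d) in B2.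
  pose proof (Cmod_le_re_im (fst y - fst z)). pose proof (Cmod_le_re_im (snd y - snd z)). lra.
Qed.

Lemma continuous_on_of_eps (D : C2 -> Prop) (g : C2 -> C) :
  (forall z, D z -> forall e, 0 < e -> exists d, 0 < d /\ forall y, D y -> Cmod (fst y - fst z) < d -> Cmod (snd y - snd z) < d -> Cmod (g y - g z) < e) ->
  continuous_on (T := prod_UniformSpace C_UniformSpace C_UniformSpace) (U := C_UniformSpace) D g.
Proof.
  intros H z Hz. apply filterlim_locally. intros e. destruct (H z Hz e (cond_pos e)) as [d [Hd Hy]].
  assert (Hd2 : 0 < d / 2) by lra. exists (mkposreal _ Hd2). intros y By Dy. apply prod_ball_Cmod in By as [B1 B2]. simpl in B1, B2.
  specialize (Hy y Dy ltac:(lra) ltac:(lra)). split.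
  - eapply Rle_lt_trans; [apply (re_le_Cmod (g y - g z))|auto].
  - eapply Rle_lt_trans; [apply (im_le_Cmod (g y - g z))|auto].
Qed.

(** The increment splits into one increment in each variable and a mixed second difference. The
    latter is of order [|h1| * |h2|], by Cauchy's estimate in the first variable applied to an
    increment in the second. *)
Lemma frechet g (a b : C) rad M : 0 < rad ->
  (forall x y, Cmod (x - a) < rad -> Cmod (y - b) < rad -> Cmod (g x y) <= M /\ cdiff (fun x => g x y) x /\ cdiff (fun y => g x y) y) ->
  exists l1 l2 C0, 0 <= C0 /\ forall h1 h2, Cmod h1 <= rad / 2 -> Cmod h2 <= rad / 2 ->
    Cmod (g (a + h1) (b + h2) - g a b - (l1 * h1 + l2 * h2))%C <= C0 * (Cmod h1 + Cmod h2) ^ 2.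
Proof.
  intros Hr H. assert (H0 : forall z : C, Cmod (z - z) < rad) by (intros; rewrite Cmod_sub_diag; auto).
  assert (HM : 0 <= M) by (eapply Rle_trans; [apply Cmod_ge_0|apply (H a b); auto]).
  destruct (cauchy_der (fun x => g x b) a rad M Hr) as [l1 [_ [_ [_ Q1]]]]; [intros z Hz; apply H; auto|intros z Hz; apply H; auto|].
  destruct (cauchy_der (fun y => g a y) b rad M Hr) as [l2 [_ [_ [_ Q2]]]]; [intros z Hz; apply H; auto|intros z Hz; apply H; auto|].
  exists l1, l2, (4 * M / rad ^ 2). assert (Hr2 : 0 < rad ^ 2) by (apply pow_lt; auto).
  split; [apply Rle_div_r; [auto|lra]|]. intros h1 h2 Hh1 Hh2.
  specialize (Q1 h1 Hh1). specialize (Q2 h2 Hh2). cbv beta in Q1, Q2.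
  assert (Hb2 : Cmod (b + h2 - b) < rad) by (replace (b + h2 - b)%C with h2 by ring; lra).
  assert (HD : forall x, Cmod (x - a) < rad -> Cmod (g x (b + h2)%C - g x b) <= 2 * M * Cmod h2 / rad).
  { intros x Hx. destruct (cauchy_der (fun y => g x y) b rad M Hr) as [l [_ [_ [Q _]]]]; [intros z Hz; apply H; auto|intros z Hz; apply H; auto|].
    apply Q; auto. }
  destruct (cauchy_der (fun x => g x (b + h2) - g x b)%C a rad (2 * M * Cmod h2 / rad) Hr) as [l [_ [_ [Q _]]]]; auto.
  { intros z Hz. apply cdiff_minus; apply H; auto. }
  specialize (Q h1 Hh1). cbv beta in Q.
  replace (g (a + h1) (b + h2) - g a b - (l1 * h1 + l2 * h2))%C with
    ((g (a + h1) (b + h2) - g (a + h1) b - (g a (b + h2) - g a b)) + ((g (a + h1) b - g a b - l1 * h1) + (g a (b + h2) - g a b - l2 * h2)))%C by ring.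
  eapply Rle_trans; [apply Cmod_triangle|]. eapply Rle_trans; [apply Rplus_le_compat_l, Cmod_triangle|].
  replace (2 * (2 * M * Cmod h2 / rad) * Cmod h1 / rad) with (4 * M / rad ^ 2 * (Cmod h1 * Cmod h2)) in Q by (field; lra).
  replace (2 * M * Cmod h1 ^ 2 / rad ^ 2) with (4 * M / rad ^ 2 * (Cmod h1 ^ 2 / 2)) in Q1 by (field; lra).
  replace (2 * M * Cmod h2 ^ 2 / rad ^ 2) with (4 * M / rad ^ 2 * (Cmod h2 ^ 2 / 2)) in Q2 by (field; lra).
  eapply Rle_trans; [apply Rplus_le_compat; [apply Q|apply Rplus_le_compat; [apply Q1|apply Q2]]|].
  rewrite <- !Rmult_plus_distr_l. apply Rmult_le_compat_l; [apply Rle_div_r; lra|].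
  pose proof (Cmod_ge_0 h1). pose proof (Cmod_ge_0 h2). nra.
Qed.

Lemma holomorphic_at_of_frechet (g : C2 -> C) (z : C2) l1 l2 C0 e0 : 0 < e0 -> 0 <= C0 ->
  (forall h1 h2, Cmod h1 <= e0 -> Cmod h2 <= e0 ->
    Cmod (g (fst z + h1, snd z + h2)%C - g z - (l1 * h1 + l2 * h2)) <= C0 * (Cmod h1 + Cmod h2) ^ 2) -> holomorphic_at g z.
Proof.
  intros He0 HC0 H.
  set (U := prod_NormedModule C_AbsRing C_NormedModule C_NormedModule).
  assert (N1 : forall x : C2, Cmod (fst x) <= norm (V := U) x).
  { intros x. change (Cmod (fst x) <= sqrt (Cmod (fst x) ^ 2 + Cmod (snd x) ^ 2)). rewrite <- (sqrt_pow2 (Cmod (fst x))) at 1 by apply Cmod_ge_0.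
    apply sqrt_le_1_alt. pose proof (pow2_ge_0 (Cmod (snd x))). lra. }
  assert (N2 : forall x : C2, Cmod (snd x) <= norm (V := U) x).
  { intros x. change (Cmod (snd x) <= sqrt (Cmod (fst x) ^ 2 + Cmod (snd x) ^ 2)). rewrite <- (sqrt_pow2 (Cmod (snd x))) at 1 by apply Cmod_ge_0.
    apply sqrt_le_1_alt. pose proof (pow2_ge_0 (Cmod (fst x))). lra. }
  exists (fun h : U => (l1 * fst h + l2 * snd h)%C). split.
  - split.
    + intros x y. change ((l1 * (fst x + fst y) + l2 * (snd x + snd y))%C = (l1 * fst x + l2 * snd x + (l1 * fst y + l2 * snd y))%C). ring.
    + intros k x. change ((l1 * (k * fst x) + l2 * (k * snd x))%C = (k * (l1 * fst x + l2 * snd x))%C). ring.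
    + exists (Cmod l1 + Cmod l2 + 1). pose proof (Cmod_ge_0 l1). pose proof (Cmod_ge_0 l2). split; [lra|]. intros x.
      change (Cmod (l1 * fst x + l2 * snd x) <= (Cmod l1 + Cmod l2 + 1) * norm (V := U) x).
      eapply Rle_trans; [apply Cmod_triangle|]. rewrite !Cmod_mult. pose proof (N1 x). pose proof (N2 x).
      pose proof (Cmod_ge_0 (fst x)). pose proof (Cmod_ge_0 (snd x)). set (nn := norm (V := U) x) in *.
      assert (Cmod l1 * Cmod (fst x) <= Cmod l1 * nn) by (apply Rmult_le_compat_l; auto). assert (Cmod l2 * Cmod (snd x) <= Cmod l2 * nn) by (apply Rmult_le_compat_l; auto). assert (0 <= nn) by (eapply Rle_trans; [apply (Cmod_ge_0 (fst x))|apply N1]). lra.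
  - intros x Hx. apply (is_filter_lim_locally_unique (V := U)) in Hx. rewrite <- Hx. clear x Hx.
    (* Both increments are below [2 * d], so the square of their sum is at most [8 * d] times the
       norm; the choice of [d] makes [8 * d * C0 <= e]. *)
    intros e. set (d := Rmin (e0 / 2) (e / (4 * C0 + 4) / 2)).
    assert (Hd : 0 < d). { apply Rmin_pos; [lra|]. apply Rdiv_lt_0_compat; [apply Rdiv_lt_0_compat; [apply cond_pos|lra]|lra]. }
    exists (mkposreal d Hd). refine (fun (y : C2) By => _). apply prod_ball_Cmod in By as [B1 B2]. simpl in B1, B2.
    set (h1 := (fst y - fst z)%C) in *. set (h2 := (snd y - snd z)%C) in *.
    pose proof (Rmin_l (e0 / 2) (e / (4 * C0 + 4) / 2)) as D1. pose proof (Rmin_r (e0 / 2) (e / (4 * C0 + 4) / 2)) as D2. fold d in D1, D2.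
    change (Cmod h1 < 2 * d) in B1. change (Cmod h2 < 2 * d) in B2.
    specialize (H h1 h2 ltac:(lra) ltac:(lra)).
    assert (Ey : (fst z + h1, snd z + h2)%C = y). { apply injective_projections; unfold h1, h2; cbn [fst snd]; ring. }
    rewrite Ey in H.
    change (Cmod (g y - g z - (l1 * h1 + l2 * h2)) <= e * norm (V := U) ((h1, h2) : C2)).
    eapply Rle_trans; [apply H|]. pose proof (N1 (h1, h2)) as M1. pose proof (N2 (h1, h2)) as M2. simpl fst in M1. simpl snd in M2.
    set (nn := norm (V := U) ((h1, h2) : C2)) in *. pose proof (Cmod_ge_0 h1). pose proof (Cmod_ge_0 h2).
    assert (He2 : 2 * d * (4 * C0 + 4) <= e).
    { assert (X : 2 * d <= e / (4 * C0 + 4)) by lra. apply Rle_div_r in X; lra. }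
    assert (X1 : Cmod h1 + Cmod h2 <= 4 * d) by lra. assert (X2 : Cmod h1 + Cmod h2 <= 2 * nn) by lra.
    assert ((Cmod h1 + Cmod h2) ^ 2 <= 8 * d * nn) by nra.
    apply Rle_trans with (C0 * (8 * d * nn)); [apply Rmult_le_compat_l; auto|].
    replace (C0 * (8 * d * nn)) with (8 * d * C0 * nn) by ring. apply Rmult_le_compat_r; [lra|]. nra.
Qed.

Lemma mean_value h r : (forall z, cdiff h z) -> 0 <= r -> avg (fun t => h (r * ei t)%C) = h 0.
Proof.
  intros Hh Hr. destruct (Req_dec r 0) as [->|Hr0].
  { rewrite (avg_ext _ (fun _ => h 0)); [apply avg_const|]. intros t. f_equal. ring. }
  apply Ceq_sub, Cmod_small_0. intros e He. destruct (cdiff_cont h 0 (Hh 0) e He) as [d [Hd H]].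
  set (x := Rmin r (d / 2)). assert (0 < x) by (apply Rmin_pos; lra). assert (x <= r) by apply Rmin_l. assert (x <= d / 2) by apply Rmin_r.
  rewrite <- (avg_annulus h x r) by auto. rewrite <- (avg_const (h 0)). apply avg_close.
  - apply (ccont_circle h). auto.
  - apply ccont_const.
  - intros t. left. apply H. replace (x * ei t - 0)%C with (x * ei t)%C by ring. rewrite Cmod_ei_mul, Cmod_R, Rabs_right; lra.
Qed.

(* Each point of the closed ball is the centre of the circle cut out of the sphere by the complex line orthogonal to its position. *)
Lemma circle_through (u1 u2 : C) : Cmod u1 ^ 2 + Cmod u2 ^ 2 <= 1 -> exists v1 v2 : C,
  (forall t, Cmod (u1 + ei t * v1) ^ 2 + Cmod (u2 + ei t * v2) ^ 2 = 1) /\ (Cmod u1 ^ 2 + Cmod u2 ^ 2 = 1 -> v1 = 0 /\ v2 = 0).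
Proof.
  intros Hu. set (m := Cmod u1 ^ 2 + Cmod u2 ^ 2) in *. assert (Hm : 0 <= m) by (unfold m; pose proof (pow2_ge_0 (Cmod u1)); pose proof (pow2_ge_0 (Cmod u2)); lra).
  destruct (Req_dec m 0) as [E|E].
  - assert (E1 : u1 = 0). { apply Cmod_eq_0. unfold m in E. pose proof (pow2_ge_0 (Cmod u1)). pose proof (pow2_ge_0 (Cmod u2)). nra. }
    assert (E2 : u2 = 0). { apply Cmod_eq_0. unfold m in E. pose proof (pow2_ge_0 (Cmod u1)). pose proof (pow2_ge_0 (Cmod u2)). nra. }
    exists 1, 0. split; [|lra]. intros t. rewrite E1, E2. replace (0 + ei t * 1)%C with (ei t) by ring. replace (0 + ei t * 0)%C with (RtoC 0) by ring.
    rewrite Cmod_ei, Cmod_0. ring.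
  - set (c := sqrt ((1 - m) / m)). assert (Hc : c * c = (1 - m) / m) by (apply sqrt_sqrt; apply Rle_div_r; lra).
    exists (c * - Cconj u2)%C, (c * Cconj u1)%C. split.
    + intros t. apply RtoC_inj. rewrite RtoC_plus, !Cmod2_conj.
      rewrite !Cplus_conj, !Cmult_conj, Copp_conj, !Cconj_conj, Cconj_R, ei_conj.
      assert (Hei : (ei (- t) * ei t)%C = 1) by apply ei_neg_mul.
      transitivity ((u1 * Cconj u1 + u2 * Cconj u2) * (1 + c * c * (ei (- t) * ei t)))%C; [ring|].
      rewrite Hei. rewrite <- !Cmod2_conj, <- RtoC_plus. fold m. rewrite <- RtoC_mult, Hc, Cmult_1_r, <- RtoC_plus, <- RtoC_mult. f_equal. field. auto.
    + intros E1. assert (c = 0). { unfold c. rewrite E1. replace ((1 - 1) / 1) with 0 by field. apply sqrt_0. }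
      rewrite H. split; ring.
Qed.

(** [g] is defined without the approximants, as a mean of [F] over a circle in the sphere centred at
    the given point. Each approximant has the same mean value property, so its distance to [g] on
    the ball is at most its distance to [F] on the sphere. At points of the sphere the circle
    degenerates, whence [g = F] there. *)
Theorem extends_of_approx (F : C -> C -> C) L M : sph_lip F L M ->
  (forall e, 0 < e -> exists P, pol P /\ forall u1 u2, Cmod u1 ^ 2 + Cmod u2 ^ 2 = 1 -> Cmod (P u1 u2 - F u1 u2) <= e) ->
  extends_to_ball (fun z => F (fst z) (snd z)).
Proof.
  intros [HL0 HL] Happ.
  assert (Hv : forall u : C2, exists v : C2, normsq u <= 1 ->
    (forall t, Cmod (fst u + ei t * fst v) ^ 2 + Cmod (snd u + ei t * snd v) ^ 2 = 1) /\ (normsq u = 1 -> v = (RtoC 0, RtoC 0))).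
  { intros [u1 u2]. destruct (Rle_dec (normsq (u1, u2)) 1) as [Hu|Hu]; [|exists (RtoC 0, RtoC 0); intros; contradiction].
    destruct (circle_through u1 u2 Hu) as [v1 [v2 [H1 H2]]]. exists (v1, v2). intros _. split; [apply H1|].
    intros E. destruct (H2 E) as [-> ->]. auto. }
  apply fun_choice in Hv as [v Hv].
  set (g := fun u : C2 => avg (fun t => F (fst u + ei t * fst (v u)) (snd u + ei t * snd (v u)))%C).
  assert (Hcont : forall u, normsq u <= 1 -> ccont (fun t => F (fst u + ei t * fst (v u)) (snd u + ei t * snd (v u)))%C).
  { intros u Hu t e He. destruct (Hv u Hu) as [H1 _]. set (k := Cmod (fst (v u)) + Cmod (snd (v u))).
    assert (Hk : 0 <= k) by (unfold k; pose proof (Cmod_ge_0 (fst (v u))); pose proof (Cmod_ge_0 (snd (v u))); lra).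
    exists (e / (L * k + 1)). assert (HLk : 0 <= L * k) by (apply Rmult_le_pos; auto). split; [apply Rdiv_lt_0_compat; lra|].
    intros s Hs. apply Rlt_div_r in Hs; [|lra]. eapply Rle_lt_trans; [apply HL; apply H1|].
    replace (fst u + ei s * fst (v u) - (fst u + ei t * fst (v u)))%C with ((ei s - ei t) * fst (v u))%C by ring.
    replace (snd u + ei s * snd (v u) - (snd u + ei t * snd (v u)))%C with ((ei s - ei t) * snd (v u))%C by ring.
    rewrite !Cmod_mult, <- Rmult_plus_distr_l. fold k. pose proof (ei_lip s t). pose proof (Rabs_pos (s - t)).
    assert (Cmod (ei s - ei t) * k <= Rabs (s - t) * k) by (apply Rmult_le_compat_r; auto). nra. }
  assert (Hg : forall u, normsq u <= 1 -> Cmod (g u) <= M).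
  { intros u Hu. apply avg_bound; [apply Hcont; auto|]. intros t. apply HL. apply Hv; auto. }
  assert (HPg : forall P e, pol P -> (forall u1 u2, Cmod u1 ^ 2 + Cmod u2 ^ 2 = 1 -> Cmod (P u1 u2 - F u1 u2) <= e) ->
    forall u, normsq u <= 1 -> Cmod (P (fst u) (snd u) - g u) <= e).
  { intros P e [_ HP] He u Hu.
    assert (Hh : forall z, cdiff (fun z => P (fst u + z * fst (v u)) (snd u + z * snd (v u)))%C z).
    { intros z. apply HP; (apply cdiff_plus; [apply cdiff_const|]; apply cdiff_mult; auto using cdiff_id, cdiff_const). }
    pose proof (mean_value _ 1 Hh ltac:(lra)) as E. cbv beta in E.
    replace (fst u + 0 * fst (v u))%C with (fst u) in E by ring. replace (snd u + 0 * snd (v u))%C with (snd u) in E by ring.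
    rewrite <- E. apply avg_close; [apply (ccont_circle (fun z => P (fst u + z * fst (v u)) (snd u + z * snd (v u)))%C 1); auto|apply Hcont; auto|].
    intros t. rewrite Cmult_1_l. apply He. apply Hv; auto. }
  exists g. split; [|split].
  - apply continuous_on_of_eps. intros z Hz e He. destruct (Happ (e / 4)) as [P [HP HPe]]; [lra|].
    destruct (proj1 HP (fst z) (snd z) (e / 4)) as [d [Hd H]]; [lra|]. exists d. split; auto. intros y Hy H1 H2.
    pose proof (HPg P _ HP HPe z Hz) as A1. pose proof (HPg P _ HP HPe y Hy) as A2. specialize (H _ _ H1 H2).
    pose proof (Cmod_tri_sub (g y) (P (fst y) (snd y)) (g z)) as T1. pose proof (Cmod_tri_sub (P (fst y) (snd y)) (P (fst z) (snd z)) (g z)) as T2.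
    rewrite (Cmod_sub_sym (g y) (P _ _)) in T1. lra.
  - intros z Hz. unfold in_ball in Hz. set (a := fst z). set (b := snd z). set (m := normsq z) in *.
    assert (Hm : Cmod a ^ 2 + Cmod b ^ 2 = m) by reflexivity.
    (* The polydisc of this radius lies in the ball: [m + 4 * rad + 2 * rad ^ 2 <= 1]. *)
    set (rad := (1 - m) / 8). assert (Hrad : 0 < rad) by (unfold rad; lra).
    assert (Hm0 : 0 <= m). { pose proof (pow2_ge_0 (Cmod a)). pose proof (pow2_ge_0 (Cmod b)). lra. }
    assert (Hin : forall x y, Cmod (x - a) < rad -> Cmod (y - b) < rad -> normsq (x, y) <= 1).
    { intros x y Hx Hy. unfold normsq. simpl. pose proof (Cmod_le_add x a). pose proof (Cmod_le_add y b).
      pose proof (Cmod_ge_0 x). pose proof (Cmod_ge_0 y). pose proof (Cmod_ge_0 a). pose proof (Cmod_ge_0 b).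
      assert (Cmod a <= 1) by nra. assert (Cmod b <= 1) by nra.
      assert (Cmod x ^ 2 <= (Cmod a + rad) ^ 2) by (apply pow_incr; lra). assert (Cmod y ^ 2 <= (Cmod b + rad) ^ 2) by (apply pow_incr; lra).
      unfold rad in *. nra. }
    destruct (frechet (fun x y => g (x, y)) a b rad M Hrad) as [l1 [l2 [C0 [HC0 H]]]].
    + intros x y Hx Hy. split; [apply Hg; auto|]. split.
      * apply (weierstrass _ x (rad - Cmod (x - a))); [lra|]. intros e He. destruct (Happ e He) as [P [HP HPe]].
        exists (fun s => P s y). split; [intros; apply HP; auto using cdiff_id, cdiff_const|]. intros s Hs.
        apply (HPg P e HP HPe (s, y)). apply Hin; auto. pose proof (Cmod_tri_sub s x a). lra.
      * apply (weierstrass _ y (rad - Cmod (y - b))); [lra|]. intros e He. destruct (Happ e He) as [P [HP HPe]].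
        exists (fun s => P x s). split; [intros; apply HP; auto using cdiff_id, cdiff_const|]. intros s Hs.
        apply (HPg P e HP HPe (x, s)). apply Hin; auto. pose proof (Cmod_tri_sub s y b). lra.
    + apply (holomorphic_at_of_frechet g z l1 l2 C0 (rad / 2)); auto; [lra|]. intros h1 h2 Hh1 Hh2. specialize (H h1 h2 Hh1 Hh2).
      cbv beta in H. unfold a, b in H. rewrite <- (surjective_pairing z) in H. auto.
  - intros z Hz. unfold in_sphere in Hz. destruct (Hv z ltac:(lra)) as [_ H]. unfold g. rewrite (H Hz). simpl fst at 2. simpl snd at 2.
    rewrite (avg_ext _ (fun _ => F (fst z) (snd z))); [apply avg_const|]. intros t. simpl. f_equal; ring.
Qed.

Theorem theorem1p1 (f : C2 -> C) (p : C2)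
  (f_analytic : real_analytic_on_sphere f)
  (p_outside : ~ in_closed_ball p)
  (ext_z1 : forall a : C2,
     line_meets_ball a (RtoC 1, RtoC 0) ->
     extends_along_line f a (RtoC 1, RtoC 0))
  (ext_z2 : forall a : C2,
     line_meets_ball a (RtoC 0, RtoC 1) ->
     extends_along_line f a (RtoC 0, RtoC 1))
  (ext_p : forall v : C2, v <> (RtoC 0, RtoC 0) ->
     line_meets_ball p v -> extends_along_line f p v) :
  extends_to_ball f.
Proof.
  destruct (rotated_setup f p f_analytic ext_z1 ext_z2 p_outside ext_p) as [al [be [b [fr [d [M [L [Hab [Hb [Hfr [HE [HL [M0 Mp]]]]]]]]]]]]].
  pose proof (conj Hb (conj HE (conj HL (conj M0 Mp))) : setup fr b d M L) as S.
  destruct (ext_uniform f f_analytic) as [d' [M' HE']]. destruct (sph_lip_of_ext _ _ _ HE') as [L' HL'].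
  assert (H : extends_to_ball (fun z => f (fst z, snd z))).
  { apply (extends_of_approx (fun z1 z2 => f (z1, z2)) L' M' HL'). intros e He.
    destruct (approx_sphere S e He) as [P [HP HPe]].
    (* The approximant lives in the rotated coordinates, so it is composed with the inverse of
       [rot]. *)
    exists (fun z1 z2 => P (Cconj al * z1 + Cconj be * z2) (- be * z1 + al * z2))%C.
    assert (Hlin : forall c1 c2 : C, pol (fun z1 z2 => c1 * z1 + c2 * z2)%C).
    { intros c1 c2. apply pol_plus; apply pol_mult; auto using pol_const, pol_fst, pol_snd. }
    split.
    - destruct HP as [HP1 HP2]. split.
      + intros u1 u2 e' He'. destruct (HP1 (Cconj al * u1 + Cconj be * u2)%C (- be * u1 + al * u2)%C e' He') as [d1 [Hd1 H1]].
        destruct (proj1 (Hlin (Cconj al) (Cconj be)) u1 u2 d1 Hd1) as [d2 [Hd2 H2]]. destruct (proj1 (Hlin (- be)%C al) u1 u2 d1 Hd1) as [d3 [Hd3 H3]].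
        exists (Rmin d2 d3). split; [apply Rmin_pos; auto|]. intros w1 w2 W1 W2. apply Rmin_Rgt in W1 as [A1 A2]. apply Rmin_Rgt in W2 as [A3 A4].
        apply H1; [apply H2|apply H3]; auto.
      + intros g1 g2 t G1 G2. apply (HP2 (fun s => Cconj al * g1 s + Cconj be * g2 s)%C (fun s => - be * g1 s + al * g2 s)%C).
        * apply (proj2 (Hlin (Cconj al) (Cconj be))); auto.
        * apply (proj2 (Hlin (- be)%C al)); auto.
    - intros z1 z2 Hz. set (u1 := (Cconj al * z1 + Cconj be * z2)%C). set (u2 := (- be * z1 + al * z2)%C).
      assert (Hc : (al * Cconj al + be * Cconj be)%C = 1).
      { rewrite <- !Cmod2_conj, <- RtoC_plus. rewrite Hab. auto. }
      assert (Er : rot al be u1 u2 = (z1, z2)).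
      { unfold rot, u1, u2. f_equal.
        - transitivity ((al * Cconj al + be * Cconj be) * z1)%C; [ring|rewrite Hc; ring].
        - transitivity ((al * Cconj al + be * Cconj be) * z2)%C; [ring|rewrite Hc; ring]. }
      rewrite <- Er, <- Hfr. apply HPe. rewrite <- (normsq_rot al be u1 u2 Hab), Er. apply Hz. }
  destruct H as [g [G1 [G2 G3]]]. exists g. split; auto. split; auto. intros z Hz. rewrite G3 by auto. rewrite <- surjective_pairing. auto.
Qed.
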